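(* The operator $\mathcal{H}_1$ has no discrete spectrum and no threshold resonance. Moreover, the operator $\mathcal{H}_2$ has exactly one eigenvalue in $(0,1)$ and no threshold resonance.
   Context: Vortex profile: $(U,a)$ denotes the degree-one vortex, i.e. the unique pair of real functions on $[0,\infty)$ solving $$U'(r)=\frac{1-a(r)}{r}U(r),\qquad a'(r)=\frac r2\bigl(1-U(r)^2\bigr),\qquad r>0,$$ with $U(0)=a(0)=0$, $U(r)\to1$ and $a(r)\to1$ as $r\to\infty$, $U'>0$, $a'>0$. Operators on $L^2((0,\infty),dr)$: $$\mathcal{H}_1=-\partial_r^2-\frac1{4r^2}+\frac{(2-a)^2}{r^2}+\frac12(1+U^2),\qquad \mathcal{H}_2=-\partial_r^2-\frac1{4r^2}+U^2,$$ self-adjoint on the domains $$\mathcal{D}(\mathcal{H}_1)=\Bigl\{f\in L^2((0,\infty),dr):\ -f''+\tfrac{15}{4r^2}f\in L^2((0,\infty),dr)\Bigr\},\qquad \mathcal{D}(\mathcal{H}_2)=r^{1/2}H^2_{\mathrm{rad}}(\mathbb{R}^2).$$ Both have continuous spectrum $[1,\infty)$, and $1$ is called the threshold. Threshold resonance: $\mathcal{H}_j$ has a threshold resonance if there is a nontrivial solution $f$ on $(0,\infty)$ of the differential equation $\mathcal{H}_jf=f$ that is subordinate (i.e. belongs to the smaller of the two possible asymptotic branches, or satisfies the Friedrichs condition) at $r=0$ and subordinate at $r=\infty$. Explicitly: for $j=1$ this means $f(r)=O(r^{5/2})$ as $r\to0+$ and $f(r)=O(r^{-1/2})$ as $r\to\infty$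 (the other branches being $r^{-3/2}$ at $0$ and $r^{3/2}$ at $\infty$); for $j=2$ it means $f(r)=O(r^{1/2})$ as $r\to0+$ and $f(r)=O(r^{1/2})$ as $r\to\infty$ (the other branches being $r^{1/2}\log r$ at both ends). *)

(* Defs.v *)
From mathcomp Require Import all_boot all_order all_algebra.
From mathcomp Require Import complex.
From mathcomp Require Import all_classical all_reals all_analysis.

Set Implicit Arguments.
Unset Strict Implicit.
Unset Printing Implicit Defensive.

Import Order.TTheory GRing.Theory Num.Theory.
Import numFieldNormedType.Exports.

Local Open Scope classical_set_scope.
Local Open Scope ring_scope.
Local Open Scope complex_scope.

Section VortexProfile.
Variable R : realType.
Implicit Types U a : R -> R.

(* Functions on [0, oo) are represented by functions on R whose values on the
   negative axis are never used. *)
Definition vortex_profile U a : Prop :=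
  [/\ [/\ {within `[0, +oo[, continuous U} & {within `[0, +oo[, continuous a}],
      [/\ U 0 = 0, a 0 = 0, U r @[r --> +oo] --> (1 : R) &
          a r @[r --> +oo] --> (1 : R)],
      forall r : R, 0 < r -> is_derive r 1 U ((1 - a r) / r * U r),
      forall r : R, 0 < r -> is_derive r 1 a (r / 2 * (1 - U r ^+ 2)) &
      forall r : R, 0 < r -> 0 < derive1 U r /\ 0 < derive1 a r].

Definition potential1 U a (r : R) : R :=
  - (4 * r ^+ 2)^-1 + (2 - a r) ^+ 2 / r ^+ 2 + (1 + U r ^+ 2) / 2.

Definition potential2 U (r : R) : R := - (4 * r ^+ 2)^-1 + U r ^+ 2.

End VortexProfile.

Section HalfLine.
Variable R : realType.
Let mu := @lebesgue_measure R.
Implicit Types (f h phi V : R -> R) (D : (R -> R) -> Prop).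

Definition half_line : set R := `]0, +oo[.

(* f \_ half_line is the extension of f by zero. *)
Definition L2_half f : Prop := f \_ half_line \in Lfun mu 2%:E.

Definition test_half phi : Prop :=
  (forall n x, derivable (derive1n n phi) x 1) /\
  (exists c d, 0 < c /\ (forall x, phi x != 0 -> c <= x <= d)).

(* - f'' + V f = h in the sense of distributions on (0, oo). *)
Definition weak_schrodinger V f h : Prop := forall phi, test_half phi ->
  \int[mu]_(r in half_line) (f r * (- derive1n 2 phi r + V r * phi r)) =
  \int[mu]_(r in half_line) (h r * phi r).

(* Graph of the operator f |-> - f'' + V f with domain D. *)
Definition schrodinger D V f h : Prop :=
  [/\ D f, L2_half f, L2_half h & weak_schrodinger V f h].

Definition ode_solution V (E : R) f : Prop := forall r : R, 0 < r ->
  [/\ derivable f r 1, derivable (derive1 f) r 1 &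
      - derive1n 2 f r + V r * f r = E * f r].

End HalfLine.

Arguments half_line {R}.

Section Sobolev.
Variable R : realType.
Let mu2 := (@lebesgue_measure R \x @lebesgue_measure R)%E.
Implicit Types (u v phi : R * R -> R) (s : seq bool).

(* Iterated partial derivative; [false] is the first coordinate direction and
   [true] the second one. *)
Definition dir (b : bool) : R * R := if b then (0, 1) else (1, 0).

Definition partials s phi : R * R -> R :=
  foldr (fun b g p => 'D_(dir b) g p) phi s.

Definition test_plane phi : Prop :=
  [/\ forall s, continuous (partials s phi),
      forall s p b, derivable (partials s phi) p (dir b) &
      exists M : R, forall p, phi p != 0 -> `|p| <= M].

Definition weak_partial s u v : Prop := forall phi, test_plane phi ->
  \int[mu2]_p (u p * partials s phi p) =
  (-1) ^+ size s * \int[mu2]_p (v p * phi p).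

(* H^2(R^2): all weak partial derivatives of order at most 2 are in L^2; the
   empty list gives u itself. *)
Definition H2_plane u : Prop := u \in Lfun mu2 2%:E /\
  forall s, (size s <= 2)%N ->
    exists2 v, v \in Lfun mu2 2%:E & weak_partial s u v.

Definition radial (g : R -> R) (p : R * R) : R :=
  g (Num.sqrt (p.1 ^+ 2 + p.2 ^+ 2)).

End Sobolev.

Section Operators.
Variable R : realType.
Implicit Types (U a f h : R -> R).

Definition domain1 f : Prop := L2_half f /\
  exists2 h, L2_half h & weak_schrodinger (fun r => 15 / (4 * r ^+ 2)) f h.

(* r^(1/2) H^2_rad(R^2), up to null sets. *)
Definition domain2 f : Prop := exists2 g : R -> R, H2_plane (radial g) &
  {ae @lebesgue_measure R, forall r, half_line r -> f r = Num.sqrt r * g r}.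

(* L^2((0, oo)) consists of complex-valued functions; the coefficients being
   real, the operators act separately on real and imaginary parts. *)
Definition complexify (A : (R -> R) -> (R -> R) -> Prop)
    (f h : R -> R[i]) : Prop :=
  A (fun r => complex.Re (f r)) (fun r => complex.Re (h r)) /\
  A (fun r => complex.Im (f r)) (fun r => complex.Im (h r)).

Definition H1 U a := complexify (schrodinger domain1 (potential1 U a)).
Definition H2 U := complexify (schrodinger domain2 (potential2 U)).

End Operators.

Section Spectrum.
Variable R : realType.
Let mu := @lebesgue_measure R.
Implicit Types (A : (R -> R[i]) -> (R -> R[i]) -> Prop) (f g h : R -> R[i])
  (z w : R[i]).

Definition L2C f : Prop :=
  L2_half (fun r => complex.Re (f r)) /\ L2_half (fun r => complex.Im (f r)).

Definition normL2 f : R :=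
  Num.sqrt (\int[mu]_(r in half_line)
    (complex.Re (f r) ^+ 2 + complex.Im (f r) ^+ 2)).

Definition ae_eqC f g : Prop :=
  {ae mu, forall r, half_line r -> f r = g r}.

(* An operator A is given by its graph. z is in the resolvent set when A - z
   is a bijection from the domain of A onto L^2 with bounded inverse. *)
Definition resolvent_set A : set R[i] := [set z |
  (forall g, L2C g -> exists f, A f (fun r => z * f r + g r)) /\
  (exists C : R, forall f h, A f h ->
     normL2 f <= C * normL2 (fun r => h r - z * f r))].

Definition spectrum A : set R[i] := ~` resolvent_set A.

Definition eigenfunction A z f : Prop := A f (fun r => z * f r).

Definition is_eigenvalue A z : Prop :=
  exists2 f, eigenfunction A z f & ~ ae_eqC f (fun=> 0).

Definition finite_multiplicity A z : Prop :=
  exists n (e : 'I_n -> R -> R[i]), forall f, eigenfunction A z f ->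
    exists c : 'I_n -> R[i], ae_eqC f (fun r => \sum_i c i * e i r).

(* Isolated points of the spectrum that are eigenvalues of finite
   multiplicity; for a self-adjoint operator the algebraic and geometric
   multiplicities agree. *)
Definition discrete_spectrum A : set R[i] := [set z |
  [/\ spectrum A z,
      exists2 e : R, 0 < e & forall w, spectrum A w -> `|w - z| < e%:C -> w = z,
      is_eigenvalue A z & finite_multiplicity A z]].

End Spectrum.

Section Resonance.
Variable R : realType.
Implicit Types (U a V f : R -> R) (alpha beta : R).

Definition subordinate alpha beta f : Prop :=
  (exists C : R, \forall r \near 0^'+, `|f r| <= C * r `^ alpha) /\
  (exists C : R, \forall r \near +oo, `|f r| <= C * r `^ beta).

(* Complex solution of - f'' + V f = f, O(r^alpha) at 0+ and O(r^beta) at oo. *)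
Definition threshold_resonance V alpha beta : Prop :=
  exists f : R -> R[i],
    [/\ ode_solution V 1 (fun r => complex.Re (f r)) /\
        ode_solution V 1 (fun r => complex.Im (f r)),
        subordinate alpha beta (fun r => complex.Re (f r)) /\
        subordinate alpha beta (fun r => complex.Im (f r)) &
        exists2 r, 0 < r & f r != 0].

Definition threshold_resonance1 U a :=
  threshold_resonance (potential1 U a) (5 / 2) (- (1 / 2)).

Definition threshold_resonance2 U :=
  threshold_resonance (potential2 U) (1 / 2) (1 / 2).

End Resonance.

(* Main.v *)
(* An eigenfunction f of H1 for z = x + iy is C^2, and N = |f|^2 satisfies
   N'' >= 2 (V - x) N with V > 1 and V - 1 >= 2 / r^2 near 0. For x <= 1, N is
   convex and integrable, hence blows up like 1 / r at the origin unless f = 0;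
   for y <> 0 the derivative - y N of the Wronskian of Re f and Im f integrates
   to 0. So eigenvalues are real and above the threshold, where Weyl sequences
   show that no point of the spectrum is isolated.
   For H2, put f = sqrt r * g: an eigenfunction is a multiple of the solution
   g_l regular at 0, the logarithmic solution not being in H^2 of the plane.
   The function psi = 1 - a / a(x), for the radius x at which the sign of
   - Delta psi - (1 - U^2) psi changes together with that of psi, is a barrier
   forcing g_l > 0 for every eigenvalue or resonance l <= 1. Positive solutions
   for two values of l are incompatible, g_1 has a zero, and the supremum of
   the l with g_l > 0 is an eigenvalue. *)

(* The graphs of both operators consist of weak equations, while the arguments sketched above
   concern classical solutions. Hence the regularity theory: testing against mollified hats at
   Lebesgue points gives a continuous representative, and subtracting a second primitive of the
   right-hand side leaves an affine function. Square integrability gives no pointwise decay, only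
   small values along sequences tending to 0 and to infinity. The proof therefore looks for monotone
   quantities, for which such a sequence is as good as a limit. A similar device replaces asymptotic
   expansions: a quantity of the wrong sign keeps this sign, and its differential equation drives it
   past an a priori bound. The bound V > 1 is the delicate inequality on the profile. It is reduced
   to (r - 2) (1 - a) <= 3/4, for which 0 < a < 1 is too weak at large r; the estimate (1 - a) (8 +
   r^2) <= 8 supplies the missing decay. *)
From HB Require Import structures.
From mathcomp Require Import all_boot all_order all_algebra.
From mathcomp Require Import complex.
From mathcomp Require Import ring lra.
From mathcomp Require Import all_classical all_reals all_analysis.
From mathcomp Require Import measurable_realfun.
Require Import Defs.

Set Implicit Arguments.
Unset Strict Implicit.
Unset Printing Implicit Defensive.

Import Order.TTheory GRing.Theory Num.Theory.
Import numFieldNormedType.Exports.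

Local Open Scope classical_set_scope.
Local Open Scope ring_scope.

(** * Calculus on the line *)

Section Calculus.
Variable R : realType.
Implicit Types (f g df dg : R -> R) (x y p q k : R).

Lemma is_derive_cont f x d : is_derive x 1 f d -> {for x, continuous f}.
Proof. by move=> [h _]; apply/differentiable_continuous/derivable1_diffP. Qed.

Lemma is_derive_mul f g x a b : is_derive x 1 f a -> is_derive x 1 g b ->
  is_derive x 1 (fun z => f z * g z) (a * g x + f x * b).
Proof.
move=> hf hg; apply: (@is_derive_eq _ _ _ _ _ _ _ _ (is_deriveM hf hg)).
by rewrite /GRing.scale/= addrC [g x * a]mulrC.
Qed.

Lemma is_derive_add f g x a b : is_derive x 1 f a -> is_derive x 1 g b ->
  is_derive x 1 (fun z => f z + g z) (a + b).
Proof. by move=> hf hg; exact: is_deriveD. Qed.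

Lemma is_derive_sub f g x a b : is_derive x 1 f a -> is_derive x 1 g b ->
  is_derive x 1 (fun z => f z - g z) (a - b).
Proof. by move=> hf hg; exact: is_deriveB. Qed.

Lemma is_derive_opp f x a : is_derive x 1 f a ->
  is_derive x 1 (fun z => - f z) (- a).
Proof. by move=> hf; exact: is_deriveN. Qed.

Lemma is_derive_const c x : is_derive x 1 (fun _ : R => c : R) 0.
Proof. exact: is_derive_cst. Qed.

Lemma is_derive_var x : is_derive x 1 (fun z : R => z) 1.
Proof. exact: is_derive_id. Qed.

Lemma is_derive_val f x a b : is_derive x 1 f a -> a = b -> is_derive x 1 f b.
Proof. by move=> h <-. Qed.

Lemma is_derive_exp f x a n : is_derive x 1 f a ->
  is_derive x 1 (fun z => f z ^+ n) (n%:R * f x ^+ n.-1 * a).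
Proof.
move=> hf; elim: n => [|n IH].
  by apply: is_derive_val (is_derive_const 1 x) _; rewrite !mul0r.
have -> : (fun z => f z ^+ n.+1) = (fun z => f z * f z ^+ n).
  by apply/funext => z; rewrite exprS.
apply: is_derive_val (is_derive_mul hf IH) _.
case: n {IH} => [|n] /=; first by rewrite !expr0 !mul0r !mulr0 addr0 !mulr1 mul1r.
by rewrite -[in RHS]natr1 exprS; ring.
Qed.

Lemma is_derive_inv f x a : f x != 0 -> is_derive x 1 f a ->
  is_derive x 1 (fun z => (f z)^-1) (- (f x) ^- 2 * a).
Proof. by move=> f0 hf; exact: is_deriveV. Qed.

Lemma is_derive_comp1 f g x a b : is_derive x 1 f a -> is_derive (f x) 1 g b ->
  is_derive x 1 (fun z => g (f z)) (b * a).
Proof.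
move=> hf hg; apply: (@is_derive_eq _ _ _ _ _ _ _ _ (is_derive1_comp hg hf)).
by rewrite mulrC.
Qed.

Lemma is_derive_expR f x a : is_derive x 1 f a ->
  is_derive x 1 (fun z => expR (f z)) (expR (f x) * a).
Proof. by move=> hf; apply: is_derive_comp1 hf _; exact: is_derive_expR. Qed.

Lemma is_derive_ln f x a : 0 < f x -> is_derive x 1 f a ->
  is_derive x 1 (fun z => ln (f z)) ((f x)^-1 * a).
Proof. by move=> h hf; apply: is_derive_comp1 hf _; exact: is_derive1_ln. Qed.

Lemma is_derive_near f g x d : (\forall z \near x, f z = g z) ->
  is_derive x 1 f d -> is_derive x 1 g d.
Proof. by move=> fg hf; exact: near_eq_is_derive hf. Qed.

Lemma continuous_within_segment f x y :
  (forall s, x <= s <= y -> {for s, continuous f}) -> {within `[x, y], continuous f}.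
Proof.
move=> cf; apply: continuous_in_subspaceT => s /set_mem /=.
by rewrite in_itv/= => /cf.
Qed.

Lemma mean_value f df x y : (forall s, x <= s <= y -> is_derive s 1 f (df s)) ->
  x < y -> exists2 s, x < s < y & f y - f x = df s * (y - x).
Proof.
move=> hf xy.
have [s|s /= sxy|s + e] := @MVT R f df x y xy.
- by rewrite in_itv/= => /andP[h1 h2]; apply: hf; rewrite !ltW.
- apply: continuous_within_segment => t /hf; exact: is_derive_cont.
- by rewrite in_itv/= => h; exists s.
Qed.

Lemma derive_ge0_le f df x y : (forall s, x <= s <= y -> is_derive s 1 f (df s)) ->
  (forall s, x < s < y -> 0 <= df s) -> x <= y -> f x <= f y.
Proof.
move=> hf df0; rewrite le_eqVlt => /predU1P[->//|xy].
have [s sxy e] := mean_value hf xy.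
by rewrite -subr_ge0 e mulr_ge0 ?df0// subr_ge0 ltW.
Qed.

Lemma derive_gt0_lt f df x y : (forall s, x <= s <= y -> is_derive s 1 f (df s)) ->
  (forall s, x < s < y -> 0 < df s) -> x < y -> f x < f y.
Proof.
move=> hf df0 xy; have [s sxy e] := mean_value hf xy.
by rewrite -subr_gt0 e mulr_gt0 ?df0// subr_gt0.
Qed.

Lemma derive_ge_growth f df k x y :
  (forall s, x <= s <= y -> is_derive s 1 f (df s)) ->
  (forall s, x < s < y -> k <= df s) -> x <= y -> f x + k * (y - x) <= f y.
Proof.
move=> hf dfk; rewrite le_eqVlt => /predU1P[->|xy]; first by rewrite subrr mulr0 addr0.
have [s sxy e] := mean_value hf xy.
have := dfk _ sxy; rewrite -(@ler_pM2r _ (y - x)) ?subr_gt0// -e; lra.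
Qed.

Lemma near_ltP (P : R -> Prop) x : (\forall z \near x, P z) ->
  exists2 e, 0 < e & forall z, `|z - x| < e -> P z.
Proof.
case=> e /= e0 h; exists e => // z zx; apply: h => /=.
by rewrite /ball/= distrC.
Qed.

(** The zero is the infimum of the points of [[p, q]] where [f] is nonpositive. This is the
    continuation tool: a sign that can only be lost at a first zero is kept once that zero is
    excluded. *)
Lemma first_zero f p q : (forall s, p <= s <= q -> {for s, continuous f}) ->
  p <= q -> 0 < f p -> f q <= 0 ->
  exists z, [/\ p < z <= q, f z = 0 & forall s, p <= s < z -> 0 < f s].
Proof.
move=> cf pq fp fq; pose A := [set s | p <= s <= q /\ f s <= 0].
have Aq : A q by split => //; rewrite pq lexx.
have infA : has_inf A.
  by split; [exists q|exists p => s [/andP[]]].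
set z := inf A.
have pz : p <= z by apply: lb_le_inf; [exists q|move=> s [/andP[]]].
have zq : z <= q by apply: ge_inf => //; case: infA.
have below s : p <= s < z -> 0 < f s.
  move=> /andP[ps sz]; rewrite ltNge; apply/negP => fs.
  have : A s by split => //; rewrite ps (ltW (lt_le_trans sz zq)).
  move=> /(ge_inf (proj2 infA)); rewrite leNgt -/z sz; exact: negP.
have cz : {for z, continuous f} by apply: cf; rewrite pz.
have fz : f z <= 0.
  rewrite leNgt; apply/negP => fz.
  have [e e0 he] := near_ltP (cvgr_gt _ cz _ fz).
  have [s As sz] := inf_adherent e0 infA.
  have zs : z <= s by apply: ge_inf => //; case: infA.
  by case: (As) => _; rewrite leNgt he//= ger0_norm ?subr_ge0// ltrBlDl.
have pz' : p < z.
  rewrite lt_neqAle pz andbT; apply/eqP => pze.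
  have fp0 := fz; rewrite -pze in fp0.
  by have := lt_le_trans fp fp0; rewrite ltxx.
exists z; split => //; first by rewrite pz'.
apply/eqP; rewrite eq_le fz /= leNgt; apply/negP => fz0.
have [e e0 he] := near_ltP (cvgr_lt _ cz _ fz0).
pose s := Num.max p (z - e / 2).
have sz : p <= s < z by rewrite /s le_max lexx /= gt_max pz' /=; lra.
have := below _ sz; rewrite ltNge ltW//; apply: he.
have : z - e / 2 <= s by rewrite /s le_max lexx orbT.
by rewrite ltr_norml; lra.
Qed.

(** Up to a first zero [f] is nondecreasing, so it cannot vanish there; hence the condition
    [0 < f s], under which alone [df] is controlled, never fails. The runaway arguments for the
    profile start from this. *)
Lemma pos_nondecr f df p : (forall s, p <= s -> is_derive s 1 f (df s)) ->
  0 < f p -> (forall s, p <= s -> 0 < f s -> 0 <= df s) ->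
  forall s, p <= s -> f p <= f s.
Proof.
move=> hf fp h.
have fpos s : p <= s -> 0 < f s.
  move=> ps; rewrite ltNge; apply/negP => fs.
  have cf u : p <= u <= s -> {for u, continuous f}.
    by move=> /andP[pu _]; exact: is_derive_cont (hf _ pu).
  have [z [/andP[pz zt] fz hz]] := first_zero cf ps fp fs.
  have : f p <= f z.
    apply: (@derive_ge0_le _ df); last exact: ltW.
      by move=> u /andP[? _]; exact: hf.
    by move=> u /andP[pu uz]; apply: h; [exact: ltW|apply: hz; rewrite ltW].
  by rewrite fz leNgt fp.
move=> s ps; apply: (@derive_ge0_le _ df) => // t /andP[pt _]; first exact: hf.
by apply: h; [exact: ltW|apply: fpos; exact: ltW].
Qed.

Lemma derive_gt0_right f x d : is_derive x 1 f d -> 0 < d ->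
  exists2 e, 0 < e & forall y, x < y < x + e -> f x < f y.
Proof.
move=> [hd hv] d0.
have : (h^-1 *: (f (h *: 1 + x) - f x)) @[h --> 0^'] --> d.
  by rewrite -hv; exact: hd.
move=> /cvgr_gt -/(_ 0 d0) [e /= e0 he]; exists e => // y /andP[xy yx].
have h0 : 0 < y - x by rewrite subr_gt0.
have := he (y - x); rewrite /ball/= sub0r normrN gtr0_norm// ltrBlDl.
move=> /(_ yx); rewrite gt_eqF// => /(_ isT).
rewrite /GRing.scale/= mulr1 subrK pmulr_rgt0 ?invr_gt0// subr_gt0//.
Qed.

End Calculus.

(** Derivatives already in the context are tried first, so that they act as rules for functions such
    as [U] and [a]. What [derive] leaves are the side conditions and the equation between the
    computed and the announced derivative. *)
Ltac dstep := first
  [ eassumption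
  | eapply is_derive_const | eapply is_derive_var
  | eapply is_derive_exp | eapply is_derive_inv
  | eapply is_derive_add | eapply is_derive_sub
  | eapply is_derive_opp | eapply is_derive_mul
  | eapply is_derive_expR | eapply is_derive_ln ].
Ltac derive := eapply is_derive_val; [repeat dstep | ]; cbv beta.

Lemma is_derive_mulln (R : realType) (c t : R) : 0 < t ->
  is_derive t 1 (fun t => c * ln t) (c / t).
Proof. by move=> t0; derive => //; rewrite mul0r add0r mulr1. Qed.

(** * Inequalities for the vortex profile *)

Section Vortex.
Variables (R : realType) (U a : R -> R).
Hypothesis profile : vortex_profile U a.
Implicit Types r s k t : R.

Let dU r : 0 < r -> is_derive r 1 U ((1 - a r) / r * U r).
Proof. by case: profile => _ _ h _ _; exact: h. Qed.

Let da r : 0 < r -> is_derive r 1 a (r / 2 * (1 - U r ^+ 2)).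
Proof. by case: profile => _ _ _ h _; exact: h. Qed.

Let dUpos r : 0 < r -> 0 < (1 - a r) / r * U r.
Proof.
move=> r0; case: profile => _ _ _ _ /(_ r r0) [+ _].
by rewrite derive1E; have [_ ->] := dU r0.
Qed.

Let dapos r : 0 < r -> 0 < r / 2 * (1 - U r ^+ 2).
Proof.
move=> r0; case: profile => _ _ _ _ /(_ r r0) [_].
by rewrite derive1E; have [_ ->] := da r0.
Qed.

(* the increasing profile functions are compared with their limits *)
Let between (f df : R -> R) : {within `[0, +oo[, continuous f} -> f 0 = 0 ->
  f r @[r --> +oo] --> (1 : R) -> (forall r, 0 < r -> is_derive r 1 f (df r)) ->
  (forall r, 0 < r -> 0 < df r) -> forall r, 0 < r -> 0 < f r < 1.
Proof.
move=> cf f0 fl hf df0.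
have incr r s : 0 < r -> r < s -> f r < f s.
  move=> r0 rs; apply: (@derive_gt0_lt _ _ df) => // t /andP[h _].
    by apply: hf; exact: lt_le_trans h.
  by apply: df0; exact: lt_trans h.
have fge0 r : 0 < r -> 0 <= f r.
  move=> r0; rewrite -f0.
  have c : {within `[0, r], continuous f}.
    apply: continuous_subspaceW cf => t /=.
    by rewrite !in_itv/= andbT => /andP[].
  have [t|t] := @MVT _ f df _ _ r0 _ c.
    by rewrite in_itv/= => /andP[t0 _]; exact: hf.
  rewrite in_itv/= => /andP[t0 _] e; rewrite -subr_ge0 e mulr_ge0//.
    by rewrite ltW ?df0.
  by rewrite subr_ge0 ltW.
move=> r r0; apply/andP; split.
  by apply: le_lt_trans (fge0 (r / 2) _) _; rewrite ?incr//; lra.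
have r1 : r < r + 1 by lra.
rewrite (lt_le_trans (incr _ _ r0 r1))// leNgt; apply/negP => h.
have [M [_ hM]] := cvgr_lt _ fl _ h.
pose s := Num.max M (r + 1) + 1.
have Ms : M < s by rewrite /s ltr_pwDr// le_max lexx.
have rs : r + 1 < s by rewrite /s ltr_pwDr// le_max lexx orbT.
have := hM _ Ms; rewrite ltNge ltW// incr//; lra.
Qed.

Lemma U_between r : 0 < r -> 0 < U r < 1.
Proof.
case: profile => -[cU _] [U0 _ Ul _] _ _ _.
by apply: (between cU U0 Ul dU dUpos).
Qed.

Lemma a_between r : 0 < r -> 0 < a r < 1.
Proof.
case: profile => -[_ ca] [_ a0 _ al] _ _ _.
by apply: (between ca a0 al da dapos).
Qed.

Lemma U_incr r s : 0 < r -> r < s -> U r < U s.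
Proof.
move=> r0 rs; apply: (@derive_gt0_lt _ _ (fun t => (1 - a t) / t * U t)) => // t /andP[h _].
  by apply: dU; exact: lt_le_trans h.
by apply: dUpos; exact: lt_trans h.
Qed.

Lemma a_incr r s : 0 < r -> r < s -> a r < a s.
Proof.
move=> r0 rs.
apply: (@derive_gt0_lt _ _ (fun t => t / 2 * (1 - U t ^+ 2))) => // t /andP[h _].
  by apply: da; exact: lt_le_trans h.
by apply: dapos; exact: lt_trans h.
Qed.

(* A nonpositive value of c U - r (1 - U^2) / 2, where c = 1 - a, would make
   this function, divided by r, tend to -oo, whereas it is at least - 1 / 2. *)
Lemma magnetic_lt r : 0 < r -> r * (1 - U r ^+ 2) / 2 < (1 - a r) * U r.
Proof.
move=> r0; rewrite -subr_gt0 ltNge; apply/negP => Xr.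
pose X t : R := (1 - a t) * U t - t * (1 - U t ^+ 2) / 2.
have dX t : 0 < t -> is_derive t 1 X ((t^-1 + U t) * X t - (1 - a t) * U t * a t / t).
  move=> t0; have hU := dU t0; have ha := da t0.
  by rewrite /X; derive; rewrite /=; field; exact: lt0r_neq0.
(* If [X] vanishes at [r], its derivative there is [- (1 - a r) * U r * a r / r < 0], so a strictly
   negative value occurs just to the right. *)
have [r1 r1r Xr1] : exists2 r1, r <= r1 & X r1 < 0.
  case: (ltP (X r) 0) => [h|h]; first by exists r.
  have X0 : X r = 0 by apply/eqP; rewrite eq_le Xr h.
  have hX : is_derive r 1 (fun t => - X t) ((1 - a r) * U r * a r / r).
    have hX := dX _ r0; derive; rewrite X0; ring.
  have [e e0 he] : exists2 e, 0 < e & forall y, r < y < r + e -> - X r < - X y.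
    apply: derive_gt0_right hX _.
    have [/andP[U0 U1] /andP[a0 a1]] := (U_between r0, a_between r0).
    by rewrite divr_gt0// !mulr_gt0// subr_gt0.
  exists (r + e / 2); first by lra.
  by have := he (r + e / 2); rewrite X0 oppr0 oppr_gt0; apply; lra.
have r10 : 0 < r1 by exact: lt_le_trans r1r.
pose n t : R := - X t / t.
have dn t : r1 <= t -> is_derive t 1 n (U t * n t + (1 - a t) * U t * a t / t ^+ 2).
  move=> h; have t0 : 0 < t by exact: lt_le_trans h.
  have hX := dX _ t0; rewrite /n; derive; first exact: lt0r_neq0.
  field; exact: lt0r_neq0.
have n1 : 0 < n r1 by rewrite divr_gt0// oppr_gt0.
have rest t : r1 <= t -> 0 <= (1 - a t) * U t * a t / t ^+ 2.
  move=> h; have t0 : 0 < t by exact: lt_le_trans h.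
  have [/andP[U0 U1] /andP[a0 a1]] := (U_between t0, a_between t0).
  by rewrite divr_ge0 ?exprn_ge0 ?mulr_ge0 ?subr_ge0 ?ltW.
have ninc : forall t, r1 <= t -> n r1 <= n t.
  apply: pos_nondecr dn n1 _ => t h nt.
  have t0 : 0 < t by exact: lt_le_trans h.
  have /andP[U0 U1] := U_between t0.
  by rewrite addr_ge0 ?rest// mulr_ge0 ?ltW.
have /andP[U10 U11] := U_between r10.
pose k := U r1 * n r1.
have k0 : 0 < k by rewrite mulr_gt0.
(* From [r1] on, [n] grows at rate at least [k], so it exceeds 1 at [s], whereas its formula gives
   less than 1/2. *)
pose s := r1 + k^-1.
have r1s : r1 <= s by rewrite lerDl invr_ge0 ltW.
have : n r1 + k * (s - r1) <= n s.
  apply: (@derive_ge_growth _ _ (fun t => U t * n t + (1 - a t) * U t * a t / t ^+ 2)).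
  - by move=> t /andP[h _]; exact: dn.
  - move=> t /andP[h _]; rewrite -[k]addr0 lerD ?rest ?(ltW h)//.
    by rewrite ler_pM ?ninc ?(ltW h) ?ltW// U_incr.
  - exact: r1s.
rewrite /s addrAC subrr add0r divff ?lt0r_neq0// -/s.
have s0 : 0 < s by exact: lt_le_trans r1s.
have [/andP[U0 U1] /andP[a0 a1]] := (U_between s0, a_between s0).
have -> : n s = - ((1 - a s) * U s / s) + (1 - U s ^+ 2) / 2.
  by rewrite /n /X; field; exact: lt0r_neq0.
have : 0 < (1 - a s) * U s / s by rewrite divr_gt0// mulr_gt0 ?subr_gt0.
have : 0 < U s ^+ 2 by rewrite exprn_gt0.
lra.
Qed.

(* y = r a' / (1 - a) satisfies r y' = y^2 + 2 y (2 - a) - r^2; once negative,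
   the right-hand side stays so and drives y to -oo. *)
Let y r := r ^+ 2 * (1 - U r ^+ 2) / (2 * (1 - a r)).

Let y_gt0 r : 0 < r -> 0 < y r.
Proof.
move=> r0; have [/andP[U0 U1] /andP[a0 a1]] := (U_between r0, a_between r0).
by rewrite divr_gt0 ?mulr_gt0 ?exprn_gt0 ?subr_gt0// expr_lt1// ltW.
Qed.

Let y_quadratic r : 0 < r -> r ^+ 2 <= y r ^+ 2 + 2 * y r * (2 - a r).
Proof.
move=> r0; rewrite -subr_ge0 leNgt; apply/negP => Qr.
pose Q t : R := y t ^+ 2 + 2 * y t * (2 - a t) - t ^+ 2.
have dy t : 0 < t -> is_derive t 1 y (Q t / t).
  move=> t0; have hU := dU t0; have ha := da t0; have /andP[a0 a1] := a_between t0.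
  have c0 : 2 * (1 - a t) != 0 by rewrite lt0r_neq0// mulr_gt0// subr_gt0.
  rewrite /Q /y; derive => //=; field.
  by rewrite lt0r_neq0//= subr_eq0 gt_eqF.
(* After division by [t ^+ 2] the derivative of [- Q] becomes a sum of terms that are nonnegative as
   long as [n] is. *)
pose n t : R := - Q t / t ^+ 2.
pose dn t : R := (2 * y t + 2 * (1 - a t)) * n t / t + y t * (1 - U t ^+ 2) / t + 2 / t.
have hn t : r <= t -> is_derive t 1 n (dn t).
  move=> h; have t0 : 0 < t by exact: lt_le_trans h.
  have hy := dy _ t0; have ha := da t0.
  rewrite /n /Q; derive; first by rewrite expf_neq0// lt0r_neq0.
  by rewrite /dn /n /Q /=; field; rewrite lt0r_neq0.
have n0 : 0 < n r by rewrite divr_gt0 ?exprn_gt0// oppr_gt0.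
have ninc : forall t, r <= t -> n r <= n t.
  apply: pos_nondecr hn n0 _ => t h nt.
  have t0 : 0 < t by exact: lt_le_trans h.
  have [/andP[U0 U1] /andP[a0 a1]] := (U_between t0, a_between t0).
  have y0 := y_gt0 t0; rewrite /dn.
  have U2 : U t ^+ 2 <= 1 by rewrite expr_le1// ltW.
  have c0 : 0 <= 1 - a t by rewrite subr_ge0 ltW.
  have w0 : 0 <= 1 - U t ^+ 2 by rewrite subr_ge0.
  have h1 : 0 <= (2 * y t + 2 * (1 - a t)) * n t by rewrite mulr_ge0 ?(ltW nt)//; lra.
  have h2 : 0 <= y t * (1 - U t ^+ 2) by rewrite mulr_ge0// ltW.
  by rewrite !addr_ge0// divr_ge0// ltW.
pose k := n r * r.
have k0 : 0 < k by rewrite mulr_gt0.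
have s0 : 0 < y r / k by rewrite divr_gt0// y_gt0.
(* [- y] grows at rate [n t * t >= k], so [y] would be nonpositive at this point. *)
pose s := r + y r / k.
have rs : r <= s by rewrite lerDl ltW.
have : - y r + k * (s - r) <= - y s.
  apply: (@derive_ge_growth _ (fun t => - y t) (fun t => - (Q t / t))); last exact: rs.
    move=> t /andP[h _]; have t0 : 0 < t by exact: lt_le_trans h.
    by have hy := dy _ t0; derive.
  move=> t /andP[h _]; have t0 : 0 < t by exact: lt_trans h.
  have -> : - (Q t / t) = n t * t by rewrite /n; field; rewrite lt0r_neq0.
  by rewrite ler_pM ?ninc ?(ltW h)// ltW.
rewrite /s addrAC subrr add0r mulrCA divff ?lt0r_neq0// -/s.
have := @y_gt0 s; rewrite (lt_le_trans r0)// => /(_ isT); lra.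
Qed.

(** The product decreases from its limit 8 at the origin, because [y >= 2 q / (8 + q)] with q = r^2.
    Otherwise [y_quadratic], weakened to q <= y^2 + 4 y, would fail: for a constant K in place of 8
    the comparison reads 12 q + 8 K < (K + q)^2, and K = 8 is the least positive value for which
    this holds for all q > 0. *)
Lemma one_sub_a_le r : 0 < r -> (1 - a r) * (8 + r ^+ 2) <= 8.
Proof.
move=> r0; pose e t : R := (1 - a t) * (8 + t ^+ 2).
have dec s : 0 < s -> s <= r -> e r <= e s.
  move=> s0 sr; rewrite -lerN2.
  pose de t : R := (1 - a t) / t * (y t * (8 + t ^+ 2) - 2 * t ^+ 2).
  apply: (@derive_ge0_le _ (fun t => - e t) de); last exact: sr.
    move=> t /andP[h _]; have t0 : 0 < t by exact: lt_le_trans h.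
    have ha := da t0; have /andP[a0 a1] := a_between t0; rewrite /e; derive.
    rewrite /de /y /=; field.
    by rewrite ?lt0r_neq0 ?subr_gt0.
  move=> t /andP[h _]; have t0 : 0 < t by exact: lt_trans h.
  have /andP[a0 a1] := a_between t0; have := y_quadratic t0; have := y_gt0 t0.
  rewrite /de => y0 yq; have ct0 : 0 <= (1 - a t) / t by apply: divr_ge0; [rewrite subr_ge0|]; exact: ltW.
  rewrite mulr_ge0// subr_ge0 leNgt; apply/negP => zq.
  have q0 : 0 < t ^+ 2 by rewrite exprn_gt0.
  set q := t ^+ 2 in zq q0 yq; set z := y t * (8 + q) in zq.
  have z0 : 0 < z by rewrite mulr_gt0//; lra.
  have le1 : q <= y t ^+ 2 + 4 * y t.
    by apply: le_trans yq _; have := mulr_gt0 y0 a0; lra.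
  have : q * (8 + q) ^+ 2 <= (y t ^+ 2 + 4 * y t) * (8 + q) ^+ 2.
    by rewrite ler_wpM2r// exprn_ge0//; lra.
  have -> : (y t ^+ 2 + 4 * y t) * (8 + q) ^+ 2 = z ^+ 2 + 4 * z * (8 + q).
    by rewrite /z; ring.
  have : 0 <= (2 * q - z) * (2 * q + z) by apply: mulr_ge0; lra.
  have : z * (8 + q) <= 2 * q * (8 + q) by apply: ler_wpM2r; lra.
  have : 0 < q ^+ 3 by rewrite exprn_gt0.
  have : 0 < q ^+ 2 by rewrite exprn_gt0.
  rewrite !exprS expr0; lra.
rewrite leNgt; apply/negP => h.
pose d := e r - 8; have d0 : 0 < d by rewrite subr_gt0.
(* Since [e s < 8 + s ^+ 2], a point [s] this close to the origin has [e s < 8 + d = e r], against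
   the monotonicity. *)
pose s := Num.min r (Num.min 1 (d / 2)).
have s0 : 0 < s by rewrite !lt_min r0 ltr01 divr_gt0.
have sr : s <= r by rewrite ge_min lexx.
have s1 : s <= 1 by rewrite !ge_min lexx orbT.
have sd : s <= d / 2 by rewrite !ge_min lexx !orbT.
have := dec _ s0 sr; have /andP[as0 _] := a_between s0.
rewrite leNgt => /negP; apply; rewrite {1}/e.
have : s ^+ 2 <= s by rewrite expr2 -[leRHS]mulr1 ler_pM2l.
have : (1 - a s) * (8 + s ^+ 2) < 8 + s ^+ 2.
  rewrite -[ltRHS]mul1r ltr_pM2r; first by lra.
  by have := sqr_ge0 s; lra.
by move: sd d0; rewrite /d; lra.
Qed.

(** This is V > 1 multiplied by r^2. With c = 1 - a, [magnetic_lt] bounds the left side by r c, and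
    the right side is 3/4 + 2 c + c^2; what remains, (r - 2) c <= 3/4, follows from [one_sub_a_le]
    when r > 2. *)
Lemma magnetic_le1 r : 0 < r ->
  r ^+ 2 * (1 - U r ^+ 2) / 2 < (2 - a r) ^+ 2 - 4^-1.
Proof.
move=> r0; have [/andP[U0 U1] /andP[a0 a1]] := (U_between r0, a_between r0).
have h1 := magnetic_lt r0; have h2 := one_sub_a_le r0.
set c := 1 - a r in h1 h2; have c0 : 0 < c by rewrite subr_gt0.
have -> : 2 - a r = 1 + c by rewrite /c; ring.
have h3 : r ^+ 2 * (1 - U r ^+ 2) / 2 < r * c.
  have -> : r ^+ 2 * (1 - U r ^+ 2) / 2 = r * (r * (1 - U r ^+ 2) / 2) by ring.
  rewrite ltr_pM2l//; apply: lt_trans h1 _.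
  by rewrite -[ltRHS]mulr1 ltr_pM2l.
apply: lt_le_trans h3 _.
have q0 : 0 <= r ^+ 2 by rewrite sqr_ge0.
suff : (r - 2) * c <= 3 / 4 by have := sqr_ge0 c; rewrite !expr2; lra.
have [r2|r2] := leP r 2.
  have : 0 <= (2 - r) * c by apply: mulr_ge0; lra.
  lra.
(* The difference 3 r^2 - 32 r + 88 has negative discriminant and its minimum at r = 16/3, whence
   the square. *)
have : 32 * (r - 2) <= 3 * (8 + r ^+ 2).
  by have := sqr_ge0 (3 * r - 16); rewrite !expr2; lra.
have : (r - 2) * (c * (8 + r ^+ 2)) <= (r - 2) * 8 by rewrite ler_wpM2l//; lra.
move=> h4 h5; rewrite -(@ler_pM2r _ (8 + r ^+ 2)); [lra|lra].
Qed.

Lemma potential1_gt1 r : 0 < r -> 1 < potential1 U a r.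
Proof.
move=> r0; rewrite -subr_gt0.
have -> : potential1 U a r - 1 =
    ((2 - a r) ^+ 2 - 4^-1 - r ^+ 2 * (1 - U r ^+ 2) / 2) / r ^+ 2.
  by rewrite /potential1; field; rewrite lt0r_neq0.
by rewrite divr_gt0 ?exprn_gt0// subr_gt0 magnetic_le1.
Qed.

Let near0 (f : R -> R) e : {within `[0, +oo[, continuous f} -> f 0 = 0 -> 0 < e ->
  exists2 d, 0 < d & forall r, 0 < r < d -> f r < e.
Proof.
move=> /continuous_within_itvcyP [_ cf] f0 e0; rewrite f0 in cf.
have [d /= d0 hd] := cvgr_lt _ cf _ e0; exists d => // r /andP[r0 rd].
by apply: hd; rewrite // /ball/= sub0r normrN gtr0_norm.
Qed.

Lemma U_near0 e : 0 < e -> exists2 d, 0 < d & forall r, 0 < r < d -> U r < e.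
Proof. by case: profile => -[cU _] [U0 _ _ _] _ _ _; exact: near0. Qed.

Lemma a_near0 e : 0 < e -> exists2 d, 0 < d & forall r, 0 < r < d -> a r < e.
Proof. by case: profile => -[_ ca] [_ a0 _ _] _ _ _; exact: near0. Qed.

Lemma U_nearoo e : e < 1 -> exists2 M, 0 < M & forall r, M < r -> e < U r.
Proof.
move=> e1; case: profile => _ [_ _ Ul _] _ _ _.
have [M [_ hM]] := cvgr_gt _ Ul _ e1; exists (Num.max M 1).
  by rewrite lt_max ltr01 orbT.
by move=> r; rewrite gt_max => /andP[Mr _]; exact: hM.
Qed.

(** At the origin the potential behaves like 15 / (4 r^2). The blow-up argument needs a coefficient
    of at least 3/2; the value 2 leaves room for a spectral shift. *)
Lemma potential1_near0 : exists2 d, 0 < d & forall r, 0 < r < d ->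
  2 / r ^+ 2 <= potential1 U a r - 1.
Proof.
have [d d0 hd] := @a_near0 4^-1 ltac:(lra).
exists (Num.min d 2^-1); first by rewrite lt_min d0 invr_gt0 ltr0n.
move=> r /andP[r0]; rewrite lt_min => /andP[rd r2].
have [/andP[U0 U1] /andP[a0 a1]] := (U_between r0, a_between r0).
have a4 : a r < 4^-1 by apply: hd; rewrite r0.
have -> : potential1 U a r - 1 =
    ((2 - a r) ^+ 2 - 4^-1 - r ^+ 2 * (1 - U r ^+ 2) / 2) / r ^+ 2.
  by rewrite /potential1; field; rewrite lt0r_neq0.
rewrite ler_pM2r ?invr_gt0 ?exprn_gt0//.
have : r ^+ 2 * (1 - U r ^+ 2) <= r ^+ 2.
  by apply: ler_piMr; rewrite ?gerBl sqr_ge0.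
have : 0 <= (2^-1 - r) * (2^-1 + r) by apply: mulr_ge0; lra.
have : 0 <= (4^-1 - a r) * (15 / 4 - a r) by apply: mulr_ge0; lra.
by rewrite !expr2; lra.
Qed.

Lemma potential1_nearoo e : 0 < e -> exists2 M, 0 < M & forall r, M < r ->
  potential1 U a r - 1 <= e.
Proof.
move=> e0; exists (Num.max 1 (4 / e)); first by rewrite lt_max ltr01.
move=> r; rewrite gt_max => /andP[r1 re]; have r0 : 0 < r by lra.
have [/andP[U0 U1] /andP[a0 a1]] := (U_between r0, a_between r0).
have -> : potential1 U a r - 1 = ((2 - a r) ^+ 2 - 4^-1) / r ^+ 2 - (1 - U r ^+ 2) / 2.
  by rewrite /potential1; field; rewrite lt0r_neq0.
have w0 : 0 <= 1 - U r ^+ 2 by rewrite subr_ge0 expr_le1// ltW.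
apply: (@le_trans _ _ (4 / r ^+ 2)).
  have : ((2 - a r) ^+ 2 - 4^-1) / r ^+ 2 <= 4 / r ^+ 2; last lra.
  rewrite ler_pM2r ?invr_gt0 ?exprn_gt0//.
  have : 0 <= a r * (4 - a r) by apply: mulr_ge0; lra.
  by rewrite !expr2; lra.
rewrite ler_pdivrMr ?exprn_gt0//; move: re; rewrite ltr_pdivrMr// => re.
apply: le_trans (ltW re) _; rewrite [e * _]mulrC ler_pM2r// expr2 ler_peMr ?ltW//.
Qed.

(** The derivative is a multiple of the difference of the squares of the two sides of [magnetic_lt].
    This ratio decides the sign of the defect of the comparison function. *)
Lemma magnetic_ratio_decr r s : 0 < r -> r < s ->
  (1 - U s ^+ 2) / (1 - a s) < (1 - U r ^+ 2) / (1 - a r).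
Proof.
move=> r0 rs; rewrite -ltrN2.
pose f t : R := - ((1 - U t ^+ 2) / (1 - a t)).
pose df t : R := 2 * (((1 - a t) * U t) ^+ 2 - (t * (1 - U t ^+ 2) / 2) ^+ 2) /
  (t * (1 - a t) ^+ 2).
apply: (@derive_gt0_lt _ f df) => // t /andP[h _].
  have t0 : 0 < t by exact: lt_le_trans h.
  have [/andP[U0 U1] /andP[a0 a1]] := (U_between t0, a_between t0).
  have hU := dU t0; have ha := da t0.
  have c0 : 1 - a t != 0 by rewrite subr_eq0 gt_eqF.
  rewrite /f; derive => //; rewrite /df; field.
  by rewrite c0 lt0r_neq0.
have t0 : 0 < t by exact: lt_trans h.
have [/andP[U0 U1] /andP[a0 a1]] := (U_between t0, a_between t0).
rewrite /df divr_gt0 ?mulr_gt0 ?exprn_gt0 ?subr_gt0//.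
rewrite ltr_pXn2r ?nnegrE ?magnetic_lt ?mulr_ge0 ?subr_ge0 ?ltW//.
by rewrite expr_lt1// ltW.
Qed.

(* Cross-over point of the comparison function 1 - a / a(r). *)
Lemma crossover : exists2 r, 0 < r & (1 - U r ^+ 2) * (2 - a r) = 1 - a r.
Proof.
pose f r : R := (1 - U r ^+ 2) * (2 - a r) - (1 - a r).
have [d d0 hd] := @U_near0 2^-1 ltac:(lra).
pose p := Num.min 1 (d / 2).
have p0 : 0 < p by rewrite lt_min ltr01 divr_gt0.
have p1 : p <= 1 by rewrite ge_min lexx.
have pd : p < d by rewrite gt_min; apply/orP; right; lra.
have fp : 0 < f p.
  have [/andP[U0 _] /andP[a0 a1]] := (U_between p0, a_between p0).
  have U2 : U p < 2^-1 by apply: hd; rewrite p0.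
  have : U p ^+ 2 < 2^-1 by rewrite expr2; nra.
  by rewrite /f; set u := U p ^+ 2; nra.
(* At r = 4, [magnetic_lt] reads 1 - U^2 < (1 - a) U / 2, which is below (1 - a) / 2, and 2 - a is
   at most 2. *)
have f4 : f 4 <= 0.
  have h4 : (0 : R) < 4 by [].
  have [/andP[U0 U1] /andP[a0 a1]] := (U_between h4, a_between h4).
  have := magnetic_lt h4; rewrite /f; set u := U 4 ^+ 2 => h.
  have w : 1 - u <= (1 - a 4) / 2 by nra.
  have : (1 - u) * (2 - a 4) <= (1 - a 4) / 2 * 2 by apply: ler_pM => //; rewrite /u; nra.
  lra.
have cf s : p <= s <= 4 -> {for s, continuous f}.
  move=> /andP[ps _]; have s0 : 0 < s by exact: lt_le_trans ps.
  have hU := dU s0; have ha := da s0.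
  by apply: is_derive_cont; rewrite /f; repeat dstep.
have [z [/andP[pz _] fz _]] := first_zero cf ltac:(lra) fp f4.
exists z; first exact: lt_trans pz.
by apply/eqP; rewrite -subr_eq0 -/(f z) fz.
Qed.

End Vortex.

(** * Square-integrable solutions for the first operator *)

Section Blowup.
Variable R : realType.
Implicit Types (r s d k c : R).

(* N is integrable on (0, oo), with primitive P. *)
Definition bounded_primitive (N P : R -> R) (C : R) : Prop :=
  forall r, 0 < r -> is_derive r 1 P (N r) /\ 0 <= P r <= C.

(** Integrability yields small values only at some arbitrarily distant points. This lemma and
    [bounded_primitive_lt0] stand in for boundary conditions at the two ends. *)
Lemma bounded_primitive_ltoo N P C M c : bounded_primitive N P C ->
  0 < M -> 0 < c -> exists2 r, M < r & N r < c.
Proof.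
move=> hP M0 c0; apply: contrapT => hN.
have hNc r : M < r -> c <= N r.
  by move=> Mr; rewrite leNgt; apply/negP => h; apply: hN; exists r.
have C0 : 0 <= C by have [_ /andP[h h']] := hP _ M0; exact: le_trans h'.
pose r := M + (C + 1) / c.
have Mr : M < r by rewrite ltrDl divr_gt0//; lra.
have : P M + c * (r - M) <= P r.
  apply: (@derive_ge_growth _ P N); last exact: ltW.
    by move=> s /andP[Ms _]; apply: (hP s _).1; exact: lt_le_trans Ms.
  by move=> s /andP[Ms _]; exact: hNc.
rewrite /r addrAC subrr add0r mulrCA divff ?lt0r_neq0// -/r.
have [_ /andP[h1 h2]] := hP _ M0.
have [_ /andP[h3 h4]] := hP r (lt_trans M0 Mr).
lra.
Qed.

Lemma log_unbounded d c (K : R) : 0 < d -> 0 < c ->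
  exists2 r, 0 < r < d & K < c * (ln d - ln r).
Proof.
move=> d0 c0; pose t := Num.max 1 ((K + 1) / c).
have t1 : 1 <= t by rewrite le_max lexx.
exists (d * expR (- t)).
  rewrite mulr_gt0 ?expR_gt0//= gtr_pMr// expR_lt1; lra.
rewrite lnM ?posrE ?expR_gt0// expRK opprD opprK addNKr.
have : (K + 1) / c <= t by rewrite le_max lexx orbT.
rewrite ler_pdivrMr// mulrC; lra.
Qed.

(** If [N] stayed above [c / r] near the origin, its primitive would diverge like a logarithm. *)
Lemma bounded_primitive_lt0 N P C d c : bounded_primitive N P C ->
  0 < d -> 0 < c -> exists2 r, 0 < r < d & N r < c / r.
Proof.
move=> hP d0 c0; apply: contrapT => hN.
have hNc r : 0 < r < d -> c / r <= N r.
  by move=> rd; rewrite leNgt; apply/negP => h; apply: hN; exists r.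
have [r /andP[r0 rd] hr] := log_unbounded C d0 c0.
have : P r - c * ln r <= P d - c * ln d.
  apply: (@derive_ge0_le _ (fun s => P s - c * ln s) (fun s => N s - c / s)); last exact: ltW.
    move=> s /andP[rs _]; have s0 : 0 < s by exact: lt_le_trans rs.
    have [hPs _] := hP _ s0.
    by derive => //; rewrite mul0r add0r mulr1.
  move=> s /andP[rs sd]; rewrite subr_ge0 hNc// sd andbT.
  exact: lt_trans rs.
have [_ /andP[h1 h2]] := hP _ r0.
have [_ /andP[h3 h4]] := hP _ d0.
lra.
Qed.

(* The inequality N'' >= 3 N / r^2 forces growth at least 1 / r at the origin
   unless N tends to 0: K = (r N)' / r^2 satisfies K' >= N / r^3. *)
Lemma inverse_square_blowup N N1 N2 P C d c : bounded_primitive N P C ->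
  0 < d -> 0 < c ->
  (forall r, 0 < r <= d -> is_derive r 1 N (N1 r) /\ is_derive r 1 N1 (N2 r)) ->
  (forall r, 0 < r < d -> c <= N r /\ 3 * N r / r ^+ 2 <= N2 r) -> False.
Proof.
move=> hP d0 c0 hN hc.
pose K r : R := N1 r / r + N r / r ^+ 2.
have dK r : 0 < r <= d -> is_derive r 1 K (N2 r / r - 2 * N r / r ^+ 3).
  move=> /[dup] rd /andP[r0 _]; have [h1 h2] := hN _ rd; have r1 := lt0r_neq0 r0.
  by rewrite /K; derive; rewrite ?expf_neq0//; field.
have dKge r : 0 < r < d -> c / r ^+ 3 <= N2 r / r - 2 * N r / r ^+ 3.
  move=> /[dup] rd /andP[r0 _]; have [h1 h2] := hc _ rd; have r1 := lt0r_neq0 r0.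
  rewrite -subr_ge0.
  have -> : N2 r / r - 2 * N r / r ^+ 3 - c / r ^+ 3 =
    (N2 r - 3 * N r / r ^+ 2) / r + (N r - c) / r ^+ 3 by field.
  by rewrite addr_ge0// divr_ge0 ?exprn_ge0 ?subr_ge0 ?(ltW r0).
have K_small r : 0 < r <= d -> K r + c / 2 / r ^+ 2 <= K d + c / 2 / d ^+ 2.
  move=> /andP[r0 rd].
  apply: (@derive_ge0_le _ (fun s => K s + c / 2 / s ^+ 2)
    (fun s => N2 s / s - 2 * N s / s ^+ 3 - c / s ^+ 3)); last exact: rd.
    move=> s /andP[rs sd]; have s0 : 0 < s by exact: lt_le_trans rs.
    have hK := dK s; rewrite s0 sd in hK; have {}hK := hK isT.
    have s1 := lt0r_neq0 s0.
    by derive; rewrite ?expf_neq0//; field.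
  move=> s /andP[rs sd]; have s0 : 0 < s by exact: lt_trans rs.
  by have := dKge s; rewrite s0 sd => /(_ isT); rewrite subr_ge0.
(* K' >= c / r^3 integrates to a term c / (2 r^2), which drives [K] to -oo at the origin. *)
have [r /andP[r0 rd] Kr] : exists2 r, 0 < r < d & K r < 0.
  pose M := `|K d + c / 2 / d ^+ 2| + 1.
  have M0 : 0 < M by rewrite ltr_wpDl.
  pose r := Num.min (d / 2) (Num.min 1 (c / 2 / M)).
  have r0 : 0 < r by rewrite !lt_min ltr01 !divr_gt0.
  have rd : r <= d / 2 by rewrite ge_min lexx.
  have r1 : r <= 1 by rewrite !ge_min lexx orbT.
  have rM : r <= c / 2 / M by rewrite !ge_min lexx !orbT.
  exists r; first by rewrite r0; lra.
  have := K_small r; rewrite r0 => /(_ ltac:(lra)).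
  have : M <= c / 2 / r ^+ 2.
    rewrite ler_pdivlMr ?exprn_gt0// mulrC -ler_pdivlMr//.
    by apply: le_trans rM; rewrite expr2 ler_piMr// ltW.
  have := ler_norm (K d + c / 2 / d ^+ 2); rewrite /M; lra.
have Kneg s : 0 < s < r -> K s < 0.
  move=> /andP[s0 sr]; apply: le_lt_trans Kr.
  apply: (@derive_ge0_le _ K (fun t => N2 t / t - 2 * N t / t ^+ 3)); last exact: ltW.
    move=> t /andP[st tr]; apply: dK.
    by rewrite (lt_le_trans s0 st) (le_trans tr (ltW rd)).
  move=> t /andP[st tr]; have t0 := lt_trans s0 st.
  apply: le_trans (dKge t _); last by rewrite t0 (lt_trans tr rd).
  by rewrite divr_ge0 ?exprn_ge0 ?ltW.
(* The derivative of [t * N t] is [t ^+ 2 * K t < 0] on (0, r), so [N s >= r * c / s] there, against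
   integrability. *)
have c' : 0 < r * c by rewrite mulr_gt0.
have [s /andP[s0 sr]] := bounded_primitive_lt0 hP r0 c'.
rewrite ltr_pdivlMr// mulrC ltNge => /negP; apply.
have [hcr _] := hc r ltac:(by rewrite r0).
apply: (@le_trans _ _ (r * N r)); first by rewrite ler_pM2l.
rewrite -lerN2; pose g t : R := - (t * N t).
apply: (@derive_ge0_le _ g (fun t => - (t ^+ 2 * K t))); last exact: ltW.
  move=> t /andP[st tr]; have t0 := lt_le_trans s0 st.
  have [hNt _] := hN t ltac:(by rewrite t0 (le_trans tr (ltW rd))).
  rewrite /g; derive; rewrite /K; field; exact: lt0r_neq0.
move=> t /andP[st tr]; have t0 := lt_trans s0 st.
by rewrite oppr_ge0; apply: mulr_ge0_le0; rewrite ?sqr_ge0 ?(ltW (Kneg t _))// t0 tr.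
Qed.

End Blowup.

(** * The squared modulus and the Wronskian of an eigenfunction *)

Section SquaredModulus.
Variable R : realType.
Variables (V u v u1 v1 : R -> R) (x y : R).
Implicit Types (r s d k c : R).

Let N r := u r ^+ 2 + v r ^+ 2.
Let N1 r := 2 * (u r * u1 r + v r * v1 r).
Let N2 r := 2 * (u1 r ^+ 2 + v1 r ^+ 2) + 2 * (V r - x) * N r.
Let W r := u r * v1 r - v r * u1 r.

Hypothesis du : forall r, 0 < r -> is_derive r 1 u (u1 r).
Hypothesis dv : forall r, 0 < r -> is_derive r 1 v (v1 r).
Hypothesis du1 : forall r, 0 < r -> is_derive r 1 u1 ((V r - x) * u r + y * v r).
Hypothesis dv1 : forall r, 0 < r -> is_derive r 1 v1 ((V r - x) * v r - y * u r).

Variables (P : R -> R) (C : R).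
Hypothesis hP : bounded_primitive N P C.

Let dN r : 0 < r -> is_derive r 1 N (N1 r).
Proof.
by move=> r0; have hu := du r0; have hv := dv r0; rewrite /N /N1; derive; rewrite /=; ring.
Qed.

Let dN1 r : 0 < r -> is_derive r 1 N1 (N2 r).
Proof.
move=> r0; have hu := du r0; have hv := dv r0; have hu1 := du1 r0; have hv1 := dv1 r0.
by rewrite /N /N1 /N2; derive; rewrite /N; ring.
Qed.

Let N_ge0 r : 0 <= N r.
Proof. by rewrite addr_ge0 ?sqr_ge0. Qed.

(** A convex function with a positive slope grows at least linearly, which its integrability
    forbids. *)
Let convex_blowup r : (forall s, r <= s -> 0 <= N2 s) -> 0 < r -> N1 r <= 0.
Proof.
move=> N20 r0; rewrite leNgt; apply/negP => h.
have dN' s : r <= s -> is_derive s 1 N (N1 s).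
  by move=> rs; apply: dN; exact: lt_le_trans rs.
have N1r s : r <= s -> N1 r <= N1 s.
  move=> rs; apply: (@derive_ge0_le _ N1 N2); last exact: rs.
    by move=> t /andP[rt _]; apply: dN1; exact: lt_le_trans rt.
  by move=> t /andP[rt _]; apply: N20; exact: ltW.
have [s rs] := bounded_primitive_ltoo hP (ltr_wpDr ler01 r0) h.
rewrite ltNge => /negP; apply.
have : N r + N1 r * (s - r) <= N s.
  apply: (@derive_ge_growth _ N N1); [|move=> t /andP[rt _]; exact/N1r/ltW|lra].
  by move=> t /andP[rt _]; exact: dN'.
have := N_ge0 r; have : N1 r <= N1 r * (s - r) by apply: ler_peMr; lra.
lra.
Qed.

Hypothesis V_ge1 : forall r, 0 < r -> 1 <= V r.
Variable d0 : R.
Hypothesis d0_gt0 : 0 < d0.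
Hypothesis V_near0 : forall r, 0 < r < d0 -> 2 / r ^+ 2 <= V r - 1.

Let N2_ge r : 0 < r -> 2 * (V r - x) * N r <= N2 r.
Proof. by move=> r0; rewrite /N2 lerDr mulr_ge0// addr_ge0 ?sqr_ge0. Qed.

Lemma eigenfunction_eq0_le : x <= 1 -> forall r, 0 < r -> N r = 0.
Proof.
move=> x1 r r0; apply/eqP; rewrite eq_le N_ge0 andbT leNgt; apply/negP => Nr.
have Vx s : 0 < s -> 0 <= V s - x by move=> /V_ge1; lra.
have N2_ge0 s : 0 < s -> 0 <= N2 s.
  by move=> s0; apply: le_trans (N2_ge s0); rewrite !mulr_ge0 ?Vx ?N_ge0.
have N1_le0 s : 0 < s -> N1 s <= 0.
  by move=> s0; apply: convex_blowup => // t st; apply: N2_ge0; exact: lt_le_trans st.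
pose d := Num.min d0 r.
have d_gt0 : 0 < d by rewrite lt_min d0_gt0.
apply: (@inverse_square_blowup _ N N1 N2 _ _ d _ hP d_gt0 Nr).
  by move=> s /andP[s0 _]; split; [exact: dN|exact: dN1].
move=> s /andP[s0]; rewrite lt_min => /andP[sd sr]; split.
  rewrite -lerN2; apply: (@derive_ge0_le _ (fun t => - N t) (fun t => - N1 t)); last exact: ltW.
    by move=> t /andP[st _]; have h := dN (lt_le_trans s0 st); derive.
  by move=> t /andP[st _]; rewrite oppr_ge0 N1_le0// (lt_trans s0 st).
apply: le_trans (N2_ge s0).
have -> : 3 * N s / s ^+ 2 = 3 / s ^+ 2 * N s by ring.
rewrite ler_wpM2r ?N_ge0//.
have := V_near0 (r := s); rewrite s0 sd => /(_ isT).
have : 3 / s ^+ 2 <= 4 / s ^+ 2 by rewrite ler_pM2r ?invr_gt0 ?exprn_gt0//; lra.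
lra.
Qed.

Let V_near0_shift : exists2 d, 0 < d & forall r, 0 < r < d -> 3 / 2 / r ^+ 2 <= V r - x.
Proof.
pose B := `|x - 1| + 1; have B0 : 0 < B by rewrite ltr_wpDl.
exists (Num.min d0 (Num.min 1 (2 * B)^-1)).
  by rewrite !lt_min d0_gt0 ltr01 invr_gt0 mulr_gt0.
move=> r /andP[r0]; rewrite !lt_min => /andP[rd /andP[r1 rB]].
have := V_near0 (r := r); rewrite r0 rd => /(_ isT).
have : 2 * B <= (r ^+ 2)^-1.
  rewrite -[leLHS]invrK lef_pV2 ?posrE ?exprn_gt0 ?invr_gt0 ?mulr_gt0//.
  by apply: le_trans (ltW rB); rewrite expr2 ler_piMr ?ltW.
have := ler_norm (x - 1); rewrite /B; set q := (r ^+ 2)^-1; lra.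
Qed.

(* Lagrange's identity *)
Let wronskian_sqr r : W r ^+ 2 <= N r * (u1 r ^+ 2 + v1 r ^+ 2).
Proof.
rewrite -subr_ge0; have -> : N r * (u1 r ^+ 2 + v1 r ^+ 2) - W r ^+ 2 =
  (u r * u1 r + v r * v1 r) ^+ 2 by rewrite /N /W; ring.
exact: sqr_ge0.
Qed.

Let sqr_norm_ge (z c : R) : 0 <= c -> c <= `|z| -> c ^+ 2 <= z ^+ 2.
Proof. by move=> c0 cz; rewrite -[z ^+ 2]real_normK ?num_real// ler_sqr ?nnegrE. Qed.

(** Suppose |W| >= c beyond M and let F = u1^2 + v1^2. Lagrange's identity gives F N >= c^2, hence F
    + N >= 2 c and N'' + (2 + 2 B) N >= 4 c. Then N' + (2 + 2 B) P grows linearly; as P is bounded,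
    N' is eventually at least 1, and N cannot be integrable. *)
Let wronskian_ltoo M B c : 0 < M -> 0 < c -> (forall r, M < r -> `|V r - x| <= B) ->
  exists2 r, M < r & `|W r| < c.
Proof.
move=> M0 c0 hB; apply: contrapT => hW.
have hWc r : M < r -> c <= `|W r|.
  by move=> Mr; rewrite leNgt; apply/negP => h; apply: hW; exists r.
have N2_ge' r : M < r -> 4 * c <= N2 r + (2 + 2 * B) * N r.
  move=> Mr; have := sqr_norm_ge (ltW c0) (hWc _ Mr); have := wronskian_sqr r.
  have := hB _ Mr; rewrite ler_norml => /andP[h1 h2].
  have n0 := N_ge0 r; rewrite /N2; set F := u1 r ^+ 2 + v1 r ^+ 2 => h3 h4.
  have F0 : 0 <= F by rewrite addr_ge0 ?sqr_ge0.
  have h5 : 2 * c <= F + N r.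
    have c20 : 0 <= 2 * c by lra.
    have FN : 0 <= F + N r by lra.
    rewrite -ler_sqr ?nnegrE//.
    by have := sqr_ge0 (F - N r); rewrite !expr2 in h3 h4 *; lra.
  have : 0 <= (V r - x + B) * N r by apply: mulr_ge0; lra.
  lra.
pose L := 2 + 2 * B; pose Z r : R := N1 r + L * P r.
have B0 : 0 <= B by apply: le_trans (hB (M + 1) _); rewrite ?normr_ge0; lra.
have M1 : M < M + 1 by lra.
have C0 : 0 <= C by have [_ /andP[h h']] := hP M0; exact: le_trans h'.
have Zge r : M + 1 <= r -> Z (M + 1) + 4 * c * (r - (M + 1)) <= Z r.
  move=> Mr; apply: (@derive_ge_growth _ Z (fun s => N2 s + L * N s)); last exact: Mr.
    move=> s /andP[h _]; have s0 : 0 < s by lra.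
    by have [h1 _] := hP s0; have h2 := dN1 s0; rewrite /Z; derive; ring.
  by move=> s /andP[h _]; apply: N2_ge'; lra.
pose K := 1 + L * C + `|Z (M + 1)|.
have L0 : 0 <= L by rewrite /L; lra.
have K0 : 0 <= K by rewrite /K !addr_ge0// mulr_ge0.
have N1_ge r : M + 1 + K / (4 * c) <= r -> 1 <= N1 r.
  have k0 : 0 <= K / (4 * c) by rewrite divr_ge0// mulr_ge0// ltW.
  move=> hr; have hr' : M + 1 <= r by lra.
  have r0 : 0 < r by lra.
  have := Zge _ hr'; have [_ /andP[p0 pC]] := hP r0.
  have : 4 * c * (K / (4 * c)) <= 4 * c * (r - (M + 1)).
    by rewrite ler_pM2l ?mulr_gt0//; lra.
  rewrite mulrCA divff ?mulr1; last by rewrite lt0r_neq0// mulr_gt0.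
  have : L * P r <= L * C by rewrite ler_wpM2l.
  have := ler_norm (- Z (M + 1)); rewrite normrN /K /Z; lra.
set r2 := M + 1 + K / (4 * c) in N1_ge.
have r20 : 0 < r2 by rewrite /r2 ltr_wpDr ?divr_ge0 ?mulr_ge0 ?(ltW c0)//; lra.
have [r hr] := bounded_primitive_ltoo hP (ltr_wpDr ler01 r20) ltr01.
rewrite ltNge => /negP; apply.
have : N r2 + 1 * (r - r2) <= N r.
  apply: (@derive_ge_growth _ N N1); last by lra.
    by move=> s /andP[h _]; apply: dN; exact: lt_le_trans h.
  by move=> s /andP[h _]; apply: N1_ge; exact: ltW.
have := N_ge0 r2; lra.
Qed.

(** Suppose |W| >= c near the origin. By [inverse_square_blowup] N takes arbitrarily small values
    there, and it is convex, hence nondecreasing with N <= A r. Lagrange's identity now forces N''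
    >= 2 c^2 / (A r), so that N' tends logarithmically to -oo at the origin, against N' >= 0. *)
Let wronskian_lt0 e c : 0 < e -> 0 < c -> exists2 r, 0 < r < e & `|W r| < c.
Proof.
move=> e0 c0; apply: contrapT => hW.
have [d1 d10 hV] := V_near0_shift.
pose d := Num.min e d1 / 2.
have m0 : 0 < Num.min e d1 by rewrite lt_min e0.
have d_gt0 : 0 < d by rewrite divr_gt0.
have de : d < e by rewrite (lt_le_trans _ (_ : Num.min e d1 <= e)) ?ge_min ?lexx// /d; lra.
have dd1 : d < d1.
  by rewrite (lt_le_trans _ (_ : Num.min e d1 <= d1)) ?ge_min ?lexx ?orbT// /d; lra.
have hWc r : 0 < r <= d -> c ^+ 2 <= N r * (u1 r ^+ 2 + v1 r ^+ 2).
  move=> /andP[r0 rd]; apply: le_trans (wronskian_sqr r).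
  apply: sqr_norm_ge; first exact: ltW.
  rewrite leNgt; apply/negP => h; apply: hW; exists r => //.
  by rewrite r0 (le_lt_trans rd de).
have c2 : 0 < c ^+ 2 by rewrite exprn_gt0.
have N_gt0 r : 0 < r <= d -> 0 < N r.
  move=> /hWc h; rewrite lt_neqAle N_ge0 andbT; apply/eqP => h0.
  by move: h; rewrite -h0 mul0r leNgt c2.
have N2_ge3 r : 0 < r <= d -> 3 * N r / r ^+ 2 <= N2 r - 2 * (u1 r ^+ 2 + v1 r ^+ 2).
  move=> /andP[r0 rd]; have := hV r; rewrite r0 (le_lt_trans rd dd1) => /(_ isT) h.
  have : 3 / 2 / r ^+ 2 * N r <= (V r - x) * N r by rewrite ler_wpM2r ?N_ge0.
  by rewrite /N2; lra.
have N2_ge3' r : 0 < r <= d -> 3 * N r / r ^+ 2 <= N2 r.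
  move=> rd; apply: le_trans (N2_ge3 _ rd) _.
  by rewrite gerBl mulr_ge0// addr_ge0 ?sqr_ge0.
have N2_ge0 r : 0 < r <= d -> 0 <= N2 r.
  move=> rd; apply: le_trans (N2_ge3' _ rd).
  by rewrite divr_ge0 ?sqr_ge0 ?mulr_ge0 ?N_ge0.
have N_small s n : 0 < s <= d -> 0 < n -> exists2 r, 0 < r < s & N r < n.
  move=> /andP[s0 sd] n0; apply: contrapT => hn.
  apply: (@inverse_square_blowup _ N N1 N2 _ _ s _ hP s0 n0).
    by move=> r /andP[r0 _]; split; [exact: dN|exact: dN1].
  move=> r /andP[r0 rs]; split; last by rewrite N2_ge3'// r0 (le_trans (ltW rs)).
  by rewrite leNgt; apply/negP => h; apply: hn; exists r => //; rewrite r0.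
have N1_mono r s : 0 < r -> r <= s -> s <= d -> N1 r <= N1 s.
  move=> r0 rs sd; apply: (@derive_ge0_le _ N1 N2); last exact: rs.
    by move=> t /andP[rt _]; apply: dN1; exact: lt_le_trans rt.
  by move=> t /andP[rt ts]; apply: N2_ge0; rewrite (lt_trans r0 rt) (le_trans (ltW ts)).
have N1_ge0 r : 0 < r <= d -> 0 <= N1 r.
  move=> /[dup] rd /andP[r0 rd']; rewrite leNgt; apply/negP => h.
  have [s /andP[s0 sr]] := N_small _ _ rd (N_gt0 _ rd).
  rewrite ltNge => /negP; apply; rewrite -lerN2.
  apply: (@derive_ge0_le _ (fun t => - N t) (fun t => - N1 t)); last exact: ltW.
    by move=> t /andP[st _]; have h' := dN (lt_le_trans s0 st); derive.
  move=> t /andP[st tr]; rewrite oppr_ge0; apply: le_trans (ltW h).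
  by apply: N1_mono => //; [exact: lt_trans st|exact: ltW].
pose A := N1 d.
have N_le s : 0 < s <= d -> N s <= A * s.
  move=> /[dup] sd /andP[s0 sd']; rewrite leNgt; apply/negP => h.
  have [r /andP[r0 rs] hr] := N_small _ (N s - A * s) sd ltac:(by rewrite subr_gt0).
  have : - N r + - A * (s - r) <= - N s.
    apply: (@derive_ge_growth _ (fun t => - N t) (fun t => - N1 t)); last exact: ltW.
      by move=> t /andP[st _]; have h' := dN (lt_le_trans r0 st); derive.
    move=> t /andP[rt ts]; rewrite lerN2; apply: N1_mono => //.
      exact: lt_trans rt.
    exact: le_trans (ltW ts) _.
  have : 0 <= A * r by rewrite mulr_ge0 ?(ltW r0)// N1_ge0// d_gt0 lexx.
  lra.
have dd : 0 < d <= d by rewrite d_gt0 lexx.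
have A0 : 0 < A.
  have := lt_le_trans (N_gt0 _ dd) (N_le _ dd).
  by rewrite pmulr_lgt0.
have k0 : 0 < 2 * c ^+ 2 / A by rewrite divr_gt0// mulr_gt0.
have [r /andP[r0 rd]] := log_unbounded A d_gt0 k0.
set k := 2 * c ^+ 2 / A in k0 * => hk.
have : N1 r - k * ln r <= N1 d - k * ln d.
  apply: (@derive_ge0_le _ (fun t => N1 t - k * ln t) (fun t => N2 t - k / t)); last exact: ltW.
    move=> t /andP[rt _]; have t0 := lt_le_trans r0 rt.
    by have h := dN1 t0; derive => //; rewrite mul0r add0r mulr1.
  move=> t /andP[rt td]; have t0 := lt_trans r0 rt.
  have td' : 0 < t <= d by rewrite t0 ltW.
  rewrite subr_ge0.
  have hF : 0 <= u1 t ^+ 2 + v1 t ^+ 2 by rewrite addr_ge0 ?sqr_ge0.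
  apply: (@le_trans _ _ (2 * (u1 t ^+ 2 + v1 t ^+ 2))); last first.
    have := N2_ge3 _ td'.
    have : 0 <= 3 * N t / t ^+ 2 by rewrite divr_ge0 ?sqr_ge0 ?mulr_ge0 ?N_ge0.
    lra.
  have -> : k / t = 2 * (c ^+ 2 / (A * t)) by rewrite /k; field; rewrite !lt0r_neq0.
  rewrite ler_pM2l// ler_pdivrMr ?(mulr_gt0 A0 t0)// mulrC.
  by apply: le_trans (hWc _ td') _; rewrite ler_wpM2r// N_le.
have := N1_ge0 r; rewrite r0 (ltW rd) => /(_ isT).
move: hk; rewrite /A; lra.
Qed.

(** [Z = - y W] is nondecreasing and takes arbitrarily small values near both ends of the half-line.
    So it vanishes identically, and with it its derivative [y ^+ 2 * N]. *)
Lemma eigenfunction_eq0_nonreal M B : y != 0 -> 0 < M ->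
  (forall r, M < r -> `|V r - x| <= B) -> forall r, 0 < r -> N r = 0.
Proof.
move=> y0 M0 hB r r0; apply/eqP; rewrite eq_le N_ge0 andbT leNgt; apply/negP => Nr.
pose Z s := - (y * W s).
have dZ s : 0 < s -> is_derive s 1 Z (y ^+ 2 * N s).
  move=> s0; have hu := du s0; have hv := dv s0; have hu1 := du1 s0; have hv1 := dv1 s0.
  by rewrite /Z /W; derive; rewrite /N; ring.
have Zmono s t : 0 < s -> s <= t -> Z s <= Z t.
  move=> s0 st; apply: (@derive_ge0_le _ Z (fun t => y ^+ 2 * N t)); last exact: st.
    by move=> k /andP[h _]; apply: dZ; exact: lt_le_trans h.
  by move=> k _; rewrite mulr_ge0 ?sqr_ge0.
have normZ s : `|Z s| = `|y| * `|W s| by rewrite /Z normrN normrM.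
have ny : 0 < `|y| by rewrite normr_gt0.
have Zle0 s : 0 < s -> Z s <= 0.
  move=> s0; rewrite leNgt; apply/negP => h.
  have Ms : 0 < Num.max M s by rewrite lt_max M0.
  have hBs t : Num.max M s < t -> `|V t - x| <= B.
    by rewrite gt_max => /andP[Mt _]; exact: hB.
  have c0 : 0 < Z s / `|y| by rewrite divr_gt0.
  have [t] := wronskian_ltoo Ms c0 hBs.
  rewrite gt_max => /andP[_ st]; rewrite ltr_pdivlMr// mulrC -normZ ltNge => /negP; apply.
  by apply: le_trans (ler_norm _); apply: Zmono => //; exact: ltW.
have Zge0 s : 0 < s -> 0 <= Z s.
  move=> s0; rewrite leNgt; apply/negP => h.
  have c0 : 0 < - Z s / `|y| by rewrite divr_gt0// oppr_gt0.
  have [t /andP[t0 ts]] := wronskian_lt0 s0 c0.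
  rewrite ltr_pdivlMr// mulrC -normZ ltNge => /negP; apply.
  rewrite -normrN; apply: le_trans (ler_norm _); rewrite lerN2; apply: Zmono => //; exact: ltW.
have y2 : 0 < y ^+ 2 by rewrite lt_neqAle sqr_ge0 eq_sym expf_neq0.
have [e e0 he] := derive_gt0_right (dZ _ r0) (mulr_gt0 y2 Nr).
have Z0 s : 0 < s -> Z s = 0 by move=> s0; apply/eqP; rewrite eq_le Zle0// Zge0.
have := he (r + e / 2); rewrite !Z0 ?ltxx; [|lra|lra].
by move=> h; have /h : r < r + e / 2 < r + e by lra.
Qed.

End SquaredModulus.

(** * Regular solutions of the radial equation *)

Section Primitive.
Variable R : realType.
Implicit Types (f h : R -> R) (x y : R).
Let mu := @lebesgue_measure R.

(* A primitive vanishing at 0, valid on (-1, oo): starting to the left of 0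
   makes it differentiable at 0. *)
Definition primitive h x : R :=
  \int[mu]_(t in `[-1, x]) h t - \int[mu]_(t in `[-1, 0]) h t.

Lemma primitive0 h : primitive h 0 = 0.
Proof. exact: subrr. Qed.

Lemma primitive_cst0 x : primitive (fun=> 0) x = 0.
Proof. by rewrite /primitive /Rintegral !integral0_eq// subrr. Qed.

Lemma continuous_integrable_segment h x y : continuous h ->
  mu.-integrable `[x, y] (EFin \o h).
Proof.
move=> ch; apply: continuous_compact_integrable; first exact: segment_compact.
exact: continuous_subspaceT.
Qed.

Lemma is_derive_primitive h x : continuous h -> -1 < x ->
  is_derive x 1 (primitive h) (h x).
Proof.
move=> ch x1.
have xx : x < x + 1 by lra.
have [d1 d2] := @continuous_FTC1_closed R h (-1) x (x + 1) xx
  (@continuous_integrable_segment h _ _ ch) x1 (ch x).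
have hF : is_derive x 1 (fun x => \int[mu]_(t in `[-1, x]) h t) (h x).
  by apply: DeriveDef; [exact: d1|rewrite -d2 derive1E].
exact: is_derive_val (is_derive_sub hF (is_derive_const _ _)) (subr0 _).
Qed.

End Primitive.

Section RegularSolution.
Variables (R : realType) (q : R -> R).
Hypothesis cq : continuous q.
Hypothesis q_le1 : forall r, `|q r| <= 1.
Implicit Types (f : R -> R) (r y c : R).

Let M y : R := Num.max y 0.

Let M_ge0 y : 0 <= M y. Proof. by rewrite /M le_max lexx orbT. Qed.

Let M_id y : 0 <= y -> M y = y.
Proof. by move=> y0; apply/max_idPl. Qed.

Let cM : continuous M.
Proof. by move=> y; apply: continuous_max; [exact: cvg_id|exact: cvg_cst]. Qed.

(** The equation (y g')' = y q g with g(0) = 1 and g'(0) = 0 integrates to g' = [k g] and g = 1 +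
    [T g]. The cut-off [M] freezes the arguments at 0, so that all iterates are continuous on the
    whole line. *)
Let h f y := M y * q y * f y.
Let p f y := primitive (h f) y.
Let k f y := p f y / y.
Let T f y := primitive (fun s => k f (M s)) (M y).

Let ch f : continuous f -> continuous (h f).
Proof. by move=> cf y; apply: cvgM; [apply: cvgM; [exact: cM|exact: cq]|exact: cf]. Qed.

Let dp f y : continuous f -> 0 <= y -> is_derive y 1 (p f) (y * q y * f y).
Proof.
move=> cf y0; rewrite -{2}(M_id y0).
by apply: (is_derive_primitive (ch cf)); lra.
Qed.

Lemma derive_le_comparison (f df g dg : R -> R) y :
  (forall s, 0 <= s <= y -> is_derive s 1 f (df s)) ->
  (forall s, 0 <= s <= y -> is_derive s 1 g (dg s)) ->
  (forall s, 0 < s < y -> df s <= dg s) -> 0 <= y -> f 0 <= g 0 -> f y <= g y.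
Proof.
move=> hf hg hfg y0 fg0.
have : g 0 - f 0 <= g y - f y.
  apply: (@derive_ge0_le _ (fun s => g s - f s) (fun s => dg s - df s)); last exact: y0.
    by move=> s sy; have h1 := hf _ sy; have h2 := hg _ sy; derive.
  by move=> s sy; rewrite subr_ge0 hfg.
lra.
Qed.

Let p_dist f f' c : continuous f -> continuous f' ->
  (forall y, 0 <= y -> `|f y - f' y| <= c * expR (2 * y)) ->
  forall y, 0 <= y -> `|p f y - p f' y| <= c / 2 * y * expR (2 * y).
Proof.
move=> cf cf' hc y y0.
have c0 : 0 <= c.
  by have := le_trans (normr_ge0 _) (hc _ (lexx 0)); rewrite pmulr_lge0 ?expR_gt0.
have dq s : 0 <= s -> `|s * q s * f s - s * q s * f' s| <= c * s * expR (2 * s).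
  move=> s0; rewrite -mulrBr !normrM (ger0_norm s0) -mulrA [c * s]mulrC -mulrA.
  apply: ler_wpM2l => //; rewrite -[leRHS]mul1r; apply: ler_pM => //; exact: hc.
have dE s : 0 <= s <= y -> is_derive s 1 (fun s => c / 2 * s * expR (2 * s))
   (c / 2 * expR (2 * s) + c * s * expR (2 * s)).
  by move=> _; derive; field.
have hd (f1 f2 : R -> R) : continuous f1 -> continuous f2 ->
   (forall s, 0 <= s <= y -> is_derive s 1 (fun s => p f1 s - p f2 s) (s * q s * f1 s - s * q s * f2 s)).
  move=> c1 c2 s /andP[s0 _]; have h1 := dp c1 s0; have h2 := dp c2 s0; by derive.
have pos s : 0 <= c / 2 * expR (2 * s) by rewrite mulr_ge0 ?expR_ge0 ?divr_ge0.
rewrite ler_norml; apply/andP; split.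
  rewrite lerNl opprB; apply: (derive_le_comparison (hd _ _ cf' cf) dE) => //.
    move=> s /andP[s0 _]; have := dq s (ltW s0); rewrite distrC => /(le_trans (ler_norm _)).
    by have := pos s; lra.
  by rewrite /p !primitive0 subr0 mulr0 mul0r.
apply: (derive_le_comparison (hd _ _ cf cf') dE) => //.
  move=> s /andP[s0 _]; have := dq s (ltW s0) => /(le_trans (ler_norm _)).
  by have := pos s; lra.
by rewrite /p !primitive0 subr0 mulr0 mul0r.
Qed.

Let p_le f c y : continuous f -> (forall s, 0 <= s <= y -> `|f s| <= c) ->
  0 <= y -> `|p f y| <= c * y ^+ 2.
Proof.
move=> cf hc y0.
have c0 : 0 <= c by apply: le_trans (hc 0 _); rewrite ?lexx.
have dE s : 0 <= s <= y -> is_derive s 1 (fun s => c * s ^+ 2) (2 * (c * s)).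
  by move=> _; derive; rewrite /=; ring.
have dNp s : 0 <= s <= y -> is_derive s 1 (fun s => - p f s) (- (s * q s * f s)).
  by move=> /andP[s0 _]; have h1 := dp cf s0; derive.
have hq s : 0 < s < y -> `|s * q s * f s| <= 2 * (c * s).
  move=> /andP[s0 sy]; apply: (@le_trans _ _ (c * s)).
    rewrite !normrM (gtr0_norm s0) -mulrA [c * s]mulrC ler_wpM2l ?(ltW s0)//.
    by rewrite -[leRHS]mul1r ler_pM// hc// !ltW.
  by have := mulr_ge0 c0 (ltW s0); lra.
rewrite ler_norml; apply/andP; split.
  rewrite lerNl; apply: (derive_le_comparison dNp dE) => //.
    by move=> s sy; apply: le_trans (hq _ sy); rewrite -normrN ler_norm.
  by rewrite /p primitive0 oppr0 expr0n mulr0.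
apply: (derive_le_comparison _ dE) => //.
- by move=> s /andP[s0 _]; exact: dp.
- by move=> s sy; apply: le_trans (hq _ sy); exact: ler_norm.
- by rewrite /p primitive0 expr0n mulr0.
Qed.

(** At 0 the bound [p_le] makes the quotient tend to 0, which is also its value there by the
    convention [0^-1 = 0]. *)
Let ck f : continuous f -> continuous (fun s => k f (M s)).
Proof.
move=> cf y; have [y0|y0] := ltP 0 y.
  apply: (@continuous_comp _ _ _ M (k f)); first exact: cM.
  rewrite M_id ?ltW//.
  have h1 := dp cf (ltW y0).
  have : is_derive y 1 (k f) (y * q y * f y * y^-1 + p f y * (- y ^- 2 * 1)).
    by rewrite /k; derive; [exact: lt0r_neq0|].
  exact: is_derive_cont.
have [B hB] : exists B, forall s, 0 <= s <= 1 -> `|f s| <= B.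
  have cf' : {within `[0, 1], continuous (fun s : R => `|f s|)}.
    by apply: continuous_subspaceT => s; apply: cvg_norm; exact: cf.
  have [b _ hb] := @EVT_max R _ 0 1 ler01 cf'.
  by exists `|f b| => s s01; apply: hb; rewrite in_itv.
have B0 : 0 <= B by apply: le_trans (hB 0 _); rewrite ?lexx ?ler01.
have kle s : 0 <= s <= 1 -> `|k f s| <= B * s.
  move=> /andP[s0 s1]; have [->|s00] := eqVneq s 0.
    by rewrite /k invr0 mulr0 normr0 mulr0.
  have sp : 0 < s by rewrite lt_neqAle eq_sym s00.
  rewrite /k normrM normfV (ger0_norm s0) ler_pdivrMr// -mulrA -expr2.
  apply: p_le => // t /andP[t0 ts]; apply: hB; rewrite t0; exact: le_trans ts _.
have My : M y = 0 by apply/max_idPr.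
rewrite /continuous_at My.
have -> : k f 0 = 0 by rewrite /k invr0 mulr0.
have Bp : 0 < B + 1 by lra.
apply/cvgrPdist_le => e e0; near=> s; rewrite sub0r normrN.
apply: (@le_trans _ _ ((B + 1) * M s)).
  apply: le_trans (kle (M s) _) _; last by rewrite ler_wpM2r//; lra.
  rewrite M_ge0 /=; near: s; have := cM (x := y).
  by move=> /cvgr_le; apply; rewrite My.
rewrite mulrC -ler_pdivlMr//; near: s; have := cM (x := y).
by move=> /cvgr_le; apply; rewrite My; exact: divr_gt0.
Unshelve. all: by end_near. Qed.

Let dT f y : continuous f -> 0 <= y ->
  is_derive y 1 (primitive (fun s => k f (M s))) (k f y).
Proof.
move=> cf y0; rewrite -{2}(M_id y0).
by apply: (is_derive_primitive (ck cf)); lra.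
Qed.

Let cT f : continuous f -> continuous (T f).
Proof.
move=> cf y; have h1 := is_derive_cont (dT cf (M_ge0 y)).
exact: (continuous_comp (cM (x:=y)) h1).
Qed.

(** In the norm weighted by exp(2 y) each of the two integrations gains a factor 1/2, so [T]
    contracts by 1/4 on the whole half-line at once. *)
Let T_dist f f' c : continuous f -> continuous f' ->
  (forall y, 0 <= y -> `|f y - f' y| <= c * expR (2 * y)) ->
  forall y, `|T f y - T f' y| <= c / 4 * expR (2 * M y).
Proof.
move=> cf cf' hc y; rewrite /T; move: (M y) (M_ge0 y) => {}y y0.
have c0 : 0 <= c.
  by have := le_trans (normr_ge0 _) (hc _ (lexx 0)); rewrite pmulr_lge0 ?expR_gt0.
have kd s : 0 < s -> `|k f s - k f' s| <= c / 2 * expR (2 * s).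
  move=> s0; rewrite /k -mulrBl normrM normfV (gtr0_norm s0) ler_pdivrMr//.
  by apply: le_trans (p_dist cf cf' hc (ltW s0)) _; rewrite mulrAC.
have dE s : 0 <= s <= y -> is_derive s 1 (fun s => c / 4 * expR (2 * s)) (c / 2 * expR (2 * s)).
  by move=> _; derive; field.
have hd (f1 f2 : R -> R) : continuous f1 -> continuous f2 ->
   (forall s, 0 <= s <= y -> is_derive s 1 (fun s => primitive (fun s => k f1 (M s)) s -
      primitive (fun s => k f2 (M s)) s) (k f1 s - k f2 s)).
  move=> c1 c2 s /andP[s0 _]; exact: is_derive_sub (dT c1 s0) (dT c2 s0).
have pos : 0 <= c / 4 * expR (2 * 0) by rewrite mulr_ge0 ?expR_ge0 ?divr_ge0.
rewrite ler_norml; apply/andP; split.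
  rewrite lerNl opprB; apply: (derive_le_comparison (hd _ _ cf' cf) dE) => //.
    by move=> s /andP[s0 _]; have := kd s s0; rewrite distrC => /(le_trans (ler_norm _)).
  by rewrite !primitive0 subr0.
apply: (derive_le_comparison (hd _ _ cf cf') dE) => //.
  by move=> s /andP[s0 _]; have := kd s s0 => /(le_trans (ler_norm _)).
by rewrite !primitive0 subr0.
Qed.

Let S := fix S n : R -> R := if n is n'.+1 then (fun y => 1 + T (S n') y) else (fun=> 0).

Let SE n y : S n.+1 y = 1 + T (S n) y. Proof. by []. Qed.

Let cS n : continuous (S n).
Proof.
elim: n => [|n IH]; first exact: cst_continuous.
by move=> y; apply: cvgD; [exact: cvg_cst|exact: cT].
Qed.

Let E y := expR (2 * M y).

Let E_gt0 y : 0 < E y. Proof. exact: expR_gt0. Qed.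

Let S_step n y : `|S n.+1 y - S n y| <= 4^-1 ^+ n * E y.
Proof.
elim: n y => [|n IH] y.
  have -> : S 1 y = 1.
    rewrite /= [T _ y](_ : _ = 0) ?addr0//.
    have T0 : T (fun=> 0) y = primitive (fun=> 0) (M y).
      rewrite /T; congr (primitive _ _); apply/funext => s.
      rewrite /k /p; have -> : h (fun=> 0) = (fun=> 0) by apply/funext => t; rewrite /h mulr0.
      by rewrite primitive_cst0 mul0r.
    by rewrite T0 primitive_cst0.
  rewrite subr0 expr0 mul1r normr1 /E -[leLHS]expR0 ler_expR mulr_ge0//.
have -> : S n.+2 y - S n.+1 y = T (S n.+1) y - T (S n) y by rewrite !SE opprD addrACA subrr add0r.
have -> : 4^-1 ^+ n.+1 * E y = 4^-1 ^+ n / 4 * E y by rewrite exprSr.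
apply: T_dist => // z z0; apply: le_trans (IH z) _.
by rewrite /E M_id.
Qed.

(** Nested lower and upper bounds for the limit of the iteration, which is then a pointwise
    supremum. The factor 2 exceeds the sum 4/3 of the geometric series of the steps. *)
Let A n y := S n y - 2 * 4^-1 ^+ n * E y.
Let B n y := S n y + 2 * 4^-1 ^+ n * E y.

Let pow_gt0 n : 0 < (4^-1 : R) ^+ n. Proof. by rewrite exprn_gt0. Qed.

Let A_incr m n y : (m <= n)%N -> A m y <= A n y.
Proof.
apply: (@homo_leq _ (A ^~ y) <=%R) => [//|? ? ? |{}n]; first exact: le_trans.
have := S_step n y; rewrite ler_norml => /andP[h1 _].
have := mulr_gt0 (pow_gt0 n) (E_gt0 y).
by rewrite /A exprSr; lra.
Qed.

Let B_decr m n y : (m <= n)%N -> B n y <= B m y.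
Proof.
apply: (@homo_leq _ (B ^~ y) (fun a b => b <= a)) => [//|? ? ? h1 h2|{}n].
  exact: le_trans h2 h1.
have := S_step n y; rewrite ler_norml => /andP[_ h1].
have := mulr_gt0 (pow_gt0 n) (E_gt0 y).
by rewrite /B exprSr; lra.
Qed.

Let A_le_B m n y : A m y <= B n y.
Proof.
apply: le_trans (A_incr y (leq_maxl m n)) _.
apply: le_trans (B_decr y (leq_maxr m n)).
have := mulr_gt0 (pow_gt0 (maxn m n)) (E_gt0 y).
by rewrite /A /B; lra.
Qed.

Let g y := sup (range (A ^~ y)).

Let g_approx n y : `|g y - S n y| <= 2 * 4^-1 ^+ n * E y.
Proof.
have hs : has_sup (range (A ^~ y)).
  split; first by exists (A 0%N y); exists 0%N.
  by exists (B 0%N y) => _ [m _ <-]; exact: A_le_B.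
have h1 : A n y <= g y by apply: sup_upper_bound => //; exists n.
have h2 : g y <= B n y.
  by apply: ge_sup; [case: hs|move=> _ [m _ <-]; exact: A_le_B].
by rewrite ler_norml; move: h1 h2; rewrite /A /B; lra.
Qed.

Let pow_small c e : 0 < e -> exists n, c * (4^-1 : R) ^+ n < e.
Proof.
move=> e0.
have lim0 : (c * (4^-1 : R) ^+ n) @[n --> \oo] --> c * 0.
  by apply: cvgMr; apply: cvg_expr; rewrite gtr0_norm; lra.
rewrite mulr0 in lim0.
have [N _ hN] := cvgr_lt _ lim0 _ e0.
by exists N; apply: hN => /=.
Qed.

Let cg : continuous g.
Proof.
move=> y; apply/cvgrPdist_lt => e e0.
have e3 : 0 < e / 3 by lra.
have [n hn] := pow_small (2 * expR (2 * (`|y| + 1))) e3.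
have close z : z <= `|y| + 1 -> `|g z - S n z| < e / 3.
  move=> hz; apply: le_lt_trans (g_approx n z) _; apply: le_lt_trans hn.
  rewrite mulrAC ler_pM2r// ler_pM2l// ler_expR ler_pM2l// /M ge_max hz /=.
  by rewrite addr_ge0.
near=> z.
have h1 := close y; have h2 := close z.
have h3 : `|S n y - S n z| < e / 3.
  by near: z; have := cS (n:=n) (x:=y); move/cvgrPdist_lt; exact.
have yy : y <= `|y| + 1 by have := ler_norm y; lra.
have zz : z <= `|y| + 1.
  by near: z; apply: cvgr_le cvg_id _ _; have := ler_norm y; lra.
have -> : g y - g z = (g y - S n y) + (S n y - S n z) + (S n z - g z) by ring.
apply: le_lt_trans (ler_normD _ _) _; have := ler_normD (g y - S n y) (S n y - S n z).
have := h1 yy; have := h2 zz; rewrite [ `|g z - _|]distrC; lra.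
Unshelve. all: by end_near. Qed.

Let g_fix y : g y = 1 + T g y.
Proof.
apply/eqP; rewrite -subr_eq0 -normr_le0; apply/ler_addgt0Pl => e e0.
rewrite addr0.
have [n hn] := pow_small (3 * E y) e0.
apply: le_trans (ltW hn).
have h1 := g_approx n.+1 y.
have h2 : `|T (S n) y - T g y| <= 2 * 4^-1 ^+ n / 4 * E y.
  apply: T_dist => // z z0; rewrite distrC; apply: le_trans (g_approx n z) _.
  by rewrite /E M_id.
have -> : g y - (1 + T g y) = (g y - S n.+1 y) + (T (S n) y - T g y).
  by rewrite SE; move: (T (S n) y) (T g y) (g y) => u v w; ring.
apply: le_trans (ler_normD _ _) _.
rewrite exprSr in h1.
have := mulr_gt0 (pow_gt0 n) (E_gt0 y).
lra.
Qed.

Lemma regular_solution : exists g g1 : R -> R, [/\ continuous g, g 0 = 1,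
  forall r, 0 < r -> is_derive r 1 g (g1 r),
  forall r, 0 < r -> is_derive r 1 g1 (q r * g r - g1 r / r) &
  exists B, forall r, 0 < r <= 1 -> `|g1 r| <= B * r].
Proof.
exists g, (k g); split.
- exact: cg.
- rewrite g_fix /T; have -> : M 0 = 0 by exact: M_id.
  by rewrite primitive0 addr0.
- move=> r r0; have h1 := dT cg (ltW r0).
  have h2 : is_derive r 1 (fun y => 1 + primitive (fun s => k g (M s)) y) (k g r).
    by derive; rewrite add0r.
  apply: is_derive_near h2; near=> z.
  have z0 : 0 < z by near: z; exact: cvgr_gt cvg_id _ r0.
  by rewrite [in RHS]g_fix /T M_id// ltW.
- move=> r r0; have h1 := dp cg (ltW r0).
  rewrite /k; derive; first exact: lt0r_neq0.
  by field; exact: lt0r_neq0.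
- have cf' : {within `[0, 1], continuous (fun s : R => `|g s|)}.
    by apply: continuous_subspaceT => s; apply: cvg_norm; exact: cg.
  have [b _ hb] := @EVT_max R _ 0 1 ler01 cf'.
  exists `|g b| => r /andP[r0 r1].
  rewrite /k normrM normfV (gtr0_norm r0) ler_pdivrMr// -mulrA -expr2.
  apply: (p_le cg); last exact: ltW.
  move=> s /andP[s0 sr]; apply: hb; rewrite in_itv/= s0 /=; exact: le_trans r1.
Unshelve. all: by end_near. Qed.

End RegularSolution.

(** * Flux, Wronskian and energy estimates for the radial equation *)

Section RadialEquation.
Variable R : realType.
Implicit Types (V g k : R -> R) (r s t z : R).

Definition radial_solution V g g1 : Prop := forall r, 0 < r ->
  is_derive r 1 g (g1 r) /\ is_derive r 1 g1 (V r * g r - g1 r / r).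

Definition regular_at0 g g1 : Prop := [/\ continuous g, g 0 = 1 &
  exists B, forall r, 0 < r <= 1 -> `|g1 r| <= B * r].

Lemma radial_solutionN V g g1 : radial_solution V g g1 ->
  radial_solution V (fun r => - g r) (fun r => - g1 r).
Proof.
move=> h r r0; have [h1 h2] := h r r0; split; first by derive.
by derive; ring.
Qed.

Lemma radial_flux V g g1 r : radial_solution V g g1 -> 0 < r ->
  is_derive r 1 (fun r => r * g1 r) (r * V r * g r).
Proof.
by move=> h r0; have [h1 h2] := h r r0; derive; field; exact: lt0r_neq0.
Qed.

Lemma radial_wronskian V V' g g1 k k1 r : radial_solution V g g1 ->
  radial_solution V' k k1 -> 0 < r ->
  is_derive r 1 (fun r => r * (g r * k1 r - g1 r * k r)) (r * (V' r - V r) * g r * k r).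
Proof.
move=> h h' r0; have [h1 h2] := h r r0; have [h3 h4] := h' r r0.
by derive; field; exact: lt0r_neq0.
Qed.

Lemma radial_quotient V V' g g1 k k1 r : radial_solution V g g1 ->
  radial_solution V' k k1 -> 0 < r -> g r != 0 ->
  is_derive r 1 (fun r => k r / g r) ((g r * k1 r - g1 r * k r) / g r ^+ 2).
Proof.
move=> h h' r0 gr; have [h1 h2] := h r r0; have [h3 h4] := h' r r0.
by derive => //; field.
Qed.

(** Gronwall's argument for g^2 + g'^2. The damping term - g' / r has the favourable sign, so the
    rate 2 does not depend on [s], which may later tend to 0. *)
Lemma radial_energy_forward V g g1 s r : radial_solution V g g1 ->
  (forall t, 0 < t -> `|V t| <= 1) -> 0 < s -> s <= r ->
  g r ^+ 2 + g1 r ^+ 2 <= expR (2 * (r - s)) * (g s ^+ 2 + g1 s ^+ 2).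
Proof.
move=> h hV s0 sr; pose K t : R := g t ^+ 2 + g1 t ^+ 2.
have : expR (2 * (r - s)) * (K s * expR (- 2 * s)) >= expR (2 * (r - s)) * (K r * expR (- 2 * r)).
  rewrite ler_pM2l ?expR_gt0// -lerN2.
  pose dK t : R := (2 * g t * g1 t + 2 * g1 t * (V t * g t - g1 t / t) - 2 * K t) * expR (- 2 * t).
  apply: (@derive_ge0_le _ (fun t => - (K t * expR (- 2 * t))) (fun t => - dK t)); last exact: sr.
    move=> t /andP[st _]; have t0 := lt_le_trans s0 st; have [h1 h2] := h t t0.
    by rewrite /K; derive; rewrite /dK /K /=; ring.
  move=> t /andP[st _]; have t0 := lt_trans s0 st.
  rewrite oppr_ge0 /dK pmulr_lle0 ?expR_gt0//.
  have := hV t t0; rewrite ler_norml => /andP[V1 V2].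
  have : 0 <= g1 t ^+ 2 / t by rewrite divr_ge0 ?sqr_ge0 ?ltW.
  have : 0 <= (1 - V t) * (g t + g1 t) ^+ 2 by rewrite mulr_ge0 ?sqr_ge0 ?subr_ge0.
  have : 0 <= (1 + V t) * (g t - g1 t) ^+ 2 by rewrite mulr_ge0 ?sqr_ge0//; lra.
  have := sqr_ge0 (g t - g1 t); have := sqr_ge0 (g t + g1 t).
  rewrite /K !expr2; lra.
rewrite mulrCA -expRD.
have -> : 2 * (r - s) + - 2 * r = - 2 * s by ring.
have -> : expR (2 * (r - s)) * (K s * expR (- 2 * s)) = K s * expR (2 * (r - s)) * expR (- 2 * s) by ring.
by rewrite ler_pM2r ?expR_gt0// [K s * _]mulrC.
Qed.

(** Backwards the damping has the unfavourable sign, and the rate [2 + 2 / s] degenerates at the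
    origin; this is enough for uniqueness. *)
Lemma radial_energy_backward V g g1 s r : radial_solution V g g1 ->
  (forall t, 0 < t -> `|V t| <= 1) -> 0 < s -> s <= r ->
  g r = 0 -> g1 r = 0 -> g s = 0.
Proof.
move=> h hV s0 sr gr g1r; pose K t : R := g t ^+ 2 + g1 t ^+ 2.
pose m := 2 + 2 / s.
have : K s * expR (m * s) <= K r * expR (m * r).
  pose dK t : R := (2 * g t * g1 t + 2 * g1 t * (V t * g t - g1 t / t) + m * K t) * expR (m * t).
  apply: (@derive_ge0_le _ (fun t => K t * expR (m * t)) dK); last exact: sr.
    move=> t /andP[st _]; have t0 := lt_le_trans s0 st; have [h1 h2] := h t t0.
    by rewrite /K; derive; rewrite /dK /K /=; ring.
  move=> t /andP[st _]; have t0 := lt_trans s0 st.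
  rewrite /dK pmulr_lge0 ?expR_gt0//.
  have := hV t t0; rewrite ler_norml => /andP[V1 V2].
  have : g1 t ^+ 2 / t <= g1 t ^+ 2 / s.
    by rewrite ler_wpM2l ?sqr_ge0// lef_pV2 ?posrE// ltW.
  have : 0 <= g t ^+ 2 / s by rewrite divr_ge0 ?sqr_ge0 ?ltW.
  have : 0 <= (1 + V t) * (g t + g1 t) ^+ 2 by rewrite mulr_ge0 ?sqr_ge0//; lra.
  have : 0 <= (1 - V t) * (g t - g1 t) ^+ 2 by rewrite mulr_ge0 ?sqr_ge0 ?subr_ge0.
  have := sqr_ge0 (g t - g1 t); have := sqr_ge0 (g t + g1 t).
  rewrite /m /K !expr2; lra.
rewrite /K gr g1r expr0n addr0 mul0r pmulr_lle0 ?expR_gt0// => hK.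
have := sqr_ge0 (g s); have := sqr_ge0 (g1 s) => h1 h2.
by apply/eqP; rewrite -sqrf_eq0 eq_le h2 andbT; lra.
Qed.

Lemma radial_unique V g g1 s : radial_solution V g g1 ->
  (forall t, 0 < t -> `|V t| <= 1) -> 0 < s -> g s = 0 -> g1 s = 0 ->
  forall r, 0 < r -> g r = 0.
Proof.
move=> h hV s0 gs g1s r r0; have [rs|sr] := leP r s.
  exact: (radial_energy_backward h hV r0 rs).
have := radial_energy_forward h hV s0 (ltW sr).
rewrite gs g1s expr0n addr0 mulr0 => hK.
have := sqr_ge0 (g r); have := sqr_ge0 (g1 r) => h1 h2.
by apply/eqP; rewrite -sqrf_eq0 eq_le h2 andbT; lra.
Qed.

Lemma regular_near0 g g1 e : regular_at0 g g1 -> 0 < e ->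
  exists2 d, 0 < d & forall r, 0 < r < d -> `|g r - 1| < e /\ `|g1 r| < e.
Proof.
move=> [cg g0 [B hB]] e0.
have := cg 0; rewrite /continuous_at g0 => /cvgrPdist_lt /(_ _ e0) /near_ltP [d d0 hd].
have B1 : 0 < `|B| + 1 by rewrite ltr_wpDl.
exists (Num.min d (Num.min 1 (e / (`|B| + 1)))).
  by rewrite !lt_min d0 ltr01 divr_gt0.
move=> r /andP[r0]; rewrite !lt_min => /andP[rd /andP[r1 re]]; split.
  by rewrite distrC; apply: hd; rewrite subr0 gtr0_norm.
apply: le_lt_trans (hB r _) _; first by rewrite r0 ltW.
move: re; rewrite ltr_pdivlMr// mulrC; apply: le_lt_trans.
rewrite ler_wpM2r ?(ltW r0)//; have := ler_norm B; lra.
Qed.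

Lemma regular_flux_vanishes g g1 e : regular_at0 g g1 -> 0 < e ->
  exists2 d, 0 < d & forall r, 0 < r < d -> `|r * g1 r| < e.
Proof.
move=> hg e0; have [d d0 hd] := regular_near0 hg e0.
exists (Num.min d 1); first by rewrite lt_min d0 ltr01.
move=> r /andP[r0]; rewrite lt_min => /andP[rd r1].
have [|_ h] := hd r; first by rewrite r0.
by apply: le_lt_trans h; rewrite normrM gtr0_norm//; apply: ler_piMl => //; exact: ltW.
Qed.

(* a nondecreasing function on (0, x] with zero limit at 0 is nonnegative *)
Lemma ge0_of_vanishing (f df : R -> R) x :
  (forall r, 0 < r <= x -> is_derive r 1 f (df r)) ->
  (forall r, 0 < r < x -> 0 <= df r) ->
  (forall e, 0 < e -> exists2 d, 0 < d & forall r, 0 < r < d -> `|f r| < e) ->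
  forall r, 0 < r <= x -> 0 <= f r.
Proof.
move=> hf hdf hv r /andP[r0 rx]; rewrite leNgt; apply/negP => fr.
have [d d0 hd] := hv (- f r) ltac:(by rewrite oppr_gt0).
pose s := Num.min r (d / 2).
have s0 : 0 < s by rewrite lt_min r0 divr_gt0.
have sr : s <= r by rewrite ge_min lexx.
have sd : s < d by rewrite gt_min; apply/orP; right; lra.
have := hd s; rewrite s0 sd => /(_ isT); rewrite ltNge => /negP; apply.
rewrite -normrN; apply: le_trans (ler_norm _); rewrite lerN2.
apply: (@derive_ge0_le _ f df); last exact: sr.
  by move=> t /andP[st tr]; apply: hf; rewrite (lt_le_trans s0 st) (le_trans tr).
by move=> t /andP[st tr]; apply: hdf; rewrite (lt_trans s0 st) (lt_le_trans tr).
Qed.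

End RadialEquation.

(** * The regular solution and its dependence on the spectral parameter *)

Section VortexEquation.
Variables (R : realType) (U a : R -> R).
Hypothesis profile : vortex_profile U a.
Implicit Types (g k : R -> R) (r s t z l m : R).

Definition eigen_potential l r := U r ^+ 2 - l.

Local Notation sol l := (radial_solution (eigen_potential l)).

Lemma eigen_potential_le1 l : 0 <= l <= 1 -> forall t, 0 < t -> `|eigen_potential l t| <= 1.
Proof.
move=> /andP[l0 l1] t t0; have /andP[U0 U1] := U_between profile t0.
have U2 : U t ^+ 2 <= 1 by rewrite expr_le1// ltW.
by have := sqr_ge0 (U t); rewrite ler_norml /eigen_potential; lra.
Qed.

Let cU : continuous (fun r => U (Num.max r 0)).
Proof.
have U00 : U 0 = 0 by case: profile => _ [].
move=> y; have cM : continuous (fun r : R => Num.max r 0).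
  by move=> z; apply: continuous_max; [exact: cvg_id|exact: cvg_cst].
have [y0|y0] := ltP 0 y.
  apply: (@continuous_comp _ _ _ (fun r : R => Num.max r 0) U); first exact: cM.
  have -> : Num.max y 0 = y by apply/max_idPl; exact: ltW.
  by case: profile => _ _ /(_ y y0) /is_derive_cont.
have My : Num.max y 0 = 0 by apply/max_idPr.
rewrite /continuous_at My U00; apply/cvgrPdist_lt => e e0.
have [d d0 hd] := U_near0 profile e0.
near=> z; rewrite sub0r normrN.
have zd : Num.max z 0 < d.
  by near: z; apply: cvgr_lt (cM y) _ _; rewrite My.
have [z0|z0] := ltP 0 (Num.max z 0); last first.
  have -> : Num.max z 0 = 0 by apply/eqP; rewrite eq_le z0 le_max lexx orbT.
  by rewrite U00 normr0.
have /andP[U0 _] := U_between profile z0.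
by rewrite gtr0_norm// hd// z0.
Unshelve. all: by end_near. Qed.

Lemma regular_solution_exists l : 0 <= l <= 1 ->
  exists g g1, sol l g g1 /\ regular_at0 g g1.
Proof.
move=> l01; pose q r : R := U (Num.max r 0) ^+ 2 - l.
have cq : continuous q.
  move=> y; apply: cvgB; last exact: cvg_cst.
  have -> : (fun r => U (Num.max r 0) ^+ 2) = (fun r => U (Num.max r 0) * U (Num.max r 0)).
    by apply/funext => r; rewrite expr2.
  by rewrite expr2; apply: cvgM; exact: cU.
have q1 r : `|q r| <= 1.
  have U00 : U 0 = 0 by case: profile => _ [].
  rewrite /q; have [r0|r0] := ltP 0 r; first exact: eigen_potential_le1.
  by case/andP: l01 => l0 l1; rewrite U00 expr0n sub0r normrN ger0_norm.
have [g [g1 [cg g0 d1 d2 hB]]] := regular_solution cq q1.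
exists g, g1; split; last by [].
move=> r r0; split; first exact: d1.
have -> : eigen_potential l r = q r; last exact: d2.
by rewrite /q /eigen_potential; have -> : Num.max r 0 = r by apply/max_idPl; exact: ltW.
Qed.

(** The energy is propagated from a point near the origin where |g| < 2 and |g'| < 1, whence 5 = 2^2
    + 1^2. *)
Lemma regular_energy l g g1 r : 0 <= l <= 1 -> sol l g g1 -> regular_at0 g g1 ->
  0 < r -> g r ^+ 2 + g1 r ^+ 2 <= 5 * expR (2 * r).
Proof.
move=> l01 hg rg r0; have [d d0 hd] := regular_near0 rg ltr01.
pose s := Num.min r (d / 2).
have s0 : 0 < s by rewrite lt_min r0 divr_gt0.
have sr : s <= r by rewrite ge_min lexx.
have sd : s < d by rewrite gt_min; apply/orP; right; lra.
have := radial_energy_forward hg (eigen_potential_le1 l01) s0 sr => /le_trans; apply.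
have [|h1 h2] := hd s; first by rewrite s0.
rewrite mulrC; apply: ler_pM; rewrite ?addr_ge0 ?sqr_ge0 ?expR_ge0//.
  move: h1 h2; rewrite !ltr_norml => /andP[h1 h2] /andP[h3 h4].
  have : 0 <= (2 - g s) * (2 + g s) by apply: mulr_ge0; lra.
  have : 0 <= (1 - g1 s) * (1 + g1 s) by apply: mulr_ge0; lra.
  by rewrite !expr2; lra.
by rewrite ler_expR; lra.
Qed.

(* Continuous dependence on the spectral parameter, by the energy of g - k. *)
Lemma regular_dependence l m g g1 k k1 r : 0 <= l <= 1 -> 0 <= m <= 1 ->
  sol l g g1 -> regular_at0 g g1 -> sol m k k1 -> regular_at0 k k1 -> 0 < r ->
  (g r - k r) ^+ 2 + (g1 r - k1 r) ^+ 2 <=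
    (l - m) ^+ 2 * (5 * expR (2 * r)) * expR (3 * r).
Proof.
move=> l01 m01 hg rg hk rk r0.
pose c := (l - m) ^+ 2 * (5 * expR (2 * r)).
have c0 : 0 <= c by rewrite mulr_ge0 ?sqr_ge0 ?mulr_ge0 ?expR_ge0.
pose D t : R := (g t - k t) ^+ 2 + (g1 t - k1 t) ^+ 2.
pose dD t : R := 2 * (g t - k t) * (g1 t - k1 t) + 2 * (g1 t - k1 t) *
  (eigen_potential l t * (g t - k t) - (l - m) * k t - (g1 t - k1 t) / t).
have hD t : 0 < t -> is_derive t 1 D (dD t).
  move=> t0; have [h1 h2] := hg t t0; have [h3 h4] := hk t t0.
  by rewrite /D; derive; rewrite /dD /eigen_potential /=; ring.
have dD_le t : 0 < t -> t <= r -> dD t <= 3 * D t + c.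
  move=> t0 tr; have := eigen_potential_le1 l01 t0; rewrite ler_norml => /andP[V1 V2].
  set V := eigen_potential l t in V1 V2 *.
  have := regular_energy m01 hk rk t0.
  have : 5 * expR (2 * t) <= 5 * expR (2 * r) by rewrite ler_pM2l// ler_expR ler_pM2l.
  move=> h1 h2; have : (l - m) ^+ 2 * k t ^+ 2 <= c.
    rewrite /c ler_wpM2l ?sqr_ge0//; have := sqr_ge0 (k1 t); lra.
  rewrite /dD /D -/V; set x := g t - k t; set y := g1 t - k1 t => h3.
  have : 0 <= y ^+ 2 / t by rewrite divr_ge0 ?sqr_ge0 ?ltW.
  have : 0 <= (1 - V) * (x + y) ^+ 2 by rewrite mulr_ge0 ?sqr_ge0 ?subr_ge0.
  have : 0 <= (1 + V) * (x - y) ^+ 2 by rewrite mulr_ge0 ?sqr_ge0//; lra.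
  have := sqr_ge0 (x - y).
  have := sqr_ge0 (y + (l - m) * k t).
  have := sqr_ge0 x; rewrite !expr2 in h3 *; lra.
apply/ler_addgt0Pl => e e0.
(* The Gronwall estimate has to start at some [s > 0], the equation being singular at 0. The energy
   at [s] is made smaller than this amount, which the final factor [expR (3 * r)] turns into [e]. *)
pose e' := e * expR (- 3 * r); have e'0 : 0 < e' by rewrite mulr_gt0 ?expR_gt0.
have [d d0 hd] : exists2 d, 0 < d & forall s, 0 < s < d -> D s <= e'.
  pose n := Num.min 1 (e' / 8); have n0 : 0 < n by rewrite lt_min ltr01 divr_gt0.
  have [d1 d10 h1] := regular_near0 rg n0; have [d2 d20 h2] := regular_near0 rk n0.
  exists (Num.min d1 d2); first by rewrite lt_min d10.
  move=> s /andP[s0]; rewrite lt_min => /andP[sd1 sd2].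
  have [|a1 a2] := h1 s; first by rewrite s0.
  have [|a3 a4] := h2 s; first by rewrite s0.
  have n1 : n <= 1 by rewrite ge_min lexx.
  have n2 : n <= e' / 8 by rewrite ge_min lexx orbT.
  move: a1 a2 a3 a4; rewrite !ltr_norml => /andP[a1 a1'] /andP[a2 a2'] /andP[a3 a3'] /andP[a4 a4'].
  have : 0 <= (2 * n - (g s - k s)) * (2 * n + (g s - k s)) by apply: mulr_ge0; lra.
  have : 0 <= (2 * n - (g1 s - k1 s)) * (2 * n + (g1 s - k1 s)) by apply: mulr_ge0; lra.
  have : n * n <= e' / 8 by apply: le_trans n2; apply: ler_piMr => //; exact: ltW.
  by rewrite /D !expr2; lra.
pose s := Num.min r (d / 2).
have s0 : 0 < s by rewrite lt_min r0 divr_gt0.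
have sr : s <= r by rewrite ge_min lexx.
have sd : s < d by rewrite gt_min; apply/orP; right; lra.
have Ds : D s <= e' by apply: hd; rewrite s0.
have : (D r + c) * expR (- 3 * r) <= (D s + c) * expR (- 3 * s).
  rewrite -lerN2; pose dE t : R := (dD t - 3 * (D t + c)) * expR (- 3 * t).
  apply: (@derive_ge0_le _ (fun t => - ((D t + c) * expR (- 3 * t))) (fun t => - dE t)); last exact: sr.
    move=> t /andP[st _]; have t0 := lt_le_trans s0 st; have h1 := hD t t0.
    by derive; rewrite /dE; ring.
  move=> t /andP[st tr]; have t0 := lt_trans s0 st.
  rewrite oppr_ge0 /dE pmulr_lle0 ?expR_gt0//.
  have := dD_le t t0 (ltW tr); lra.
have Ds0 : 0 <= D s by rewrite addr_ge0 ?sqr_ge0.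
have : (D s + c) * expR (- 3 * s) <= D s + c.
  by apply: ler_piMr; [exact: addr_ge0|rewrite -[leRHS]expR0 ler_expR; lra].
move=> h1 h2; have {h1 h2} : (D r + c) * expR (- 3 * r) <= e' + c by lra.
move=> h3; have E1 : expR (- 3 * r) * expR (3 * r) = 1.
  by rewrite -expRD (_ : _ + _ = 0) ?expR0//; ring.
have : ((D r + c) * expR (- 3 * r)) * expR (3 * r) <= (e' + c) * expR (3 * r).
  by rewrite ler_pM2r ?expR_gt0.
rewrite -mulrA E1 mulr1 mulrDl /e' -(mulrA e) E1 mulr1.
move: c0; rewrite /D /c; lra.
Qed.

End VortexEquation.

(** * Dichotomy between regular and logarithmic solutions *)

Section VortexSpectrum.
Variables (R : realType) (U a : R -> R).
Hypothesis profile : vortex_profile U a.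
Implicit Types (g k : R -> R) (r s t z l m c d : R).

Local Notation sol l := (radial_solution (eigen_potential U l)).

(** The flux r g' starts from 0 with derivative r (U^2 - l) g, which is negative near the origin
    because U vanishes there and l > 0. *)
Lemma regular_decr l g g1 : 0 < l <= 1 -> sol l g g1 -> regular_at0 g g1 ->
  exists2 d, 0 < d & forall r, 0 < r < d -> 0 < g r < 2 /\ g1 r <= 0.
Proof.
move=> /andP[l0 l1] hg rg.
have [d1 d10 h1] := U_near0 profile l0.
have [d2 d20 h2] := regular_near0 rg ltr01.
pose d := Num.min d1 d2 / 2.
have m0 : 0 < Num.min d1 d2 by rewrite lt_min d10.
have d0 : 0 < d by rewrite divr_gt0.
have dd1 : d < d1 by rewrite (lt_le_trans _ (_ : Num.min d1 d2 <= d1)) ?ge_min ?lexx// /d; lra.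
have dd2 : d < d2 by rewrite (lt_le_trans _ (_ : Num.min d1 d2 <= d2)) ?ge_min ?lexx ?orbT// /d; lra.
have g_pos r : 0 < r <= d -> 0 < g r < 2.
  move=> /andP[r0 rd]; have [|] := h2 r; first by rewrite r0 (le_lt_trans rd).
  by rewrite ltr_norml => h _; lra.
exists d => // r /andP[r0 rd]; split; first by rewrite g_pos// r0 ltW.
have : 0 <= - (r * g1 r).
  apply: (@ge0_of_vanishing _ (fun r => - (r * g1 r))
    (fun r => - (r * eigen_potential U l r * g r)) d).
  - by move=> s /andP[s0 _]; have h := radial_flux hg s0; derive.
  - move=> s /andP[s0 sd]; have /andP[gs _] := g_pos s ltac:(by rewrite s0 ltW).
    have /andP[U0 U1] := U_between profile s0.
    have Ul : U s < l by apply: h1; rewrite s0 (lt_trans sd).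
    have U2 : U s ^+ 2 <= U s by rewrite expr2 ler_piMr ?ltW.
    rewrite oppr_ge0 pmulr_lle0// pmulr_rle0// /eigen_potential; lra.
  - move=> e e0; have [d' d'0 hd'] := regular_flux_vanishes rg e0.
    by exists d' => // s sd; rewrite normrN hd'.
  - by rewrite r0 ltW.
by rewrite oppr_ge0 pmulr_rle0.
Qed.

Lemma radial_solutionB V g g1 k k1 c : radial_solution V g g1 -> radial_solution V k k1 ->
  radial_solution V (fun r => k r - c * g r) (fun r => k1 r - c * g1 r).
Proof.
move=> hg hk r r0; have [h1 h2] := hg r r0; have [h3 h4] := hk r r0.
split; first by derive; ring.
by derive; ring.
Qed.

Let derive_eq0_const (f : R -> R) : (forall r, 0 < r -> is_derive r 1 f 0) ->
  forall r s, 0 < r -> 0 < s -> f r = f s.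
Proof.
move=> hf; suff h r s : 0 < r -> r <= s -> f r = f s.
  by move=> r s r0 s0; have [/h|/ltW/h h'] := leP r s; [exact|exact/esym/h'].
move=> r0 rs; apply/eqP; rewrite eq_le; apply/andP; split.
  apply: (@derive_ge0_le _ f (fun=> 0)) => // t /andP[h _]; apply: hf; exact: lt_le_trans h.
rewrite -lerN2; apply: (@derive_ge0_le _ (fun t => - f t) (fun=> 0)) => // t /andP[h _].
by have h1 := hf t (lt_le_trans r0 h); derive; exact: oppr0.
Qed.

(** Reduction of order: (k / g)' = w / (r g^2) >= w / (4 r), so k / g tends to -oo at the origin and
    k becomes negative. As g' <= 0, the term g' k in the Wronskian is then nonnegative, whence w <=
    r g k' <= 2 r k'. *)
Let singular_pos l g g1 k k1 w : 0 < l <= 1 -> sol l g g1 -> regular_at0 g g1 ->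
  sol l k k1 -> 0 < w -> (forall r, 0 < r -> r * (g r * k1 r - g1 r * k r) = w) ->
  exists c d, [/\ 0 < c, 0 < d & forall r, 0 < r < d -> c / r <= k1 r].
Proof.
move=> l01 hg rg hk w0 hw.
have [d d0 hd] := regular_decr l01 hg rg.
have w4 : 0 < w / 4 by rewrite divr_gt0.
pose s := d / 2; have s0 : 0 < s by rewrite divr_gt0.
have sd : s < d by rewrite /s; lra.
have [d' /andP[d'0 d's] hd'] := log_unbounded (k s / g s) s0 w4.
exists (w / 2), d'; split=> //; first by rewrite divr_gt0.
move=> r /andP[r0 rd'].
have rs : r < s by exact: lt_trans d's.
have [/andP[gr gr2] g1r] := hd r ltac:(by rewrite r0 (lt_trans rs)).
have kr : k r <= 0.
  have : k r / g r <= 0.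
    apply: (@le_trans _ _ (k s / g s - w / 4 * (ln s - ln r))); last first.
      have : w / 4 * (ln s - ln d') <= w / 4 * (ln s - ln r).
        by rewrite ler_pM2l// lerD2l lerN2 ler_ln ?posrE// ltW.
      lra.
    have : k r / g r - w / 4 * ln r <= k s / g s - w / 4 * ln s.
      apply: (@derive_ge0_le _ (fun t => k t / g t - w / 4 * ln t)
        (fun t => (g t * k1 t - g1 t * k t) / g t ^+ 2 - w / 4 / t)); last exact: ltW.
        move=> t /andP[rt ts]; have t0 := lt_le_trans r0 rt.
        have [/andP[gt _] _] := hd t ltac:(by rewrite t0 (le_lt_trans ts sd)).
        have h1 := radial_quotient hg hk t0 (lt0r_neq0 gt).
        exact: is_derive_sub h1 (is_derive_mulln (w / 4) t0).
      move=> t /andP[rt ts]; have t0 := lt_trans r0 rt.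
      have [/andP[gt gt2] _] := hd t ltac:(by rewrite t0 (lt_trans ts sd)).
      have -> : g t * k1 t - g1 t * k t = w / t by rewrite -(hw t t0); field; exact: lt0r_neq0.
      rewrite subr_ge0 [leRHS]mulrAC ler_pM2r ?invr_gt0// ler_pM2l// lef_pV2 ?posrE ?exprn_gt0//.
      have : 0 <= (2 - g t) * (2 + g t) by apply: mulr_ge0; lra.
      by rewrite expr2; lra.
    lra.
  by rewrite pmulr_lle0 ?invr_gt0.
have h1 : w <= r * g r * k1 r.
  have := hw r r0; have : 0 <= r * (g1 r * k r).
    by rewrite mulr_ge0 ?(ltW r0)// mulr_le0.
  lra.
rewrite ler_pdivrMr//.
have k1r : 0 <= k1 r * r.
  rewrite -(@pmulr_rge0 _ (g r))//; lra.
have : g r * (k1 r * r) <= 2 * (k1 r * r) by apply: ler_wpM2r => //; exact: ltW.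
lra.
Qed.

(** The weighted Wronskian r (g k' - g' k) is constant. If it is zero, the solutions are
    proportional by uniqueness; otherwise its sign tells to which of k and - k [singular_pos]
    applies. *)
Lemma regular_or_singular l g g1 k k1 : 0 < l <= 1 -> sol l g g1 -> regular_at0 g g1 ->
  sol l k k1 -> (exists c, forall r, 0 < r -> k r = c * g r) \/
  exists c d, [/\ 0 < c, 0 < d & (forall r, 0 < r < d -> c / r <= k1 r) \/
                                 (forall r, 0 < r < d -> c / r <= - k1 r)].
Proof.
move=> l01 hg rg hk.
pose w r : R := r * (g r * k1 r - g1 r * k r).
have hw r : 0 < r -> w r = w 1.
  move=> r0; apply: derive_eq0_const => // s s0.
  by apply: is_derive_val (radial_wronskian hg hk s0) _; rewrite subrr mulr0 !mul0r.
case: (ltgtP (w 1) 0) => w1.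
- right; have [||c [d [c0 d0 h]]] := singular_pos l01 hg rg (radial_solutionN hk) (w := - w 1).
  + by rewrite oppr_gt0.
  + by move=> r r0; rewrite -(hw r r0) /w; ring.
  by exists c, d; split => //; right.
- right; have [c [d [c0 d0 h]]] := singular_pos l01 hg rg hk w1 hw.
  by exists c, d; split => //; left.
left; have [d d0 hd] := regular_decr l01 hg rg.
pose s := d / 2; have s0 : 0 < s by rewrite divr_gt0.
have [/andP[gs _] _] := hd s ltac:(by rewrite s0 /s; lra).
have gs0 := lt0r_neq0 gs.
exists (k s / g s) => r r0; apply/eqP; rewrite -subr_eq0; apply/eqP.
have l01' : 0 <= l <= 1 by lra.
apply: (radial_unique (radial_solutionB (k s / g s) hg hk) (eigen_potential_le1 profile l01') s0 _ _ r0).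
  by rewrite divfK// subrr.
have : g s * k1 s = g1 s * k s.
  apply/eqP; rewrite -subr_eq0; have /eqP := hw s s0.
  by rewrite w1 /w mulf_eq0 gt_eqF.
move=> e; have -> : k1 s = g1 s * k s / g s by rewrite -e mulrAC divff// mul1r.
by field.
Qed.

End VortexSpectrum.

(** * Sturm comparison with 1 - a / a(r) *)

Lemma derive_gt0_left (R : realType) (f : R -> R) (x d : R) : is_derive x 1 f d -> 0 < d ->
  exists2 e, 0 < e & forall y, x - e < y < x -> f y < f x.
Proof.
move=> [hd hv] d0.
have : (h^-1 *: (f (h *: 1 + x) - f x)) @[h --> 0^'] --> d by rewrite -hv; exact: hd.
move=> /cvgr_gt -/(_ 0 d0) [e /= e0 he]; exists e => // y /andP[xy yx].
have h0 : y - x < 0 by rewrite subr_lt0.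
have := he (y - x); rewrite /ball/= sub0r normrN ltr0_norm// opprB ltrBlDl -ltrBlDr.
move=> /(_ xy); rewrite lt_eqF// => /(_ isT).
by rewrite /GRing.scale/= mulr1 subrK nmulr_rgt0 ?invr_lt0// subr_lt0.
Qed.

(** The summand 1 keeps the lower bound positive at [p] itself, so that logarithmic growth also
    bounds [g] away from 0. *)
Definition log_growth (R : realType) (g : R -> R) := exists c p : R,
  [/\ 0 < c, 0 < p & forall r, p <= r -> c * (1 + (ln r - ln p)) <= `|g r|].

Section VortexSturm.
Variables (R : realType) (U a : R -> R).
Hypothesis profile : vortex_profile U a.
Implicit Types (g k : R -> R) (r s t z l m c d : R).

Local Notation sol l := (radial_solution (eigen_potential U l)).

Section Comparison.
Variable x : R.
Hypothesis x0 : 0 < x.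
Hypothesis hx : (1 - U x ^+ 2) * (2 - a x) = 1 - a x.

Let ax : 0 < a x < 1. Proof. exact: (a_between profile). Qed.

Let psi r := 1 - a r / a x.
Let psi1 r := - (r / 2 * (1 - U r ^+ 2)) / a x.
(* the defect - (r psi')' / r - (1 - U^2) psi *)
Let S r := (1 - U r ^+ 2) * (2 / a x - 1) - (1 - a r) / a x.

Let psi_gt0 r : 0 < r < x -> 0 < psi r.
Proof.
move=> /andP[r0 rx]; have /andP[ax0 _] := ax.
by rewrite subr_gt0 ltr_pdivrMr// mul1r (a_incr profile)//.
Qed.

Let psi_lt0 r : x < r -> psi r < 0.
Proof.
move=> xr; have /andP[ax0 _] := ax.
by rewrite subr_lt0 ltr_pdivlMr// mul1r (a_incr profile)//.
Qed.

Let psix : psi x = 0.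
Proof. by have /andP[ax0 _] := ax; rewrite /psi divff ?subrr// lt0r_neq0. Qed.

(** Up to a positive factor the defect is the decreasing ratio of [magnetic_ratio_decr] minus its
    value at [x]. The crossover equation [hx] serves to put the change of sign exactly at [x]. *)
Let S_ratio r : 0 < r -> S r = (1 - a r) * (2 / a x - 1) *
  ((1 - U r ^+ 2) / (1 - a r) - (1 - U x ^+ 2) / (1 - a x)).
Proof.
move=> r0; have /andP[ax0 ax1] := ax; have /andP[a0 a1] := a_between profile r0.
have -> : (1 - U x ^+ 2) / (1 - a x) = (2 - a x)^-1.
  have c0 : 1 - a x != 0 by rewrite subr_eq0 gt_eqF.
  have c1 : 2 - a x != 0 by rewrite lt0r_neq0//; lra.
  by apply: (mulIf c0); rewrite divfK//; apply: (mulIf c1); rewrite hx mulrAC mulVf ?mul1r.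
rewrite /S; field; rewrite !lt0r_neq0//=; lra.
Qed.

Let S_gt0 r : 0 < r < x -> 0 < S r.
Proof.
move=> /andP[r0 rx]; have /andP[ax0 ax1] := ax; have /andP[a0 a1] := a_between profile r0.
rewrite S_ratio// !mulr_gt0// subr_gt0 ?(magnetic_ratio_decr profile)//.
by rewrite ltr_pdivlMr// mul1r; lra.
Qed.

Let S_lt0 r : x < r -> S r < 0.
Proof.
move=> xr; have r0 := lt_trans x0 xr; have /andP[ax0 ax1] := ax; have /andP[a0 a1] := a_between profile r0.
rewrite S_ratio// pmulr_rlt0 ?subr_lt0 ?(magnetic_ratio_decr profile)//.
by rewrite mulr_gt0 ?subr_gt0// ltr_pdivlMr// mul1r; lra.
Qed.

Let dpsi r : 0 < r -> is_derive r 1 psi (psi1 r).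
Proof.
case: profile => _ _ _ ha _ r0; have h := ha r r0; have /andP[ax0 _] := ax.
by rewrite /psi; derive; rewrite /psi1; field; exact: lt0r_neq0.
Qed.

Let W g g1 r := r * (psi r * g1 r - psi1 r * g r).

(** For every l <= 1 the terms (1 - l) psi and S are never of opposite signs: both are nonnegative
    before [x] and nonpositive after it. One barrier thus serves all parameters up to the
    threshold. *)
Let dW l g g1 r : sol l g g1 -> 0 < r ->
  is_derive r 1 (W g g1) (r * ((1 - l) * psi r + S r) * g r).
Proof.
move=> hg r0; have [h1 h2] := hg r r0; have h3 := dpsi r0.
case: (profile) => _ _ hU ha _; have h4 := hU r r0; have h5 := ha r r0.
have /andP[ax0 _] := ax.
have h6 : is_derive r 1 psi1 (- ((1 - U r ^+ 2) / 2 - U r ^+ 2 * (1 - a r)) / a x).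
  by rewrite /psi1; derive; rewrite /=; field; rewrite !lt0r_neq0.
rewrite /W; derive.
by rewrite /eigen_potential /psi /psi1 /S; field; rewrite !lt0r_neq0.
Qed.

Let dquot l g g1 r : sol l g g1 -> 0 < r -> r != x ->
  is_derive r 1 (fun r => g r / psi r) (W g g1 r / (r * psi r ^+ 2)).
Proof.
move=> hg r0 rx; have [h1 h2] := hg r r0; have h3 := dpsi r0.
have p0 : psi r != 0.
  case: (ltgtP r x) rx => // rx _; last by rewrite lt_eqF// psi_lt0.
  by rewrite gt_eqF// psi_gt0// r0.
by derive => //; rewrite /W; field; rewrite p0 lt0r_neq0.
Qed.

(** At a first zero z <= x of g one has g' <= 0 and psi >= 0, so W(z) <= 0. But W starts from 0 and
    is strictly increasing on (0, z). *)
Let regular_pos_left l g g1 : 0 <= l <= 1 -> sol l g g1 -> regular_at0 g g1 ->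
  forall r, 0 < r <= x -> 0 < g r.
Proof.
move=> /andP[l0 l1] hg rg r /andP[r0 rx]; rewrite ltNge; apply/negP => gr.
have [cg g0 _] := rg.
have g0' : 0 < g 0 by rewrite g0.
have [z [/andP[z0 zr] gz gpos]] := @first_zero _ g 0 r (fun s _ => cg s) (ltW r0) g0' gr.
have zx := le_trans zr rx.
have g1z : g1 z <= 0.
  have [h1 _] := hg z z0; rewrite leNgt; apply/negP => h.
  have [e e0 he] := derive_gt0_left h1 h.
  pose s := Num.max (z / 2) (z - e / 2).
  have sz : s < z by rewrite gt_max; lra.
  have s2 : z / 2 <= s by rewrite le_max lexx.
  have se : z - e / 2 <= s by rewrite le_max lexx orbT.
  have := he s ltac:(lra); rewrite gz ltNge => /negP; apply.
  by rewrite ltW// gpos// sz andbT; lra.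
have dWpos t : 0 < t < z -> 0 < t * ((1 - l) * psi t + S t) * g t.
  move=> /andP[t0 tz]; have tx := lt_le_trans tz zx.
  rewrite mulr_gt0 ?gpos ?(ltW t0) ?tz//= mulr_gt0// ltr_wpDl// ?S_gt0 ?t0//.
  by apply: mulr_ge0; [lra|apply/ltW/psi_gt0; rewrite t0].
have Wge : 0 <= W g g1 (z / 2).
  apply: (@ge0_of_vanishing _ (W g g1) (fun t => t * ((1 - l) * psi t + S t) * g t) (z / 2)); last by lra.
  - by move=> t /andP[t0 _]; exact: dW.
  - by move=> t /andP[t0 tz]; apply/ltW/dWpos; lra.
  move=> e e0.
  have /andP[ax0 ax1] := ax.
  have [d d0 hd] := regular_near0 rg ltr01.
  pose B := 1 + (a x)^-1; have B0 : 0 < B by rewrite addr_gt0 ?invr_gt0.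
  pose D := Num.min (Num.min x d) (Num.min 1 (e / (4 * B))).
  exists D; first by rewrite !lt_min x0 d0 ltr01 divr_gt0// mulr_gt0.
  move=> t /andP[t0]; rewrite !lt_min => /andP[/andP[tx td] /andP[t1 te]].
  have [|gt g1t] := hd t; first by rewrite t0.
  have tx' : 0 < t < x by rewrite t0.
  have psit : `|psi t| <= 1.
    rewrite gtr0_norm ?psi_gt0// gerBl divr_ge0// ltW//.
    by case/andP: (a_between profile t0).
  have psi1t : `|psi1 t| <= (a x)^-1.
    have /andP[U0 U1] := U_between profile t0.
    have U2 : 0 <= 1 - U t ^+ 2 <= 1.
      by rewrite subr_ge0 gerBl sqr_ge0 expr_le1 ?(ltW U0) ?(ltW U1).
    rewrite /psi1 mulNr normrN normrM normfV (gtr0_norm ax0) ler_piMl ?invr_ge0 ?(ltW ax0)//.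
    have /andP[u0 u1] := U2.
    rewrite ger0_norm; last by rewrite mulr_ge0// divr_ge0// ltW.
    have : (t / 2) * (1 - U t ^+ 2) <= (t / 2) * 1 by apply: ler_wpM2l => //; lra.
    lra.
  rewrite /W normrM gtr0_norm//.
  have : `|psi t * g1 t - psi1 t * g t| <= 2 * B.
    apply: le_trans (ler_normB _ _) _; rewrite (normrM (psi t)) (normrM (psi1 t)).
    have gt2 : `|g t| <= 2 by move: gt; rewrite ler_norml ltr_norml; lra.
    have : `|psi t| * `|g1 t| <= 1 * 1 by apply: ler_pM => //; exact: ltW.
    have : `|psi1 t| * `|g t| <= (a x)^-1 * 2 by apply: ler_pM.
    rewrite /B; lra.
  move=> h; apply: (@le_lt_trans _ _ (t * (2 * B))); first by rewrite ler_pM2l.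
  move: te; rewrite ltr_pdivlMr ?mulr_gt0//.
  have : 0 < t * B by rewrite mulr_gt0.
  lra.
have : W g g1 (z / 2) < W g g1 z.
  apply: (@derive_gt0_lt _ _ (fun t => t * ((1 - l) * psi t + S t) * g t)); last by lra.
    by move=> t /andP[h _]; apply: dW => //; lra.
  by move=> t /andP[h1 h2]; apply: dWpos; lra.
rewrite ltNge => /negP; apply; apply: le_trans Wge.
rewrite /W gz mulr0 subr0 pmulr_rle0// mulr_ge0_le0//.
move: zx; rewrite le_eqVlt => /predU1P[->|zx]; first by rewrite psix.
by rewrite ltW// psi_gt0// z0.
Qed.

(** The quotient g / psi vanishes at z and its derivative W / (r psi^2) is positive there. While the
    quotient is positive, W increases; so the quotient stays positive. As psi is bounded, its
    derivative is at least a constant times 1 / r, and psi stays away from 0 beyond [p], so g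
    inherits the growth. *)
Let log_growth_right l g g1 z : 0 <= l <= 1 -> sol l g g1 -> x < z ->
  g z = 0 -> g1 z < 0 -> log_growth g.
Proof.
move=> /andP[l0 l1] hg xz gz g1z.
have z0 := lt_trans x0 xz; have /andP[ax0 ax1] := ax.
pose y r : R := g r / psi r.
have dy r : z <= r -> is_derive r 1 y (W g g1 r / (r * psi r ^+ 2)).
  move=> zr; apply: (dquot hg); first exact: lt_le_trans zr.
  by rewrite gt_eqF// (lt_le_trans xz).
have Wz : 0 < W g g1 z.
  by rewrite /W gz mulr0 subr0 mulr_gt0// nmulr_rgt0// psi_lt0.
have psi2_gt0 r : z <= r -> 0 < r * psi r ^+ 2.
  move=> zr; have r0 := lt_le_trans z0 zr.
  by rewrite mulr_gt0// lt_neqAle sqr_ge0 eq_sym expf_neq0// lt_eqF// psi_lt0// (lt_le_trans xz).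
have [e e0 he] := derive_gt0_right (dy z (lexx z)) (divr_gt0 Wz (psi2_gt0 z (lexx z))).
have yz : y z = 0 by rewrite /y gz mul0r.
(* as long as g / psi >= 0, the weighted Wronskian W increases *)
have Wmono r s : z <= r -> r <= s -> (forall t, r < t < s -> 0 < y t) -> W g g1 r <= W g g1 s.
  move=> zr rs ypos.
  apply: (@derive_ge0_le _ _ (fun t => t * ((1 - l) * psi t + S t) * g t)); last exact: rs.
    by move=> t /andP[rt _]; apply: dW => //; apply: lt_le_trans (le_trans zr rt).
  move=> t /andP[rt ts]; have xt : x < t by apply: lt_trans xz (le_lt_trans zr rt).
  have t0 := lt_trans x0 xt; have pt := psi_lt0 xt; have st := S_lt0 xt.
  have yt := ypos t ltac:(by rewrite rt ts).
  have gt : g t < 0 by move: yt; rewrite /y nmulr_lgt0 ?invr_lt0.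
  have h : (1 - l) * psi t <= 0 by apply: mulr_ge0_le0; [lra|exact: ltW].
  rewrite nmulr_lge0// pmulr_rle0//; lra.
pose p := z + e / 2; have zp : z < p by rewrite /p; lra.
have Wp : 0 < W g g1 p.
  apply: lt_le_trans Wz (Wmono z p _ _ _) => //; first exact: ltW.
  by move=> t /andP[zt tp]; rewrite -yz; apply: he; rewrite /p in tp; lra.
have yp : 0 < y p by rewrite -yz; apply: he; rewrite /p; lra.
have ypos r : p <= r -> 0 < y r.
  move=> pr; rewrite ltNge; apply/negP => yr.
  have cy s : p <= s <= r -> {for s, continuous y}.
    by move=> /andP[ps _]; apply: is_derive_cont (dy s _); apply: le_trans ps; exact: ltW.
  have [s [/andP[ps sr] ys hs]] := first_zero cy pr yp yr.
  have : y p <= y s.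
    apply: (@derive_ge0_le _ y (fun t => W g g1 t / (t * psi t ^+ 2))); last exact: ltW.
      by move=> t /andP[pt _]; apply: dy; apply: le_trans pt; exact: ltW.
    move=> t /andP[pt ts]; have zt : z <= t by apply/ltW/(lt_trans zp).
    apply/ltW/divr_gt0; last exact: psi2_gt0.
    apply: lt_le_trans Wp (Wmono p t (ltW zp) (ltW pt) _) => v /andP[pv vt].
    by apply: hs; rewrite (ltW pv) (lt_trans vt ts).
  by rewrite ys leNgt yp.
have p0 := lt_trans z0 zp; have xp := lt_trans xz zp.
pose b := (a x)^-1 - 1.
have b0 : 0 < b by rewrite subr_gt0 invf_gt1.
have psib r : p <= r -> `|psi p| <= `|psi r| <= b.
  move=> pr; have r0 := lt_le_trans p0 pr; have xr := lt_le_trans xp pr.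
  rewrite !ltr0_norm ?psi_lt0// lerN2 /psi !opprB lerD2l lerN2.
  have apr : a p <= a r.
    by move: pr; rewrite le_eqVlt => /predU1P[->//|/(a_incr profile p0)/ltW].
  have /andP[_ ar1] := a_between profile r0.
  rewrite ler_pM2r ?invr_gt0// apr /= /b lerD2r ler_pdivrMr// mulVf ?lt0r_neq0//.
  exact: ltW.
pose c := W g g1 p / b ^+ 2.
have c0 : 0 < c by rewrite divr_gt0 ?exprn_gt0.
have ygrow r : p <= r -> y p + c * (ln r - ln p) <= y r.
  move=> pr; have : y p - c * ln p <= y r - c * ln r.
    apply: (@derive_ge0_le _ (fun t => y t - c * ln t)
      (fun t => W g g1 t / (t * psi t ^+ 2) - c / t)); last exact: pr.
      move=> t /andP[pt _]; have t0 := lt_le_trans p0 pt.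
      have h := dy t (le_trans (ltW zp) pt).
      exact: is_derive_sub h (is_derive_mulln c t0).
    move=> t /andP[pt tr]; have t0 := lt_trans p0 pt.
    have Wt : W g g1 p <= W g g1 t.
      by apply: Wmono => [||v /andP[pv _]]; [exact: ltW|exact: ltW|apply/ypos/ltW].
    have /andP[_ pb] := psib t (ltW pt).
    rewrite subr_ge0 invfM [leRHS]mulrCA mulrC ler_pM2l ?invr_gt0// /c.
    apply: ler_pM; [exact: ltW| |exact: Wt|].
      by rewrite invr_ge0 ltW// exprn_gt0.
    have h2 : 0 < psi t ^+ 2.
      by rewrite lt_neqAle sqr_ge0 eq_sym expf_neq0// lt_eqF// psi_lt0// (lt_trans xp).
    have hb : psi t ^+ 2 <= b ^+ 2.
      by rewrite -[leLHS]real_normK ?num_real// ler_sqr ?nnegrE// ltW.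
    by rewrite lef_pV2 ?posrE ?h2 ?(exprn_gt0 _ b0).
  lra.
exists (`|psi p| * Num.min (y p) c), p; split => //.
  by rewrite mulr_gt0 ?lt_min ?yp// normr_gt0 lt_eqF// psi_lt0.
move=> r pr; have xr := lt_le_trans xp pr.
have -> : g r = psi r * y r by rewrite /y mulrC divfK// lt_eqF// psi_lt0.
rewrite normrM -mulrA; apply: ler_pM => //.
- rewrite mulr_ge0 ?le_min ?(ltW yp) ?(ltW c0)// addr_ge0// subr_ge0 ler_ln ?posrE//.
  exact: lt_le_trans pr.
- by case/andP: (psib r pr).
rewrite gtr0_norm ?ypos//; apply: le_trans (ygrow r pr).
have L0 : 0 <= ln r - ln p by rewrite subr_ge0 ler_ln ?posrE// (lt_le_trans p0).
rewrite mulrDr mulr1 lerD ?ge_min ?lexx// ler_wpM2r// ge_min lexx orbT//.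
Qed.

Lemma regular_pos_aux l g g1 : 0 <= l <= 1 -> sol l g g1 -> regular_at0 g g1 ->
  ~ log_growth g -> forall r, 0 < r -> 0 < g r.
Proof.
move=> l01 hg rg hlog r r0.
have [rx|xr] := leP r x; first by apply: (regular_pos_left l01 hg rg); rewrite r0.
rewrite ltNge; apply/negP => gr.
have gx : 0 < g x by apply: (regular_pos_left l01 hg rg); rewrite x0 lexx.
have [cg g0 _] := rg.
have [z [/andP[xz zr] gz gpos]] := @first_zero _ g x r (fun s _ => cg s) (ltW xr) gx gr.
have z0 := lt_trans x0 xz.
apply: hlog; apply: (log_growth_right l01 hg xz gz).
case: (ltgtP (g1 z) 0) => // h; last first.
  have := radial_unique hg (eigen_potential_le1 profile l01) z0 gz h x0.
  by move=> e; move: gx; rewrite e ltxx.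
have [h1 _] := hg z z0; have [e e0 he] := derive_gt0_left h1 h.
pose s := Num.max x (z - e / 2).
have sz : s < z by rewrite gt_max xz; lra.
have se : z - e / 2 <= s by rewrite le_max lexx orbT.
have := he s ltac:(lra); rewrite gz ltNge (ltW (gpos s _))//.
by rewrite sz le_max lexx.
Qed.

End Comparison.

Lemma regular_pos l g g1 : 0 <= l <= 1 -> sol l g g1 -> regular_at0 g g1 ->
  ~ log_growth g -> forall r, 0 < r -> 0 < g r.
Proof. by have [x x0 hx] := crossover profile; exact: (regular_pos_aux x0 hx). Qed.

(* At the threshold r g' is decreasing, so that g tends to -oo. *)
Lemma threshold_not_pos g g1 : sol 1 g g1 -> regular_at0 g g1 ->
  exists2 r, 0 < r & g r <= 0.
Proof.
move=> hg rg; apply: contrapT => hn.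
have gpos r : 0 < r -> 0 < g r.
  by move=> r0; rewrite ltNge; apply/negP => h; apply: hn; exists r.
have d r : 0 < r -> is_derive r 1 (fun r => - (r * g1 r)) (r * (1 - U r ^+ 2) * g r).
  move=> r0; have h := radial_flux hg r0.
  by apply: is_derive_val (is_derive_opp h) _; rewrite /eigen_potential; ring.
have d_gt0 r : 0 < r -> 0 < r * (1 - U r ^+ 2) * g r.
  move=> r0; have /andP[U0 U1] := U_between profile r0.
  by rewrite !mulr_gt0 ?gpos ?subr_gt0// expr_lt1// ltW.
have h12 : 0 <= - (2^-1 * g1 2^-1).
  apply: (@ge0_of_vanishing _ (fun r => - (r * g1 r)) (fun r => r * (1 - U r ^+ 2) * g r) 1).
  - by move=> r /andP[r0 _]; exact: d.
  - by move=> r /andP[r0 _]; exact/ltW/d_gt0.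
  - move=> e e0; have [d' d'0 hd'] := regular_flux_vanishes rg e0.
    by exists d' => // s sd; rewrite normrN hd'.
  - by rewrite invr_gt0 ltr0n /= invf_le1// ler1n.
have incr r s : 0 < r -> r < s -> - (r * g1 r) < - (s * g1 s).
  move=> r0 rs; apply: (@derive_gt0_lt _ (fun r => - (r * g1 r)) (fun r => r * (1 - U r ^+ 2) * g r)).
  - by move=> t /andP[rt _]; apply: d; exact: lt_le_trans rt.
  - by move=> t /andP[rt _]; apply: d_gt0; exact: lt_trans rt.
  - exact: rs.
pose c := - (1 * g1 1).
have c0 : 0 < c by apply: le_lt_trans h12 (incr _ _ _ _); rewrite ?invr_gt0// invf_lt1// ltr1n.
have ggrow r : 1 <= r -> g r <= g 1 - c * ln r.
  move=> r1; have : - g 1 - c * ln 1 <= - g r - c * ln r.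
    apply: (@derive_ge0_le _ (fun t => - g t - c * ln t) (fun t => - g1 t - c / t)); last exact: r1.
      move=> t /andP[t1 _]; have t0 : 0 < t by lra.
      have [h _] := hg t t0.
      exact: is_derive_sub (is_derive_opp h) (is_derive_mulln c t0).
    move=> t /andP[t1 _]; have t0 : 0 < t by lra.
    rewrite subr_ge0 ler_pdivrMr//.
    by have := incr 1 t ltr01 t1; rewrite -/c; lra.
  rewrite ln1; lra.
(* The point where the upper bound [g 1 - c * ln r] vanishes. *)
pose r := expR (g 1 / c).
have g10 := gpos 1 ltr01.
have r1 : 1 <= r by rewrite -[leLHS]expR0 ler_expR divr_ge0 ?ltW.
have := ggrow r r1; rewrite /r expRK mulrCA divff ?mulr1 ?lt0r_neq0// subrr leNgt.
by rewrite gpos ?expR_gt0.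
Qed.

End VortexSturm.

(** * The ground state *)

Definition bounded_below_oo (R : realType) (g : R -> R) := exists c p : R,
  [/\ 0 < c, 0 < p & forall r, p <= r -> c <= `|g r|].

Lemma log_growth_bounded_below (R : realType) (g : R -> R) : log_growth g -> bounded_below_oo g.
Proof.
move=> [c [p [c0 p0 h]]]; exists c, p; split => // r pr; apply: le_trans (h r pr).
rewrite -[leLHS]mulr1 ler_pM2l// lerDl subr_ge0 ler_ln ?posrE//; exact: lt_le_trans pr.
Qed.

Section GroundState.
Variables (R : realType) (U a : R -> R).
Hypothesis profile : vortex_profile U a.
Implicit Types (g k : R -> R) (r s t z l m c d : R).

Local Notation sol l := (radial_solution (eigen_potential U l)).

Lemma tail_potential l : l < 1 -> exists d M, [/\ 0 < d, 0 < M &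
  forall r, M < r -> d <= eigen_potential U l r].
Proof.
(* As U^2 >= 2 U - 1, the bound U > (3 + l) / 4 leaves U^2 - l > (1 - l) / 2. *)
move=> l1; have [M M0 hM] := U_nearoo profile (ltac:(lra) : (3 + l) / 4 < 1).
exists ((1 - l) / 2), (Num.max 1 M); split => //; [lra|by rewrite lt_max ltr01|].
move=> r; rewrite gt_max => /andP[r1 Mr]; have r0 : 0 < r by lra.
have := hM r Mr; have /andP[U0 U1] := U_between profile r0.
have := sqr_ge0 (1 - U r); rewrite /eigen_potential !expr2; lra.
Qed.

Lemma tail_increasing l g g1 r0 : sol l g g1 -> 0 < r0 ->
  (forall r, r0 < r -> 0 <= eigen_potential U l r) -> 0 < g r0 -> 0 < g1 r0 ->
  forall r, r0 <= r -> g r0 <= g r.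
Proof.
move=> hg p0 hV gr g1r.
have mono s : r0 <= s -> (forall t, r0 < t < s -> 0 < g1 t) -> g r0 <= g s.
  move=> rs h; apply: (@derive_ge0_le _ g g1); last exact: rs.
    by move=> t /andP[rt _]; exact: (hg t (lt_le_trans p0 rt)).1.
  by move=> t rts; exact/ltW/h.
have g1pos r : r0 <= r -> 0 < g1 r.
  move=> rr; rewrite ltNge; apply/negP => h.
  have cy s : r0 <= s <= r -> {for s, continuous g1}.
    by move=> /andP[rs _]; exact: is_derive_cont (hg s (lt_le_trans p0 rs)).2.
  have [z [/andP[rz zr] gz hz]] := first_zero cy rr g1r h.
  have : r0 * g1 r0 <= z * g1 z.
    apply: (@derive_ge0_le _ (fun t => t * g1 t) (fun t => t * eigen_potential U l t * g t)); last exact: ltW.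
      by move=> t /andP[rt _]; apply: (radial_flux hg); exact: lt_le_trans rt.
    move=> t /andP[rt tz]; have t0 := lt_trans p0 rt.
    rewrite mulr_ge0 ?mulr_ge0 ?hV ?(ltW t0)//; apply: le_trans (ltW gr) _.
    by apply: mono; [exact: ltW|move=> s /andP[rs st]; apply: hz; rewrite ltW//= (lt_trans st)].
  by rewrite gz mulr0 leNgt mulr_gt0.
by move=> r rr; apply: mono => // t /andP[rt _]; apply: g1pos; exact: ltW.
Qed.

(** A positive slope anywhere in the tail would, by [tail_increasing], keep g above a positive value
    from there on. *)
Lemma tail_decreasing l g g1 : l < 1 -> sol l g g1 -> (forall r, 0 < r -> 0 < g r) ->
  ~ bounded_below_oo g -> exists d M, [/\ 0 < d, 0 < M,
    (forall r, M < r -> d <= eigen_potential U l r) & forall r, M < r -> g1 r <= 0].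
Proof.
move=> l1 hg gpos hb; have [d [M [d0 M0 hM]]] := tail_potential l1.
exists d, M; split => // r Mr; rewrite leNgt; apply/negP => h; apply: hb.
have r0 := lt_trans M0 Mr.
exists (g r), r; split; [exact: gpos|exact: r0|move=> s rs].
apply: le_trans (ler_norm _); apply: (tail_increasing hg r0 _ (gpos _ r0) h) => // t rt.
exact/ltW/(lt_le_trans d0)/hM/(lt_trans Mr).
Qed.

Lemma regular_pos' l g g1 : 0 <= l <= 1 -> sol l g g1 -> regular_at0 g g1 ->
  ~ bounded_below_oo g -> forall r, 0 < r -> 0 < g r.
Proof.
move=> l01 hg rg hb; apply: (regular_pos profile l01 hg rg).
by move=> /log_growth_bounded_below.
Qed.

(* Two positive decaying solutions for l < m: the Wronskian is negative and
   decreasing, which drives k / g to -oo. *)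
Lemma ground_state_unique l m g g1 k k1 : 0 < l -> l < m -> m < 1 ->
  sol l g g1 -> regular_at0 g g1 -> ~ bounded_below_oo g ->
  sol m k k1 -> regular_at0 k k1 -> ~ bounded_below_oo k -> False.
Proof.
move=> l0 lm m1 hg rg bg hk rk bk.
have gpos := regular_pos' (ltac:(lra) : 0 <= l <= 1) hg rg bg.
have kpos := regular_pos' (ltac:(lra) : 0 <= m <= 1) hk rk bk.
have [d [M [d0 M0 hM hd]]] := tail_decreasing (lt_trans lm m1) hg gpos bg.
pose w r : R := r * (g r * k1 r - g1 r * k r).
have dw r : 0 < r -> is_derive r 1 (fun r => - w r) (r * (m - l) * g r * k r).
  move=> r0; apply: is_derive_val (is_derive_opp (radial_wronskian hg hk r0)) _.
  by rewrite /eigen_potential; ring.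
have dw_gt0 r : 0 < r -> 0 < r * (m - l) * g r * k r.
  by move=> r0; rewrite !mulr_gt0 ?gpos ?kpos ?subr_gt0.
have w12 : 0 <= - w 2^-1.
  apply: (@ge0_of_vanishing _ (fun r => - w r) (fun r => r * (m - l) * g r * k r) 1).
  - by move=> r /andP[r0 _]; exact: dw.
  - by move=> r /andP[r0 _]; exact/ltW/dw_gt0.
  - move=> e e0; have e4 : 0 < e / 4 by lra.
    have [d1 d10 h1] := regular_near0 rg ltr01.
    have [d2 d20 h2] := regular_near0 rk ltr01.
    have [d3 d30 h3] := regular_flux_vanishes rg e4.
    have [d4 d40 h4] := regular_flux_vanishes rk e4.
    exists (Num.min (Num.min d1 d2) (Num.min d3 d4)); first by rewrite !lt_min d10 d20 d30.
    move=> r /andP[r0]; rewrite !lt_min => /andP[/andP[r1 r2] /andP[r3 r4]].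
    have [|gr _] := h1 r; first by rewrite r0.
    have [|kr _] := h2 r; first by rewrite r0.
    have g1r := h3 r ltac:(by rewrite r0); have k1r := h4 r ltac:(by rewrite r0).
    have gr2 : `|g r| <= 2 by move: gr; rewrite ler_norml ltr_norml; lra.
    have kr2 : `|k r| <= 2 by move: kr; rewrite ler_norml ltr_norml; lra.
    rewrite normrN (_ : w r = g r * (r * k1 r) - k r * (r * g1 r)); last by rewrite /w; ring.
    apply: le_lt_trans (ler_normB _ _) _; rewrite (normrM (g r)) (normrM (k r)).
    have : `|g r| * `|r * k1 r| <= 2 * `|r * k1 r| by rewrite ler_wpM2r.
    have : `|k r| * `|r * g1 r| <= 2 * `|r * g1 r| by rewrite ler_wpM2r.
    lra.
  - by rewrite invr_gt0 ltr0n /= invf_le1// ler1n.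
have w_incr r s : 0 < r -> r < s -> - w r < - w s.
  move=> r0 rs; apply: (@derive_gt0_lt _ (fun r => - w r) (fun r => r * (m - l) * g r * k r)).
  - by move=> t /andP[rt _]; apply: dw; exact: lt_le_trans rt.
  - by move=> t /andP[rt _]; apply: dw_gt0; exact: lt_trans rt.
  - exact: rs.
pose p := Num.max 1 (M + 1).
have p1 : 1 <= p by rewrite le_max lexx.
have pM : M < p by rewrite lt_max; apply/orP; right; lra.
have p0 : 0 < p by lra.
have o0 : 0 < - w 1 by apply: le_lt_trans w12 (w_incr _ _ _ _); rewrite ?invr_gt0// invf_lt1// ltr1n.
have gle r : p <= r -> g r <= g p.
  move=> pr; rewrite -lerN2; apply: (@derive_ge0_le _ (fun t => - g t) (fun t => - g1 t)); last exact: pr.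
    by move=> t /andP[pt _]; apply/is_derive_opp; exact: (hg t (lt_le_trans p0 pt)).1.
  by move=> t /andP[pt _]; rewrite oppr_ge0 hd// (lt_trans pM).
have gp := gpos p p0.
pose c := - w 1 / g p ^+ 2.
have c0 : 0 < c by rewrite divr_gt0 ?exprn_gt0.
have grow r : p <= r -> c * ln r - c * ln p <= k p / g p - k r / g r.
  move=> pr; have : - (k p / g p) - c * ln p <= - (k r / g r) - c * ln r; last by lra.
  apply: (@derive_ge0_le _ (fun t => - (k t / g t) - c * ln t)
    (fun t => - ((g t * k1 t - g1 t * k t) / g t ^+ 2) - c / t)); last exact: pr.
    move=> t /andP[pt _]; have t0 := lt_le_trans p0 pt.
    exact: is_derive_sub (is_derive_opp (radial_quotient hg hk t0 (lt0r_neq0 (gpos t t0))))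
      (is_derive_mulln c t0).
  move=> t /andP[pt _]; have t0 := lt_trans p0 pt; have gt := gpos t t0.
  have -> : - ((g t * k1 t - g1 t * k t) / g t ^+ 2) = - w t / g t ^+ 2 / t.
    by rewrite /w; field; rewrite !lt0r_neq0.
  rewrite subr_ge0 ler_pM2r ?invr_gt0// /c.
  have h1 : - w 1 <= - w t by apply/ltW/w_incr => //; lra.
  apply: ler_pM; [exact: ltW|by rewrite invr_ge0 sqr_ge0|exact: h1|].
  rewrite lef_pV2 ?posrE ?exprn_gt0// ler_sqr ?nnegrE ?(ltW gt) ?(ltW gp)//.
  by apply: gle; exact: ltW.
(* Here the lower bound [c * ln r - c * ln p] equals [k p / g p], so [k r / g r] would be
   nonpositive. *)
pose r := expR (k p / g p / c + ln p).
have pr : p <= r.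
  rewrite /r expRD lnK ?posrE// -[leLHS]mul1r ler_pM2r// -[leLHS]expR0 ler_expR.
  by apply/ltW/divr_gt0 => //; apply: divr_gt0 => //; exact: kpos.
have r0 := lt_le_trans p0 pr.
have := grow r pr; have : 0 < k r / g r by rewrite divr_gt0 ?gpos ?kpos.
rewrite /r expRK mulrDr mulrCA divff ?mulr1 ?lt0r_neq0// -/r; lra.
Qed.

Let sqr_lt_ltNl (x e : R) : 0 < e -> x ^+ 2 < e ^+ 2 -> - e < x.
Proof.
move=> e0 h; rewrite ltNge; apply/negP => xe.
have : 0 <= (- x - e) * (- x + e) by apply: mulr_ge0; lra.
by move: h; rewrite !expr2; lra.
Qed.

(** For l = 0 the flux r g' has the positive derivative r U^2 g, so g increases. Thus the parameter
    0 has a positive solution, but it cannot be the maximal one, whose solution is eventually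
    nonincreasing. *)
Let zero_flux_pos g g1 : sol 0 g g1 -> regular_at0 g g1 ->
  (forall r, 0 < r -> 0 < g r) /\ forall r, 0 < r -> 0 < g1 r.
Proof.
move=> hg rg; have [cg g0 _] := rg.
have dflux r : 0 < r -> is_derive r 1 (fun r => r * g1 r) (r * U r ^+ 2 * g r).
  by move=> r0; apply: is_derive_val (radial_flux hg r0) _; rewrite /eigen_potential; ring.
have dpos r : 0 < r -> 0 < g r -> 0 < r * U r ^+ 2 * g r.
  move=> r0 gr; have /andP[U0 _] := U_between profile r0.
  by rewrite !mulr_gt0// exprn_gt0.
have flux_ge0 z : (forall r, 0 < r < z -> 0 < g r) -> forall r, 0 < r <= z -> 0 <= r * g1 r.
  move=> hz; apply: (@ge0_of_vanishing _ (fun r => r * g1 r) (fun r => r * U r ^+ 2 * g r) z).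
  - by move=> r /andP[r0 _]; exact: dflux.
  - by move=> r /andP[r0 rz]; apply/ltW/dpos => //; apply: hz; rewrite r0.
  - by move=> e e0; exact: regular_flux_vanishes rg e0.
have gpos r : 0 < r -> 0 < g r.
  move=> r0; rewrite ltNge; apply/negP => gr.
  have g0' : 0 < g 0 by rewrite g0.
  have [z [/andP[z0 zr] gz hz]] := @first_zero _ g 0 r (fun s _ => cg s) (ltW r0) g0' gr.
  have z2 : 0 < z / 2 by rewrite divr_gt0.
  have hz' t : 0 < t < z -> 0 < g t by move=> /andP[t0 tz]; apply: hz; rewrite (ltW t0).
  have : g (z / 2) <= g z.
    apply: (@derive_ge0_le _ g g1); last by lra.
      by move=> t /andP[zt _]; exact: (hg t (lt_le_trans z2 zt)).1.
    move=> t /andP[zt tz]; have t0 := lt_trans z2 zt.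
    by rewrite -(pmulr_rge0 _ t0); apply: (flux_ge0 z) => //; rewrite t0 ltW.
  by rewrite gz leNgt hz'//; lra.
split=> // r r0; rewrite -(pmulr_rgt0 _ r0).
have r2 : 0 < r / 2 by rewrite divr_gt0.
have := flux_ge0 r (fun t h => gpos t (andP h).1) (r / 2) ltac:(lra).
move=> /le_lt_trans; apply.
apply: (@derive_gt0_lt _ (fun r => r * g1 r) (fun r => r * U r ^+ 2 * g r)); last by lra.
  by move=> t /andP[h _]; apply: dflux; exact: lt_le_trans h.
by move=> t /andP[h _]; have t0 := lt_trans r2 h; apply: dpos => //; exact: gpos.
Qed.

(* The supremum l of the parameters whose regular solution is positive: its
   solution is positive and, by maximality, eventually nonincreasing. *)
Let maximal_positive : exists l g g1, [/\ 0 < l < 1, sol l g g1, regular_at0 g g1,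
  (forall r, 0 < r -> 0 < g r) & exists d M, [/\ 0 < d, 0 < M,
    (forall r, M < r -> d <= eigen_potential U l r) & forall r, M < r -> g1 r <= 0]].
Proof.
have /choice[F hF] : forall l, exists p : (R -> R) * (R -> R), 0 <= l <= 1 ->
    sol l p.1 p.2 /\ regular_at0 p.1 p.2.
  move=> l; have [l01|l01] := boolP (0 <= l <= 1); last by exists (idfun, idfun).
  by have [g [g1 h]] := regular_solution_exists profile l01; exists (g, g1).
pose S := [set l : R | 0 <= l <= 1 /\ forall r, 0 < r -> 0 < (F l).1 r].
have i0 : (0 : R) <= 0 <= (1 : R) by rewrite lexx ler01.
have S0 : S 0 by split => //; have [h1 h2] := hF 0 i0; exact: (zero_flux_pos h1 h2).1.
have hS : has_sup S by split; [exists 0|exists 1 => l [/andP[]]].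
pose L := sup S.
have L0 : 0 <= L by apply: sup_upper_bound.
have L1 : L <= 1 by apply: ge_sup; [exists 0|move=> l [/andP[]]].
have L01 : 0 <= L <= 1 by rewrite L0.
have [hg rg] := hF L L01; set g := (F L).1 in hg rg; set g1 := (F L).2 in hg rg.
have C_gt0 r : 0 < 5 * expR (2 * r) * expR (3 * r) by rewrite !mulr_gt0 ?expR_gt0.
have close l r : 0 <= l <= 1 -> 0 < r -> ((F l).1 r - g r) ^+ 2 + ((F l).2 r - g1 r) ^+ 2 <=
    (l - L) ^+ 2 * (5 * expR (2 * r) * expR (3 * r)).
  by move=> l01 r0; have [hl rl] := hF l l01; rewrite mulrA; exact: (regular_dependence profile).
have small r e : 0 < e -> exists2 h, 0 < h & forall l, `|l - L| <= h ->
    (l - L) ^+ 2 * (5 * expR (2 * r) * expR (3 * r)) < e ^+ 2.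
  move=> e0; set C := _ * expR (3 * r); have C0 : 0 < C := C_gt0 r.
  exists (e / (C + 1)); first by rewrite divr_gt0//; lra.
  move=> l; rewrite ler_pdivlMr; last by lra.
  move=> hl; rewrite -real_normK ?num_real//.
  set x := `|l - L| in hl *; have x0 : 0 <= x by rewrite normr_ge0.
  have [->|xn] := eqVneq x 0; first by rewrite expr0n mul0r exprn_gt0.
  have xp : 0 < x by rewrite lt_neqAle eq_sym xn.
  have : (x * (C + 1)) ^+ 2 <= e ^+ 2.
    by rewrite ler_sqr ?nnegrE ?(ltW e0)// mulr_ge0//; lra.
  apply: lt_le_trans; rewrite exprMn ltr_pM2l ?exprn_gt0//.
  by have := sqr_ge0 C; rewrite !expr2; lra.
have g_ge0 r : 0 < r -> 0 <= g r.
  move=> r0; rewrite leNgt; apply/negP => gr.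
  have [h h0 hh] := small r (- g r) ltac:(lra).
  have [l Sl Ll] := sup_adherent h0 hS; rewrite -/L in Ll.
  have lL : l <= L by apply: sup_upper_bound.
  have [l01 lpos] := Sl.
  have := hh l ltac:(by rewrite ler0_norm; lra).
  have := close l r l01 r0; have := sqr_ge0 ((F l).2 r - g1 r) => h1 h2 h3.
  have h4 : (g r - (F l).1 r) ^+ 2 < (- g r) ^+ 2 by rewrite !expr2 in h1 h2 h3 *; lra.
  have gr' : 0 < - g r by lra.
  by have := sqr_lt_ltNl gr' h4; have := lpos r r0; lra.
(* A zero of the nonnegative limit solution would be a double zero, and uniqueness would make it
   vanish identically, against g(0) = 1. *)
have gpos r : 0 < r -> 0 < g r.
  move=> r0; rewrite lt_neqAle g_ge0// andbT; apply/eqP => gr.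
  have [h1 _] := hg r r0.
  have g1r : g1 r = 0.
    case: (ltgtP (g1 r) 0) => // h.
      have [e e0 he] := derive_gt0_right (is_derive_opp h1) ltac:(lra).
      by have := he (r + e / 2) ltac:(lra); have := g_ge0 (r + e / 2) ltac:(lra); rewrite -gr; lra.
    have [e e0 he] := derive_gt0_left h1 h.
    pose s := Num.max (r / 2) (r - e / 2).
    have sr : s < r by rewrite gt_max; lra.
    have s2 : r / 2 <= s by rewrite le_max lexx.
    have se : r - e / 2 <= s by rewrite le_max lexx orbT.
    by have := he s ltac:(lra); have := g_ge0 s ltac:(lra); rewrite -gr; lra.
  have pot t : 0 < t -> `|eigen_potential U L t| <= 1.
    move=> t0; have /andP[U0 U1] := U_between profile t0.
    have U2 : U t ^+ 2 <= 1 by rewrite expr_le1// ltW.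
    by have := sqr_ge0 (U t); rewrite ler_norml /eigen_potential; lra.
  have g0 := radial_unique hg pot r0 (esym gr) g1r.
  have [d d0 hd] := regular_near0 rg ltr01.
  have [|+ _] := hd (d / 2); first by lra.
  by rewrite g0 ?sub0r ?normrN ?normr1 ?ltxx; lra.
have Llt1 : L < 1.
  rewrite lt_neqAle L1 andbT; apply/eqP => e.
  rewrite e in hg; have [r r0 gr] := threshold_not_pos profile hg rg.
  by have := gpos r r0; lra.
have [d [M [d0 M0 hM]]] := tail_potential Llt1.
(* If g' > 0 at a point r of the tail, slightly larger parameters still have positive solutions: on
   [0, r] by continuous dependence, beyond r by [tail_increasing]. This contradicts the choice of
   L. *)
have decr r : M < r -> g1 r <= 0.
  move=> Mr; rewrite leNgt; apply/negP => g1r.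
  have r0 := lt_trans M0 Mr.
  have [cg gg0 _] := rg.
  have [b br hb] := @EVT_min R g 0 r (ltW r0) (continuous_subspaceT cg).
  have gb : 0 < g b.
    move: br; rewrite in_itv/= le_eqVlt => /andP[/predU1P[<- _|b0 _]]; last exact: gpos.
    by rewrite gg0.
  have [h h0 hh] := small r (Num.min (g b) (g1 r)) ltac:(by rewrite lt_min gb).
  (* The three bounds keep the solution close to g on [0, r], the potential nonnegative beyond r,
     and l at most 1. *)
  pose l := L + Num.min h (Num.min d (1 - L)).
  have hl : L < l by rewrite /l ltrDl !lt_min h0 d0 subr_gt0.
  have hl2 : l - L <= h by rewrite /l addrAC subrr add0r ge_min lexx.
  have hl3 : l - L <= d by rewrite /l addrAC subrr add0r !ge_min lexx orbT.
  have hl4 : l <= 1 by rewrite /l -lerBrDl !ge_min lexx !orbT.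
  have l01 : 0 <= l <= 1 by rewrite hl4 andbT; lra.
  have sml := hh l ltac:(by rewrite ger0_norm; lra).
  suff : S l by move=> /(sup_upper_bound hS); rewrite -/L leNgt hl.
  split => //; have [hgl rgl] := hF l l01.
  have m_gt0 : 0 < Num.min (g b) (g1 r) by rewrite lt_min gb.
  have mle : Num.min (g b) (g1 r) <= g b /\ Num.min (g b) (g1 r) <= g1 r.
    by rewrite !ge_min !lexx orbT.
  set mn := Num.min _ _ in sml m_gt0 mle; have [m1 m2] := mle.
  have near_s s : 0 < s <= r -> 0 < (F l).1 s.
    move=> /andP[s0 sr]; have := close l s l01 s0.
    have : (l - L) ^+ 2 * (5 * expR (2 * s) * expR (3 * s)) <=
           (l - L) ^+ 2 * (5 * expR (2 * r) * expR (3 * r)).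
      rewrite ler_wpM2l ?sqr_ge0// ler_pM ?mulr_ge0 ?expR_ge0//.
        by rewrite ler_pM2l// ler_expR ler_pM2l.
      by rewrite ler_expR ler_pM2l.
    move=> h1 h2; have h3 := sqr_ge0 ((F l).2 s - g1 s).
    have h4 : ((F l).1 s - g s) ^+ 2 < mn ^+ 2 by lra.
    have := sqr_lt_ltNl m_gt0 h4.
    have : g b <= g s by apply: hb; rewrite in_itv/= (ltW s0).
    lra.
  have g1l : 0 < (F l).2 r.
    have := close l r l01 r0 => h2; have h3 := sqr_ge0 ((F l).1 r - g r).
    have h4 : ((F l).2 r - g1 r) ^+ 2 < mn ^+ 2 by lra.
    have := sqr_lt_ltNl m_gt0 h4; lra.
  move=> s s0; have [sr|rs] := leP s r; first by apply: near_s; rewrite s0.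
  have glr : 0 < (F l).1 r by apply: near_s; rewrite r0 lexx.
  apply: lt_le_trans glr _; apply: (tail_increasing hgl r0 _ _ g1l); last exact: ltW.
    by move=> t rt; have := hM t (lt_trans Mr rt); rewrite /eigen_potential; lra.
  by apply: near_s; rewrite r0 lexx.
exists L, g, g1; split => //; last by exists d, M.
rewrite Llt1 andbT lt_neqAle L0 andbT; apply/eqP => e.
rewrite -e in hg; have [_ h] := zero_flux_pos hg rg.
have := decr (M + 1) ltac:(lra); have := h (M + 1) ltac:(lra); lra.
Qed.

(** The flux G = - r g' is nonnegative and nonincreasing in the tail, with - G' >= r d g;
    integrating over [r/2, r] gives d r^2 g(r) <= 4 G(p). The bound on g' follows from the mean
    value of g' over [r/2, r]. Inverse square decay is enough for membership in the domain. *)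
Lemma ground_state_exists : exists l g g1 C M, [/\ 0 < l < 1, sol l g g1, regular_at0 g g1,
  (forall r, 0 < r -> 0 < g r) & 0 < M /\ forall r, M <= r ->
    `|g r| <= C / r ^+ 2 /\ `|g1 r| <= C / r ^+ 2].
Proof.
have [l [g [g1 [l01 hg rg gpos [d [M [d0 M0 hM hd]]]]]]] := maximal_positive.
pose p := Num.max 1 (M + 1).
have p1 : 1 <= p by rewrite le_max lexx.
have pM : M < p by rewrite lt_max; apply/orP; right; lra.
have p0 : 0 < p by lra.
pose G r := - (r * g1 r).
have dG r : 0 < r -> is_derive r 1 (fun r => - G r) (r * eigen_potential U l r * g r).
  move=> r0; rewrite (_ : (fun r => - G r) = (fun r => r * g1 r)); last first.
    by apply/funext => t; rewrite /G opprK.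
  exact: (radial_flux hg r0).
have gle r s : p <= r -> r <= s -> g s <= g r.
  move=> pr rs; rewrite -lerN2; have r0 := lt_le_trans p0 pr.
  apply: (@derive_ge0_le _ (fun t => - g t) (fun t => - g1 t)); last exact: rs.
    by move=> t /andP[rt _]; apply/is_derive_opp; exact: (hg t (lt_le_trans r0 rt)).1.
  by move=> t /andP[rt _]; rewrite oppr_ge0 hd// (lt_trans (lt_le_trans pM pr)).
have Gle r s : p <= r -> r <= s -> G s <= G r.
  move=> pr rs; rewrite -lerN2; have r0 := lt_le_trans p0 pr.
  apply: (@derive_ge0_le _ (fun t => - G t) (fun t => t * eigen_potential U l t * g t)); last exact: rs.
    by move=> t /andP[rt _]; apply: dG; exact: lt_le_trans rt.
  move=> t /andP[rt _]; have t0 := lt_trans r0 rt.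
  rewrite mulr_ge0 ?(ltW (gpos _ t0))// mulr_ge0 ?(ltW t0)//.
  by apply: le_trans (ltW d0) (hM t _); apply: lt_trans rt; exact: lt_le_trans pr.
have G_ge0 r : p <= r -> 0 <= G r.
  move=> pr; rewrite /G oppr_ge0 pmulr_rle0; last exact: lt_le_trans pr.
  by apply: hd; exact: lt_le_trans pr.
have g_decay r : 2 * p <= r -> g r <= 4 * G p / d / r ^+ 2.
  move=> pr; have r0 : 0 < r by lra.
  have pr2 : p <= r / 2 by lra.
  have r20 : 0 < r / 2 by lra.
  rewrite ler_pdivlMr ?exprn_gt0// ler_pdivlMr//.
  have h1 : - G (r / 2) + r / 2 * d * g r * (r - r / 2) <= - G r.
    apply: (@derive_ge_growth _ (fun t => - G t) (fun t => t * eigen_potential U l t * g t)); last by lra.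
      by move=> t /andP[h _]; apply: dG; exact: lt_le_trans h.
    move=> t /andP[rt tr]; have t0 := lt_trans r20 rt.
    have grt : g r <= g t by apply: gle; [lra|exact: ltW].
    have gr := gpos r r0.
    apply: ler_pM => //; [by rewrite mulr_ge0 ?ltW|exact: ltW|].
    apply: ler_pM; [exact: ltW|exact: ltW|exact: ltW|].
    by apply: hM; apply: lt_trans rt; exact: lt_le_trans pr2.
  have h2 := G_ge0 r ltac:(lra); have h3 := Gle p (r / 2) (lexx p) pr2.
  have -> : g r * r ^+ 2 * d = 4 * (r / 2 * d * g r * (r - r / 2)) by field.
  lra.
pose C := 4 * G p / d.
have C0 : 0 <= C by rewrite divr_ge0 ?mulr_ge0 ?G_ge0// ltW.
have g1_decay r : 4 * p <= r -> - g1 r <= 8 * C / r ^+ 2.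
  move=> pr; have r0 : 0 < r by lra.
  have pr2 : 2 * p <= r / 2 by lra.
  have r20 : 0 < r / 2 by lra.
  have h1 : - g (r / 2) + - g1 r * (r - r / 2) <= - g r.
    apply: (@derive_ge_growth _ (fun t => - g t) (fun t => - g1 t)); last by lra.
      by move=> t /andP[h _]; apply/is_derive_opp; exact: (hg t (lt_le_trans r20 h)).1.
    move=> t /andP[rt tr]; have t0 := lt_trans r20 rt.
    have := Gle t r ltac:(lra) (ltW tr); rewrite /G => h.
    rewrite -(@ler_pM2l _ t)//; apply: le_trans (_ : r * - g1 r <= _); last by lra.
    rewrite ler_wpM2r ?(ltW tr)// oppr_ge0 hd//; lra.
  have h2 := g_decay (r / 2) pr2; rewrite -/C in h2.
  have h3 := gpos r r0.
  have e4 : C / (r / 2) ^+ 2 = 4 * C / r ^+ 2 by field; exact: lt0r_neq0.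
  rewrite e4 in h2.
  have h4 : - g1 r * (r / 2) <= 4 * C / r ^+ 2.
    have : - g1 r * (r - r / 2) = - g1 r * (r / 2) by field.
    lra.
  have h5 : 0 <= - g1 r * (r / 2 - 1 / 2).
    by apply: mulr_ge0; [rewrite oppr_ge0 hd//; lra|lra].
  have -> : 8 * C / r ^+ 2 = 2 * (4 * C / r ^+ 2) by ring.
  lra.
exists l, g, g1, (8 * C), (4 * p); split => //; split; first by lra.
move=> r pr; have r0 : 0 < r by lra.
have ri : 0 < (r ^+ 2)^-1 by rewrite invr_gt0 exprn_gt0.
split; last by rewrite ler0_norm ?g1_decay// hd//; lra.
rewrite gtr0_norm ?gpos//; apply: le_trans (g_decay r _) _; first by lra.
by rewrite ler_pM2r// -/C; lra.
Qed.

End GroundState.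

(** * Test functions *)

Section Smooth.
Variable R : realType.
Implicit Types (f g : R -> R) (x y c : R).

(** The recursion differentiates first, so that closure under sums and products is a plain induction
    on the order. *)
Fixpoint smooth_upto n f : Prop :=
  if n is n'.+1 then (forall x, derivable f x 1) /\ smooth_upto n' (derive1 f) else True.

Definition smooth f := forall n, smooth_upto n f.

Lemma smooth_uptoW n f : smooth_upto n.+1 f -> smooth_upto n f.
Proof. by elim: n f => [//|n IH] f [h1 h2]; split => //; apply: IH. Qed.

Lemma derive1_ext f df : (forall x, is_derive x 1 f (df x)) -> (derive1 f) = df.
Proof. by move=> h; apply/funext => x; rewrite derive1E; have [_ ->] := h x. Qed.

Lemma smooth_derive f : smooth f -> smooth (derive1 f).
Proof. by move=> sf n; have [] := sf n.+1. Qed.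

Lemma smooth_derivable f : smooth f -> forall x, derivable f x 1.
Proof. by move=> sf; have [] := sf 1%N. Qed.

Lemma smooth_is_derive f x : smooth f -> is_derive x 1 f ((derive1 f) x).
Proof. by move=> sf; apply: DeriveDef; [exact: smooth_derivable|rewrite derive1E]. Qed.

Lemma smooth_continuous f : smooth f -> continuous f.
Proof. by move=> sf x; exact: is_derive_cont (smooth_is_derive x sf). Qed.

Lemma smooth_derive1n f n : smooth f -> smooth (derive1n n f).
Proof.
by move=> sf; elim: n => [//|n IH]; rewrite derive1nS; exact: smooth_derive.
Qed.

Lemma smooth_of_derive f df : (forall x, is_derive x 1 f (df x)) -> smooth df -> smooth f.
Proof.
move=> hf sdf [//|n] /=; split; first by move=> x; have [] := hf x.
by rewrite (derive1_ext hf).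
Qed.

Lemma smooth_uptoD n f g : smooth_upto n f -> smooth_upto n g ->
  smooth_upto n (fun x => f x + g x).
Proof.
elim: n f g => [//|n IH] f g [f1 f2] [g1 g2] /=.
have hd x : is_derive x 1 (fun x => f x + g x) ((derive1 f) x + (derive1 g) x).
  by apply: is_derive_add; (apply: DeriveDef; [|rewrite derive1E]); [exact: f1| |exact: g1|].
split; first by move=> x; have [] := hd x.
by rewrite (derive1_ext hd); exact: IH.
Qed.

Lemma smooth_uptoM n f g : smooth_upto n f -> smooth_upto n g ->
  smooth_upto n (fun x => f x * g x).
Proof.
elim: n f g => [//|n IH] f g /[dup] /smooth_uptoW f0 [f1 f2] /[dup] /smooth_uptoW g0 [g1 g2] /=.
have hd x : is_derive x 1 (fun x => f x * g x) ((derive1 f) x * g x + f x * (derive1 g) x).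
  by apply: is_derive_mul; (apply: DeriveDef; [|rewrite derive1E]); [exact: f1| |exact: g1|].
split; first by move=> x; have [] := hd x.
by rewrite (derive1_ext hd); apply: smooth_uptoD; exact: IH.
Qed.

Lemma smooth_cst c : smooth (fun=> c).
Proof.
move=> n; elim: n c => [//|n IH] c /=.
have hd x : is_derive x 1 (fun=> c) (0 : R) by exact: is_derive_const.
by split; [move=> x; have [] := hd x|rewrite (derive1_ext hd)].
Qed.

Lemma smoothD f g : smooth f -> smooth g -> smooth (fun x => f x + g x).
Proof. by move=> sf sg n; exact: smooth_uptoD. Qed.

Lemma smoothM f g : smooth f -> smooth g -> smooth (fun x => f x * g x).
Proof. by move=> sf sg n; exact: smooth_uptoM. Qed.

Lemma smooth_affine f a b : smooth f -> smooth (fun x => f (a * x + b)).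
Proof.
move=> sf n; elim: n f sf => [//|n IH] f sf /=.
have hd x : is_derive x 1 (fun x => f (a * x + b)) (a * (derive1 f) (a * x + b)).
  have h1 : is_derive x 1 (fun x => a * x + b) a.
    by derive; ring.
  by apply: is_derive_val (is_derive_comp1 h1 (smooth_is_derive _ sf)) _; rewrite mulrC.
split; first by move=> x; have [] := hd x.
rewrite (derive1_ext hd); apply: smooth_uptoM; first exact: smooth_cst.
by apply: IH; exact: smooth_derive.
Qed.

(* The functions x^(-k) exp(-1/x), extended by 0 to x <= 0. *)
Definition flat k x : R := if 0 < x then x^-1 ^+ k * expR (- x^-1) else 0.

Lemma flat_le0 k x : x <= 0 -> flat k x = 0.
Proof. by rewrite /flat ltNge => ->. Qed.

Lemma exprn_le_expR n y : 0 <= y -> y ^+ n <= n%:R ^+ n * expR y.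
Proof.
move=> y0; case: n => [|n].
  by rewrite !expr0 mul1r -[leLHS]expR0 ler_expR.
have n0 : (0 : R) < n.+1%:R by rewrite ltr0n.
have -> : expR y = expR (y / n.+1%:R) ^+ n.+1.
  by rewrite -expRM_natl -mulr_natl mulrC divfK// lt0r_neq0.
rewrite -exprMn; apply: lerXn2r; rewrite ?nnegrE ?mulr_ge0 ?expR_ge0 ?(ltW n0)//.
rewrite -ler_pdivrMl// mulrC.
by apply: le_trans (expR_ge1Dx _); rewrite lerDr.
Qed.

Lemma flat_bound k : exists2 C, 0 < C & forall x, `|flat k x| <= C * x ^+ 2.
Proof.
exists (k.+2%:R ^+ k.+2); first by rewrite exprn_gt0// ltr0n.
move=> x; rewrite /flat; case: ifPn => [x0|_]; last first.
  by rewrite normr0 mulr_ge0 ?sqr_ge0// exprn_ge0.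
rewrite ger0_norm; last by rewrite mulr_ge0 ?expR_ge0// exprn_ge0 ?invr_ge0 ?ltW.
have xi0 : 0 <= x^-1 by rewrite invr_ge0 ltW.
have h := exprn_le_expR k.+2 xi0.
have -> : x^-1 ^+ k = x^-1 ^+ k.+2 * x ^+ 2.
  rewrite -addn2 exprD -mulrA -exprMn mulVf ?lt0r_neq0// expr1n mulr1//.
rewrite mulrAC; apply: ler_wpM2r; first exact: sqr_ge0.
by rewrite expRN ler_pdivrMr ?expR_gt0.
Qed.

Lemma is_derive_flat k x : is_derive x 1 (flat k) (flat k.+2 x - k%:R * flat k.+1 x).
Proof.
case: (ltgtP x 0) => x0.
- rewrite !flat_le0 ?ltW// mulr0 subr0.
  apply: is_derive_near (is_derive_const 0 x); near=> z.
  by rewrite flat_le0// ltW//; near: z; exact: cvgr_lt cvg_id _ x0.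
- have h : is_derive x 1 (fun x => x^-1 ^+ k * expR (- x^-1)) (flat k.+2 x - k%:R * flat k.+1 x).
    have xn := lt0r_neq0 x0.
    derive => //.
    rewrite /flat x0; case: k => [|k] /=.
      by rewrite expr0 !mul0r add0r mul1r subr0 expr2; field.
    by rewrite -[k.+1 in X in X + _]addn1 natrD !exprS; field.
  apply: is_derive_near h; near=> z.
  by rewrite /flat; have -> : 0 < z by near: z; exact: cvgr_gt cvg_id _ x0.
rewrite x0 !flat_le0// mulr0 subr0.
have [C C0 hC] := flat_bound k.
have : (h^-1 *: (flat k (h *: 1 + 0) - flat k 0)) @[h --> 0^'] --> (0 : R).
  apply/cvgrPdist_le => e e0; near=> h.
  rewrite sub0r normrN (flat_le0 k (lexx 0)) subr0 addr0 /GRing.scale/= mulr1.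
  have hn0 : h != 0 by near: h; exact: nbhs_dnbhs_neq.
  rewrite normrM normfV ler_pdivrMl ?normr_gt0//.
  apply: le_trans (hC h) _; rewrite -real_normK ?num_real// expr2 mulrA mulrC.
  rewrite ler_wpM2l// mulrC -ler_pdivlMr//.
  by near: h; apply: dnbhs0_le; exact: divr_gt0.
move=> h; apply: DeriveDef; first by apply/cvg_ex; exists 0.
by apply: cvg_lim => //.
Unshelve. all: by end_near. Qed.

Lemma smooth_flat k : smooth (flat k).
Proof.
move=> n; elim: n k => [//|n IH] k /=; split; first by move=> x; have [] := is_derive_flat k x.
rewrite (derive1_ext (is_derive_flat k)).
have -> : (fun x => flat k.+2 x - k%:R * flat k.+1 x) = (fun x => flat k.+2 x + - k%:R * flat k.+1 x).
  by apply/funext => x; rewrite mulNr.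
by apply: smooth_uptoD => //; apply: smooth_uptoM => //; exact: smooth_cst.
Qed.

Definition bump x := flat 0 (1 * x + 1) * flat 0 (-1 * x + 1).

Lemma smooth_bump : smooth bump.
Proof. by apply: smoothM; apply: smooth_affine; exact: smooth_flat. Qed.

Lemma bump_ge0 x : 0 <= bump x.
Proof.
have flat0_ge0 y : 0 <= flat 0 y by rewrite /flat; case: ifP => // _; rewrite expr0 mul1r expR_ge0.
exact: mulr_ge0.
Qed.

Lemma bump_gt0 x : -1 < x < 1 -> 0 < bump x.
Proof.
by move=> /andP[x0 x1]; rewrite /bump /flat !ifT ?expr0 ?mul1r ?mulr_gt0 ?expR_gt0//; lra.
Qed.

Lemma bump_eq0 x : 1 <= `|x| -> bump x = 0.
Proof.
rewrite ler_normr => /orP[x1|x1]; rewrite /bump.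
  by rewrite [X in _ * X]flat_le0 ?mulr0//; lra.
by rewrite flat_le0 ?mul0r//; lra.
Qed.

Lemma bump_le1 x : bump x <= 1.
Proof.
have f1 y : 0 <= flat 0 y <= 1.
  rewrite /flat; case: ifP => [y0|_]; last by rewrite lexx ler01.
  by rewrite expr0 mul1r expR_ge0 -[leRHS]expR0 ler_expR oppr_le0 invr_ge0 ltW.
have /andP[a0 a1] := f1 (1 * x + 1); have /andP[b0 b1] := f1 (-1 * x + 1).
by rewrite -[leRHS]mulr1 ler_pM.
Qed.

Lemma bump_half : exists2 c, 0 < c & forall x, `|x| <= 2^-1 -> c <= bump x.
Proof.
have cb : {within `[- 2^-1, 2^-1], continuous bump}.
  exact: continuous_subspaceT (smooth_continuous smooth_bump).
have [b] := @EVT_min R bump (- 2^-1) 2^-1 ltac:(lra) cb.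
rewrite in_itv/= => b1 hb; exists (bump b); first by rewrite bump_gt0//; lra.
by move=> x; rewrite ler_norml => hx; apply: hb; rewrite in_itv.
Qed.

Lemma is_derive_primitive0 (h : R -> R) x : continuous h -> (forall y, y <= -1/2 -> h y = 0) ->
  is_derive x 1 (primitive h) (h x).
Proof.
move=> ch h0; have [x1|x1] := ltP (-1) x; first exact: is_derive_primitive.
have cst y : y < -1 / 2 -> primitive h y = primitive h (-1).
  move=> y1; rewrite /primitive; congr (_ - _).
  rewrite /Rintegral !integral0_eq// => t /=; rewrite in_itv/= => /andP[t1 t2].
    by rewrite h0//; lra.
  by rewrite h0//; lra.
rewrite h0; last by lra.
apply: is_derive_near (is_derive_const (primitive h (-1)) x); near=> z.
by rewrite cst//; near: z; apply: cvgr_lt cvg_id _ _; lra.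
Unshelve. all: by end_near. Qed.

(** [primitive] is reliable on the whole line only for functions vanishing to the left of -1/2. So
    [g - g 0] is split at 0 into its right half and its reflected left half, and [g 0 * t] restores
    the constant. *)
Lemma antiderivative (g : R -> R) : continuous g ->
  exists F : R -> R, forall t : R, is_derive t 1 F (g t).
Proof.
move=> cg; pose g0 s := g s - g 0.
pose h1 s := g0 (Num.max s 0); pose h2 s := g0 (- Num.max s 0).
have cM : continuous (fun r : R => Num.max r 0).
  by move=> z; apply: continuous_max; [exact: cvg_id|exact: cvg_cst].
have cg0 : continuous g0 by move=> y; apply: cvgB; [exact: cg|exact: cvg_cst].
have c1 : continuous h1 by move=> y; exact: (continuous_comp (cM y) (cg0 _)).
have cN : continuous (fun s : R => - Num.max s 0) by move=> z; apply: cvgN; exact: cM.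
have c2 : continuous h2 by move=> y; exact: (continuous_comp (cN y) (cg0 _)).
have z1 y : y <= -1/2 -> h1 y = 0.
  move=> hy; have My : Num.max y 0 = 0 by apply/max_idPr; lra.
  by rewrite /h1 /g0 My subrr.
have z2 y : y <= -1/2 -> h2 y = 0.
  move=> hy; have My : Num.max y 0 = 0 by apply/max_idPr; lra.
  by rewrite /h2 /g0 My oppr0 subrr.
exists (fun t => primitive h1 t - primitive h2 (- t) + g 0 * t) => t.
have d1 := is_derive_primitive0 t c1 z1.
have d2 := is_derive_comp1 (is_derive_opp (is_derive_var t)) (is_derive_primitive0 (- t) c2 z2).
apply: is_derive_val (is_derive_add (is_derive_sub d1 d2)
  (is_derive_mul (is_derive_const (g 0) t) (is_derive_var t))) _.
rewrite /h1 /h2 /g0; have [t0|t0] := leP t 0.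
  have -> : Num.max (- t) 0 = - t by apply/max_idPl; rewrite oppr_ge0.
  by rewrite opprK; ring.
have -> : Num.max (- t) 0 = 0 by apply/max_idPr; rewrite oppr_le0 ltW.
by rewrite oppr0; ring.
Qed.

(** The substitution r = exp t carries the half-line to the whole line, so no behaviour of [g] at 0
    is required. *)
Lemma antiderivative_half (g : R -> R) : (forall r : R, 0 < r -> {for r, continuous g}) ->
  exists2 F : R -> R, F 1 = 0 & forall r : R, 0 < r -> is_derive r 1 F (g r).
Proof.
move=> cg; pose h t := g (expR t) * expR t.
have ch : continuous h.
  move=> t; have c1 : {for expR t, continuous g} := cg _ (expR_gt0 t).
  have c2 : {for t, continuous (g \o expR)}.
    by apply: continuous_comp; [exact: continuous_expR|exact: c1].
  by apply: cvgM; [exact: c2|exact: continuous_expR].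
have [F hF] := antiderivative ch.
exists (fun r => F (ln r) - F 0); first by rewrite ln1 subrr.
move=> r r0.
have h1 := is_derive_comp1 (is_derive_ln r0 (is_derive_var r)) (hF (ln r)).
apply: is_derive_val (is_derive_sub h1 (is_derive_const (F 0) r)) _.
by rewrite subr0 mulr1 /h lnK ?posrE// mulfK// lt0r_neq0.
Qed.

End Smooth.

(** * Compactly supported integrals; classical solutions are weak solutions *)

Section Integration.
Variable R : realType.
Let mu := @lebesgue_measure R.
Implicit Types (f g h phi V : R -> R) (c d r s x : R).

Lemma continuous_near f g x : (\forall z \near x, f z = g z) ->
  {for x, continuous f} -> {for x, continuous g}.
Proof.
move=> fg; have fx := nbhs_singleton fg; rewrite /prop_for /continuous_at fx.
by apply: cvg_trans; exact: near_eq_cvg fg.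
Qed.

Lemma measurable_half_line : measurable (@half_line R).
Proof. exact: measurable_itv. Qed.

Lemma half_lineE x : half_line x = (0 < x) :> Prop.
Proof. by rewrite /half_line /= in_itv/= andbT. Qed.

Lemma Rintegral_support (D : set R) c d f : `[c, d] `<=` D ->
  (forall x, D x -> ~~ (c <= x <= d) -> f x = 0) ->
  \int[mu]_(x in D) f x = \int[mu]_(x in `[c, d]) f x.
Proof.
move=> cdD f0; rewrite Rintegral_mkcond [RHS]Rintegral_mkcond; congr (Rintegral _ _ _).
apply/funext => x; rewrite /patch; have [xcd|xcd] := boolP (x \in `[c, d]%classic).
  by rewrite ifT// inE; apply: cdD; rewrite inE in xcd.
case: ifPn => // xD; apply: f0; first by rewrite inE in xD.
by apply: contra xcd => h; rewrite inE/= in_itv.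
Qed.

Lemma integrable_support (D : set R) c d f : measurable D -> `[c, d] `<=` D ->
  (forall x, D x -> ~~ (c <= x <= d) -> f x = 0) ->
  mu.-integrable `[c, d] (EFin \o f) -> mu.-integrable D (EFin \o f).
Proof.
move=> mD cdD f0 hi; apply/integrable_mkcond => //.
have /integrable_mkcond -/(_ (measurable_itv _)) := hi.
congr (integrable _ _ _); apply/funext => x; rewrite /patch.
have [xcd|xcd] := boolP (x \in `[c, d]%classic).
  by rewrite ifT// inE; apply: cdD; rewrite inE in xcd.
case: ifPn => // xD; rewrite /= f0//; first by rewrite inE in xD.
by apply: contra xcd => h; rewrite inE/= in_itv.
Qed.

Lemma continuous_segment_integrable c d f :
  (forall x, c <= x <= d -> {for x, continuous f}) -> mu.-integrable `[c, d] (EFin \o f).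
Proof.
move=> cf; apply: continuous_compact_integrable; first exact: segment_compact.
exact: continuous_within_segment.
Qed.

Lemma Rintegral_derive c d (F f : R -> R) : c < d ->
  (forall x, c <= x <= d -> is_derive x 1 F (f x)) ->
  (forall x, c <= x <= d -> {for x, continuous f}) ->
  \int[mu]_(x in `[c, d]) f x = F d - F c.
Proof.
move=> cd hF cf; rewrite /Rintegral (@continuous_FTC2 _ f F)//.
- exact: continuous_within_segment.
- split.
  + move=> x; rewrite in_itv/= => /andP[h1 h2]; by have [] := hF x ltac:(by rewrite (ltW h1) (ltW h2)).
  + apply: cvg_at_right_filter; apply: is_derive_cont (hF c _); by rewrite lexx ltW.
  + apply: cvg_at_left_filter; apply: is_derive_cont (hF d _); by rewrite lexx ltW.
- move=> x; rewrite in_itv/= => /andP[h1 h2]; rewrite derive1E.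
  by have [_ ->] := hF x ltac:(by rewrite (ltW h1) (ltW h2)).
Qed.

Lemma test_half_smooth phi : test_half phi -> smooth phi.
Proof.
move=> [h _] n; suff : forall n k, smooth_upto n (derive1n k phi) by move=> /(_ n 0%N).
elim=> [//|{}n IH] k /=; split; first exact: h.
by have := IH k.+1; rewrite derive1nS.
Qed.

Lemma smooth_test_half phi c d : smooth phi -> 0 < c ->
  (forall x, phi x != 0 -> c <= x <= d) -> test_half phi.
Proof.
move=> sf c0 h; split; last by exists c, d.
by move=> n x; apply: smooth_derivable; exact: smooth_derive1n.
Qed.

Lemma derive1_support phi c d : smooth phi -> (forall x, phi x != 0 -> c <= x <= d) ->
  forall x, derive1 phi x != 0 -> c <= x <= d.
Proof.
move=> sf h x; apply: contraNT; rewrite negb_and -!ltNge => xcd.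
have h0 z : ~~ (c <= z <= d) -> phi z = 0.
  by move=> hz; apply/eqP; apply: contraNT hz => /h.
have : is_derive x 1 phi 0.
  apply: is_derive_near (is_derive_const 0 x); case/orP: xcd => xc; near=> z.
    rewrite h0// negb_and -ltNge; apply/orP; left.
    by near: z; exact: cvgr_lt cvg_id _ xc.
  rewrite h0// negb_and -!ltNge; apply/orP; right.
  by near: z; exact: cvgr_gt cvg_id _ xc.
by move=> [_ e]; rewrite derive1E e.
Unshelve. all: by end_near. Qed.

Lemma classical_weak V f f1 f2 h :
  (forall r, 0 < r -> is_derive r 1 f (f1 r) /\ is_derive r 1 f1 (f2 r)) ->
  (forall r, 0 < r -> {for r, continuous f2}) ->
  (forall r, 0 < r -> {for r, continuous V}) ->
  (forall r, 0 < r -> h r = V r * f r - f2 r) -> weak_schrodinger V f h.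
Proof.
move=> hf cf2 cV hh phi tphi; have sphi := test_half_smooth tphi.
have [_ [c [d [c0 cd]]]] := tphi.
have s1 := smooth_derive sphi; have s2 := smooth_derive s1.
have cd1 := derive1_support sphi cd; have cd2 := derive1_support s1 cd1.
have e2 : derive1n 2 phi = derive1 (derive1 phi) by [].
rewrite e2; set p1 := derive1 phi in s1 s2 cd1 cd2 e2 *; set p2 := derive1 p1 in s2 cd2 e2 *.
(* The support is enclosed in a strictly larger segment, so that [phi] and its derivative vanish at
   the ends; the maximum covers the case [d < c], where [phi] is zero. *)
have z0 (g : R -> R) : (forall x, g x != 0 -> c <= x <= d) -> forall x, ~~ (c / 2 <= x <= Num.max c d + 1) -> g x = 0.
  move=> hg x hx; apply/eqP; apply: contraNT hx => /hg /andP[h1 h2].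
  have : d <= Num.max c d by rewrite le_max lexx orbT.
  lra.
pose b := Num.max c d + 1.
have cb : c < b by rewrite /b ltr_pwDr// le_max lexx.
have db : d < b by rewrite /b ltr_pwDr// le_max lexx orbT.
have sub : `[c / 2, b]%classic `<=` @half_line R.
  by move=> x; rewrite half_lineE /= in_itv/= => /andP[+ _]; lra.
have pos x : c / 2 <= x <= b -> 0 < x by lra.
have cf x : 0 < x -> {for x, continuous f} by move=> x0; exact: is_derive_cont (hf x x0).1.
have ch x : 0 < x -> {for x, continuous h}.
  move=> x0; have : {for x, continuous (fun r => V r * f r - f2 r)}.
    by apply: cvgB; [apply: cvgM; [exact: cV|exact: cf]|exact: cf2].
  apply: continuous_near; near=> z.
  by rewrite -hh//; near: z; exact: cvgr_gt cvg_id _ x0.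
have cp x := smooth_continuous sphi (x := x).
have cp2 x := smooth_continuous s2 (x := x).
rewrite (Rintegral_support sub); last first.
  by move=> x _ hx; rewrite (z0 _ cd _ hx) (z0 _ cd2 _ hx) mulr0 oppr0 addr0 mulr0.
rewrite [RHS](Rintegral_support sub); last first.
  by move=> x _ hx; rewrite (z0 _ cd _ hx) mulr0.
apply/eqP; rewrite -subr_eq0 -RintegralB//; first last.
- by apply: continuous_segment_integrable => x /pos x0; apply: cvgM; [exact: ch|exact: cp].
- apply: continuous_segment_integrable => x /pos x0; apply: cvgM; first exact: cf.
  by apply: cvgD; [apply: cvgN; exact: cp2|apply: cvgM; [exact: cV|exact: cp]].
pose Phi x := f1 x * phi x - f x * p1 x.
have dPhi x : c / 2 <= x <= b -> is_derive x 1 Phi (f2 x * phi x - f x * p2 x).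
  move=> /pos x0; have [h1 h2] := hf x x0.
  have h3 := smooth_is_derive x sphi; have h4 := smooth_is_derive x s1.
  by apply: is_derive_val (is_derive_sub (is_derive_mul h2 h3) (is_derive_mul h1 h4)) _; rewrite -/p1 -/p2; ring.
have -> : \int[mu]_(x in `[c / 2, b]) (f x * (- p2 x + V x * phi x) - h x * phi x) =
          \int[mu]_(x in `[c / 2, b]) (f2 x * phi x - f x * p2 x).
  apply: eq_Rintegral => x; rewrite inE/= in_itv/= => /pos x0.
  by rewrite hh//; ring.
rewrite (Rintegral_derive _ dPhi); last 2 first.
- by lra.
- move=> x /pos x0; apply: cvgB; apply: cvgM; [exact: cf2|exact: cp|exact: cf|exact: cp2].
have nz (g : R -> R) x : (forall x, g x != 0 -> c <= x <= d) -> ~~ (c <= x <= d) -> g x = 0.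
  by move=> hg hx; apply/eqP; apply: contraNT hx => /hg.
have nb : ~~ (c <= b <= d) by rewrite negb_and -!ltNge db orbT.
have nc : ~~ (c <= c / 2 <= d) by rewrite negb_and -!ltNge; apply/orP; left; lra.
by rewrite /Phi !(nz phi) ?(nz p1)// !mulr0 !subrr.
Unshelve. all: by end_near. Qed.

End Integration.

(** * Square integrability *)

Section SquareIntegrable.
Context d (T : measurableType d) (R : realType) (mu : {measure set T -> \bar R}).

Lemma Lfun2P (f : T -> R) : f \in Lfun mu 2%:E <->
  measurable_fun setT f /\ mu.-integrable setT (EFin \o (fun x => f x ^+ 2)).
Proof.
split=> [h|[mf /integrableP[_ fi]]].
  split; last exact: Lfun2_integrable_sqr.
  by move: h; rewrite inE => /andP[+ _]; rewrite inE.
rewrite inE; apply/andP; split; rewrite inE//= /finite_norm unlock.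
apply: poweR_lty; apply: le_lt_trans fi.
rewrite le_eqVlt; apply/orP; left; apply/eqP; apply: eq_integral => x _ /=.
by congr (_%:E); rewrite powR_mulrn// -normrX.
Qed.

End SquareIntegrable.

Section HalfLineL2.
Variable R : realType.
Let mu := @lebesgue_measure R.
Implicit Types (f g h phi V : R -> R) (c d r s x p e : R).

Lemma L2_halfP f : L2_half f <-> measurable_fun half_line f /\
  mu.-integrable half_line (EFin \o (fun x => f x ^+ 2)).
Proof.
rewrite /L2_half Lfun2P; have mD := @measurable_half_line R.
have -> : (EFin \o (fun x => (f \_ half_line) x ^+ 2)) =
          (EFin \o (fun x => f x ^+ 2)) \_ half_line.
  apply/funext => x; rewrite /patch /=; case: ifPn => //.
  by rewrite expr0n.
split=> -[h1 h2]; split.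
- by apply/(measurable_restrictT _ mD).
- by apply/integrable_mkcond.
- by apply/(measurable_restrictT _ mD).
- by move/integrable_mkcond : h2; apply.
Qed.

Lemma half_line_segment c d : 0 < c -> `[c, d]%classic `<=` @half_line R.
Proof. by move=> c0 x; rewrite half_lineE/= in_itv/= => /andP[h _]; exact: lt_le_trans h. Qed.

Lemma L2_half_integrable f c d : L2_half f -> 0 < c -> mu.-integrable `[c, d] (EFin \o f).
Proof.
move=> /L2_halfP[mf fi] c0; have sub := @half_line_segment c d c0.
have mcd : measurable `[c, d]%classic by exact: measurable_itv.
apply: (@le_integrable _ _ _ mu _ mcd _ (EFin \o (fun x => 1 + f x ^+ 2))).
- by apply/measurable_EFinP; apply: measurable_funS mf => //; exact: measurable_half_line.
- move=> x _ /=; rewrite lee_fin [leRHS]ger0_norm ?addr_ge0 ?sqr_ge0//.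
  rewrite -real_normK ?num_real//; have := sqr_ge0 (`|f x| - 1).
  by have := normr_ge0 (f x); rewrite !expr2; lra.
rewrite (_ : _ \o _ = (EFin \o cst 1) \+ (EFin \o (fun x => f x ^+ 2)))//.
apply: integrableD => //.
  apply: continuous_segment_integrable => x _; exact: cvg_cst.
by apply: integrableS fi => //; exact: measurable_half_line.
Qed.

Lemma integrable_mul_continuous c d g f : mu.-integrable `[c, d] (EFin \o f) ->
  (forall x, c <= x <= d -> {for x, continuous g}) ->
  mu.-integrable `[c, d] (EFin \o (fun x => f x * g x)).
Proof.
move=> fi cg.
have cg' := continuous_within_segment cg.
rewrite (_ : _ \o _ = ((EFin \o f) \* (EFin \o g))%E)//.
have mcd : measurable `[c, d]%classic by exact: measurable_itv.
apply: integrableMl => //.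
  exact: subspace_continuous_measurable_fun.
have := @compact_bounded _ _ (g @` `[c, d]) (continuous_compact cg' (@segment_compact R c d)).
move=> [M [Mr hM]]; exists M; split => // z Mz x cdx /=.
by apply: (hM z Mz); exists x.
Qed.

End HalfLineL2.

(** * Regularity of weak solutions *)

Section Mollifier.
Variable R : realType.
Let mu := @lebesgue_measure R.
Implicit Types (F f g h : R -> R) (c d r s x p e : R).

Lemma primitive_le0 h x : (forall y, y <= 0 -> h y = 0) -> x <= 0 -> primitive h x = 0.
Proof.
move=> h0 x0; rewrite /primitive /Rintegral !integral0_eq ?subrr// => t /=;
  by rewrite in_itv/= => /andP[t1 t2]; rewrite h0// (le_trans t2).
Qed.

(* A smooth approximation gam of J max(s, 0), twice the primitive of a bump
   supported in [0, 2 e]. *)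
Lemma mollifier : exists2 kappa : R, 0 < kappa & forall e, 0 < e -> e <= 4^-1 ->
  exists (gam gam1 b : R -> R) (J : R), [/\ smooth gam,
   forall s, is_derive s 1 gam (gam1 s) /\ is_derive s 1 gam1 (b s),
   [/\ continuous b, forall s, 0 <= b s <= 1, forall s, b s != 0 -> 0 <= s <= 2 * e,
       gam1 0 = 0 & gam1 (2 * e) = J],
   [/\ forall s, s <= 0 -> gam s = 0,
       exists K, forall s, 2 * e <= s -> gam s = J * s - K &
       forall s, `|gam s - J * Num.max s 0| <= 2 * e * J] &
   kappa * e <= J].
Proof.
have [k k0 hk] := bump_half R; exists k => // e e0 e4.
have en := lt0r_neq0 e0.
pose b s : R := bump (e^-1 * s + - 1).
have sb : smooth b by apply: smooth_affine; exact: smooth_bump.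
have b01 s : 0 <= b s <= 1 by rewrite bump_ge0 bump_le1.
have bsupp s : b s != 0 -> 0 <= s <= 2 * e.
  apply: contraNT; rewrite negb_and -!ltNge => hs; apply/eqP/bump_eq0.
  rewrite ler_normr; case/orP: hs => hs.
    have : e^-1 * s < 0 by rewrite pmulr_rlt0 ?invr_gt0.
    by move=> h; apply/orP; right; lra.
  have : 2 < e^-1 * s by rewrite mulrC ltr_pdivlMr.
  by move=> h; apply/orP; left; lra.
have b0 s : s <= 0 -> b s = 0.
  move=> s0; apply/bump_eq0; rewrite ler_normr; apply/orP; right.
  have : e^-1 * s <= 0 by rewrite pmulr_rle0 ?invr_gt0.
  lra.
have b2 s : 2 * e <= s -> b s = 0.
  move=> s2; apply/bump_eq0; rewrite ler_normr; apply/orP; left.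
  have : 2 <= e^-1 * s by rewrite mulrC ler_pdivlMr.
  lra.
have cb := smooth_continuous sb.
pose g1 := primitive b.
have dg1 s : is_derive s 1 g1 (b s).
  by apply: is_derive_primitive0 => // y hy; apply: b0; lra.
have sg1 : smooth g1 by apply: smooth_of_derive dg1 sb.
have g10 s : s <= 0 -> g1 s = 0 by exact: primitive_le0.
have cg1 := smooth_continuous sg1.
pose g := primitive g1.
have dg s : is_derive s 1 g (g1 s).
  by apply: is_derive_primitive0 => // y hy; apply: g10; lra.
have g0 s : s <= 0 -> g s = 0 by exact: primitive_le0.
pose J := g1 (2 * e).
have g1mono r s : r <= s -> g1 r <= g1 s.
  move=> rs; apply: (@derive_ge0_le _ g1 b) => //.
  by move=> t _; case/andP: (b01 t).
have g1J s : 2 * e <= s -> g1 s = J.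
  move=> hs; apply/eqP; rewrite eq_le; apply/andP; split; last exact: g1mono.
  have : g1 s - g1 (2 * e) <= 0.
    have : - g1 (2 * e) <= - g1 s; last by lra.
    apply: (@derive_ge0_le _ (fun t => - g1 t) (fun t => - b t)); last exact: hs.
    by move=> t /andP[ht _]; rewrite b2 ?oppr0// ltW.
  by rewrite subr_le0.
have g1_ge0 s : 0 <= g1 s.
  by have [/g10->//|s0] := leP s 0; rewrite -(g10 0 (lexx 0)) g1mono// ltW.
have g1_le s : g1 s <= J.
  by have [h|h] := leP s (2 * e); [exact: g1mono|rewrite g1J// ltW].
have g2 s : 2 * e <= s -> g s = J * s - (J * (2 * e) - g (2 * e)).
  move=> hs; pose F (t : R) : R := g t - J * t.
  have dF (t : R) : is_derive t 1 F (g1 t - J).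
    by have h := dg t; rewrite /F; derive; ring.
  have h1 : F (2 * e) <= F s.
    apply: (@derive_ge0_le _ F (fun t => g1 t - J)) => // t /andP[ht _].
    by rewrite g1J ?subrr// ltW.
  have h2 : - F (2 * e) <= - F s.
    apply: (@derive_ge0_le _ (fun t => - F t) (fun t => - (g1 t - J))) => //.
    by move=> t /andP[ht _]; rewrite g1J ?subrr ?oppr0// ltW.
  by move: h1 h2; rewrite /F; lra.
have J0 : 0 <= J := g1_ge0 _.
have gJ s : 0 <= s -> J * s - 2 * e * J <= g s <= J * s.
  move=> s0; apply/andP; split; last first.
    have := @derive_le_comparison _ g g1 (fun t => J * t) (fun=> J) s.
    apply => //; last by rewrite g0// mulr0.
    by move=> t _; derive; ring.
  have [hs|hs] := leP s (2 * e).
    have : g 0 <= g s by apply: (@derive_ge0_le _ g g1).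
    rewrite g0// => h; apply: le_trans h; have : J * s <= J * (2 * e) by rewrite ler_wpM2l.
    lra.
  rewrite g2 ?(ltW hs)//.
  have : g 0 <= g (2 * e) by apply: (@derive_ge0_le _ g g1) => //; lra.
  by rewrite g0//; lra.
exists g, g1, b, J; split => //.
- exact: smooth_of_derive dg sg1.
- by split => //; exact: g10.
- split => //; first by exists (J * (2 * e) - g (2 * e)).
  move=> s; have [s0|s0] := leP s 0.
    by rewrite g0// mulr0 subr0 normr0 mulr_ge0// mulr_ge0// ltW.
  have /andP[h1 h2] := gJ s (ltW s0); rewrite ler_norml; apply/andP; split; first by lra.
  by apply: (@le_trans _ _ 0); [lra|rewrite mulr_ge0// mulr_ge0// ltW].
(* The bump is at least [k] on [e/2, 3e/2], an interval of length [e]. *)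
have : g1 (e / 2) + k * (3 / 2 * e - e / 2) <= g1 (3 / 2 * e).
  apply: (@derive_ge_growth _ g1 b) => //; last by lra.
  move=> t /andP[t1 t2]; apply: hk; rewrite ler_norml.
  have h1 : 2^-1 <= e^-1 * t by rewrite mulrC ler_pdivlMr//; lra.
  have h2 : e^-1 * t <= 3 / 2 by rewrite mulrC ler_pdivrMr//; lra.
  lra.
have := g1_ge0 (e / 2); have := g1_le (3 / 2 * e); lra.
Qed.

(** The weight lies between 0 and 1 and is used on [p, p + 2 e], inside the ball of radius 3 e. The
    error is thus at most the integral of |F - F(p)| over this ball, whose measure is 6 e; hence the
    tolerance eta / 6. *)
Lemma lebesgue_pt_mollify F p eta : locally_integrable setT F -> lebesgue_pt F p -> 0 < eta ->
  exists2 e0, 0 < e0 & forall e (b gam1 : R -> R) J, 0 < e -> e < e0 ->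
    (forall s, is_derive s 1 gam1 (b s)) -> continuous b -> (forall s, 0 <= b s <= 1) ->
    gam1 0 = 0 -> gam1 (2 * e) = J ->
    `|\int[mu]_(s in `[p, p + 2 * e]) (F s * b (s - p)) - F p * J| <= eta * e.
Proof.
move=> [mF _ lF] hp eta0.
have eta6 : 0 < eta / 6 by rewrite divr_gt0.
have lt0 : (0 < (eta / 6)%:E :> \bar R)%E by rewrite lte_fin.
have [r0 /= r00 hr] := hp _ (open_ereal_lt' lt0).
exists (r0 / 3); first by rewrite divr_gt0.
move=> e b g1 J e0 er db cb b01 g10 g1J.
have e3 : 0 < 3 * e by rewrite mulr_gt0.
have := hr (3 * e); rewrite /ball/= sub0r normrN gtr0_norm//.
move=> /(_ ltac:(lra) e3); rewrite /davg /iavg lebesgue_measure_ball ?(ltW e3)//.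
set I := (\int[_]_(_ in _) _)%E => hI.
pose D : set (measurableTypeR R) := `[p, p + 2 * e]%classic.
have mD : measurable D by exact: measurable_itv.
have Dball : D `<=` ball p (3 * e).
  move=> x; rewrite /D /ball/= in_itv/= distrC => /andP[h1 h2].
  by rewrite ger0_norm ?subr_ge0//; lra.
have iF : mu.-integrable D (EFin \o F).
  apply/integrableP; split; first by apply/measurable_EFinP; exact: measurable_funTS.
  by apply: (lF D) => //; exact: segment_compact.
have cbp x : {for x, continuous (fun s => b (s - p))}.
  apply: (@continuous_comp _ _ _ (fun s => s - p) b); last exact: cb.
  by apply: cvgB; [exact: cvg_id|exact: cvg_cst].
have iFb : mu.-integrable D (EFin \o (fun s => F s * b (s - p))).
  exact: integrable_mul_continuous.
have icst : mu.-integrable D (EFin \o (fun s => F p)).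
  by apply: continuous_segment_integrable => x _; exact: cvg_cst.
have iFpb : mu.-integrable D (EFin \o (fun s => F p * b (s - p))).
  exact: (integrable_mul_continuous icst).
have pe : p < p + 2 * e by lra.
have intb : \int[mu]_(s in D) (F p * b (s - p)) = F p * J.
  have -> : F p * J = F p * g1 (p + 2 * e - p) - F p * g1 (p - p).
    by rewrite subrr g10 mulr0 subr0; congr (_ * _); rewrite -g1J; congr g1; ring.
  apply: (@Rintegral_derive _ p (p + 2 * e) (fun s => F p * g1 (s - p))) => // x _.
    have h1 : is_derive x 1 (fun s => s - p) 1 by derive; ring.
    have h2 := is_derive_comp1 h1 (db (x - p)).
    by apply: is_derive_val (is_derive_mul (is_derive_const (F p) x) h2) _; ring.
  by apply: cvgM; [exact: cvg_cst|exact: cbp].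
rewrite -intb -RintegralB//.
have iB : mu.-integrable D (EFin \o (fun s => F s * b (s - p) - F p * b (s - p))).
  by apply: eq_integrable (integrableB mD iFb iFpb) => // t _ /=; rewrite EFinB.
rewrite -lee_fin EFin_normr_Rintegral//.
have mF0 : measurable_fun setT (EFin \o center (F p) \o F).
  by apply/measurable_EFinP; apply: measurable_funB.
apply: (@le_trans _ _ (\int[mu]_(s in D) `| (EFin \o center (F p) \o F) s |)%E).
  apply: le_trans (le_abse_integral mu mD _) _; first by case/integrableP : iB.
  apply: ge0_le_integral => //.
  - by apply: measurableT_comp => //; case/integrableP : iB.
  - by apply: measurableT_comp => //; exact: measurable_funTS.
  move=> x _ /=; rewrite lee_fin -mulrBl normrM.
  have /andP[b0 b1] := b01 (x - p).
  by rewrite (ger0_norm b0) ler_piMr.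
apply: (@le_trans _ _ I).
  apply: ge0_subset_integral => //; first exact: measurable_ball.
  by apply: measurableT_comp => //; exact: measurable_funTS.
have c0 : (0 < (3 * e) *+ 2) by rewrite pmulrn_lgt0.
have -> : I = (((3 * e) *+ 2)%:E * (((3 * e) *+ 2)%:E^-1 * I))%E.
  by rewrite muleA divee ?mul1e// gt_eqF.
apply: (@le_trans _ _ (((3 * e) *+ 2)%:E * (eta / 6)%:E)%E).
  by rewrite lee_pmul2l//; exact: ltW.
by rewrite -EFinM lee_fin -mulr_natl; lra.
Qed.

End Mollifier.

(** * The three-point identity for weak second derivatives *)

Section WeakRegularity.
Variable R : realType.
Let mu := @lebesgue_measure R.
Implicit Types (F G f g h V : R -> R) (c d r s x p q e : R).

Lemma integrable_patch_locally c d f : mu.-integrable `[c, d] (EFin \o f) ->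
  locally_integrable setT (f \_ `[c, d]).
Proof.
move=> fi; apply: open_integrable_locally; first exact: openT.
have mD : measurable (`[c, d]%classic : set (measurableTypeR R)) by exact: measurable_itv.
move/(@integrable_mkcond _ _ _ mu) : fi => /(_ mD); congr (integrable _ _ _).
by apply/funext => x; rewrite /patch /=; case: ifP.
Qed.

Lemma mollify_segment c d f p eta : mu.-integrable `[c, d] (EFin \o f) ->
  lebesgue_pt (f \_ `[c, d]) p -> c <= p < d -> 0 < eta ->
  exists2 e0, 0 < e0 & forall e (b gam1 : R -> R) J, 0 < e -> e < e0 ->
    (forall s, is_derive s 1 gam1 (b s)) -> continuous b -> (forall s, 0 <= b s <= 1) ->
    (forall s, b s != 0 -> 0 <= s <= 2 * e) ->
    gam1 0 = 0 -> gam1 (2 * e) = J ->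
    `|\int[mu]_(s in `[c, d]) (f s * b (s - p)) - f p * J| <= eta * e.
Proof.
move=> fi lp /andP[cp pd] eta0.
have [e1 e10 he1] := lebesgue_pt_mollify (integrable_patch_locally fi) lp eta0.
exists (Num.min e1 ((d - p) / 2)); first by rewrite lt_min e10 divr_gt0 ?subr_gt0.
move=> e b g1 J e0; rewrite lt_min => /andP[ee1 ed] db cb b01 bs g10 g1J.
have := he1 e b g1 J e0 ee1 db cb b01 g10 g1J.
have -> : (f \_ `[c, d]) p = f p.
  by rewrite /patch mem_set//= in_itv/= cp ltW.
congr (`|_ - _| <= _).
rewrite [RHS](@Rintegral_support _ `[c, d] p (p + 2 * e)); last 2 first.
- by move=> x /=; rewrite !in_itv/= => /andP[x1 x2]; apply/andP; split; lra.
- move=> x _ hx; have -> : b (x - p) = 0; last by rewrite mulr0.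
  by apply/eqP; apply: contraNT hx => /bs; lra.
apply: eq_Rintegral => x; rewrite inE/= in_itv/= => /andP[x1 x2].
by rewrite /patch mem_set//= in_itv/=; apply/andP; split; lra.
Qed.

(** Its second derivative is the combination of point masses at p, q, r that defines a second
    difference. The coefficients annihilate affine functions, so it vanishes beyond the three
    points, whatever their order. *)
Definition hat p q r s : R :=
  (r - q) * Num.max (s - p) 0 - (r - p) * Num.max (s - q) 0 + (q - p) * Num.max (s - r) 0.

Lemma continuous_max0 p s : {for s, continuous (fun x : R => Num.max (x - p) 0)}.
Proof.
apply: (@continuous_max _ _ (fun x : R => x - p) (fun=> 0)); last exact: cvg_cst.
by apply: cvgB; [exact: cvg_id|exact: cvg_cst].
Qed.

Lemma continuous_hat p q r : continuous (hat p q r).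
Proof.
move=> s; apply: cvgD; first apply: cvgB.
all: by apply: cvgM; [exact: cvg_cst|exact: continuous_max0].
Qed.

Lemma ler_norm_comb3 (a b c x y z t : R) : `|x| <= t -> `|y| <= t -> `|z| <= t ->
  `|a * x - b * y + c * z| <= (`|a| + `|b| + `|c|) * t.
Proof.
move=> hx hy hz; apply: le_trans (ler_normD _ _) _.
apply: le_trans (lerD (ler_normB _ _) (lexx _)) _.
by rewrite !normrM !mulrDl !lerD// ler_wpM2l.
Qed.

(* Testing against three mollified hat functions whose combination is constant 0 at infinity. *)
Lemma weak_three_points c d f G p q r :
  mu.-integrable `[c, d] (EFin \o f) -> mu.-integrable `[c, d] (EFin \o G) -> 0 < c ->
  (forall phi, test_half phi ->
    \int[mu]_(x in half_line) (f x * derive1n 2 phi x) = \int[mu]_(x in half_line) (G x * phi x)) ->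
  lebesgue_pt (f \_ `[c, d]) p -> lebesgue_pt (f \_ `[c, d]) q -> lebesgue_pt (f \_ `[c, d]) r ->
  c <= p < d -> c <= q < d -> c <= r < d ->
  (r - q) * f p - (r - p) * f q + (q - p) * f r = \int[mu]_(s in `[c, d]) (G s * hat p q r s).
Proof.
move=> fi Gi c0 weak lp lq lr pcd qcd rcd.
set lhs := LHS; set rhs := RHS.
have [k k0 hmol] := mollifier R.
pose S := `|r - q| + `|r - p| + `|q - p|.
have S0 : 0 <= S by rewrite !addr_ge0.
have aGi : mu.-integrable `[c, d] (EFin \o (fun s => `|G s|)).
  by have := integrable_abse Gi.
pose IG := \int[mu]_(s in `[c, d]) `|G s|.
have IG0 : 0 <= IG by apply: Rintegral_ge0.
suff key eta : 0 < eta -> `|lhs - rhs| <= (S / k + 2 * S * IG) * eta.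
  apply/eqP; rewrite -subr_eq0 -normr_le0; apply/ler_addgt0Pr => /= t t0; rewrite add0r.
  have T0 : 0 <= S / k + 2 * S * IG by rewrite addr_ge0// ?mulr_ge0// ?invr_ge0 ltW.
  apply: le_trans (key (t / (S / k + 2 * S * IG + 1)) _) _.
    by rewrite divr_gt0// ltr_wpDl.
  by rewrite mulrCA ler_piMr ?(ltW t0)// ler_pdivrMr ?mul1r ?lerDl// ltr_wpDl.
move=> eta0.
have [ep ep0 hp] := mollify_segment fi lp pcd eta0.
have [eq eq0 hq] := mollify_segment fi lq qcd eta0.
have [er er0 hr] := mollify_segment fi lr rcd eta0.
have [e [[e0 e4] [[eep eeq eer] [epd eqd erd eeta]]]] :
    exists e, [/\ 0 < e & e <= 4^-1] /\ [/\ e < ep, e < eq & e < er] /\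
      [/\ p + 2 * e <= d, q + 2 * e <= d, r + 2 * e <= d & e <= eta].
  case/andP: pcd => cp pd; case/andP: qcd => cq qd; case/andP: rcd => cr rd.
  pose m := Num.min (Num.min (Num.min ep eq) (Num.min er eta))
     (Num.min (Num.min (d - p) (d - q)) (Num.min (d - r) 1)).
  have m0 : 0 < m by rewrite !lt_min ep0 eq0 er0 eta0 !subr_gt0 pd qd rd ltr01.
  have : m <= m by []; rewrite {2}/m !le_min.
  case/andP => /andP[/andP[h1 h2] /andP[h3 h4]] /andP[/andP[h5 h6] /andP[h7 h8]].
  by exists (m / 4); clear -m0 h1 h2 h3 h4 h5 h6 h7 h8; clearbody m; do ?split; lra.
have [g [g1 [b [J [sg dg [cb b01 bs g10 g1J] [g0 [K gK] gJ] kJ]]]]] := hmol e e0 e4.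
have Hp := hp e b g1 J e0 eep (fun s => (dg s).2) cb b01 bs g10 g1J.
have Hq := hq e b g1 J e0 eeq (fun s => (dg s).2) cb b01 bs g10 g1J.
have Hr := hr e b g1 J e0 eer (fun s => (dg s).2) cb b01 bs g10 g1J.
pose phi s : R := (r - q) * g (s - p) - (r - p) * g (s - q) + (q - p) * g (s - r).
pose phi1 s : R := (r - q) * g1 (s - p) - (r - p) * g1 (s - q) + (q - p) * g1 (s - r).
pose phi2 s : R := (r - q) * b (s - p) - (r - p) * b (s - q) + (q - p) * b (s - r).
have dsh (u u1 : R -> R) (t s : R) : (forall s, is_derive s 1 u (u1 s)) ->
    is_derive s 1 (fun s => u (s - t)) (u1 (s - t)).
  move=> du; have h1 : is_derive s 1 (fun s => s - t) 1 by derive; ring.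
  by apply: is_derive_val (is_derive_comp1 h1 (du (s - t))) _; ring.
have dphi (s : R) : is_derive s 1 phi (phi1 s).
  have Dp := dsh g g1 p s (fun s => (dg s).1); have Dq := dsh g g1 q s (fun s => (dg s).1).
  have Dr := dsh g g1 r s (fun s => (dg s).1).
  by rewrite /phi /phi1; derive; ring.
have dphi1 (s : R) : is_derive s 1 phi1 (phi2 s).
  have Dp := dsh g1 b p s (fun s => (dg s).2); have Dq := dsh g1 b q s (fun s => (dg s).2).
  have Dr := dsh g1 b r s (fun s => (dg s).2).
  by rewrite /phi1 /phi2; derive; ring.
have sphi : smooth phi.
  have sh t : smooth (fun s => g (s - t)).
    by have := smooth_affine 1 (- t) sg; under eq_fun do rewrite mul1r.
  have cm u t : smooth (fun s => u * g (s - t)) by apply: smoothM; [exact: smooth_cst|exact: sh].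
  rewrite /phi (_ : (fun s => _) = (fun s => (r - q) * g (s - p) + (- (r - p)) * g (s - q) +
      (q - p) * g (s - r))); last by apply/funext => s; rewrite mulNr.
  by apply: smoothD; first apply: smoothD.
have supp s : phi s != 0 -> c <= s <= d.
  apply: contraNT; rewrite negb_and -!ltNge => /orP[h|h]; rewrite /phi.
    by rewrite !g0; try (clear -h pcd qcd rcd; lra); rewrite !mulr0 subr0 addr0.
  by rewrite !gK; try (clear -h epd eqd erd; lra); apply/eqP; ring.
have phi2E : derive1n 2 phi = phi2.
  by rewrite /= (derive1_ext dphi) (derive1_ext dphi1).
have sub := @half_line_segment R c d c0.
have bsh t s : {for s, continuous (fun s => b (s - t))}.
  apply: (@continuous_comp _ _ _ (fun s => s - t) b); last exact: cb.
  by apply: cvgB; [exact: cvg_id|exact: cvg_cst].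
have fb t : mu.-integrable `[c, d] (EFin \o (fun s => f s * b (s - t))).
  exact: integrable_mul_continuous.
have := weak phi (smooth_test_half sphi c0 supp); rewrite phi2E.
rewrite (@Rintegral_support _ _ c d) => //; last first.
  move=> s _; rewrite negb_and -!ltNge => hs.
  suff -> : phi2 s = 0 by rewrite mulr0.
  have b0 t : c <= t -> t + 2 * e <= d -> b (s - t) = 0.
    move=> t1 t2; apply/eqP; apply: contraTT hs => /bs /andP[h1 h2].
    by rewrite negb_or -!leNgt; apply/andP; split; [clear -h1 t1|clear -h2 t2]; lra.
  case/andP: pcd => cp _; case/andP: qcd => cq _; case/andP: rcd => cr _.
  by rewrite /phi2 (b0 p)// (b0 q)// (b0 r)// !mulr0 subr0 addr0.
rewrite [X in _ = X](@Rintegral_support _ _ c d) => //; last first.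
  by move=> s _ hs; rewrite (_ : phi s = 0) ?mulr0//; apply/eqP; apply: contraNT hs => /supp.
have mcd : measurable (`[c, d]%classic : set (measurableTypeR R)) by exact: measurable_itv.
have fbc (u t : R) : mu.-integrable `[c, d] (EFin \o (fun s => u * (f s * b (s - t)))).
  by apply: eq_integrable (integrableZl mcd u (fb t)).
have -> : \int[mu]_(x in `[c, d]) (f x * phi2 x) =
    (r - q) * \int[mu]_(s in `[c, d]) (f s * b (s - p)) -
    (r - p) * \int[mu]_(s in `[c, d]) (f s * b (s - q)) +
    (q - p) * \int[mu]_(s in `[c, d]) (f s * b (s - r)).
  rewrite -!RintegralZl// -RintegralB// -RintegralD//; last first.
    by apply: eq_integrable (integrableB mcd (fbc _ _) (fbc _ _)).
  by apply: eq_Rintegral => s _; rewrite /phi2; ring.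
set X := \int[mu]_(s in _) (_ * b (s - p)) in Hp *.
set Y := \int[mu]_(s in _) (_ * b (s - q)) in Hq *.
set Z := \int[mu]_(s in _) (_ * b (s - r)) in Hr *.
move=> E.
have H1 := ler_norm_comb3 (r - q) (r - p) (q - p) Hp Hq Hr.
have GL : mu.-integrable `[c, d] (EFin \o (fun s => G s * hat p q r s)).
  by apply: integrable_mul_continuous => // x _; exact: continuous_hat.
have Gphi : mu.-integrable `[c, d] (EFin \o (fun s => G s * phi s)).
  by apply: integrable_mul_continuous => // x _; exact: smooth_continuous.
have H2 : `|\int[mu]_(s in `[c, d]) (G s * phi s) - J * rhs| <= S * (2 * e * J) * IG.
  rewrite -RintegralZl// -RintegralB//; last by apply: eq_integrable (integrableZl mcd J GL).
  have i1 : mu.-integrable `[c, d] (EFin \o (fun s => G s * phi s - J * (G s * hat p q r s))).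
    by apply: eq_integrable (integrableB mcd Gphi (integrableZl mcd J GL)).
  apply: le_trans (le_normr_Rintegral mcd i1) _.
  rewrite -RintegralZl//; apply: le_Rintegral => //.
  - by have := integrable_abse i1.
  - by apply: eq_integrable (integrableZl mcd (S * (2 * e * J)) aGi).
  move=> s _ /=; rewrite (_ : _ - _ = (phi s - J * hat p q r s) * G s); last by ring.
  rewrite normrM ler_wpM2r//.
  have -> : phi s - J * hat p q r s = (r - q) * (g (s - p) - J * Num.max (s - p) 0) -
     (r - p) * (g (s - q) - J * Num.max (s - q) 0) + (q - p) * (g (s - r) - J * Num.max (s - r) 0).
    by rewrite /phi /hat; ring.
  exact: ler_norm_comb3.
have J0 : 0 < J by apply: lt_le_trans kJ; rewrite mulr_gt0.
have : `|J * (lhs - rhs)| <= S * (eta * e) + S * (2 * e * J) * IG.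
  have -> : J * (lhs - rhs) = (\int[mu]_(s in `[c, d]) (G s * phi s) - J * rhs) -
      ((r - q) * (X - f p * J) - (r - p) * (Y - f q * J) + (q - p) * (Z - f r * J)).
    by rewrite -E /lhs; ring.
  by apply: le_trans (ler_normB _ _) _; rewrite addrC lerD.
rewrite normrM (gtr0_norm J0) -ler_pdivlMl// => /le_trans; apply.
rewrite ler_pdivrMl//.
(* Here the lower bound [k * e <= J] enters: dividing the mollification error by [J] leaves a
   multiple of [eta / k]. *)
have h1 : S * (eta * e) <= S / k * eta * J.
  have -> : S * (eta * e) = S / k * eta * (k * e) by field; rewrite gt_eqF.
  by rewrite ler_wpM2l// !mulr_ge0// ?invr_ge0 ltW.
have h2 : S * (2 * e * J) * IG <= 2 * S * IG * J * eta.
  have -> : S * (2 * e * J) * IG = 2 * S * IG * J * e by ring.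
  by rewrite ler_wpM2l// !mulr_ge0// ltW.
by clear -h1 h2; lra.
Qed.

End WeakRegularity.

Section WeakSolutions.
Variable R : realType.
Let mu := @lebesgue_measure R.
Implicit Types (F G f g h V : R -> R) (c d r s x p q e : R).

Definition locally_integrable_half f :=
  forall c d, 0 < c -> mu.-integrable `[c, d] (EFin \o f).

Definition weak_second_derivative f G := forall phi, test_half phi ->
  \int[mu]_(x in half_line) (f x * derive1n 2 phi x) = \int[mu]_(x in half_line) (G x * phi x).

Lemma test_half_support (phi : R -> R) : test_half phi ->
  exists c d, [/\ 0 < c, forall x, phi x != 0 -> c <= x <= d &
    forall x, derive1n 2 phi x != 0 -> c <= x <= d].
Proof.
move=> tphi; have sphi := test_half_smooth tphi.
have [_ [c [d [c0 cd]]]] := tphi; exists c, d; split => //.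
exact: (derive1_support (smooth_derive sphi) (derive1_support sphi cd)).
Qed.

Lemma weak_schrodinger_second V f h : (forall r, 0 < r -> {for r, continuous V}) ->
  locally_integrable_half f -> locally_integrable_half h ->
  weak_schrodinger V f h -> weak_second_derivative f (fun x => V x * f x - h x).
Proof.
move=> cV fi hi weak phi tphi.
have [c [d [c0 cd cd2]]] := test_half_support tphi.
have sphi := test_half_smooth tphi.
have s2 := smooth_derive1n 2 sphi; set p2 := derive1n 2 phi in s2 cd2 *.
have sub := @half_line_segment R c d c0.
have mcd : measurable (`[c, d]%classic : set (measurableTypeR R)) by exact: measurable_itv.
have pz (u : R -> R) x : (forall x, u x != 0 -> c <= x <= d) -> ~~ (c <= x <= d) -> u x = 0.
  by move=> hu; apply: contraNeq => /hu.
have red (u : R -> R) : (forall x, ~~ (c <= x <= d) -> u x = 0) ->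
    \int[mu]_(x in half_line) u x = \int[mu]_(x in `[c, d]) u x.
  by move=> hu; apply: Rintegral_support => // x _; exact: hu.
have := weak phi tphi; rewrite -/p2.
rewrite (red (fun x => f x * (- p2 x + V x * phi x))); last first.
  by move=> x hx; rewrite (pz _ _ cd hx) (pz _ _ cd2 hx) mulr0 oppr0 addr0 mulr0.
rewrite (red (fun x => h x * phi x)); last by move=> x /(pz _ _ cd) ->; rewrite mulr0.
rewrite (red (fun x => f x * p2 x)); last by move=> x /(pz _ _ cd2) ->; rewrite mulr0.
rewrite (red (fun x => (V x * f x - h x) * phi x)); last first.
  by move=> x /(pz _ _ cd) ->; rewrite mulr0.
have c2 x : c <= x <= d -> {for x, continuous p2} by move=> _; exact: smooth_continuous.
have c1 x : c <= x <= d -> {for x, continuous phi} by move=> _; exact: smooth_continuous.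
have cVp x : c <= x <= d -> {for x, continuous (fun x => V x * phi x)}.
  by move=> /andP[hx _]; apply: cvgM; [apply: cV; exact: lt_le_trans hx|exact: smooth_continuous].
have i1 := integrable_mul_continuous (fi c d c0) c2.
have i2 := integrable_mul_continuous (fi c d c0) cVp.
have i3 := integrable_mul_continuous (hi c d c0) c1.
have -> : \int[mu]_(x in `[c, d]) (f x * (- p2 x + V x * phi x)) =
   \int[mu]_(x in `[c, d]) (f x * (V x * phi x)) - \int[mu]_(x in `[c, d]) (f x * p2 x).
  by rewrite -RintegralB//; apply: eq_Rintegral => x _; ring.
have -> : \int[mu]_(x in `[c, d]) ((V x * f x - h x) * phi x) =
   \int[mu]_(x in `[c, d]) (f x * (V x * phi x)) - \int[mu]_(x in `[c, d]) (h x * phi x).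
  by rewrite -RintegralB//; apply: eq_Rintegral => x _; ring.
lra.
Qed.

Lemma hat_eq0 c d p q r s : c <= p <= d -> c <= q <= d -> c <= r <= d ->
  ~~ (c <= s <= d) -> hat p q r s = 0.
Proof.
move=> /andP[cp pd] /andP[cq qd] /andP[cr rd]; rewrite negb_and -!ltNge /hat => /orP[h|h].
  by rewrite !max_r ?mulr0 ?subr0 ?addr0//; [clear -cr h|clear -cq h|clear -cp h]; lra.
rewrite !max_l; first by ring.
all: by [clear -pd h; lra|clear -qd h; lra|clear -rd h; lra].
Qed.

Lemma continuous_half_lebesgue_pt c d f p : 0 < c -> c < p < d ->
  (forall r, 0 < r -> {for r, continuous f}) -> lebesgue_pt (f \_ `[c, d]) p.
Proof.
move=> c0 /andP[cp pd] cf.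
apply: (@continuous_lebesgue_pt R _ p `]c, d[%classic).
- by split; [exact: interval_open|rewrite /= in_itv/= cp].
- exact: measurable_itv.
- apply: measurable_funTS.
  have fi : mu.-integrable `[c, d] (EFin \o f).
    by apply: continuous_segment_integrable => x /andP[cx _]; apply: cf; exact: lt_le_trans cx.
  by have [] := integrable_patch_locally fi.
apply: (@continuous_near _ f); last by apply: cf; exact: lt_trans cp.
near=> z; rewrite /patch mem_set//= in_itv/=; apply/andP; split; apply: ltW.
  by near: z; exact: cvgr_gt cvg_id _ cp.
by near: z; exact: cvgr_lt cvg_id _ pd.
Unshelve. all: by end_near. Qed.

(** With a zero right-hand side the three-point identity at p, 1 and 2 is the interpolation formula
    of an affine function. *)
Lemma weak_affine f : (forall r, 0 < r -> {for r, continuous f}) ->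
  weak_second_derivative f (fun=> 0) ->
  exists al be : R, forall r, 0 < r -> f r = al + be * r.
Proof.
move=> cf weak; exists (2 * f 1 - f 2), (f 2 - f 1) => p p0.
pose c := Num.min p 1 / 2; pose d := Num.max p 2 + 1.
have c0 : 0 < c by rewrite divr_gt0// lt_min p0 ltr01.
have m1 : Num.min p 1 <= p by rewrite ge_min lexx.
have m2 : Num.min p 1 <= 1 by rewrite ge_min lexx orbT.
have m3 : p <= Num.max p 2 by rewrite le_max lexx.
have m4 : 2 <= Num.max p 2 by rewrite le_max lexx orbT.
have fi : mu.-integrable `[c, d] (EFin \o f).
  by apply: continuous_segment_integrable => x /andP[cx _]; apply: cf; exact: lt_le_trans cx.
have zi : mu.-integrable `[c, d] (EFin \o (fun=> 0 : R)).
  by apply: continuous_segment_integrable => x _; exact: cvg_cst.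
have hp : c < p < d by rewrite /c /d; apply/andP; split; lra.
have h1 : c < 1 < d by rewrite /c /d; apply/andP; split; lra.
have h2 : c < 2 < d by rewrite /c /d; apply/andP; split; lra.
have W x : c < x < d -> c <= x < d by move=> /andP[/ltW -> ->].
have := weak_three_points fi zi c0 weak (continuous_half_lebesgue_pt c0 hp cf)
  (continuous_half_lebesgue_pt c0 h1 cf) (continuous_half_lebesgue_pt c0 h2 cf)
  (W _ hp) (W _ h1) (W _ h2).
have -> : \int[mu]_(s in `[c, d]) (0 * hat p 1 2 s) = 0.
  under eq_Rintegral do rewrite mul0r.
  have mcd : measurable (`[c, d]%classic : set (measurableTypeR R)) by exact: measurable_itv.
  by rewrite (Rintegral_cst mu mcd) mul0r.
lra.
Qed.

Lemma ae_imply (P Q : R -> Prop) : {ae mu, forall x, P x} ->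
  (forall x, P x -> Q x) -> {ae mu, forall x, Q x}.
Proof. by move=> hP PQ; apply: negligibleS hP => x /=; exact: contra_not (PQ x). Qed.

Lemma ae_and (P Q : R -> Prop) : {ae mu, forall x, P x} -> {ae mu, forall x, Q x} ->
  {ae mu, forall x, P x /\ Q x}.
Proof.
move=> hP hQ; apply: negligibleS (negligibleU hP hQ) => x /= h.
by case: (pselect (P x)) => Px; [right => Qx; apply: h|left].
Qed.

Lemma ae_exists (P : R -> Prop) c d : {ae mu, forall x, P x} -> c < d ->
  exists2 x, c < x < d & P x.
Proof.
move=> aP cd; apply: contrapT => h.
have mcd : measurable (`]c, d[%classic : set (measurableTypeR R)) by exact: measurable_itv.
have : mu.-negligible `]c, d[%classic.
  apply: negligibleS aP => x; rewrite /= in_itv/= => xcd Px.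
  by apply: h; exists x.
move/(negligibleP mu mcd) => h0.
have : (0 = (d - c)%:E :> \bar R)%E.
  apply: etrans (esym h0) _; apply: etrans (lebesgue_measure_itv _) _.
  by rewrite /= lte_fin cd -EFinB.
by move=> [e]; move: cd; rewrite -subr_gt0 -e ltxx.
Qed.

(** Integrability may fail at 0 and at infinity, so the differentiation theorem is applied to
    countably many cut-offs. *)
Lemma ae_lebesgue_pts f : locally_integrable_half f ->
  {ae mu, forall x, forall n : nat, lebesgue_pt (f \_ `[n.+1%:R^-1, n.+1%:R]) x}.
Proof.
move=> fi; apply/ae_foralln => n; apply: lebesgue_differentiation.
by apply: integrable_patch_locally; apply: fi; rewrite invr_gt0.
Qed.

Lemma lipschitz_max0 (x p q : R) : `|Num.max (x - p) 0 - Num.max (x - q) 0| <= `|p - q|.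
Proof.
have := ler_norm (p - q); have := ler_norm (q - p); rewrite (distrC q p) => h1 h2.
by case: (leP (x - p) 0) => h3; case: (leP (x - q) 0) => h4; rewrite ler_norml; lra.
Qed.

(** Two Lebesgue points q and r are fixed. Solved for f(p), the three-point identity expresses f
    almost everywhere by a function that is locally Lipschitz in p, because the hat is. *)
Lemma weak_continuous f G : locally_integrable_half f -> locally_integrable_half G ->
  weak_second_derivative f G ->
  exists2 ft, forall r, 0 < r -> {for r, continuous ft} &
    {ae mu, forall r, half_line r -> f r = ft r}.
Proof.
move=> fi Gi weak; have ae := ae_lebesgue_pts fi.
have [q /andP[q1 q2] lq] := ae_exists ae (ltac:(lra) : 1 < 2 :> R).
have [r /andP[r2 r3] lr] := ae_exists ae (ltac:(lra) : 2 < 3 :> R).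
pose I p := \int[mu]_(s in half_line) (G s * hat p q r s).
have IE c d p : 0 < c -> c <= p <= d -> c <= 1 -> 3 <= d ->
    I p = \int[mu]_(s in `[c, d]) (G s * hat p q r s).
  move=> c0 pcd c1 d3; apply: Rintegral_support; first exact: half_line_segment.
  move=> x _ hx; rewrite (@hat_eq0 c d) ?mulr0//; apply/andP; split.
  - by clear -q1 c1; lra.
  - by clear -q2 d3; lra.
  - by clear -r2 c1; lra.
  - by clear -r3 d3; lra.
have rq : r - q != 0 by rewrite gt_eqF//; lra.
exists (fun p => ((r - p) * f q - (q - p) * f r + I p) / (r - q)).
  move=> p0 p00.
  pose c := Num.min p0 1 / 2; pose d := Num.max p0 3 * 2.
  have m1 : Num.min p0 1 <= p0 by rewrite ge_min lexx.
  have m2 : Num.min p0 1 <= 1 by rewrite ge_min lexx orbT.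
  have m3 : p0 <= Num.max p0 3 by rewrite le_max lexx.
  have m4 : 3 <= Num.max p0 3 by rewrite le_max lexx orbT.
  have c0 : 0 < c by rewrite divr_gt0// lt_min p00 ltr01.
  have c1 : c <= 1 by rewrite /c; clear -m2; lra.
  have d3 : 3 <= d by rewrite /d; clear -m4; lra.
  have cp : c < p0 by rewrite /c; clear -m1 p00; lra.
  have pd : p0 < d by rewrite /d; clear -m3 p00; lra.
  have mcd : measurable (`[c, d]%classic : set (measurableTypeR R)) by exact: measurable_itv.
  have aGi : mu.-integrable `[c, d] (EFin \o (fun s => `|G s|)).
    by have := integrable_abse (Gi c d c0).
  pose IG := \int[mu]_(s in `[c, d]) `|G s|.
  have IG0 : 0 <= IG by apply: Rintegral_ge0.
  have GL p : mu.-integrable `[c, d] (EFin \o (fun s => G s * hat p q r s)).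
    by apply: integrable_mul_continuous; [exact: Gi|move=> x _; exact: continuous_hat].
  pose K := (r - q) + d + d.
  have K0 : 0 <= K by rewrite /K; clear -d3 q2 r2; lra.
  have lip p : c <= p <= d -> `|I p - I p0| <= K * IG * `|p - p0|.
    move=> hp; rewrite (IE c d p)// (IE c d p0)//; last by rewrite !ltW.
    rewrite -RintegralB//.
    have i1 : mu.-integrable `[c, d] (EFin \o (fun s => G s * hat p q r s - G s * hat p0 q r s)).
      by apply: eq_integrable (integrableB mcd (GL p) (GL p0)).
    apply: le_trans (le_normr_Rintegral mcd i1) _.
    rewrite mulrAC -RintegralZl//; apply: le_Rintegral => //.
    - by have := integrable_abse i1.
    - by apply: eq_integrable (integrableZl mcd (K * `|p - p0|) aGi).
    move=> s /=; rewrite in_itv/= => /andP[cs sd].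
    rewrite (_ : _ - _ = (hat p q r s - hat p0 q r s) * G s); last by ring.
    rewrite normrM ler_wpM2r//.
    have -> : hat p q r s - hat p0 q r s = (r - q) * (Num.max (s - p) 0 - Num.max (s - p0) 0)
        - (p0 - p) * Num.max (s - q) 0 + (p0 - p) * Num.max (s - r) 0 by rewrite /hat; ring.
    have mx t : 0 < t -> `|Num.max (s - t) 0| <= d.
      move=> t0; rewrite ger0_norm ?le_max ?lexx ?orbT// ge_max.
      by apply/andP; split; [clear -t0 sd|clear -d3]; lra.
    have rq0 : 0 <= r - q by clear -q2 r2; lra.
    have b1 : `|(r - q) * (Num.max (s - p) 0 - Num.max (s - p0) 0)| <= (r - q) * `|p - p0|.
      by rewrite normrM (ger0_norm rq0) ler_wpM2l// lipschitz_max0.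
    have b2 t : 0 < t -> `|(p0 - p) * Num.max (s - t) 0| <= d * `|p - p0|.
      by move=> t0; rewrite normrM distrC mulrC ler_wpM2r// mx.
    apply: le_trans (ler_normD _ _) _; rewrite /K (mulrDl (r - q + d)) (mulrDl (r - q)).
    apply: lerD; last by apply: b2; clear -r2; lra.
    apply: le_trans (ler_normB _ _) _; apply: lerD => //.
    by apply: b2; clear -q1; lra.
  have cI : {for p0, continuous I}.
    apply/cvgrPdist_le => /= eps eps0.
    have KI : 0 < K * IG + 1 by rewrite ltr_wpDl// mulr_ge0.
    have rad0 : 0 < eps / (K * IG + 1) by rewrite divr_gt0.
    near=> p.
    rewrite distrC; apply: le_trans (lip p _) _.
      apply/andP; split; apply: ltW.
        by near: p; exact: cvgr_gt cvg_id _ cp.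
      by near: p; exact: cvgr_lt cvg_id _ pd.
    have : `|p - p0| < eps / (K * IG + 1).
      by rewrite distrC; near: p; exists (eps / (K * IG + 1)); first exact: rad0.
    rewrite ltr_pdivlMr// => /ltW; apply: le_trans.
    by rewrite mulrC ler_wpM2l// lerDl.
  apply: cvgM; last exact: cvg_cst.
  apply: cvgD; last exact: cI.
  apply: cvgB; apply: cvgM; try exact: cvg_cst.
    by apply: cvgB; [exact: cvg_cst|exact: cvg_id].
  by apply: cvgB; [exact: cvg_cst|exact: cvg_id].
apply: (ae_imply ae) => p lp; rewrite half_lineE => p0.
have [n hn] : exists n : nat, [/\ p^-1 < n.+1%:R, p < n.+1%:R & 3 < n.+1%:R :> R].
  pose M := Num.max (Num.max p^-1 p) 3.
  exists (Num.truncn M); have : M < (Num.truncn M).+1%:R by apply: truncnS_gt.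
  by rewrite !gt_max => /andP[/andP[-> ->] ->].
have [n1 n2 n3] := hn; have n0 : 0 < n.+1%:R :> R by rewrite ltr0n.
have np : n.+1%:R^-1 <= p by rewrite -[p]invrK lef_pV2 ?posrE ?invr_gt0//; exact: ltW.
have nq : n.+1%:R^-1 <= 1 :> R by rewrite invf_le1// ler1n.
have c0 : 0 < n.+1%:R^-1 :> R by rewrite invr_gt0.
have hp : n.+1%:R^-1 <= p < n.+1%:R by rewrite np n2.
have hq : n.+1%:R^-1 <= q < n.+1%:R by rewrite (le_trans nq (ltW q1)) (lt_trans _ n3)//; clear -q2; lra.
have hr : n.+1%:R^-1 <= r < n.+1%:R by rewrite (le_trans nq) ?(lt_trans r3 n3)//; clear -r2; lra.
have := weak_three_points (fi _ _ c0) (Gi _ _ c0) c0 weak (lp n) (lq n) (lr n) hp hq hr.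
rewrite -(IE _ _ p c0) ?np ?(ltW n2) ?(ltW n3)//.
by move=> e; apply: (mulIf rq); rewrite mulfVK//; clear -e; lra.
Unshelve. all: by end_near. Qed.

End WeakSolutions.

(** * From weak solutions to classical ones *)

Section ClassicalRegularity.
Variable R : realType.
Let mu := @lebesgue_measure R.
Implicit Types (F G H f g h V : R -> R) (c d r s x p q e : R).

Lemma continuous_locally_integrable_half f : (forall r, 0 < r -> {for r, continuous f}) ->
  locally_integrable_half f.
Proof.
move=> cf c d c0; apply: continuous_segment_integrable => x /andP[cx _].
by apply: cf; exact: lt_le_trans cx.
Qed.

Lemma integral_test_support f phi c d : 0 < c -> (forall x, phi x != 0 -> c <= x <= d) ->
  \int[mu]_(x in half_line) (f x * phi x) = \int[mu]_(x in `[c, d]) (f x * phi x).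
Proof.
move=> c0 hphi; apply: Rintegral_support; first exact: half_line_segment.
move=> x _ hx; rewrite (_ : phi x = 0) ?mulr0//.
by apply/eqP; apply: contraNT hx => /hphi.
Qed.

Lemma integral_test_ae f g phi c d : 0 < c -> (forall x, phi x != 0 -> c <= x <= d) ->
  locally_integrable_half f -> locally_integrable_half g -> continuous phi ->
  {ae mu, forall r, half_line r -> f r = g r} ->
  \int[mu]_(x in half_line) (f x * phi x) = \int[mu]_(x in half_line) (g x * phi x).
Proof.
move=> c0 hphi fi gi cphi fg; rewrite !(integral_test_support _ c0 hphi).
have mcd : measurable (`[c, d]%classic : set (measurableTypeR R)) by exact: measurable_itv.
have i u : locally_integrable_half u -> mu.-integrable `[c, d] (EFin \o (fun x => u x * phi x)).
  by move=> ui; apply: integrable_mul_continuous => [|x _]; [exact: ui|exact: cphi].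
rewrite /Rintegral; congr fine; apply: ae_eq_integral => //.
- by case/integrableP : (i f fi).
- by case/integrableP : (i g gi).
apply: (ae_imply fg) => x hx xcd; congr (_ * _)%:E; apply: hx.
exact: half_line_segment xcd.
Qed.

Lemma weak_second_ae f g G H : locally_integrable_half f -> locally_integrable_half g ->
  locally_integrable_half G -> locally_integrable_half H ->
  {ae mu, forall r, half_line r -> f r = g r} ->
  {ae mu, forall r, half_line r -> G r = H r} ->
  weak_second_derivative f G -> weak_second_derivative g H.
Proof.
move=> fi gi Gi Hi fg GH weak phi tphi.
have [c [d [c0 cd cd2]]] := test_half_support tphi.
have sphi := test_half_smooth tphi.
rewrite -(integral_test_ae c0 cd2 fi gi (smooth_continuous (smooth_derive1n 2 sphi)) fg).
by rewrite -(integral_test_ae c0 cd Gi Hi (smooth_continuous sphi) GH) weak.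
Qed.

Lemma weak_secondB f g G H : locally_integrable_half f -> locally_integrable_half g ->
  locally_integrable_half G -> locally_integrable_half H ->
  weak_second_derivative f G -> weak_second_derivative g H ->
  weak_second_derivative (fun x => f x - g x) (fun x => G x - H x).
Proof.
move=> fi gi Gi Hi wf wg phi tphi.
have [c [d [c0 cd cd2]]] := test_half_support tphi.
have sphi := test_half_smooth tphi.
have mcd : measurable (`[c, d]%classic : set (measurableTypeR R)) by exact: measurable_itv.
have key u v (psi : R -> R) : locally_integrable_half u -> locally_integrable_half v ->
    continuous psi -> (forall x, psi x != 0 -> c <= x <= d) ->
    \int[mu]_(x in half_line) ((u x - v x) * psi x) =
    \int[mu]_(x in half_line) (u x * psi x) - \int[mu]_(x in half_line) (v x * psi x).
  move=> ui vi cpsi hpsi; rewrite !(integral_test_support _ c0 hpsi).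
  rewrite -RintegralB//; first by apply: eq_Rintegral => x _; rewrite mulrBl.
    by apply: integrable_mul_continuous => [|x _]; [exact: ui|exact: cpsi].
  by apply: integrable_mul_continuous => [|x _]; [exact: vi|exact: cpsi].
rewrite (key f g)//; last exact: smooth_continuous (smooth_derive1n 2 sphi).
by rewrite (key G H) ?wf ?wg//; exact: smooth_continuous.
Qed.

Lemma ae_comb f g h k (V : R -> R) : {ae mu, forall r, half_line r -> f r = g r} ->
  {ae mu, forall r, half_line r -> h r = k r} ->
  {ae mu, forall r, half_line r -> V r * f r - h r = V r * g r - k r}.
Proof.
by move=> h1 h2; apply: (ae_imply (ae_and h1 h2)) => x [e1 e2] hx; rewrite e1// e2.
Qed.

Lemma locally_integrable_comb V f h : (forall r, 0 < r -> {for r, continuous V}) ->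
  locally_integrable_half f -> locally_integrable_half h ->
  locally_integrable_half (fun x => V x * f x - h x).
Proof.
move=> cV fi hi c d c0.
have mcd : measurable (`[c, d]%classic : set (measurableTypeR R)) by exact: measurable_itv.
have i1 : mu.-integrable `[c, d] (EFin \o (fun x => f x * V x)).
  apply: integrable_mul_continuous; first exact: fi.
  by move=> x /andP[cx _]; apply: cV; exact: lt_le_trans cx.
apply: eq_integrable (integrableB mcd i1 (hi c d c0)) => //.
by move=> x _ /=; rewrite mulrC EFinB.
Qed.

Lemma L2_locally_integrable f : L2_half f -> locally_integrable_half f.
Proof. by move=> hf c d c0; exact: L2_half_integrable. Qed.

Lemma weak_schrodinger_continuous V f h : (forall r, 0 < r -> {for r, continuous V}) ->
  L2_half f -> L2_half h -> weak_schrodinger V f h ->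
  exists2 ft, forall r, 0 < r -> {for r, continuous ft} &
    {ae mu, forall r, half_line r -> f r = ft r}.
Proof.
move=> cV /L2_locally_integrable fi /L2_locally_integrable hi weak.
apply: (weak_continuous fi (locally_integrable_comb cV fi hi)).
exact: (weak_schrodinger_second cV fi hi weak).
Qed.

(** [ft] minus a second primitive of [V ft - ht] has zero weak second derivative, hence it is
    affine. *)
Lemma weak_schrodinger_classical V f h ft ht : (forall r, 0 < r -> {for r, continuous V}) ->
  L2_half f -> L2_half h -> weak_schrodinger V f h ->
  (forall r, 0 < r -> {for r, continuous ft}) -> (forall r, 0 < r -> {for r, continuous ht}) ->
  {ae mu, forall r, half_line r -> f r = ft r} ->
  {ae mu, forall r, half_line r -> h r = ht r} ->
  exists f1, forall r, 0 < r ->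
    is_derive r 1 ft (f1 r) /\ is_derive r 1 f1 (V r * ft r - ht r).
Proof.
move=> cV /L2_locally_integrable fi /L2_locally_integrable hi weak cft cht fft hht.
have fti := continuous_locally_integrable_half cft.
have hti := continuous_locally_integrable_half cht.
pose G r : R := V r * ft r - ht r.
have cG r : 0 < r -> {for r, continuous G}.
  by move=> r0; apply: cvgB; [apply: cvgM; [exact: cV|exact: cft]|exact: cht].
have Gi := continuous_locally_integrable_half cG.
have [H1 _ dH1] := antiderivative_half cG.
have cH1 r : 0 < r -> {for r, continuous H1} by move=> /dH1; exact: is_derive_cont.
have [H2 _ dH2] := antiderivative_half cH1.
have cH2 r : 0 < r -> {for r, continuous H2} by move=> /dH2; exact: is_derive_cont.
have H2i := continuous_locally_integrable_half cH2.
have w1 : weak_second_derivative ft G.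
  apply: (weak_second_ae fi fti (locally_integrable_comb cV fi hi) Gi fft (ae_comb V fft hht)).
  exact: (weak_schrodinger_second cV fi hi weak).
have c0 r : 0 < r -> {for r, continuous (fun=> 0 : R)} by move=> _; exact: cvg_cst.
have cNG r : 0 < r -> {for r, continuous (fun x => - G x)} by move=> /cG; exact: cvgN.
have NGi := continuous_locally_integrable_half cNG.
(* The second primitive is viewed as a solution with potential 0 and right-hand side [- G], which
   explains the form of the term. *)
have w2 : weak_second_derivative H2 (fun x => 0 * H2 x - - G x).
  apply: weak_schrodinger_second => //.
  apply: (@classical_weak _ _ H2 H1 G) => // [r r0|r _]; first by split; [exact: dH2|exact: dH1].
  by rewrite mul0r sub0r.
have := weak_secondB fti H2i Gi (locally_integrable_comb c0 H2i NGi) w1 w2.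
rewrite (_ : (fun x => G x - _) = (fun=> 0)); last by apply/funext => x; ring.
move=> /weak_affine[|al [be e]].
  by move=> r r0; apply: cvgB; [exact: cft|exact: cH2].
exists (fun r => H1 r + be) => r r0; split; last first.
  by have d1 := dH1 r r0; derive; rewrite addr0.
apply: (@is_derive_near _ (fun r => H2 r + (al + be * r))); last first.
  by have d1 := dH2 r r0; derive; ring.
near=> z; have z0 : 0 < z by near: z; exact: cvgr_gt cvg_id _ r0.
by rewrite -e//; ring.
Unshelve. all: by end_near. Qed.

(** The primitive that vanishes at 1 has absolute value at most the total integral C; adding C puts
    it between 0 and 2 C. *)
Lemma square_bounded_primitive f ft : L2_half f ->
  (forall r, 0 < r -> {for r, continuous ft}) -> {ae mu, forall r, half_line r -> f r = ft r} ->
  exists (P : R -> R) C, forall r, 0 < r -> is_derive r 1 P (ft r ^+ 2) /\ 0 <= P r <= C.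
Proof.
move=> /L2_halfP[mf fi] cft fft.
have mD := @measurable_half_line R.
have cft2 r : 0 < r -> {for r, continuous (fun x => ft x ^+ 2)}.
  by move=> r0; rewrite (_ : (fun x => _) = (fun x => ft x * ft x)) //; apply: cvgM; exact: cft.
have [H H10 dH] := antiderivative_half cft2.
pose C := \int[mu]_(x in half_line) (f x ^+ 2).
have bnd c d : 0 < c -> c < d -> H d - H c <= C.
  move=> c0 cd; have sub := @half_line_segment R c d c0.
  have mcd : measurable (`[c, d]%classic : set (measurableTypeR R)) by exact: measurable_itv.
  have cs x : c <= x <= d -> 0 < x by move=> /andP[cx _]; exact: lt_le_trans cx.
  have <- : \int[mu]_(x in `[c, d]) (ft x ^+ 2) = H d - H c.
    by apply: Rintegral_derive => // x /cs; [exact: dH|exact: cft2].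
  have ii : mu.-integrable `[c, d] (EFin \o (fun x => f x ^+ 2)) by apply: integrableS fi.
  have jj : mu.-integrable `[c, d] (EFin \o (fun x => ft x ^+ 2)).
    by apply: continuous_segment_integrable => x /cs; exact: cft2.
  rewrite (_ : \int[mu]_(x in `[c, d]) (ft x ^+ 2) = \int[mu]_(x in `[c, d]) (f x ^+ 2)).
    rewrite /C /Rintegral; apply: fine_le.
    - exact: integrable_fin_num ii.
    - exact: integrable_fin_num fi.
    apply: ge0_subset_integral => //; first by case/integrableP : fi.
    by move=> x _; rewrite lee_fin sqr_ge0.
  rewrite /Rintegral; congr fine; apply: ae_eq_integral => //.
  - by case/integrableP : jj.
  - by case/integrableP : ii.
  by apply: (ae_imply fft) => x hx xcd; rewrite hx//; exact: sub.
have Hmono c d : 0 < c -> c <= d -> H c <= H d.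
  move=> c0 cd; apply: (@derive_ge0_le _ H (fun x => ft x ^+ 2)) => //.
    by move=> s /andP[cs _]; apply: dH; exact: lt_le_trans cs.
  by move=> s _; exact: sqr_ge0.
have C0 : 0 <= C by apply: Rintegral_ge0 => x _; exact: sqr_ge0.
exists (fun r => H r + C), (C + C) => r r0; split.
  by have d1 := dH r r0; derive; rewrite addr0.
have [r1|r1] := ltP r 1.
  have := bnd r 1 r0 r1; have := Hmono r 1 r0 (ltW r1); rewrite H10; lra.
have := Hmono 1 r ltr01 r1; rewrite H10.
move: r1; rewrite le_eqVlt => /predU1P[<-|r1]; first by rewrite H10; lra.
have := bnd 1 r ltr01 r1; rewrite H10; lra.
Qed.

End ClassicalRegularity.

(** * Radial functions in the plane *)

Section NullSets.
Variable R : realType.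
Let mu := @lebesgue_measure R.
Let l := (@wlength R idfun).

Lemma outer_measure_itv (a b : R) : a <= b -> ((wlength idfun)^*%mu `[a, b] <= (b - a)%:E :> \bar R)%E.
Proof.
move=> ab; have := @lebesgue_measure_itv R `[a, b].
rewrite /= /lebesgue_measure /lebesgue_stieltjes_measure /measure_extension /= => ->.
by case: ifP => //; rewrite lee_fin subr_ge0.
Qed.

(* A map expanding distances by a factor at least k > 0 pulls back covers by intervals. *)
Lemma negligible_expanding (psi : R -> R) (D N : set R) (k : R) : 0 < k ->
  (forall x y, D x -> D y -> k * `|x - y| <= `|psi x - psi y|) ->
  mu.-negligible N -> mu.-negligible (D `&` psi @^-1` N).
Proof.
move=> k0 hpsi /negligible_outer_measure N0; apply/negligible_outer_measure.
apply/eqP; rewrite eq_le outer_measure_ge0 andbT; apply/lee_addgt0Pr => /= e e0; rewrite add0e.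
(* A nonempty preimage of an interval of length L has diameter at most L / k, so it lies in an
   interval of length 2 L / k around any of its points. *)
have e1 : 0 < e * (k / 2) by rewrite mulr_gt0// divr_gt0.
have [F [Fitv NF] Fe] : exists2 I_, open_itv_cover N I_ &
    (\sum_(0 <= i <oo) l (I_ i) <= (e * (k / 2))%:E)%E.
  have : (l^* N)%mu \is a fin_num by rewrite N0.
  rewrite outer_measure_open_itv_cover => /lb_ereal_inf_adherent-/(_ _ e1)[_/= [F]] NF <-.
  rewrite -outer_measure_open_itv_cover N0 add0e => Fe.
  by exists F => //; exact/ltW.
have l0 A : (0 <= l A)%E by exact: wlength_ge0.
have c0 : (0 <= (2 / k)%:E :> \bar R)%E by rewrite lee_fin divr_ge0// ltW.
pose E i := D `&` psi @^-1` (F i).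
have sub : D `&` psi @^-1` N `<=` \bigcup_i E i.
  by move=> x [Dx /NF [i _ Fi]]; exists i.
apply: (@le_trans _ _ ((wlength idfun)^*%mu (\bigcup_i E i))); first exact: le_outer_measure.
apply: (le_trans (outer_measure_sigma_subadditive (wlength idfun)^*%mu E)).
apply: (@le_trans _ _ (\sum_(0 <= i <oo) ((2 / k)%:E * l (F i)))%E).
  apply: lee_nneseries => [i _ _|i _]; first exact: outer_measure_ge0.
  have [[a b] Fab] := Fitv i; rewrite /E Fab.
  have [[x0 [Dx0]]|/forallNP h] := pselect (exists x, D x /\ `]a, b[%classic (psi x)); last first.
    rewrite (_ : _ `&` _ = set0); first by rewrite outer_measure0 mule_ge0.
    by apply/seteqP; split => // x [Dx px]; have := h x; rewrite not_andP => -[].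
  rewrite /= in_itv/= => /andP[ax xb].
  have ab : a < b by exact: lt_trans xb.
  have L0 : 0 <= (b - a) / k by rewrite divr_ge0 ?ltW// subr_gt0.
  apply: (@le_trans _ _ ((wlength idfun)^*%mu `[x0 - (b - a) / k, x0 + (b - a) / k])).
    apply: le_outer_measure => x [Dx /=]; rewrite !in_itv/= => /andP[ax' xb'].
    rewrite lerBlDr addrC -lerBlDr.
    have : `|x - x0| <= (b - a) / k.
      rewrite ler_pdivlMr// mulrC; apply: le_trans (hpsi _ _ Dx Dx0) _.
      by rewrite ler_norml; clear -ax xb ax' xb'; lra.
    by rewrite ler_norml => /andP[h1 h2]; apply/andP; split; [clear -h1|clear -h2]; lra.
  apply: le_trans (outer_measure_itv _) _; first by clear -L0; lra.
  rewrite /l wlength_itv/= lte_fin ab -EFinB -EFinM lee_fin.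
  by rewrite le_eqVlt; apply/orP; left; apply/eqP; field; rewrite gt_eqF.
rewrite nneseriesZl; last by [].
apply: (@le_trans _ _ ((2 / k)%:E * (e * (k / 2))%:E)%E).
  by rewrite lee_wpmul2l.
rewrite -EFinM lee_fin le_eqVlt; apply/orP; left; apply/eqP; field; by rewrite gt_eqF.
Qed.

End NullSets.

(** * Measurability and integration by parts in the plane *)

Section Plane.
Variable R : realType.
Let mu := @lebesgue_measure R.
Let mu2 := (@lebesgue_measure R \x @lebesgue_measure R)%E.
Let T := (measurableTypeR R * measurableTypeR R)%type.
Implicit Types (f F u v w : R * R -> R).

(** The sigma-algebra of the plane is the product one; squares with rational centres and radii
    1/(n+1) exhibit an open set as a countable union of rectangles. *)
Lemma open_plane_measurable (O : set (R * R)) : open O -> measurable (O : set T).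
Proof.
move=> oO.
pose B (q : rat * rat * nat) : set T :=
  ball (ratr q.1.1 : R) q.2.+1%:R^-1 `*` ball (ratr q.1.2 : R) q.2.+1%:R^-1.
rewrite (_ : O = \bigcup_(q in [set q | B q `<=` O]) B q).
  rewrite bigcup_mkcond; apply: countable_bigcupT_measurable => // q.
  case: ifPn => // _; apply: measurableX; exact: measurable_ball.
apply/seteqP; split=> [p Op|p [q qO]]; last exact: qO.
have /nbhs_ballP[e /= e0 eO] : nbhs p O by apply: open_nbhs_nbhs.
have [n n2] : exists n : nat, n.+1%:R^-1 + n.+1%:R^-1 < e.
  have [n hn] : exists n : nat, e^-1 < n.+1%:R / 2.
    exists (Num.truncn (e^-1 * 2)); rewrite ltr_pdivlMr//; exact: truncnS_gt.
  have N0 : 0 < n.+1%:R / 2 :> R by rewrite divr_gt0 ?ltr0n.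
  exists n; have -> : n.+1%:R^-1 + n.+1%:R^-1 = (n.+1%:R / 2)^-1 :> R.
    by rewrite invfM invrK mulr_natr mulr2n.
  by rewrite -[e]invrK ltf_pV2// posrE invr_gt0.
have n0 : 0 < n.+1%:R^-1 :> R by rewrite invr_gt0.
have rat_near (x r : R) : 0 < r -> exists q : rat, ball (ratr q : R) r x.
  move=> r0; have [q] := @rat_in_itvoo R (x - r) (x + r) ltac:(lra).
  rewrite in_itv/= => /andP[h1 h2]; exists q; rewrite /ball/= ltr_norml; apply/andP; split; lra.
have [q1 hq1] := rat_near p.1 _ n0; have [q2 hq2] := rat_near p.2 _ n0.
exists (q1, q2, n) => //= -[x y] [/= hx hy]; apply: eO; split.
  by apply: le_ball (ltW n2) _ _; apply: ball_triangle hx; exact: ball_sym.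
by apply: le_ball (ltW n2) _ _; apply: ball_triangle hy; exact: ball_sym.
Qed.

Lemma continuous_plane_measurable f : continuous f -> measurable_fun (setT : set T) f.
Proof.
move=> /continuousP cf; apply: (measurability _ (RGenOpens.measurableE R)).
move=> _ [_ [a [b ->] <-]]; rewrite setTI; apply: open_plane_measurable.
by apply: cf; exact: interval_open.
Qed.

Lemma is_derive_line (F : R * R -> R) (p v : R * R) (d : R) :
  is_derive (0 : R) 1 (fun t : R => F (t *: v + p)) d -> is_derive p v F d.
Proof.
have e : (fun h : R => h^-1 *: (((fun t : R => F (t *: v + p)) \o shift 0) (h *: 1) - F (0 *: v + p))) =
         (fun h : R => h^-1 *: ((F \o shift p) (h *: v) - F p)).
  apply/funext => h /=; rewrite /shift/= addr0 scale0r add0r.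
  by rewrite [h *: 1]mulr1.
by move=> [h1 h2]; split; [rewrite /derivable -e|rewrite /derive -e].
Qed.

Lemma is_derive_slice (F : R * R -> R) (b : bool) (x y d : R) :
  is_derive (if b then (y, x) else (x, y)) (dir R b) F d ->
  is_derive x 1 (fun t => F (if b then (y, t) else (t, y))) d.
Proof.
set p := if b then _ else _.
have e : (fun h : R => h^-1 *: ((F \o shift p) (h *: dir R b) - F p)) =
    (fun h : R => h^-1 *: (((fun t => F (if b then (y, t) else (t, y))) \o shift x) (h *: 1) - F p)).
  apply/funext => h /=; congr (_ *: (F _ - _)).
  rewrite /p /dir /shift/=; case: b {p}; congr (_, _); rewrite /= ?scaler0 ?add0r//.
by move=> [h1 h2]; split; [rewrite /derivable -e|rewrite /derive -e].
Qed.

Lemma slice_integral0 (F f : R -> R) M : (forall x : R, is_derive x 1 F (f x)) -> continuous f ->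
  (forall x, F x != 0 -> `|x| <= M) -> (forall x, f x != 0 -> `|x| <= M) ->
  (\int[mu]_x (f x)%:E = 0)%E.
Proof.
move=> dF cf hF hf; pose N := `|M| + 1.
have N0 : 0 < N by rewrite ltr_wpDl.
have MN : M < N by rewrite ltr_pwDr// ler_norm.
have f0 x : setT x -> ~~ (- N <= x <= N) -> f x = 0.
  move=> _; rewrite -ler_norml -ltNge => hx; apply/eqP; apply: contraTT hx => /hf hx.
  by rewrite -leNgt (le_trans hx)// ltW.
have F0 x : N <= `|x| -> F x = 0.
  move=> hx; apply/eqP; apply: contraTT hx => /hF hx.
  by rewrite -ltNge (le_lt_trans hx).
have sub : `[- N, N]%classic `<=` [set: R] by [].
have ii : mu.-integrable `[- N, N] (EFin \o f).
  by apply: continuous_segment_integrable => x _; exact: cf.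
have iT : mu.-integrable setT (EFin \o f) by apply: integrable_support ii.
rewrite -(fineK (integrable_fin_num measurableT iT)); congr (_%:E).
have -> : fine (\int[mu]_x (EFin \o f) x) = \int[mu]_x f x by [].
rewrite (@Rintegral_support _ _ (- N) N)//.
have -> : \int[mu]_(x in `[- N, N]) f x = F N - F (- N).
  by apply: Rintegral_derive => // [|x _]; [clear -N0; lra|exact: cf].
by rewrite !F0 ?subrr ?normrN ?ger0_norm// ltW.
Qed.

Lemma norm_coord (p : R * R) : `|p.1| <= `|p| /\ `|p.2| <= `|p|.
Proof. by rewrite prod_normE/= !le_max !lexx orbT. Qed.

(** Differentiability may fail at the origin. Only one line in the given direction passes through
    it, so by Fubini's theorem it suffices to integrate along the others. *)
Lemma plane_ibp b (F f : R * R -> R) M : mu2.-integrable setT (EFin \o f) ->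
  (forall p : R * R, 0 < p.1 ^+ 2 + p.2 ^+ 2 -> is_derive p (dir R b) F (f p)) ->
  (forall p : R * R, 0 < p.1 ^+ 2 + p.2 ^+ 2 -> {for p, continuous f}) ->
  (forall p, F p != 0 -> `|p| <= M) -> (forall p, f p != 0 -> `|p| <= M) ->
  \int[mu2]_p f p = 0.
Proof.
move=> fi dF cf hF hf.
pose pt (x y : R) : R * R := if b then (y, x) else (x, y).
have pos x y : y != 0 -> 0 < (pt x y).1 ^+ 2 + (pt x y).2 ^+ 2.
  move=> y0; have y2 : 0 < y ^+ 2 by rewrite exprn_even_gt0.
  by rewrite /pt; case: (b) => /=; [apply: ltr_wpDr|apply: ltr_wpDl]; rewrite ?sqr_ge0.
have slice y : y != 0 -> (\int[mu]_x (f (pt x y))%:E = 0)%E.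
  move=> y0; apply: (@slice_integral0 (fun t => F (pt t y)) _ M).
  - by move=> x; apply: is_derive_slice; apply: dF; exact: pos.
  - move=> x; apply: (@continuous_comp _ _ _ (fun t => pt t y) f); last by apply: cf; exact: pos.
    rewrite /pt; case: (b); [exact: (cvg_pair (cvg_cst y) cvg_id)|].
    exact: (cvg_pair cvg_id (cvg_cst y)).
  - move=> x /hF; apply: le_trans; have [h1 h2] := norm_coord (pt x y).
    by move: h1 h2; rewrite /pt; case: (b).
  - move=> x /hf; apply: le_trans; have [h1 h2] := norm_coord (pt x y).
    by move: h1 h2; rewrite /pt; case: (b).
have ae0 : {ae mu, forall y, y != 0}.
  apply: (@negligibleS _ _ _ mu [set 0]); first by move=> y /= /negP; rewrite negbK => /eqP.
  by apply/negligibleP; [exact: measurable_set1|exact: lebesgue_measure_set1].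
rewrite /Rintegral (_ : (\int[_]_(_ in _) _)%E = 0%E)//.
rewrite /pt in slice; clear pt pos dF cf hF hf; case: b slice => slice.
  rewrite -(integral12_prod_meas1 fi).
  rewrite (@ae_eq_integral _ _ _ mu _ (cst 0%E)) ?integral0//.
  - exact: measurable_fubini_F fi.
  - by apply: (ae_imply ae0) => x x0 _ /=; exact: slice.
rewrite -(integral21_prod_meas1 fi).
rewrite (@ae_eq_integral _ _ _ mu _ (cst 0%E)) ?integral0//.
- exact: measurable_fubini_G fi.
- by apply: (ae_imply ae0) => x x0 _ /=; exact: slice.
Qed.

Lemma bounded_support_integrable f C M : measurable_fun (setT : set T) f ->
  (forall p, `|f p| <= C) -> (forall p, f p != 0 -> `|p| <= M) ->
  mu2.-integrable setT (EFin \o f).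
Proof.
move=> mf fC fM.
pose I : set (measurableTypeR R) := `[- M, M]%classic; pose D : set T := I `*` I.
have mI : measurable I by exact: measurable_itv.
have mD : measurable D by exact: measurableX.
have -> : EFin \o f = (EFin \o f) \_ D.
  apply/funext => p; rewrite /patch/=; case: ifPn => // /negP Dp.
  congr (_%:E); apply/eqP; apply: contraT => /fM pM; case: Dp; apply/mem_set.
  have [h1 h2] := norm_coord p.
  by split; rewrite /= /I /mkset in_itv/= -ler_norml;
    [exact: le_trans h1 pM|exact: le_trans h2 pM].
apply/(integrable_mkcond _ mD); apply: (@measurable_bounded_integrable _ _ _ mu2 f D mD).
- have muI : (mu I < +oo)%E.
    by apply: compact_finite_measure; exact: segment_compact.
  have e : mu2 D = (mu I * mu I)%E by exact: product_measure1E.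
  by rewrite -[X in (X < _)%E]/(mu2 D) e; apply: lte_mul_pinfty; rewrite ?ge0_fin_numE.
- exact: measurable_funTS.
by exists C; split => [|z Cz p _ /=]; [exact: num_real|exact: le_trans (fC p) (ltW Cz)].
Qed.

End Plane.

(** * Tensor test functions and the radius *)

Section PlaneGeometry.
Variable R : realType.
Let mu := @lebesgue_measure R.
Let mu2 := (@lebesgue_measure R \x @lebesgue_measure R)%E.
Let T := (measurableTypeR R * measurableTypeR R)%type.
Implicit Types (u v w : R * R -> R) (p q : R * R).

Lemma continuous_support_integrable (f : R * R -> R) M : continuous f ->
  (forall p, f p != 0 -> `|p| <= M) -> mu2.-integrable setT (EFin \o f).
Proof.
move=> cf fM.
have cK : compact (`[- M, M]%classic `*` `[- M, M]%classic : set (R * R)).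
  by apply: compact_setX; exact: segment_compact.
have cf' : {within `[- M, M]%classic `*` `[- M, M]%classic, continuous f}.
  exact: continuous_subspaceT.
have [N [_ hN]] := compact_bounded (continuous_compact cf' cK).
apply: (@bounded_support_integrable R f (`|N| + 1) M) => //.
  exact: continuous_plane_measurable.
move=> p; have [->|fp] := eqVneq (f p) 0; first by rewrite normr0 addr_ge0.
apply: (hN (`|N| + 1)); first by rewrite ltr_pwDr// ler_norm.
exists p => //; have [h1 h2] := norm_coord p; have pM := fM p fp.
by split; rewrite /mkset/= in_itv/= -ler_norml; [exact: le_trans h1 pM|exact: le_trans h2 pM].
Qed.

Definition box (a b : R) : set T := `[a, b]%classic `*` `[a, b]%classic.

Lemma boxE (a b : R) p : box a b p <-> a <= p.1 <= b /\ a <= p.2 <= b.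
Proof. by rewrite /box /setX /mkset /= !in_itv. Qed.

Lemma measurable_box (a b : R) : measurable (box a b).
Proof. by apply: measurableX; exact: measurable_itv. Qed.

Lemma box_measure (a b : R) : a < b -> mu2 (box a b) = ((b - a) ^+ 2)%:E.
Proof.
move=> ab; have mI : measurable (`[a, b]%classic : set (measurableTypeR R)) by exact: measurable_itv.
rewrite /mu2 /box; apply: etrans (product_measure1E _ _ mI mI) _.
rewrite expr2 EFinM; congr (_ * _)%E.
all: by apply: etrans (lebesgue_measure_itv _) _; rewrite /= lte_fin ab -EFinB.
Qed.

Definition tensor (f g : R -> R) p : R := f p.1 * g p.2.

Lemma is_derive_tensor (b : bool) (f g : R -> R) p : smooth f -> smooth g ->
  is_derive p (dir R b) (tensor f g)
    (if b then tensor f (derive1 g) p else tensor (derive1 f) g p).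
Proof.
move=> sf sg; apply: is_derive_line; rewrite /tensor.
have hd (h : R -> R) (c x : R) : smooth h ->
    is_derive (0 : R) 1 (fun t : R => h (t * c + x)) (derive1 h x * c).
  move=> sh; have h1 : is_derive (0 : R) 1 (fun t : R => t * c + x) c by derive; ring.
  have h2 : is_derive (0 * c + x) 1 h (derive1 h x).
    by rewrite mul0r add0r; exact: smooth_is_derive.
  exact: is_derive_comp1 h1 h2.
have h := is_derive_mul (hd f (dir R b).1 p.1 sf) (hd g (dir R b).2 p.2 sg).
apply: (is_derive_val (f := fun t : R => f (t *: dir R b + p).1 * g (t *: dir R b + p).2) h).
by rewrite !mul0r !add0r /dir; case: (b) => /=; ring.
Qed.

Lemma continuous_tensor (f g : R -> R) : continuous f -> continuous g -> continuous (tensor f g).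
Proof.
move=> cf cg p; apply: cvgM.
  by apply: (@continuous_comp _ _ _ fst f); [exact: cvg_fst|exact: cf].
by apply: (@continuous_comp _ _ _ snd g); [exact: cvg_snd|exact: cg].
Qed.

Lemma partials_tensor s (f g : R -> R) : smooth f -> smooth g ->
  exists f' g', [/\ smooth f', smooth g' & partials s (tensor f g) = tensor f' g'].
Proof.
move=> sf sg; elim: s => [|b s [f' [g' [sf' sg' IH]]]] /=; first by exists f, g.
have sdf := smooth_derive sf'; have sdg := smooth_derive sg'.
have e p : 'D_(dir R b) (tensor f' g') p =
    if b then tensor f' (derive1 g') p else tensor (derive1 f') g' p by have [_ ->] := is_derive_tensor b p sf' sg'.
rewrite IH; case: b e => e; [exists f', (derive1 g')|exists (derive1 f'), g'];
  by split => //; apply/funext => p; rewrite e.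
Qed.

Lemma test_tensor (f g : R -> R) M : smooth f -> smooth g ->
  (forall x, f x != 0 -> `|x| <= M) -> (forall x, g x != 0 -> `|x| <= M) ->
  test_plane (tensor f g).
Proof.
move=> sf sg fM gM; split.
- move=> s; have [f' [g' [sf' sg' ->]]] := partials_tensor s sf sg.
  by apply: continuous_tensor; exact: smooth_continuous.
- move=> s p b; have [f' [g' [sf' sg' ->]]] := partials_tensor s sf sg.
  by have [] := is_derive_tensor b p sf' sg'.
exists M => p; rewrite /tensor mulf_eq0 negb_or => /andP[/fM h1 /gM h2].
by rewrite prod_normE/= ge_max h1.
Qed.

Definition radius p : R := Num.sqrt (p.1 ^+ 2 + p.2 ^+ 2).

Lemma continuous_radius : continuous radius.
Proof.
move=> p; apply: (@continuous_comp _ _ _ (fun p : R * R => p.1 ^+ 2 + p.2 ^+ 2) Num.sqrt); last first.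
  exact: sqrt_continuous.
by apply: cvgD; rewrite !expr2; apply: cvgM; (exact: cvg_fst || exact: cvg_snd).
Qed.

Lemma radius_sqr p : radius p ^+ 2 = p.1 ^+ 2 + p.2 ^+ 2.
Proof. by rewrite sqr_sqrtr// addr_ge0// sqr_ge0. Qed.

Lemma radius_gt0 p : 0 < p.1 ^+ 2 + p.2 ^+ 2 -> 0 < radius p.
Proof. by rewrite sqrtr_gt0. Qed.

Lemma is_derive_radial (K K1 : R -> R) (b : bool) p : 0 < p.1 ^+ 2 + p.2 ^+ 2 ->
  (forall r : R, 0 < r -> is_derive r 1 K (K1 r)) ->
  is_derive p (dir R b) (fun p => K (radius p))
    (K1 (radius p) / radius p * (if b then p.2 else p.1)).
Proof.
move=> p0 dK; apply: is_derive_line => /=.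
have r0 := radius_gt0 p0.
pose S (t : R) : R := (t * (dir R b).1 + p.1) ^+ 2 + (t * (dir R b).2 + p.2) ^+ 2.
have S0 : S 0 = p.1 ^+ 2 + p.2 ^+ 2 by rewrite /S !mul0r !add0r.
have dS : is_derive (0 : R) 1 S (2 * (if b then p.2 else p.1)).
  rewrite /S; derive; rewrite !mul0r !add0r /dir.
  by case: b {S S0} => /=; ring.
have dq : is_derive (S 0) 1 Num.sqrt (2 * radius p)^-1.
  by rewrite S0; apply: is_derive1_sqrt.
have dK0 : is_derive (Num.sqrt (S 0)) 1 K (K1 (radius p)) by rewrite S0; exact: dK.
have h := is_derive_comp1 (is_derive_comp1 dS dq) dK0.
apply: (is_derive_val (f := fun t : R => K (radius (t *: dir R b + p))) h).
by field; rewrite gt_eqF.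
Qed.

(** For fixed x in [a, b] the map from y to the radius expands distances at least by the factor a /
    (2 b), since (ry - rz) (ry + rz) = (y - z) (y + z). So [negligible_expanding] makes every
    section null, and integration over x concludes. *)
Lemma plane_ae_radius (N : set R) (a b : R) : 0 < a -> mu.-negligible N ->
  mu2.-negligible (box a b `&` radius @^-1` N).
Proof.
move=> a0 [A [mA A0 NA]]; exists (box a b `&` radius @^-1` A); split.
- apply: measurableI; first exact: measurable_box.
  rewrite -[X in measurable X]setTI.
  exact: (continuous_plane_measurable continuous_radius measurableT mA).
- rewrite /mu2 /= /product_measure1 integral0_eq// => x _ /=.
  have [|xab] := boolP (a <= x <= b); last first.
    rewrite (_ : xsection _ _ = set0) ?measure0//; apply/seteqP; split => // y /=.
    by rewrite /xsection/= inE/= => -[/boxE[/= h _]]; rewrite h in xab.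
  move=> /andP[ax xb].
  have b0 : 0 < b by apply: lt_le_trans xb; exact: lt_le_trans ax.
  have neg : mu.-negligible (`[a, b]%classic `&` (fun y => radius (x, y)) @^-1` A).
    apply: (@negligible_expanding R _ _ _ (a / (b + b))); first by rewrite divr_gt0// addr_gt0.
      move=> y z; rewrite /= !in_itv/= => /andP[ay yb] /andP[az zb].
      have rb (w : R) : a <= w -> w <= b -> 0 < radius (x, w) /\ radius (x, w) <= b + b.
        move=> aw wb; have w0 : 0 < w by exact: lt_le_trans aw.
        have x0 : 0 < x by exact: lt_le_trans ax.
        split; first by apply: radius_gt0; rewrite /= addr_gt0// exprn_gt0.
        rewrite -(@ler_pXn2r _ 2)// ?nnegrE ?sqrtr_ge0 ?addr_ge0 ?(ltW b0)// radius_sqr/=.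
        have : x ^+ 2 <= b ^+ 2 by rewrite ler_pXn2r// ?nnegrE ltW.
        have : w ^+ 2 <= b ^+ 2 by rewrite ler_pXn2r// ?nnegrE ltW.
        by have := sqr_ge0 b; rewrite !expr2; clear; lra.
      have [ry0 ryb] := rb y ay yb; have [rz0 rzb] := rb z az zb.
      set ry := radius (x, y) in ry0 ryb *; set rz := radius (x, z) in rz0 rzb *.
      have e : (ry - rz) * (ry + rz) = (y - z) * (y + z).
        have := radius_sqr (x, y); have := radius_sqr (x, z); rewrite -/ry -/rz /= !expr2.
        by clear; lra.
      have : `|ry - rz| * (ry + rz) = `|y - z| * (y + z).
        have y0 : 0 <= y by apply: le_trans ay; exact: ltW.
        have z0 : 0 <= z by apply: le_trans az; exact: ltW.
        by rewrite -[X in _ * X = _]ger0_norm ?addr_ge0 ?(ltW ry0) ?(ltW rz0)//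
           -[X in _ = _ * X]ger0_norm ?addr_ge0// -!normrM e.
      have hh : `|y - z| * (a + a) <= `|y - z| * (y + z) by rewrite ler_wpM2l// lerD.
      have hk : `|ry - rz| * (ry + rz) <= `|ry - rz| * (b + b + (b + b)) by rewrite ler_wpM2l// lerD.
      rewrite mulrAC ler_pdivrMr ?addr_gt0//; move: hh hk; set Y := `|y - z|; set Z := `|ry - rz|.
      by clear; lra.
    by exists A; split.
  have sub : xsection (box a b `&` radius @^-1` A) x `<=`
      `[a, b]%classic `&` (fun y => radius (x, y)) @^-1` A.
    by move=> y; rewrite /xsection/= inE/= => -[/boxE[_ /= h] h2]; split => //=; rewrite in_itv.
  have := negligibleS sub neg => /negligibleP -> //.
  apply: measurable_xsection; apply: measurableI; first exact: measurable_box.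
  rewrite -[X in measurable X]setTI.
  exact: (continuous_plane_measurable continuous_radius measurableT mA).
by move=> p [h1 h2]; split => //; exact: NA.
Qed.

End PlaneGeometry.

(** * The logarithmic solution is not in H^2 of the plane *)

Section SingularExclusion.
Variable R : realType.
Let mu := @lebesgue_measure R.
Let mu2 := (@lebesgue_measure R \x @lebesgue_measure R)%E.
Let T := (measurableTypeR R * measurableTypeR R)%type.
Implicit Types (u v w : R * R -> R) (p q : R * R).

(** As e tends to 0 the squares [e, 2e]^2 eventually avoid any given point, and dominated
    convergence applies. *)
Lemma box_integral_small (f : R * R -> R) (d eta : R) : mu2.-integrable setT (EFin \o f) ->
  0 < d -> 0 < eta -> exists2 e, 0 < e < d & \int[mu2]_(p in box e (2 * e)) f p < eta.
Proof.
move=> fi d0 eta0.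
pose e (n : nat) : R := d / 2 * n.+1%:R^-1.
have e0 n : 0 < e n by rewrite /e mulr_gt0 ?divr_gt0 ?invr_gt0 ?ltr0n.
have ed n : e n < d.
  apply: (@le_lt_trans _ _ (d / 2)); last by clear -d0; lra.
  by rewrite ler_piMr ?invf_le1 ?ler1n// divr_ge0// ltW.
pose F n : T -> \bar R := (EFin \o f) \_ (box (e n) (2 * e n)).
have mF n : measurable_fun setT (F n).
  apply/(measurable_restrictT _ (measurable_box _ _)); apply: measurable_funTS.
  by case/integrableP : fi.
have cF p : F ^~ p @ \oo --> (0 : \bar R)%E.
  apply: cvg_near_cst.
  have [p0|p0] := leP p.1 0.
    apply: nearW => n; rewrite /F /patch ifF//; apply/negP => /set_mem /boxE[/andP[h _] _].
    by have := lt_le_trans (e0 n) h; rewrite ltNge p0.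
  near=> n; rewrite /F /patch ifF//; apply/negP => /set_mem /boxE[/andP[_ h] _].
  suff : 2 * e n < p.1 by rewrite ltNge h.
  have -> : 2 * e n = d * n.+1%:R^-1 by rewrite /e mulrA; congr (_ * _); field.
  rewrite mulrC -ltr_pdivlMr//; near: n.
  by have := near_infty_natSinv_lt (PosNum (divr_gt0 p0 d0)).
have dom : {ae mu2, forall p n, setT p -> (`|F n p| <= (abse \o (EFin \o f)) p)%E}.
  apply: aeW => p n _; rewrite /F /patch; case: ifP => // _.
  by rewrite abse0 abse_ge0.
have lim0 : {ae mu2, forall p, setT p -> F ^~ p @ \oo --> cst 0%E p}.
  by apply: aeW => p _; exact: cF.
have [_ _] := dominated_convergence measurableT mF (measurable_cst _) lim0 (integrable_abse fi) dom.
rewrite integral0 => /fine_cvgP[_ /cvgrPdist_lt /(_ _ eta0) [n _ /(_ n (leqnn n))]].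
rewrite /= sub0r normrN => /ltr_normlW h; exists (e n); first by rewrite e0 ed.
apply: le_lt_trans h; rewrite Rintegral_mkcond le_eqVlt; apply/orP; left; apply/eqP.
congr fine; apply: eq_integral => p _; rewrite /F /patch; by case: ifP.
Unshelve. all: by end_near. Qed.

Lemma plane_support_integral (D : set T) (f : R * R -> R) : (forall p, f p != 0 -> D p) ->
  \int[mu2]_p f p = \int[mu2]_(p in D) f p.
Proof.
move=> fD; rewrite [RHS]Rintegral_mkcond; congr (Rintegral _ _ _); apply/funext => p.
rewrite /patch; case: ifPn => // /negP Dp; apply/eqP; apply: contraT => /fD pD.
by case: Dp; exact/mem_set.
Qed.

Lemma continuous_radial (K : R -> R) p : 0 < p.1 ^+ 2 + p.2 ^+ 2 ->
  (forall r, 0 < r -> {for r, continuous K}) -> {for p, continuous (fun p => K (radius p))}.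
Proof.
move=> p0 cK; apply: (@continuous_comp _ _ _ (@radius R) K); first exact: continuous_radius.
by apply: cK; exact: radius_gt0.
Qed.

Lemma cut_continuous (f : R * R -> R) a : 0 < a ->
  (forall p, 0 < p.1 ^+ 2 + p.2 ^+ 2 -> {for p, continuous f}) ->
  (forall p, f p != 0 -> a <= p.1) -> continuous f.
Proof.
move=> a0 cf fa p; have [pa|pa] := ltP p.1 a; last first.
  by apply: cf; rewrite ltr_wpDr ?sqr_ge0// exprn_gt0// (lt_le_trans a0).
have z q : q.1 < a -> f q = 0.
  by move=> h; apply/eqP; apply: contraTT h => /fa; rewrite -leNgt.
rewrite /prop_for /continuous_at z//; have : (fun=> 0 : R) q @[q --> p] --> (0 : R) by exact: cvg_cst.
apply: cvg_trans; apply: near_eq_cvg; near=> q; rewrite z//; near: q.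
have : q.1 @[q --> p] --> p.1 by exact: cvg_fst.
by move/cvgr_lt => /(_ a pa).
Unshelve. all: by end_near. Qed.

(* Test against bumps supported in the squares [e, 2e]^2: the x-derivative of the profile is of
   order 1/e there, so that the L^2 norm of the weak derivative on the square stays bounded below. *)
Lemma H2_plane_not_singular (k k1 g0 : R -> R) (sg c d : R) : sg ^+ 2 = 1 -> 0 < c -> 0 < d ->
  (forall r : R, 0 < r -> is_derive r 1 k (k1 r)) ->
  (forall r : R, 0 < r -> {for r, continuous k1}) ->
  H2_plane (radial g0) -> {ae mu, forall r, half_line r -> g0 r = k r} ->
  (forall r, 0 < r < d -> c / r <= sg * k1 r) -> False.
Proof.
move=> sg1 c0 d0 dk ck1 [uL /(_ [:: false] isT) [v vL wv]] gk sing.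
have ck r : 0 < r -> {for r, continuous k} by move=> /dk; exact: is_derive_cont.
have [kap kap0 hkap] := bump_half R.
have [mv vi] := (Lfun2P _ _).1 vL.
have [mu0 _] := (Lfun2P _ _).1 uL.
(* The lower bound [c * kap ^+ 2 / (8 * e)] of the derivative, times the area [(e / 2) ^+ 2] of the
   inner square, is exactly [c' * e]. *)
pose c' := c * kap ^+ 2 / 32.
have c'0 : 0 < c' by rewrite /c' divr_gt0// mulr_gt0// exprn_gt0.
(* With e < d / 3 the whole square lies where the singular bound holds: the radius is at most 2 sqrt
   2 e < 3 e there. *)
have [e /andP[e0 ed] small] := box_integral_small vi (divr_gt0 d0 (ltr0Sn R 2)) (exprn_gt0 2 c'0).
have en := lt0r_neq0 e0.
pose be t : R := bump (2 / e * t + - 3).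
have sbe : smooth be by apply: smooth_affine; exact: smooth_bump.
have sdbe := smooth_derive sbe.
have be_supp t : be t != 0 -> e <= t <= 2 * e.
  apply: contraNT; rewrite negb_and -!ltNge => ht; apply/eqP/bump_eq0.
  have E : t = e / 2 * (2 / e * t) by field.
  rewrite ler_normr; case/orP: ht => ht; apply/orP; [right|left].
    have : 2 / e * t < 2 by rewrite mulrAC ltr_pdivrMr// ltr_pM2l.
    by clear; lra.
  have : 4 < 2 / e * t by rewrite mulrAC ltr_pdivlMr//; clear -ht; lra.
  by clear; lra.
have dbe_supp := derive1_support sbe be_supp.
have supp_norm (f : R -> R) : (forall t, f t != 0 -> e <= t <= 2 * e) ->
    forall t, f t != 0 -> `|t| <= 2 * e.
  move=> hf t /hf /andP[t1 t2]; rewrite ger0_norm//; apply: le_trans t1; exact: ltW.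
pose phi := tensor be be; pose phi1 := tensor (derive1 be) be.
have tphi : test_plane phi by apply: test_tensor => //; exact: supp_norm.
have dphi p : is_derive p (dir R false) phi (phi1 p) by exact: (is_derive_tensor false).
have pphi : partials [:: false] phi = phi1 by apply/funext => p /=; have [_ ->] := dphi p.
have phi_box p : phi p != 0 -> box e (2 * e) p.
  by rewrite /phi /tensor mulf_eq0 negb_or => /andP[/be_supp h1 /be_supp h2]; apply/boxE.
have phi1_box p : phi1 p != 0 -> box e (2 * e) p.
  by rewrite /phi1 /tensor mulf_eq0 negb_or => /andP[/dbe_supp h1 /be_supp h2]; apply/boxE.
have phi01 p : 0 <= phi p <= 1.
  by rewrite /phi /tensor mulr_ge0 ?bump_ge0//= mulr_ile1 ?bump_ge0 ?bump_le1.
have cphi : continuous phi by apply: continuous_tensor; exact: smooth_continuous.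
have cphi1 : continuous phi1 by apply: continuous_tensor; exact: smooth_continuous.
have boxM p : box e (2 * e) p -> `|p| <= 2 * e.
  move=> /boxE[/andP[h1 h2] /andP[h3 h4]]; rewrite prod_normE/= ge_max.
  by rewrite !ger0_norm ?h2//; [apply: le_trans h3|apply: le_trans h1]; exact: ltW.
pose W p : R := k1 (radius p) / radius p * p.1 * phi p.
pose Z p : R := k (radius p) * phi1 p.
have cW : continuous W.
  apply: (@cut_continuous _ e e0) => [p p0|p].
    apply: cvgM; last exact: cphi.
    apply: cvgM; last exact: cvg_fst.
    apply: cvgM; first exact: (continuous_radial p0 ck1).
    apply: (@continuous_radial (fun r => r^-1) p p0) => r r0.
    by apply: (@cvgV _ _ _ _ id); [exact: lt0r_neq0|exact: cvg_id].
  by rewrite /W mulf_eq0 negb_or => /andP[_ /phi_box /boxE[/andP[]]].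
have cZ : continuous Z.
  apply: (@cut_continuous _ e e0) => [p p0|p].
    by apply: cvgM; [exact: (continuous_radial p0 ck)|exact: cphi1].
  by rewrite /Z mulf_eq0 negb_or => /andP[_ /phi1_box /boxE[/andP[]]].
have WM p : W p != 0 -> `|p| <= 2 * e.
  by rewrite /W mulf_eq0 negb_or => /andP[_ /phi_box /boxM].
have ZM p : Z p != 0 -> `|p| <= 2 * e.
  by rewrite /Z mulf_eq0 negb_or => /andP[_ /phi1_box /boxM].
have iW := continuous_support_integrable cW WM.
have iZ := continuous_support_integrable cZ ZM.
have ibp : \int[mu2]_p W p + \int[mu2]_p Z p = 0.
  rewrite -RintegralD//.
  have iWZ : mu2.-integrable setT (EFin \o (fun p => W p + Z p)).
    by apply: eq_integrable (integrableD measurableT iW iZ).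
  apply: (@plane_ibp R false (fun p => k (radius p) * phi p) _ (2 * e)) => //.
  - move=> p p0; have h1 := is_derive_radial false p0 dk; have h2 := dphi p.
    have h := @is_deriveM _ _ (fun p => k (radius p)) phi p (dir R false) _ _ h1 h2.
    apply: (@is_derive_eq _ _ _ _ _ _ _ _ h).
    by rewrite /W /Z /GRing.scale/=; ring.
  - by move=> p _; apply: cvgD; [exact: cW|exact: cZ].
  - by move=> p; rewrite mulf_eq0 negb_or => /andP[_ /phi_box /boxM].
  move=> p h; have [w0|/WM//] := eqVneq (W p) 0.
  by apply: ZM; move: h; rewrite w0 add0r.
have wk := wv phi tphi; rewrite pphi /= expr1 mulN1r in wk.
have uZ : \int[mu2]_p (radial g0 p * phi1 p) = \int[mu2]_p Z p.
  rewrite /Rintegral; congr fine; apply: ae_eq_integral => //.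
  - apply/measurable_EFinP; apply: measurable_funM => //.
    exact: continuous_plane_measurable.
  - by case/integrableP : iZ.
  apply: negligibleS (plane_ae_radius (2 * e) e0 gk) => p /= hp.
  have [p0|p0] := eqVneq (phi1 p) 0; first by case: hp => _; rewrite /Z p0 !mulr0.
  split; first exact: phi1_box.
  move=> h; apply: hp => _; congr (_%:E); rewrite /Z /radial; congr (_ * _).
  apply: h; rewrite half_lineE; apply: radius_gt0.
  have /boxE[/andP[h1 _] _] := phi1_box p p0.
  by rewrite ltr_wpDr ?sqr_ge0// exprn_gt0// (lt_le_trans e0).
have vW : \int[mu2]_p (v p * phi p) = \int[mu2]_p W p by move: wk ibp; rewrite uZ; lra.
have sgn : `|sg| = 1 by move: sg1 => /eqP; rewrite sqrf_eq1 => /orP[/eqP ->|/eqP ->]; rewrite ?normrN normr1.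
(* On the inner square the arguments of both bumps are in [-1/2, 1/2], so each factor is at least
   [kap]. *)
pose Q := box e (2 * e); pose Q' : set T := box (5 / 4 * e) (7 / 4 * e).
have mQ : measurable Q by exact: measurable_box.
have mQ' : measurable Q' by exact: measurable_box.
pose S := \int[mu2]_(p in Q) (v p ^+ 2).
have S_small : S < c' ^+ 2 by exact: small.
have muQ : fine (mu2 Q) = e ^+ 2.
  have -> : mu2 Q = ((2 * e - e) ^+ 2)%:E by apply: box_measure; clear -e0; lra.
  by rewrite /=; ring.
have muQ' : fine (mu2 Q') = (e / 2) ^+ 2.
  have -> : mu2 Q' = ((7 / 4 * e - 5 / 4 * e) ^+ 2)%:E by apply: box_measure; clear -e0; lra.
  by rewrite /=; field.
have finQ : (mu2 Q < +oo)%E.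
  have -> : mu2 Q = ((2 * e - e) ^+ 2)%:E by apply: box_measure; clear -e0; lra.
  exact: ltry.
have finQ' : (mu2 Q' < +oo)%E.
  have -> : mu2 Q' = ((7 / 4 * e - 5 / 4 * e) ^+ 2)%:E by apply: box_measure; clear -e0; lra.
  exact: ltry.
have icst (D : set T) (r : R) : measurable D -> (mu2 D < +oo)%E -> mu2.-integrable D (EFin \o (fun=> r)).
  move=> mD fD; apply: (@measurable_bounded_integrable _ _ _ mu2 (fun=> r) D mD) => //.
  by exists `|r|; split => // y ry p _ /=; exact: ltW.
pose low := c * kap ^+ 2 / (8 * e).
have low0 : 0 <= low by rewrite /low divr_ge0 ?mulr_ge0 ?sqr_ge0// ltW.
(* On the square the first coordinate is at least e and the squared radius at most 8 e^2, so c x /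
   r^2 >= c / (8 e). *)
have Wlow p : low * (phi p / kap ^+ 2) <= sg * W p.
  have [p0|p0] := eqVneq (phi p) 0; first by rewrite /W p0 mul0r !mulr0.
  have /boxE[/andP[h1 h2] /andP[h3 h4]] := phi_box p p0.
  have P0 : 0 < p.1 ^+ 2 + p.2 ^+ 2.
    by rewrite ltr_wpDr ?sqr_ge0// exprn_gt0// (lt_le_trans e0).
  have r0 := radius_gt0 P0; have rsq := radius_sqr p.
  have b1 : p.1 ^+ 2 <= (2 * e) ^+ 2.
    by rewrite ler_pXn2r// nnegrE; [apply: le_trans h1|apply: mulr_ge0]; rewrite ?ltW.
  have b2 : p.2 ^+ 2 <= (2 * e) ^+ 2.
    by rewrite ler_pXn2r// nnegrE; [apply: le_trans h3|apply: mulr_ge0]; rewrite ?ltW.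
  have rd : radius p < d.
    apply: (@le_lt_trans _ _ (3 * e)); last by clear -ed; lra.
    rewrite -(@ler_pXn2r _ 2)// ?nnegrE ?sqrtr_ge0 ?mulr_ge0 ?(ltW e0)// rsq.
    by move: b1 b2; have := sqr_ge0 e; rewrite !exprMn; clear; lra.
  have /andP[f0 _] := phi01 p.
  have hs := sing (radius p); rewrite r0 rd in hs; have {}hs := hs isT.
  rewrite /W (_ : sg * _ = (sg * k1 (radius p)) * (p.1 / radius p) * phi p); last by ring.
  have -> : low * (phi p / kap ^+ 2) = c / (8 * e) * phi p.
    by rewrite /low; field; rewrite en gt_eqF.
  rewrite ler_wpM2r//.
  apply: (@le_trans _ _ (c / radius p * (p.1 / radius p))); last first.
    by rewrite ler_wpM2r// divr_ge0 ?(ltW r0)// (le_trans (ltW e0)).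
  have -> : c / radius p * (p.1 / radius p) = c * p.1 / (radius p ^+ 2).
    by field; rewrite gt_eqF.
  rewrite rsq ler_pdivlMr// mulrAC ler_pdivrMr ?mulr_gt0// -mulrA ler_wpM2l ?(ltW c0)//.
  apply: (@le_trans _ _ (e * (8 * e))); last by rewrite ler_wpM2r// mulr_ge0// ltW.
  by move: b1 b2; rewrite !expr2; clear; lra.
have iWs : mu2.-integrable setT (EFin \o (fun p => sg * W p)).
  by apply: eq_integrable (integrableZl measurableT sg iW).
have lower : c' * e <= sg * \int[mu2]_p W p.
  rewrite -RintegralZl//.
  have -> : c' * e = \int[mu2]_p (((fun=> low) \_ Q') p).
    rewrite -Rintegral_mkcond; apply: etrans (esym (Rintegral_cst mu2 mQ' low)).
    by rewrite muQ' /low /c'; field.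
  apply: le_Rintegral => //; first by have := (integrable_mkcond _ mQ').1 (icst Q' low mQ' finQ');
    congr (integrable _ _ _); apply/funext => p; rewrite /patch/=; case: ifP.
  move=> p _; rewrite /patch; case: ifPn => [/set_mem /boxE[/andP[h1 h2] /andP[h3 h4]]|_].
    apply: le_trans (Wlow p); rewrite ler_peMr// ler_pdivlMr ?exprn_gt0// mul1r expr2.
    have bl t : 5 / 4 * e <= t -> t <= 7 / 4 * e -> kap <= be t.
      move=> t1 t2; apply: hkap; rewrite ler_norml.
      have g1 : 5 / 2 <= 2 / e * t by rewrite mulrAC ler_pdivlMr//; clear -t1; lra.
      have g2 : 2 / e * t <= 7 / 2 by rewrite mulrAC ler_pdivrMr//; clear -t2; lra.
      by clear -g1 g2; lra.
    by rewrite /phi /tensor; apply: ler_pM; [exact: ltW|exact: ltW|exact: bl|exact: bl].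
  apply: le_trans (Wlow p); have /andP[f0 _] := phi01 p.
  by rewrite mulr_ge0// divr_ge0// sqr_ge0.
have viQ : mu2.-integrable Q (EFin \o (fun p => v p ^+ 2)) by apply: integrableS vi.
(* Cauchy-Schwarz in additive form. With the weight e / c' both terms of the integrated bound are at
   most c' e / 2, the first one strictly below, which contradicts the lower bound c' e. *)
have sq_bound p : `|v p * phi p| <= e / (2 * c') * v p ^+ 2 + c' / (2 * e).
  have /andP[f0 f1] := phi01 p.
  rewrite normrM (ger0_norm f0); apply: (@le_trans _ _ `|v p|); first by rewrite ler_piMr.
  rewrite -(real_normK (num_real (v p))); set y := `|v p|.
  have -> : e / (2 * c') * y ^+ 2 + c' / (2 * e) = y + c' / (2 * e) * (e * y / c' - 1) ^+ 2.
    by field; rewrite en gt_eqF.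
  by rewrite lerDl mulr_ge0 ?sqr_ge0// divr_ge0 ?mulr_ge0 ?ltW.
have ibd : mu2.-integrable Q (EFin \o (fun p => e / (2 * c') * v p ^+ 2 + c' / (2 * e))).
  apply: eq_integrable (integrableD mQ (integrableZl mQ (e / (2 * c')) viQ) (icst Q (c' / (2 * e)) mQ finQ)) => //.
have ivphi : mu2.-integrable Q (EFin \o (fun p => v p * phi p)).
  apply: (@le_integrable _ _ _ mu2 Q mQ _ _ _ _ ibd).
    apply/measurable_EFinP; apply: measurable_funTS; apply: measurable_funM => //.
    exact: continuous_plane_measurable.
  move=> p _ /=; rewrite lee_fin; apply: le_trans (sq_bound p) _; exact: ler_norm.
have upper : sg * \int[mu2]_p (v p * phi p) <= e / (2 * c') * S + c' / (2 * e) * e ^+ 2.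
  rewrite (@plane_support_integral Q); last first.
    by move=> p; rewrite mulf_eq0 negb_or => /andP[_ /phi_box].
  rewrite -RintegralZl//.
  have -> : e / (2 * c') * S + c' / (2 * e) * e ^+ 2 =
      \int[mu2]_(p in Q) (e / (2 * c') * v p ^+ 2 + c' / (2 * e)).
    rewrite RintegralD//; last 2 first.
    - by apply: eq_integrable (integrableZl mQ (e / (2 * c')) viQ).
    - exact: icst.
    have -> : \int[mu2]_(p in Q) (e / (2 * c') * v p ^+ 2) = e / (2 * c') * S.
      exact: RintegralZl.
    have -> // : \int[mu2]_(p in Q) (c' / (2 * e)) = c' / (2 * e) * e ^+ 2.
    by apply: etrans (Rintegral_cst mu2 mQ _) _; rewrite muQ.
  apply: le_Rintegral => //; first by apply: eq_integrable (integrableZl mQ sg ivphi).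
  move=> p _; apply: le_trans (sq_bound p).
  by apply: le_trans (ler_norm _) _; rewrite normrM sgn mul1r.
rewrite vW in upper.
have : c' * e <= e / (2 * c') * S + c' / (2 * e) * e ^+ 2 by exact: le_trans upper.
rewrite leNgt => /negP; apply.
have -> : c' / (2 * e) * e ^+ 2 = c' * e / 2 by field.
have : e / (2 * c') * S < e / (2 * c') * c' ^+ 2 by rewrite ltr_pM2l// divr_gt0// mulr_gt0.
have -> : e / (2 * c') * c' ^+ 2 = c' * e / 2 by field; rewrite gt_eqF.
by clear; lra.
Qed.

End SingularExclusion.

(** * Decaying radial solutions lie in H^2 of the plane *)

Section RadialSobolev.
Variable R : realType.
Let mu := @lebesgue_measure R.
Let mu2 := (@lebesgue_measure R \x @lebesgue_measure R)%E.
Let T := (measurableTypeR R * measurableTypeR R)%type.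
Implicit Types (u v w : R * R -> R) (p q : R * R).

Lemma integrable_inv_oneDsqr : mu.-integrable setT (EFin \o (fun x : R => (1 + x ^+ 2)^-1)).
Proof.
have pos (x : R) : 0 < 1 + x ^+ 2 by rewrite ltr_pwDl// sqr_ge0.
have cf : continuous (fun x : R => (1 + x ^+ 2)^-1).
  move=> x; apply: cvgV; first exact: lt0r_neq0.
  by apply: cvgD; [exact: cvg_cst|exact: exprn_continuous].
have f0 (x : R) : 0 <= (1 + x ^+ 2)^-1 by rewrite invr_ge0 ltW.
apply/integrableP; split.
  by apply/measurable_EFinP; exact: continuous_measurable_fun.
under eq_integral do rewrite /= ger0_norm//.
rewrite ge0_symfun_integralT//; last by move=> x /=; rewrite sqrrN.
have -> : [set x : R | 0 <= x] = `[0, +oo[%classic.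
  by apply/seteqP; split => x/=; rewrite in_itv/= andbT.
rewrite (@ge0_continuous_FTC2y _ _ atan 0 (pi / 2))//.
- by rewrite -EFinB -EFinM ltry.
- exact: continuous_subspaceT.
- exact: cvgy_atan.
- apply: cvg_at_right_filter; exact: continuous_atan.
by move=> x _; rewrite derive1_atan.
Qed.

Lemma integrable_decay : mu2.-integrable setT
  (EFin \o (fun p : R * R => (1 + p.1 ^+ 2)^-1 * (1 + p.2 ^+ 2)^-1)).
Proof.
have pos (x : R) : 0 < 1 + x ^+ 2 by rewrite ltr_pwDl// sqr_ge0.
have f0 (x : R) : 0 <= (1 + x ^+ 2)^-1 by rewrite invr_ge0 ltW.
have cf : continuous (fun x : R => (1 + x ^+ 2)^-1).
  move=> x; apply: cvgV; first exact: lt0r_neq0.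
  by apply: cvgD; [exact: cvg_cst|exact: exprn_continuous].
have mf : measurable_fun (setT : set T) (fun p : R * R => (1 + p.1 ^+ 2)^-1 * (1 + p.2 ^+ 2)^-1).
  by apply: continuous_plane_measurable; exact: (continuous_tensor cf cf).
apply/integrableP; split; first exact/measurable_EFinP.
under eq_integral do rewrite /= ger0_norm ?mulr_ge0//.
have mE : measurable_fun (setT : set T) (EFin \o (fun p : R * R => (1 + p.1 ^+ 2)^-1 * (1 + p.2 ^+ 2)^-1)).
  exact/measurable_EFinP.
rewrite (@fubini_tonelli1 _ _ _ _ R mu mu _ mE); last by move=> p /=; rewrite lee_fin mulr_ge0.
pose I := (\int[mu]_x ((1 + x ^+ 2)^-1)%:E)%E.
have Ifin : (I < +oo)%E.
  have := integrable_inv_oneDsqr => /integrableP[_].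
  by under eq_integral do rewrite /= ger0_norm//.
have I0 : (0 <= I)%E by apply: integral_ge0 => x _; rewrite lee_fin.
have mg : measurable_fun setT (fun x : R => ((1 + x ^+ 2)^-1)%:E).
  by apply/measurable_EFinP; exact: continuous_measurable_fun.
under eq_integral => x _.
  rewrite (_ : fubini_F _ _ x = ((1 + x ^+ 2)^-1)%:E * I)%E; first over.
  rewrite /fubini_F /=; under eq_integral do rewrite EFinM.
  by rewrite ge0_integralZl ?lee_fin//; move=> y _; rewrite lee_fin.
under eq_integral do rewrite muleC.
rewrite ge0_integralZl//; last by move=> y _; rewrite lee_fin.
by apply: lte_mul_pinfty => //; rewrite ge0_fin_numE.
Qed.

(** As (1 + x^2) (1 + y^2) <= (1 + r^2)^2, inverse square decay is dominated by a tensor product,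
    whose integral reduces to that of the derivative of [atan]. *)
Lemma decay_Lfun2 (v : R * R -> R) (C : R) : measurable_fun (setT : set T) v ->
  (forall p, `|v p| * (1 + radius p ^+ 2) <= C) -> v \in Lfun mu2 2%:E.
Proof.
move=> mv vC; apply/Lfun2P; split => //.
have pos (x : R) : 0 < 1 + x ^+ 2 by rewrite ltr_pwDl// sqr_ge0.
apply: (@le_integrable _ _ _ mu2 _ measurableT _ _ _ _ (integrableZl measurableT (C ^+ 2) integrable_decay)).
  by apply/measurable_EFinP; apply: measurable_funX.
move=> p _ /=; rewrite lee_fin ger0_norm ?sqr_ge0// ger0_norm; last first.
  by apply: mulr_ge0; [exact: sqr_ge0|apply: mulr_ge0; rewrite invr_ge0 ltW].
rewrite -invfM ler_pdivlMr ?mulr_gt0//.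
apply: (@le_trans _ _ (`|v p| ^+ 2 * (1 + radius p ^+ 2) ^+ 2)).
  rewrite real_normK ?num_real// ler_wpM2l ?sqr_ge0// radius_sqr.
  have := sqr_ge0 p.1; have := sqr_ge0 p.2; set x := p.1 ^+ 2; set y := p.2 ^+ 2 => y0 x0.
  have := mulr_ge0 x0 y0; have := sqr_ge0 x; have := sqr_ge0 y; rewrite !expr2.
  by move: x0 y0; clear; lra.
rewrite -exprMn ler_pXn2r// nnegrE; first by rewrite mulr_ge0// ltW.
by apply: le_trans (vC p); rewrite mulr_ge0// ltW.
Qed.

Lemma measurable_radial (K : R -> R) : (forall r, 0 < r -> {for r, continuous K}) ->
  measurable_fun (setT : set T) (fun p : R * R => K (radius p)).
Proof.
move=> cK; pose L r : R := K 0 + ((fun r => K r - K 0) \_ half_line) r.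
have -> : (fun p : R * R => K (radius p)) = L \o (@radius R).
  apply/funext => p; rewrite /L /patch /=; have := sqrtr_ge0 (p.1 ^+ 2 + p.2 ^+ 2).
  rewrite -/(radius p) le_eqVlt => /predU1P[<-|r0].
    by case: ifP => _; rewrite ?subrr addr0.
  by rewrite mem_set ?half_lineE// addrC subrK.
apply: measurableT_comp; last exact: (continuous_plane_measurable (@continuous_radius R)).
apply: measurable_funD => //.
apply/(measurable_restrictT _ (@measurable_half_line R)).
apply: measurable_funB => //; apply: open_continuous_measurable_fun.
  exact: interval_open.
by move=> r /set_mem; rewrite half_lineE; exact: cK.
Qed.

Lemma is_derive_zero_near (f : R * R -> R) p (v : R * R) (d : R) : (\forall q \near p, f q = 0) ->
  is_derive p v f d -> d = 0.
Proof.
move=> f0 hf; have h : is_derive p v (cst 0) d.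
  by apply: near_eq_is_derive hf; near=> q; rewrite /cst; apply: (near f0 q).
by have [_ <-] := h; rewrite derive_cst.
Unshelve. all: by end_near. Qed.

Lemma is_derive_support (f f1 : R * R -> R) (v : R * R) M : (forall p, is_derive p v f (f1 p)) ->
  (forall p, f p != 0 -> `|p| <= M) -> forall p, f1 p != 0 -> `|p| <= M.
Proof.
move=> df fM p; apply: contraNT; rewrite -ltNge => pM; apply/eqP.
apply: (is_derive_zero_near _ (df p)); near=> q.
apply/eqP; apply: contraT => /fM; rewrite leNgt => /negP; case.
near: q; have : `|q| @[q --> p] --> `|p| by exact: norm_continuous.
by move/cvgr_gt => /(_ M pM).
Unshelve. all: by end_near. Qed.

Lemma test_plane_derive (phi : R * R -> R) s b p : test_plane phi ->
  is_derive p (dir R b) (partials s phi) (partials (b :: s) phi p).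
Proof. by move=> [_ h _]; split; [exact: h|]. Qed.

Lemma test_plane_support (phi : R * R -> R) : test_plane phi ->
  exists M, forall s p, partials s phi p != 0 -> `|p| <= M.
Proof.
move=> tphi; have [_ _ [M hM]] := tphi; exists M; elim=> [//|b s IH].
by apply: (is_derive_support (fun p => test_plane_derive s b p tphi)).
Qed.

(** One integration by parts. Boundedness of [w] and [w1] makes the integrands integrable and allows
    both to be discontinuous at the origin. *)
Lemma weak_partial_step (w w1 : R * R -> R) (b : bool) s (phi : R * R -> R) C : test_plane phi ->
  measurable_fun (setT : set T) w -> measurable_fun (setT : set T) w1 ->
  (forall p, `|w p| <= C) -> (forall p, `|w1 p| <= C) ->
  (forall p, 0 < p.1 ^+ 2 + p.2 ^+ 2 -> is_derive p (dir R b) w (w1 p) /\ {for p, continuous w}) ->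
  (forall p, 0 < p.1 ^+ 2 + p.2 ^+ 2 -> {for p, continuous w1}) ->
  \int[mu2]_p (w p * partials (b :: s) phi p) = - \int[mu2]_p (w1 p * partials s phi p).
Proof.
move=> tphi mw mw1 wC w1C dw cw1.
have [cphi _ _] := tphi; have [M hM] := test_plane_support tphi.
have ii (z : R * R -> R) s' : measurable_fun (setT : set T) z -> (forall p, `|z p| <= C) ->
    mu2.-integrable setT (EFin \o (fun p => z p * partials s' phi p)).
  move=> mz zC.
  have ip := continuous_support_integrable (cphi s') (hM s').
  apply: (@le_integrable _ _ _ mu2 _ measurableT _ _ _ _ (integrableZl measurableT C ip)).
    by apply/measurable_EFinP; apply: measurable_funM => //; exact: continuous_plane_measurable.
  move=> p _ /=; rewrite lee_fin !normrM ler_wpM2r//.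
  exact: le_trans (zC p) (ler_norm _).
apply/eqP; rewrite -addr_eq0; apply/eqP; rewrite -RintegralD//; try exact: ii.
apply: (@plane_ibp R b (fun p => w p * partials s phi p) _ M).
- by apply: eq_integrable (integrableD measurableT (ii w (b :: s) mw wC) (ii w1 s mw1 w1C)).
- move=> p p0; have [h1 _] := dw p p0; have h2 := test_plane_derive s b p tphi.
  have h := @is_deriveM _ _ w (partials s phi) p (dir R b) _ _ h1 h2.
  by apply: (@is_derive_eq _ _ _ _ _ _ _ _ h); rewrite /GRing.scale/=; ring.
- move=> p p0; have [_ cw] := dw p p0; apply: cvgD; apply: cvgM => //; try exact: cphi.
  exact: cw1.
- by move=> p; rewrite mulf_eq0 negb_or => /andP[_ /hM].
move=> p h; have [w0|/hM//] := eqVneq (partials s phi p) 0.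
by apply: (hM (b :: s)); apply: contraNneq h => h; rewrite w0 h !mulr0 addr0.
Qed.

Definition coord (b : bool) p : R := if b then p.2 else p.1.

Lemma is_derive_coord (b c : bool) p : is_derive p (dir R c) (coord b) (b == c)%:R.
Proof.
apply: is_derive_line; rewrite /coord /dir.
suff : is_derive (0 : R) 1 (fun t : R => t * (b == c)%:R + (if b then p.2 else p.1)) (b == c)%:R.
  congr (is_derive _ _ _ _); apply/funext => t /=.
  by case: b; case: c => /=; rewrite /GRing.scale/=.
by derive; ring.
Qed.

Lemma continuous_coord (b : bool) : continuous (coord b).
Proof. by move=> p; rewrite /coord; case: b; [exact: cvg_snd|exact: cvg_fst]. Qed.

Lemma coord_le_radius (b : bool) p : `|coord b p| <= radius p.
Proof.
rewrite -(@ler_pXn2r _ 2)// ?nnegrE ?sqrtr_ge0// radius_sqr real_normK ?num_real// /coord.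
by case: b; rewrite ?lerDl ?lerDr sqr_ge0.
Qed.

(** With ka = g' / r and q = ka' / r, the gradient is ka x_b and the Hessian q x_b x_c + ka
    delta_bc. The equation gives r^2 q = V g - 2 ka, so second derivatives inherit the decay of g
    and ka. The bound by [C * r] says that ka stays bounded at the origin. *)
Lemma H2_plane_radial (V g g1 : R -> R) C : (forall r, 0 < r -> {for r, continuous V}) ->
  (forall r, 0 < r -> `|V r| <= 1) ->
  (forall r : R, 0 < r -> is_derive r 1 g (g1 r) /\ is_derive r 1 g1 (V r * g r - g1 r / r)) ->
  (forall r, 0 <= r -> `|g r| * (1 + r ^+ 2) <= C) ->
  (forall r, 0 < r -> `|g1 r| * (1 + r ^+ 2) <= C) ->
  (forall r, 0 < r -> `|g1 r| * (1 + r ^+ 2) <= C * r) ->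
  H2_plane (radial g).
Proof.
move=> cV V1 dg gC g1C g1rC.
have C0 : 0 <= C by apply: le_trans (gC 0 (lexx 0)); rewrite mulr_ge0// addr_ge0// sqr_ge0.
have cg r : 0 < r -> {for r, continuous g} by move=> /dg[/is_derive_cont].
have cg1 r : 0 < r -> {for r, continuous g1} by move=> /dg[_ /is_derive_cont].
have cinv r : 0 < r -> {for r, continuous (fun r : R => r^-1)}.
  by move=> r0; apply: (@cvgV _ _ _ _ id); [exact: lt0r_neq0|exact: cvg_id].
pose ka r : R := g1 r / r.
pose ka1 r : R := (V r * g r - 2 * ka r) / r.
have dka (r : R) : 0 < r -> is_derive r 1 ka (ka1 r).
  move=> r0; have [_ h] := dg r r0; have rn := lt0r_neq0 r0.
  by rewrite /ka /ka1 /ka; derive => //; field.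
have cka r : 0 < r -> {for r, continuous ka} by move=> /dka /is_derive_cont.
have cka1 r : 0 < r -> {for r, continuous ka1}.
  move=> r0; apply: cvgM; last exact: cinv.
  by apply: cvgB; apply: cvgM; [exact: cV|exact: cg|exact: cvg_cst|exact: cka].
pose q r : R := ka1 r / r.
have cq r : 0 < r -> {for r, continuous q}.
  by move=> r0; apply: cvgM; [exact: cka1|exact: cinv].
pose u : R * R -> R := fun p => g (radius p).
pose u1 (b : bool) p : R := ka (radius p) * coord b p.
pose u2 (b c : bool) p : R := q (radius p) * (coord b p * coord c p) + ka (radius p) * (b == c)%:R.
have mcoord b : measurable_fun (setT : set T) (coord b).
  by apply: continuous_plane_measurable; exact: continuous_coord.
have mu_ : measurable_fun (setT : set T) u by exact: measurable_radial.
have mu1 b : measurable_fun (setT : set T) (u1 b).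
  by apply: measurable_funM => //; exact: measurable_radial.
have mu2' b c : measurable_fun (setT : set T) (u2 b c).
  apply: measurable_funD; apply: measurable_funM => //; try exact: measurable_radial.
  exact: measurable_funM.
have pos (x : R) : 0 < 1 + x ^+ 2 by rewrite ltr_pwDl// sqr_ge0.
have kaC r : 0 < r -> `|ka r| * (1 + r ^+ 2) <= C.
  move=> r0; rewrite /ka normrM normfV (gtr0_norm r0) mulrAC ler_pdivrMr//; exact: g1rC.
have radiusP p : radius p = 0 \/ 0 < p.1 ^+ 2 + p.2 ^+ 2 /\ 0 < radius p.
  have := sqrtr_ge0 (p.1 ^+ 2 + p.2 ^+ 2); rewrite -/(radius p) le_eqVlt => /predU1P[<-|r0].
    by left.
  by right; split => //; rewrite -sqrtr_gt0.
have uB p : `|u p| * (1 + radius p ^+ 2) <= 4 * C.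
  by apply: le_trans (gC _ (sqrtr_ge0 _)) _; clear -C0; lra.
have u1B b p : `|u1 b p| * (1 + radius p ^+ 2) <= 4 * C.
  have [r0|[_ r0]] := radiusP p.
    by rewrite /u1 /ka r0 invr0 mulr0 mul0r normr0 mul0r mulr_ge0.
  apply: (@le_trans _ _ C); last by clear -C0; lra.
  apply: le_trans (g1C _ r0); rewrite ler_wpM2r ?(ltW (pos _))//.
  rewrite /u1 /ka !normrM normfV (gtr0_norm r0) mulrAC ler_pdivrMr//.
  by rewrite ler_wpM2l// coord_le_radius.
have u2B b c p : `|u2 b c p| * (1 + radius p ^+ 2) <= 4 * C.
  have [r0|[_ r0]] := radiusP p.
    by rewrite /u2 /q /ka1 /ka r0 invr0 !mulr0 !mul0r addr0 normr0 mul0r mulr_ge0.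
  have s0 := pos (radius p); have k := kaC _ r0; have gg := gC _ (ltW r0).
  have dlt : `|ka (radius p) * (b == c)%:R| <= `|ka (radius p)|.
    by rewrite normrM ler_piMr// normr_nat lern1; case: (b == c).
  have qq : `|q (radius p) * (coord b p * coord c p)| <= `|g (radius p)| + 2 * `|ka (radius p)|.
    set A := `|ka _|; rewrite /q /ka1 !normrM normfV (gtr0_norm r0) {}/A.
    apply: (@le_trans _ _ (`|V (radius p) * g (radius p) - 2 * ka (radius p)| / radius p / radius p *
        (radius p * radius p))).
      rewrite ler_wpM2l//; last by apply: ler_pM => //; exact: coord_le_radius.
      by rewrite !mulr_ge0// invr_ge0 ltW.
    rewrite (_ : _ * (radius p * radius p) = `|V (radius p) * g (radius p) - 2 * ka (radius p)|); last first.
      by field; rewrite gt_eqF.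
    have h1 : `|V (radius p) * g (radius p)| <= `|g (radius p)|.
      by rewrite normrM ler_piMl// V1.
    have h2 : `|2 * ka (radius p)| <= 2 * `|ka (radius p)|.
      by rewrite normrM (ger0_norm (ler0n R 2)).
    exact: le_trans (ler_normB _ _) (lerD h1 h2).
  apply: (@le_trans _ _ ((`|g (radius p)| + 3 * `|ka (radius p)|) * (1 + radius p ^+ 2))).
    rewrite ler_wpM2r ?(ltW s0)//; apply: le_trans (ler_normD _ _) _.
    by move: qq dlt; clear; lra.
  rewrite mulrDl -mulrA; move: gg k; clear; lra.
have bnd w : (forall p, `|w p| * (1 + radius p ^+ 2) <= 4 * C) -> forall p, `|w p| <= 4 * C.
  move=> h p; apply: le_trans (h p); rewrite ler_peMr// lerDl; exact: sqr_ge0.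
have du b p : 0 < p.1 ^+ 2 + p.2 ^+ 2 -> is_derive p (dir R b) u (u1 b p) /\ {for p, continuous u}.
  move=> p0; split; last exact: (continuous_radial p0 cg).
  by have := is_derive_radial b p0 (fun r r0 => (dg r r0).1).
have cu1 b p : 0 < p.1 ^+ 2 + p.2 ^+ 2 -> {for p, continuous (u1 b)}.
  by move=> p0; apply: cvgM; [exact: (continuous_radial p0 cka)|exact: continuous_coord].
have du1 b c p : 0 < p.1 ^+ 2 + p.2 ^+ 2 ->
    is_derive p (dir R c) (u1 b) (u2 b c p) /\ {for p, continuous (u1 b)}.
  move=> p0; split; last exact: cu1.
  have h1 := is_derive_radial c p0 dka; have h2 := is_derive_coord b c p.
  have h := @is_deriveM _ _ (fun p => ka (radius p)) (coord b) p (dir R c) _ _ h1 h2.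
  by apply: (@is_derive_eq _ _ _ _ _ _ _ _ h); rewrite /u2 /q /GRing.scale/= -/(coord c p); ring.
have cu2 b c p : 0 < p.1 ^+ 2 + p.2 ^+ 2 -> {for p, continuous (u2 b c)}.
  move=> p0; apply: cvgD; apply: cvgM; try exact: cvg_cst; try exact: (continuous_radial p0 cka).
    exact: (continuous_radial p0 cq).
  by apply: cvgM; exact: continuous_coord.
split; first exact: decay_Lfun2 uB.
case=> [|b [|c [|//]]] _.
- by exists u; [exact: decay_Lfun2 uB|move=> phi _; rewrite mul1r].
- exists (u1 b); first exact: decay_Lfun2 (u1B b).
  move=> phi tphi; rewrite expr1 mulN1r.
  exact: (@weak_partial_step u (u1 b) b [::] phi (4 * C) tphi mu_ (mu1 b) (bnd _ uB)
    (bnd _ (u1B b)) (du b) (cu1 b)).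
exists (u2 b c); first exact: decay_Lfun2 (u2B b c).
move=> phi tphi; rewrite /= sqrrN expr1n mul1r.
have s1 := @weak_partial_step u (u1 b) b [:: c] phi (4 * C) tphi mu_ (mu1 b) (bnd _ uB)
  (bnd _ (u1B b)) (du b) (cu1 b).
have s2 := @weak_partial_step (u1 b) (u2 b c) c [::] phi (4 * C) tphi (mu1 b) (mu2' b c)
  (bnd _ (u1B b)) (bnd _ (u2B b c)) (du1 b c) (cu2 b c).
by apply: etrans s1 _; rewrite s2 opprK.
Qed.

End RadialSobolev.

(** * The second operator *)

Section Components.
Variable R : realType.
Let mu := @lebesgue_measure R.
Implicit Types (f h k V : R -> R) (l c d r : R).

Lemma L2_half0 : L2_half (fun=> 0 : R).
Proof.
apply/L2_halfP; split; first exact: measurable_cst.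
rewrite (_ : _ \o _ = cst 0%E); first exact: integrable0.
by apply/funext => x /=; rewrite expr0n.
Qed.

Lemma weak_schrodinger0 V : weak_schrodinger V (fun=> 0 : R) (fun=> 0).
Proof.
by move=> phi _; congr (Rintegral _ _ _); apply/funext => x; rewrite !mul0r.
Qed.

Lemma is_derive_sqrt_mul (k : R -> R) (k1 r : R) : 0 < r -> is_derive r 1 k k1 ->
  is_derive r 1 (fun s => Num.sqrt s * k s) (k r / (2 * Num.sqrt r) + Num.sqrt r * k1).
Proof.
move=> r0 dk; apply: is_derive_val (is_derive_mul (is_derive1_sqrt r0) dk) _.
by rewrite mulrC.
Qed.

(* f = sqrt r * k turns - k'' - k'/r + V k = 0 into - f'' + (V - 1/(4 r^2)) f = 0. *)
Lemma radial_to_half_line V k k1 : radial_solution V k k1 ->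
  let f r := Num.sqrt r * k r in
  exists f1, forall r : R, 0 < r -> is_derive r 1 f (f1 r) /\
    is_derive r 1 f1 ((- (4 * r ^+ 2)^-1 + V r) * f r).
Proof.
move=> sol f; exists (fun r => k r / (2 * Num.sqrt r) + Num.sqrt r * k1 r) => r r0.
have [dk dk1] := sol r r0; split; first exact: is_derive_sqrt_mul.
have s0 : 0 < Num.sqrt r by rewrite sqrtr_gt0.
have sn := lt0r_neq0 s0.
have es : r = Num.sqrt r ^+ 2 by rewrite sqr_sqrtr// ltW.
have dq := is_derive1_sqrt r0; have h1 := is_derive_sqrt_mul r0 dk1.
have h2 : is_derive r 1 (fun s => k s / (2 * Num.sqrt s))
    (k1 r / (2 * Num.sqrt r) - k r / (4 * Num.sqrt r ^+ 3)).
  derive; first by rewrite mulf_neq0.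
  by field.
apply: is_derive_val (is_derive_add h2 h1) _; rewrite /f.
set s := Num.sqrt r in sn es *; rewrite es; field.
by rewrite sn.
Qed.

Lemma half_line_to_radial V f f1 : (forall r : R, 0 < r -> is_derive r 1 f (f1 r) /\
    is_derive r 1 f1 ((- (4 * r ^+ 2)^-1 + V r) * f r)) ->
  exists k1, radial_solution V (fun r => f r / Num.sqrt r) k1.
Proof.
move=> hf; exists (fun r => f1 r / Num.sqrt r - f r / (2 * (r * Num.sqrt r))) => r r0.
have [df df1] := hf r r0.
have s0 : 0 < Num.sqrt r by rewrite sqrtr_gt0.
have sn := lt0r_neq0 s0; have rn := lt0r_neq0 r0.
have es : r = Num.sqrt r ^+ 2 by rewrite sqr_sqrtr// ltW.
have dq := is_derive1_sqrt r0.
split.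
  derive => //; move: sn es; set s := Num.sqrt r => sn es; rewrite es; field.
  by rewrite sn.
derive => //; first by rewrite !mulf_neq0.
move: sn es; set s := Num.sqrt r => sn es; rewrite es; field.
by rewrite sn.
Qed.

Lemma L2_halfZ l f : L2_half f -> L2_half (fun r => l * f r).
Proof.
move=> /L2_halfP[mf fi].
have mD : measurable (half_line : set (measurableTypeR R)) by exact: measurable_half_line.
apply/L2_halfP; split; first exact: measurable_funM.
by apply: eq_integrable (integrableZl mD (l ^+ 2) fi) => // x _ /=; rewrite exprMn.
Qed.

Lemma segment_bound f c d : (forall r, c <= r <= d -> {for r, continuous f}) ->
  exists2 B, 0 <= B & forall r, c <= r <= d -> `|f r| <= B.
Proof.
move=> cf; have cf' := continuous_within_segment cf.
have [B [_ hB]] := compact_bounded (continuous_compact cf' (@segment_compact R c d)).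
exists (`|B| + 1); first by rewrite addr_ge0.
move=> r rcd; apply: (hB (`|B| + 1)); first by rewrite ltr_pwDr// ler_norm.
by exists r => //; rewrite /mkset/= in_itv.
Qed.

(** Regularity handles [0, 1], compactness the middle range, and the decay everything beyond [N];
    the result has the form required by [H2_plane_radial]. *)
Lemma decay_bound g g1 C M : regular_at0 g g1 -> (forall r, 0 < r -> {for r, continuous g1}) ->
  0 < M -> (forall r, M <= r -> `|g r| <= C / r ^+ 2 /\ `|g1 r| <= C / r ^+ 2) ->
  exists K, [/\ forall r, 0 <= r -> `|g r| * (1 + r ^+ 2) <= K,
    forall r, 0 < r -> `|g1 r| * (1 + r ^+ 2) <= K &
    forall r, 0 < r -> `|g1 r| * (1 + r ^+ 2) <= K * r].
Proof.
move=> [cg g0 [B hB]] cg1 M0 decay.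
pose N := Num.max M 1.
have NM : M <= N by rewrite le_max lexx.
have N1 : 1 <= N by rewrite le_max lexx orbT.
have [B1 B10 hB1] := @segment_bound g 0 N (fun r _ => cg r).
have [B2 B20 hB2] : exists2 B, 0 <= B & forall r, 1 <= r <= N -> `|g1 r| <= B.
  by apply: segment_bound => r /andP[r1 _]; apply: cg1; exact: lt_le_trans r1.
have C0 : 0 <= C.
  have [h _] := decay M (lexx M); have := le_trans (normr_ge0 _) h.
  by rewrite pmulr_lge0// invr_gt0 exprn_gt0.
have B0 : 0 <= B by have := hB 1; rewrite ltr01 lexx mulr1 => /(_ isT); exact: (le_trans (normr_ge0 _)).
pose T := 1 + N ^+ 2.
have T2 : 2 <= T by rewrite /T expr2; have := ler_pM ler01 ler01 N1 N1; rewrite mulr1; clear; lra.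
have TT r : 0 <= r -> r <= N -> 1 + r ^+ 2 <= T.
  by move=> r0 rN; rewrite lerD2l ler_pXn2r// nnegrE (le_trans r0).
have far (x r : R) : N <= r -> `|x| <= C / r ^+ 2 -> `|x| * (1 + r ^+ 2) <= 2 * C.
  move=> Nr hx; have r1 : 1 <= r by exact: le_trans Nr.
  have r2 : 1 <= r ^+ 2 by rewrite exprn_ege1.
  have r20 : 0 < r ^+ 2 by exact: lt_le_trans r2.
  have q0 : 0 <= 1 + r ^+ 2 by rewrite addr_ge0// ltW.
  apply: le_trans (ler_wpM2r q0 hx) _.
  have -> : C / r ^+ 2 * (1 + r ^+ 2) = C / r ^+ 2 + C by field; rewrite gt_eqF// (lt_le_trans ltr01).
  have : C / r ^+ 2 <= C by rewrite ler_pdivrMr// ler_peMr.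
  by clear; lra.
pose K := B1 * T + B2 * T + B * T + 2 * C.
have T0 : 0 <= T by clear -T2; lra.
have m1 := mulr_ge0 B10 T0; have m2 := mulr_ge0 B20 T0; have m3 := mulr_ge0 B0 T0.
have near r : 0 < r -> r <= 1 -> `|g1 r| * (1 + r ^+ 2) <= B * T * r.
  move=> r0 r1; rewrite mulrAC; apply: ler_pM => //.
  - by rewrite addr_ge0// sqr_ge0.
  - by apply: hB; rewrite r0.
  by apply: TT; [exact: ltW|exact: le_trans N1].
have mid r : 1 <= r -> r <= N -> `|g1 r| * (1 + r ^+ 2) <= B2 * T.
  move=> r1 rN; apply: ler_pM => //; first by rewrite addr_ge0// sqr_ge0.
    by apply: hB2; rewrite r1.
  by apply: TT => //; exact: le_trans r1.
exists K; split => r r0.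
- have [rN|/ltW Nr] := leP r N.
    apply: (@le_trans _ _ (B1 * T)); last by rewrite /K; clear -m2 m3 C0; lra.
    apply: ler_pM => //; [by rewrite addr_ge0// sqr_ge0|by apply: hB1; rewrite r0|exact: TT].
  have [h _] := decay r (le_trans NM Nr).
  by apply: le_trans (far _ _ Nr h) _; rewrite /K; clear -m1 m2 m3; lra.
- have [r1|/ltW r1] := leP r 1.
    apply: le_trans (near r r0 r1) _; apply: (@le_trans _ _ (B * T)); first by rewrite ler_piMr.
    by rewrite /K; clear -m1 m2 C0; lra.
  have [rN|/ltW Nr] := leP r N.
    by apply: le_trans (mid r r1 rN) _; rewrite /K; clear -m1 m3 C0; lra.
  have [_ h] := decay r (le_trans NM Nr).
  by apply: le_trans (far _ _ Nr h) _; rewrite /K; clear -m1 m2 m3; lra.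
have K0 : 0 <= K by rewrite /K; clear -m1 m2 m3 C0; lra.
have [r1|/ltW r1] := leP r 1.
  apply: le_trans (near r r0 r1) _; rewrite ler_wpM2r ?(ltW r0)//.
  by rewrite /K; clear -m1 m2 C0; lra.
apply: (@le_trans _ _ K); last by rewrite ler_peMr.
have [rN|/ltW Nr] := leP r N.
  by apply: le_trans (mid r r1 rN) _; rewrite /K; clear -m1 m3 C0; lra.
have [_ h] := decay r (le_trans NM Nr).
by apply: le_trans (far _ _ Nr h) _; rewrite /K; clear -m1 m2 m3; lra.
Qed.

Lemma domain2_0 : domain2 (fun=> 0 : R).
Proof.
exists (fun=> 0); last by apply: aeW => r _; rewrite mulr0.
apply: (@H2_plane_radial _ (fun=> 0) _ (fun=> 0) 0).
- by move=> r _; exact: cvg_cst.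
- by move=> r _; rewrite normr0.
- by move=> r r0; split; derive; ring.
all: by move=> r _; rewrite normr0 !mul0r.
Qed.

End Components.

Section SecondOperator.
Variables (R : realType) (U a : R -> R).
Hypothesis profile : vortex_profile U a.
Let mu := @lebesgue_measure R.
Implicit Types (f g h k w : R -> R) (l c d r : R).

Local Notation sol l := (radial_solution (eigen_potential U l)).

Lemma profile_U_continuous r : 0 < r -> {for r, continuous U}.
Proof. by case: profile => _ _ dU _ _ /dU /is_derive_cont. Qed.

Lemma continuous_inv4 r : 0 < r -> {for r, continuous (fun r : R => - (4 * r ^+ 2)^-1)}.
Proof.
move=> r0; have rn := lt0r_neq0 r0.
have h : is_derive r 1 (fun r : R => - (4 * r ^+ 2)^-1)
    (- (- (4 * r ^+ 2) ^- 2 * (4 * (2 * r)))).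
  by derive; rewrite ?mulf_neq0 ?sqrf_eq0//; ring.
exact: is_derive_cont h.
Qed.

Lemma eigen_potential_continuous l r : 0 < r -> {for r, continuous (eigen_potential U l)}.
Proof.
move=> /profile_U_continuous cU; apply: cvgB; last exact: cvg_cst.
by rewrite expr2; apply: cvgM.
Qed.

Lemma potential2_continuous r : 0 < r -> {for r, continuous (potential2 U)}.
Proof.
move=> r0; apply: cvgD; first exact: continuous_inv4.
by rewrite expr2; apply: cvgM; exact: profile_U_continuous.
Qed.

Lemma potential2E l r : - (4 * r ^+ 2)^-1 + eigen_potential U l r = potential2 U r - l.
Proof. by rewrite /potential2 /eigen_potential addrA. Qed.

Lemma second_eigenvalue_exists : exists l : R, 0 < l < 1 /\ is_eigenvalue (H2 U) (l%:C)%C.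
Proof.
have [l [g [g1 [C [M [l01 hg reg gpos [M0 decay]]]]]]] := ground_state_exists profile.
exists l; split => //; have l01' : 0 <= l <= 1 by case/andP: l01 => h1 h2; rewrite !ltW.
have cg1 r : 0 < r -> {for r, continuous g1} by move=> /hg[_ /is_derive_cont].
have [K [gK g1K g1rK]] := decay_bound reg cg1 M0 decay.
have [cg _ _] := reg.
pose f r : R := Num.sqrt r * g r.
have [f1 hf] := radial_to_half_line hg.
have mD : measurable (half_line : set (measurableTypeR R)) by exact: measurable_half_line.
have cf r : 0 < r -> {for r, continuous f} by move=> /hf[/is_derive_cont].
have L2f : L2_half f.
  have mf : measurable_fun (half_line : set R) f.
    apply: open_continuous_measurable_fun; first exact: interval_open.
    by move=> r /set_mem; rewrite half_lineE; exact: cf.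
  apply/L2_halfP; split => //.
  have ii : mu.-integrable half_line (EFin \o (fun x : R => K ^+ 2 * (1 + x ^+ 2)^-1)).
    have := @integrable_inv_oneDsqr R => /(integrableS measurableT mD (@subsetT _ _)) h.
    by apply: eq_integrable (integrableZl mD (K ^+ 2) h).
  apply: (@le_integrable _ _ _ mu _ mD _ _ _ _ ii).
    by apply/measurable_EFinP; exact: measurable_funX.
  move=> r; rewrite half_lineE /= => r0; rewrite lee_fin.
  have q0 : 0 < 1 + r ^+ 2 by rewrite ltr_pwDl// sqr_ge0.
  have q1 : 0 <= K ^+ 2 / (1 + r ^+ 2) by rewrite divr_ge0 ?sqr_ge0// ltW.
  rewrite (ger0_norm q1) (ger0_norm (sqr_ge0 (f r))).
  rewrite /f exprMn sqr_sqrtr ?(ltW r0)// ler_pdivlMr//.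
  apply: (@le_trans _ _ (g r ^+ 2 * (1 + r ^+ 2) ^+ 2)).
    rewrite (_ : r * _ * _ = g r ^+ 2 * (r * (1 + r ^+ 2))); last by ring.
    rewrite ler_wpM2l ?sqr_ge0// expr2 ler_wpM2r ?(ltW q0)//.
    by have := sqr_ge0 (r - 1); have := sqr_ge0 r; rewrite !expr2; lra.
  have gr := gK r (ltW r0).
  have h0 : 0 <= `|g r| * (1 + r ^+ 2) by rewrite mulr_ge0// ltW.
  by rewrite -(real_normK (num_real (g r))) -exprMn ler_pXn2r// nnegrE (le_trans h0).
have dom : domain2 f.
  exists g; last by apply: aeW.
  apply: (@H2_plane_radial _ (eigen_potential U l) g g1 K) => //.
  - by move=> t t0; exact: eigen_potential_continuous.
  - by move=> t t0; exact: (eigen_potential_le1 profile).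
have wk : weak_schrodinger (potential2 U) f (fun r => l * f r).
  apply: (@classical_weak _ _ f f1 _ _ hf).
  - move=> t t0; apply: cvgM; last exact: cf.
    by apply: cvgD; [exact: continuous_inv4|exact: eigen_potential_continuous].
  - by move=> t; exact: potential2_continuous.
  - by move=> t t0; rewrite potential2E -/(f t); ring.
exists (fun r => (f r)%:C%C).
  split; rewrite /=.
    have -> : (fun r => complex.Re ((l%:C)%C * (f r)%:C%C)) = (fun r => l * f r).
      by apply/funext => r /=; rewrite mul0r subr0.
    by split => //; exact: L2_halfZ.
  have -> : (fun r => complex.Im ((l%:C)%C * (f r)%:C%C)) = (fun=> 0).
    by apply/funext => r /=; rewrite mul0r mulr0 addr0.
  split; [exact: domain2_0|exact: L2_half0|exact: L2_half0|exact: weak_schrodinger0].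
move=> h; have [r /andP[r1 _] e] := ae_exists h (ltac:(lra) : 1 < 2 :> R).
have r0 : 0 < r by apply: lt_trans r1.
have r0' : half_line r by rewrite half_lineE.
have /complexI := e r0'.
by apply/eqP; rewrite mulf_neq0// gt_eqF// ?sqrtr_gt0// gpos.
Qed.

End SecondOperator.

(** * Consequences of the subordinacy bounds *)

Section Subordinate.
Variable R : realType.
Implicit Types (f k : R -> R) (c d r : R).

Lemma near_right0P (P : R -> Prop) : (\forall r \near 0^'+, P r) ->
  exists2 d, 0 < d & forall r, 0 < r < d -> P r.
Proof.
move=> [d /= d0 hd]; exists d => // r /andP[r0 rd]; apply: hd => //=.
by rewrite sub0r normrN gtr0_norm.
Qed.

Lemma near_pinftyP (P : R -> Prop) : (\forall r \near +oo, P r) ->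
  exists2 M, 0 < M & forall r, M < r -> P r.
Proof.
move=> [M [_ hM]]; exists (Num.max M 1); first by rewrite lt_max ltr01 orbT.
by move=> r; rewrite gt_max => /andP[Mr _]; exact: hM.
Qed.

(** A derivative of size c / r makes [k] diverge logarithmically at 0. The factor [sg] treats both
    signs of the singular solution together. *)
Lemma singular_unbounded k k1 c d C (sg : R) : 0 < c -> 0 < d ->
  (forall r : R, 0 < r -> is_derive r 1 k (k1 r)) ->
  (forall r, 0 < r < d -> c / r <= sg * k1 r) ->
  (forall r, 0 < r < d -> `|sg * k r| <= C) -> False.
Proof.
move=> c0 d0 dk sing kC.
have h0 : 0 < d / 2 by rewrite divr_gt0.
have hd : d / 2 < d by rewrite ltr_pdivrMr// ltr_pMr// ltr1n.
have [r /andP[r0 rd]] := log_unbounded (C + C) h0 c0.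
rewrite ltNge => /negP; apply.
have h : sg * k r - c * ln r <= sg * k (d / 2) - c * ln (d / 2).
  apply: (@derive_ge0_le _ (fun r => sg * k r - c * ln r) (fun r => sg * k1 r - c * r^-1)).
  - move=> s /andP[rs _]; have s0 : 0 < s by exact: lt_le_trans rs.
    have h1 := dk s s0; have h2 := is_derive_mulln c s0.
    by derive; ring.
  - move=> s /andP[rs sd]; rewrite subr_ge0; apply: sing.
    by rewrite (lt_trans r0 rs) (lt_trans sd hd).
  exact: ltW.
have := kC r ltac:(by rewrite r0 (lt_trans rd hd)).
have := kC (d / 2) ltac:(by rewrite h0 hd).
rewrite !ler_norml; lra.
Qed.

Lemma bounded_not_log_growth f M C : (forall r, M < r -> `|f r| <= C) -> ~ log_growth f.
Proof.
move=> fC [c [p [c0 p0 h]]].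
pose t := Num.max 0 (Num.max (C / c) (M / p)).
have t0 : 0 <= t by rewrite le_max lexx.
have tC : C / c <= t by rewrite !le_max lexx orbT.
have tM : M / p <= t by rewrite !le_max lexx !orbT.
have et : 1 + t <= expR t by exact: expR_ge1Dx.
have e0 := expR_gt0 t.
have pr : p <= p * expR t by rewrite ler_peMr ?(ltW p0)//; move: et t0; lra.
have Mr : M < p * expR t.
  have : M <= t * p by rewrite -ler_pdivrMr.
  have : t * p < p * expR t by rewrite mulrC ltr_pM2l//; move: et; lra.
  lra.
have := h _ pr; rewrite lnM ?posrE// expRK.
have := fC _ Mr; have : C <= t * c by rewrite -ler_pdivrMr.
lra.
Qed.

End Subordinate.

(** * Uniqueness of the eigenvalue and absence of a resonance at the threshold *)

Section SecondOperatorSpectrum.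
Variables (R : realType) (U a : R -> R).
Hypothesis profile : vortex_profile U a.
Let mu := @lebesgue_measure R.
Implicit Types (f g h k w : R -> R) (l m c d r : R).

Local Notation sol l := (radial_solution (eigen_potential U l)).

(** Up to a nonzero factor the eigenfunction is sqrt r g with g regular, since membership in the
    domain excludes the logarithmic solution. Its square integrability then prevents g from staying
    away from 0. *)
Lemma eigenvalue_ground_state l w : 0 < l < 1 ->
  schrodinger (@domain2 R) (potential2 U) w (fun r => l * w r) ->
  ~ {ae mu, forall r, half_line r -> w r = 0} ->
  exists g g1, [/\ sol l g g1, regular_at0 g g1 & ~ bounded_below_oo g].
Proof.
move=> l01 [[g0 H2g wg0] L2w L2lw weak] wn0.
have l01' : 0 <= l <= 1 by case/andP: l01 => h1 h2; rewrite !ltW.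
have l01'' : 0 < l <= 1 by case/andP: l01 => h1 h2; rewrite h1 ltW.
have cV := potential2_continuous profile.
have [wt cwt wwt] := weak_schrodinger_continuous cV L2w L2lw weak.
have cht r : 0 < r -> {for r, continuous (fun r => l * wt r)}.
  by move=> r0; apply: cvgM; [exact: cvg_cst|exact: cwt].
have hht : {ae mu, forall r, half_line r -> l * w r = l * wt r}.
  by apply: (ae_imply wwt) => r h /h ->.
have [f1 hf1] := weak_schrodinger_classical cV L2w L2lw weak cwt cht wwt hht.
have hf r : 0 < r -> is_derive r 1 wt (f1 r) /\
    is_derive r 1 f1 ((- (4 * r ^+ 2)^-1 + eigen_potential U l r) * wt r).
  move=> r0; have [h1 h2] := hf1 r r0; split => //.
  by rewrite potential2E mulrBl.
have [k1 solk] := half_line_to_radial hf.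
set k := (fun r => wt r / Num.sqrt r) in solk.
have [g [g1 [solg reg]]] := regular_solution_exists profile l01'.
exists g, g1; split => //.
have sq r : 0 < r -> Num.sqrt r != 0 by move=> r0; rewrite gt_eqF// sqrtr_gt0.
have dk (r : R) : 0 < r -> is_derive r 1 k (k1 r) by move=> /solk[].
have ck1 r : 0 < r -> {for r, continuous k1} by move=> /solk[_ /is_derive_cont].
have gk : {ae mu, forall r, half_line r -> g0 r = k r}.
  apply: (ae_imply (ae_and wg0 wwt)) => r [e1 e2] hr.
  have r0 : 0 < r by move: hr; rewrite half_lineE.
  by rewrite /k -e2// e1// mulrC mulKf// sq.
have [[c kc]|[c [d [c0 d0 sing]]]] := regular_or_singular profile l01'' solg reg solk; last first.
  have key sg : sg ^+ 2 = 1 -> (forall r, 0 < r < d -> c / r <= sg * k1 r) -> False.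
    by move=> sg1; exact: (H2_plane_not_singular sg1 c0 d0 dk ck1 H2g gk).
  exfalso; case: sing => sing.
    by apply: (key 1) => [|r /sing]; rewrite ?expr1n ?mul1r.
  by apply: (key (- 1)) => [|r /sing]; rewrite ?sqrrN ?expr1n ?mulN1r.
have wtE r : 0 < r -> wt r = c * (Num.sqrt r * g r).
  move=> r0; have := kc r r0; rewrite /k => e.
  by rewrite -[LHS](divfK (sq r r0)) e; ring.
have c0 : c != 0.
  apply: contra_notN wn0 => /eqP c0; apply: (ae_imply wwt) => r e hr.
  by rewrite e// wtE ?c0 ?mul0r//; move: hr; rewrite half_lineE.
have [P [C hP]] := square_bounded_primitive L2w cwt wwt.
(* If |g| >= b beyond p, the square of the eigenfunction is at least c^2 p b^2 there, so it is not
   integrable. *)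
move=> [b [p [b0 p0 hb]]].
have q0 : 0 < c ^+ 2 * (p * b ^+ 2).
  by rewrite mulr_gt0 ?exprn_even_gt0// mulr_gt0// exprn_gt0.
have [r pr] := bounded_primitive_ltoo hP p0 q0.
have r0 : 0 < r by exact: lt_trans pr.
rewrite ltNge => /negP; apply.
rewrite wtE// exprMn ler_pM2l ?exprn_even_gt0//.
rewrite exprMn sqr_sqrtr ?(ltW r0)// ler_pM ?(ltW p0) ?(ltW pr) ?sqr_ge0//.
have := hb r (ltW pr) => hbr.
by rewrite -(real_normK (num_real (g r))) ler_pXn2r ?nnegrE ?(ltW b0).
Qed.

Lemma eigenvalue_component l : is_eigenvalue (H2 U) (l%:C)%C ->
  exists w, schrodinger (@domain2 R) (potential2 U) w (fun r => l * w r) /\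
   ~ {ae mu, forall r, half_line r -> w r = 0}.
Proof.
move=> [f [fre fim] fn0].
have ere : (fun r => complex.Re ((l%:C)%C * f r)) = (fun r => l * complex.Re (f r)).
  by apply/funext => r; case: (f r) => x y /=; rewrite mul0r subr0.
have eim : (fun r => complex.Im ((l%:C)%C * f r)) = (fun r => l * complex.Im (f r)).
  by apply/funext => r; case: (f r) => x y /=; rewrite mul0r addr0.
rewrite ere in fre; rewrite eim in fim.
have [h|h] := pselect {ae mu, forall r, half_line r -> complex.Re (f r) = 0}; last first.
  by exists (fun r => complex.Re (f r)).
exists (fun r => complex.Im (f r)); split => // h'; apply: fn0.
apply: (ae_imply (ae_and h h')) => r [e1 e2] hr.
by move: (e1 hr) (e2 hr); case: (f r) => x y /= -> ->.
Qed.

Lemma second_eigenvalue_unique l m : 0 < l < 1 -> 0 < m < 1 ->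
  is_eigenvalue (H2 U) (l%:C)%C -> is_eigenvalue (H2 U) (m%:C)%C -> l = m.
Proof.
move=> l01 m01 /eigenvalue_component[w [hw wn]] /eigenvalue_component[v [hv vn]].
have [g [g1 [sg rg bg]]] := eigenvalue_ground_state l01 hw wn.
have [k [k1 [sk rk bk]]] := eigenvalue_ground_state m01 hv vn.
case/andP: l01 => l0 l1; case/andP: m01 => m0 m1.
have [lm|ml|//] := ltgtP l m.
  by case: (ground_state_unique profile l0 lm m1 sg rg bg sk rk bk).
by case: (ground_state_unique profile m0 ml l1 sk rk bk sg rg bg).
Qed.

(** For w / sqrt r subordinacy means boundedness at both ends. At 0 this leaves only multiples of
    the regular solution g; at infinity it excludes logarithmic growth, so that g > 0 by the
    barrier, against [threshold_not_pos]. *)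
Lemma ode_solution_eq0 w : ode_solution (potential2 U) 1 w -> subordinate (1 / 2) (1 / 2) w ->
  forall r, 0 < r -> w r = 0.
Proof.
move=> ode [[C0 /near_right0P[d d0 h0]] [C1 /near_pinftyP[M M0 hM]]] z z0.
apply: contrapT => /eqP wz.
have hf r : 0 < r -> is_derive r 1 w (derive1 w r) /\
    is_derive r 1 (derive1 w) ((- (4 * r ^+ 2)^-1 + eigen_potential U 1 r) * w r).
  move=> r0; have [d1 d2 e] := ode r r0; split; first by split; [|rewrite derive1E].
  split => //; rewrite -derive1E; move: e; rewrite derive1nS /= => e.
  by rewrite potential2E mulrBl -e; ring.
have [k1 solk] := half_line_to_radial hf.
set k := (fun r => w r / Num.sqrt r) in solk.
have sq r : 0 < r -> Num.sqrt r != 0 by move=> r0; rewrite gt_eqF// sqrtr_gt0.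
have kb C r : 0 < r -> `|w r| <= C * r `^ (1 / 2) -> `|k r| <= C.
  move=> r0; rewrite div1r powR12_sqrt ?(ltW r0)// => h.
  by rewrite /k normrM normfV ler_pdivrMr ?normr_gt0 ?sq// [X in _ * X]ger0_norm ?sqrtr_ge0.
have dk (r : R) : 0 < r -> is_derive r 1 k (k1 r) by move=> /solk[].
have i01 : 0 <= (1 : R) <= 1 by rewrite ler01 lexx.
have i01' : 0 < (1 : R) <= 1 by rewrite ltr01 lexx.
have [g [g1 [solg reg]]] := regular_solution_exists profile i01.
have [[c kc]|[c [e [c0 e0 sing]]]] := regular_or_singular profile i01' solg reg solk; last first.
  pose b := Num.min d e.
  have b0 : 0 < b by rewrite lt_min d0.
  have be r : 0 < r < b -> 0 < r < e by rewrite lt_min => /and3P[-> _ ->].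
  have bd r : 0 < r < b -> `|k r| <= C0.
    by rewrite lt_min => /and3P[r0 rd _]; apply: kb => //; apply: h0; rewrite r0.
  exfalso; case: sing => sing.
    apply: (@singular_unbounded R k k1 c b C0 1 c0 b0 dk) => r rb; rewrite mul1r.
      by apply: sing; exact: be.
    exact: bd.
  apply: (@singular_unbounded R k k1 c b C0 (- 1) c0 b0 dk) => r rb; rewrite mulN1r.
    by apply: sing; exact: be.
  by rewrite normrN; exact: bd.
have c0 : c != 0.
  apply: contraNneq wz => c0; have := kc z z0; rewrite c0 mul0r /k => /eqP.
  by rewrite mulf_eq0 invr_eq0 (negbTE (sq z z0)) orbF.
have gM r : M < r -> `|g r| <= C1 / `|c|.
  move=> Mr; have r0 : 0 < r by exact: lt_trans Mr.
  have := kb C1 r r0 (hM r Mr); rewrite kc// normrM mulrC => h.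
  by rewrite ler_pdivlMr ?normr_gt0.
have gpos := regular_pos profile i01 solg reg (bounded_not_log_growth gM).
have [r r0] := threshold_not_pos profile solg reg.
by rewrite leNgt gpos.
Qed.

Lemma no_threshold_resonance2 : ~ threshold_resonance2 U.
Proof.
move=> [f [[ore oim] [sre sim] [r r0]]]; apply/negP; rewrite negbK.
have := ode_solution_eq0 ore sre r0; have := ode_solution_eq0 oim sim r0.
by case: (f r) => x y /= -> ->.
Qed.

End SecondOperatorSpectrum.

(** * The first operator *)

Section FirstOperator.
Variables (R : realType) (U a : R -> R).
Hypothesis profile : vortex_profile U a.
Let mu := @lebesgue_measure R.
Implicit Types (f g h k w u v : R -> R) (c d r x y : R).

Let V := potential1 U a.

Lemma potential1_continuous r : 0 < r -> {for r, continuous V}.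
Proof.
move=> r0; have [_ _ dU da _] := profile.
have cU := is_derive_cont (dU r r0); have ca := is_derive_cont (da r r0).
apply: cvgD; first apply: cvgD; first exact: continuous_inv4.
  apply: cvgM.
    by rewrite !expr2; apply: cvgM; (apply: cvgB; [exact: cvg_cst|exact: ca]).
  apply: cvgV; first by rewrite sqrf_eq0 gt_eqF.
  exact: exprn_continuous.
apply: cvgM; last exact: cvg_cst.
by apply: cvgD; [exact: cvg_cst|rewrite expr2; apply: cvgM].
Qed.

Lemma eigenfunction1_eq0 x y (f : R -> R[i]) : x <= 1 \/ y != 0 ->
  eigenfunction (H1 U a) (x +i* y)%C f -> ae_eqC f (fun=> 0).
Proof.
move=> xy [[[L2u _] _ L2h wu] [[L2v _] _ L2k wv]].
set u := (fun r => complex.Re (f r)) in L2u wu.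
set v := (fun r => complex.Im (f r)) in L2v wv.
have eh : (fun r => complex.Re ((x +i* y)%C * f r)) = (fun r => x * u r - y * v r).
  by apply/funext => r; rewrite /u /v; case: (f r).
have ek : (fun r => complex.Im ((x +i* y)%C * f r)) = (fun r => x * v r + y * u r).
  by apply/funext => r; rewrite /u /v; case: (f r).
rewrite eh in L2h wu; rewrite ek in L2k wv.
have cV := potential1_continuous.
have [ut cut uut] := weak_schrodinger_continuous cV L2u L2h wu.
have [vt cvt vvt] := weak_schrodinger_continuous cV L2v L2k wv.
have cht r : 0 < r -> {for r, continuous (fun r => x * ut r - y * vt r)}.
  by move=> r0; apply: cvgB; apply: cvgM; (exact: cvg_cst || exact: cut || exact: cvt).
have ckt r : 0 < r -> {for r, continuous (fun r => x * vt r + y * ut r)}.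
  by move=> r0; apply: cvgD; apply: cvgM; (exact: cvg_cst || exact: cut || exact: cvt).
have hh : {ae mu, forall r, half_line r -> x * u r - y * v r = x * ut r - y * vt r}.
  by apply: (ae_imply (ae_and uut vvt)) => r [e1 e2] hr; rewrite e1// e2.
have kk : {ae mu, forall r, half_line r -> x * v r + y * u r = x * vt r + y * ut r}.
  by apply: (ae_imply (ae_and uut vvt)) => r [e1 e2] hr; rewrite e1// e2.
have [u1 du] := weak_schrodinger_classical cV L2u L2h wu cut cht uut hh.
have [v1 dv] := weak_schrodinger_classical cV L2v L2k wv cvt ckt vvt kk.
have du0 (r : R) : 0 < r -> is_derive r 1 ut (u1 r) by move=> /du[].
have dv0 (r : R) : 0 < r -> is_derive r 1 vt (v1 r) by move=> /dv[].
have du1 (r : R) : 0 < r -> is_derive r 1 u1 ((V r - x) * ut r + y * vt r).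
  by move=> /du[_ h]; apply: is_derive_val h _; rewrite /V; ring.
have dv1 (r : R) : 0 < r -> is_derive r 1 v1 ((V r - x) * vt r - y * ut r).
  by move=> /dv[_ h]; apply: is_derive_val h _; rewrite /V; ring.
have [P [C hP]] := square_bounded_primitive L2u cut uut.
have [Q [D hQ]] := square_bounded_primitive L2v cvt vvt.
have hPQ : bounded_primitive (fun r => ut r ^+ 2 + vt r ^+ 2) (fun r => P r + Q r) (C + D).
  move=> r r0; have [h1 /andP[h2 h3]] := hP r r0; have [k1 /andP[k2 k3]] := hQ r r0.
  by split; [exact: is_derive_add|rewrite addr_ge0//= lerD].
have V1 r : 0 < r -> 1 <= V r by move=> r0; apply: ltW; exact: (potential1_gt1 profile).
have [d0 d00 Vd] := potential1_near0 profile.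
suff N0 r : 0 < r -> ut r ^+ 2 + vt r ^+ 2 = 0.
  apply: (ae_imply (ae_and uut vvt)) => r [e1 e2] hr.
  have r0 : 0 < r by move: hr; rewrite half_lineE.
  have := N0 r r0; move/eqP; rewrite paddr_eq0 ?sqr_ge0// !sqrf_eq0 => /andP[/eqP u0 /eqP v0].
  by move: (e1 hr) (e2 hr); rewrite u0 v0 /u /v; case: (f r) => s t /= -> ->.
move: r; case: xy => hxy.
  exact: (eigenfunction_eq0_le du0 dv0 du1 dv1 hPQ V1 d00 Vd hxy).
have [M M0 hM] := potential1_nearoo profile ltr01.
have VB r : M < r -> `|V r - x| <= 1 + `|1 - x|.
  move=> Mr; have r0 : 0 < r by exact: lt_trans Mr.
  rewrite (_ : V r - x = (V r - 1) + (1 - x)); last by ring.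
  apply: le_trans (ler_normD _ _) _; rewrite lerD2r ger0_norm ?subr_ge0 ?V1//.
  exact: hM.
exact: (eigenfunction_eq0_nonreal du0 dv0 du1 dv1 hPQ d00 Vd hxy M0 VB).
Qed.

(** A function of order r^(-1/2) need not be square integrable, so convexity of w^2 is combined with
    other boundary data: bounded at infinity, w^2 is nonincreasing, and it tends to 0 at the
    origin. *)
Lemma subordinate1_eq0 w : ode_solution V 1 w -> subordinate (5 / 2) (- (1 / 2)) w ->
  forall r, 0 < r -> w r = 0.
Proof.
move=> ode [[C0 /near_right0P[d d0 h0]] [C1 /near_pinftyP[M M0 hM]]] z z0.
have dw (r : R) : 0 < r -> is_derive r 1 w (derive1 w r).
  by move=> /ode[h _ _]; split; [|rewrite derive1E].
have dw1 (r : R) : 0 < r -> is_derive r 1 (derive1 w) ((V r - 1) * w r).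
  move=> /ode[_ h e]; split => //; rewrite -derive1E; move: e; rewrite derive1nS /= => e.
  by rewrite mulrBl -e; ring.
pose N r : R := w r ^+ 2; pose N1 r : R := 2 * (w r * derive1 w r).
pose N2 r : R := 2 * (derive1 w r ^+ 2) + 2 * ((V r - 1) * w r ^+ 2).
have dN (r : R) : 0 < r -> is_derive r 1 N (N1 r).
  by move=> r0; have h1 := dw r r0; rewrite /N /N1; derive; ring.
have dN1 (r : R) : 0 < r -> is_derive r 1 N1 (N2 r).
  by move=> r0; have h1 := dw r r0; have h2 := dw1 r r0; rewrite /N1 /N2; derive; ring.
have N20 r : 0 < r -> 0 <= N2 r.
  move=> r0; rewrite /N2 addr_ge0// mulr_ge0 ?sqr_ge0// mulr_ge0 ?sqr_ge0//.
  by rewrite subr_ge0 ltW// (potential1_gt1 profile).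
have Noo r : Num.max M 1 < r -> N r <= C1 ^+ 2.
  rewrite gt_max => /andP[Mr r1].
  have r0 : 0 < r by exact: lt_trans Mr.
  have p1 : r `^ (- (1 / 2)) <= 1 by apply: le_trans (ler_powR (ltW r1) (ltac:(lra) : - (1 / 2) <= 0 :> R)) _; rewrite powRr0.
  rewrite /N -(real_normK (num_real (w r))) -[leRHS](real_normK (num_real C1)).
  rewrite ler_pXn2r ?nnegrE//; apply: le_trans (hM r Mr) _.
  apply: le_trans (ler_norm _) _; rewrite normrM (ger0_norm (powR_ge0 _ _)) ler_piMr//.
have N1le r : 0 < r -> N1 r <= 0.
  move=> r0; rewrite leNgt; apply/negP => N1r.
  have mono s : r <= s -> N1 r <= N1 s.
    move=> rs; apply: (@derive_ge0_le _ N1 N2) => // t /andP[rt _].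
      by apply: dN1; exact: lt_le_trans rt.
    by apply: N20; exact: lt_trans rt.
  pose s := Num.max (r + 1 + C1 ^+ 2 / N1 r) (Num.max M 1 + 1).
  have s1 : r + 1 + C1 ^+ 2 / N1 r <= s by rewrite le_max lexx.
  have s2 : Num.max M 1 < s by rewrite lt_max ltrDl ltr01 orbT.
  have q0 : 0 <= C1 ^+ 2 / N1 r by rewrite divr_ge0 ?sqr_ge0// ltW.
  have rs : r <= s by apply: le_trans s1; rewrite -addrA lerDl addr_ge0.
  have : N r + N1 r * (s - r) <= N s.
    apply: (@derive_ge_growth _ N N1) => // t /andP[rt _].
      by apply: dN; exact: lt_le_trans rt.
    by apply: mono; exact: ltW.
  have := Noo s s2; have := sqr_ge0 (w r); rewrite -/(N r).
  have : N1 r * (1 + C1 ^+ 2 / N1 r) <= N1 r * (s - r) by rewrite ler_pM2l//; lra.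
  have -> : N1 r * (1 + C1 ^+ 2 / N1 r) = N1 r + C1 ^+ 2 by field; rewrite gt_eqF.
  lra.
have Ndecr s : 0 < s -> s <= z -> N z <= N s.
  move=> s0 sz; rewrite -lerN2.
  apply: (@derive_ge0_le _ (fun t => - N t) (fun t => - N1 t)) => // t /andP[st _].
    by have h := dN t (lt_le_trans s0 st); derive.
  by rewrite oppr_ge0 N1le// (lt_trans s0).
have Nz : N z <= 0.
  apply/ler_addgt0Pr => /= e e0; rewrite add0r.
  pose b := Num.min (Num.min d 1) (Num.min z (e / (C0 ^+ 2 + 1))).
  have D0 : 0 < C0 ^+ 2 + 1 by rewrite ltr_wpDl// sqr_ge0.
  have b0 : 0 < b by rewrite !lt_min d0 ltr01 z0 divr_gt0.
  have [bd b1 bz be] : [/\ b <= d, b <= 1, b <= z & b <= e / (C0 ^+ 2 + 1)].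
    by have : b <= b by []; rewrite {2}/b !le_min => /andP[/andP[-> ->] /andP[-> ->]].
  have h2 : 0 < b / 2 by rewrite divr_gt0.
  have hb : b / 2 <= b by rewrite ler_pdivrMr// ler_peMr ?(ltW b0)// ler1n.
  apply: le_trans (Ndecr _ h2 (le_trans hb bz)) _.
  have wb : `|w (b / 2)| <= C0 * (b / 2) `^ (5 / 2).
    by apply: h0; rewrite h2/=; apply: lt_le_trans bd; move: b0; lra.
  have pb : (b / 2) `^ (5 / 2) <= b / 2.
    rewrite /powR gt_eqF// -[leRHS](@lnK _ (b / 2)) ?posrE// ler_expR.
    have : ln (b / 2) <= 0 by apply: ln_le0; exact: le_trans hb b1.
    lra.
  have wb' : `|w (b / 2)| <= `|C0| * (b / 2).
    apply: le_trans wb _; apply: le_trans (ler_norm _) _; rewrite normrM.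
    by rewrite (ger0_norm (powR_ge0 _ _)) ler_wpM2l.
  rewrite /N -(real_normK (num_real (w _))).
  apply: (@le_trans _ _ ((`|C0| * (b / 2)) ^+ 2)).
    by rewrite ler_pXn2r ?nnegrE// mulr_ge0// ltW.
  rewrite exprMn real_normK ?num_real//.
  have q : (b / 2) ^+ 2 <= b.
    by rewrite expr2; apply: (le_trans _ hb); rewrite ler_piMr ?(ltW h2)//; exact: le_trans hb b1.
  apply: (@le_trans _ _ (C0 ^+ 2 * b)); first by rewrite ler_wpM2l ?sqr_ge0.
  move: be; rewrite ler_pdivlMr// mulrC; apply: le_trans.
  by rewrite ler_wpM2r ?(ltW b0)// lerDl.
by apply/eqP; rewrite -sqrf_eq0 eq_le Nz sqr_ge0.
Qed.

Lemma no_threshold_resonance1 : ~ threshold_resonance1 U a.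
Proof.
move=> [f [[ore oim] [sre sim] [r r0]]]; apply/negP; rewrite negbK.
have := subordinate1_eq0 ore sre r0; have := subordinate1_eq0 oim sim r0.
by case: (f r) => x y /= -> ->.
Qed.

End FirstOperator.

(** * Weyl sequences and the discrete spectrum of the first operator *)

Section Weyl.
Variables (R : realType) (U a : R -> R).
Hypothesis profile : vortex_profile U a.
Let mu := @lebesgue_measure R.
Implicit Types (f g h k u v : R -> R) (c d r x y w n : R).

Let V := potential1 U a.

Lemma continuous_support_L2 f c d : 0 < c -> (forall r, 0 < r -> {for r, continuous f}) ->
  (forall r, f r != 0 -> c <= r <= d) -> L2_half f.
Proof.
move=> c0 cf fcd.
have mD : measurable (half_line : set (measurableTypeR R)) by exact: measurable_half_line.
have cf2 r : 0 < r -> {for r, continuous (fun x => f x ^+ 2)}.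
  by move=> r0; rewrite (_ : (fun x => f x ^+ 2) = (fun x => f x * f x))//; apply: cvgM; exact: cf.
apply/L2_halfP; split.
  apply: open_continuous_measurable_fun; first exact: interval_open.
  by move=> r /set_mem; rewrite half_lineE; exact: cf.
apply: (@integrable_support R _ c d) => //.
- exact: half_line_segment.
- by move=> x _ hx; apply/eqP; rewrite sqrf_eq0; apply: contraNT hx => /fcd.
by apply: continuous_segment_integrable => r /andP[cr _]; apply: cf2; exact: lt_le_trans cr.
Qed.

Lemma compact_support_domain1 f f1 f2 c d : 0 < c ->
  (forall r : R, is_derive r 1 f (f1 r)) -> (forall r : R, is_derive r 1 f1 (f2 r)) ->
  continuous f2 -> (forall r, f r != 0 -> c <= r <= d) -> (forall r, f2 r != 0 -> c <= r <= d) ->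
  schrodinger (@domain1 R) V f (fun r => V r * f r - f2 r).
Proof.
move=> c0 df df1 cf2 fcd f2cd.
have cf r : {for r, continuous f} by exact: is_derive_cont (df r).
have L2 (W : R -> R) : (forall r, 0 < r -> {for r, continuous W}) -> L2_half (fun r => W r * f r - f2 r).
  move=> cW; apply: (@continuous_support_L2 _ c d) => // [r r0|r hr].
    by apply: cvgB; [apply: cvgM; [exact: cW|exact: cf]|exact: cf2].
  have [f0|/fcd//] := eqVneq (f r) 0.
  by apply: f2cd; move: hr; rewrite f0 mulr0 sub0r oppr_eq0.
have wk (W : R -> R) : (forall r, 0 < r -> {for r, continuous W}) ->
    weak_schrodinger W f (fun r => W r * f r - f2 r).
  move=> cW; apply: (@classical_weak _ _ f f1 f2) => //.
  by move=> r _; exact: cf2.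
have c15 r : 0 < r -> {for r, continuous (fun r : R => 15 / (4 * r ^+ 2))}.
  move=> r0; rewrite (_ : (fun r : R => _) = (fun r : R => - 15 * - (4 * r ^+ 2)^-1)).
    by apply: cvgM; [exact: cvg_cst|exact: continuous_inv4].
  by apply/funext => x; rewrite mulrNN.
have cV := potential1_continuous profile.
have L2f : L2_half f by apply: (@continuous_support_L2 _ c d).
split => //; [|exact: L2|exact: wk].
split => //; exists (fun r => 15 / (4 * r ^+ 2) * f r - f2 r); [exact: L2|exact: wk].
Qed.

Lemma bump_derive_bound : exists2 B, 0 <= B &
  forall t : R, `|derive1 (@bump R) t| <= B /\ `|derive1 (derive1 (@bump R)) t| <= B.
Proof.
have sb := @smooth_bump R; have s1 := smooth_derive sb; have s2 := smooth_derive s1.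
have h0 t : @bump R t != 0 -> - 1 <= t <= 1.
  rewrite -ler_norml; apply: contraNT; rewrite -ltNge => h; apply/eqP/bump_eq0; exact: ltW.
have h1 := derive1_support sb h0; have h2 := derive1_support s1 h1.
have bnd (f : R -> R) : smooth f -> (forall t, f t != 0 -> - 1 <= t <= 1) ->
    exists2 B, 0 <= B & forall t, `|f t| <= B.
  move=> sf hf; have [B B0 hB] := @segment_bound R f (- 1) 1 (fun r _ => @smooth_continuous R f sf r).
  by exists B => // t; have [->|/hf/hB//] := eqVneq (f t) 0; rewrite normr0.
have [B1 B10 hB1] := bnd _ s1 h1; have [B2 B20 hB2] := bnd _ s2 h2.
exists (Num.max B1 B2); first by rewrite le_max B10.
by move=> t; rewrite !le_max hB1 hB2 orbT.
Qed.

Lemma Rintegral_ge_segment f c d m : 0 < c -> c < d -> mu.-integrable half_line (EFin \o f) ->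
  (forall r, half_line r -> 0 <= f r) -> (forall r, c <= r <= d -> m <= f r) ->
  m * (d - c) <= \int[mu]_(r in half_line) f r.
Proof.
move=> c0 cd fi f0 fm; have sub := @half_line_segment R c d c0.
have mcd : measurable (`[c, d]%classic : set (measurableTypeR R)) by exact: measurable_itv.
have mD : measurable (half_line : set (measurableTypeR R)) by exact: measurable_half_line.
have fcd : mu.-integrable `[c, d] (EFin \o f) by apply: integrableS fi.
have mucd : mu `[c, d]%classic = (d - c)%:E.
  by apply: etrans (lebesgue_measure_itv _) _; rewrite /= lte_fin cd -EFinB.
have ci : mu.-integrable `[c, d] (EFin \o (fun=> m)).
  by apply: continuous_segment_integrable => x _; exact: cvg_cst.
apply: (@le_trans _ _ (\int[mu]_(r in `[c, d]) f r)).
  have -> : m * (d - c) = \int[mu]_(r in `[c, d]) m.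
    apply: etrans (esym (Rintegral_cst mu mcd m)); congr (_ * _).
    by rewrite -[LHS]/(fine (d - c)%:E) -mucd.
  by apply: le_Rintegral => // r /=; rewrite in_itv/=; exact: fm.
rewrite /Rintegral; apply: fine_le; [exact: integrable_fin_num fcd|exact: integrable_fin_num fi|].
apply: ge0_subset_integral => //; first by case/integrableP : fi.
Qed.

Lemma Rintegral_le_segment f c d m : 0 < c -> c < d ->
  (forall r, 0 < r -> {for r, continuous f}) ->
  (forall r, f r != 0 -> c <= r <= d) -> (forall r, c <= r <= d -> f r <= m) ->
  \int[mu]_(r in half_line) f r <= m * (d - c).
Proof.
move=> c0 cd cf fcd fm; have sub := @half_line_segment R c d c0.
have mcd : measurable (`[c, d]%classic : set (measurableTypeR R)) by exact: measurable_itv.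
have fi : mu.-integrable `[c, d] (EFin \o f).
  by apply: continuous_segment_integrable => r /andP[cr _]; apply: cf; exact: lt_le_trans cr.
have ci : mu.-integrable `[c, d] (EFin \o (fun=> m)).
  by apply: continuous_segment_integrable => x _; exact: cvg_cst.
have mucd : mu `[c, d]%classic = (d - c)%:E.
  by apply: etrans (lebesgue_measure_itv _) _; rewrite /= lte_fin cd -EFinB.
rewrite (@Rintegral_support _ _ c d) //; last first.
  by move=> x _ hx; apply/eqP; apply: contraNT hx => /fcd.
have -> : m * (d - c) = \int[mu]_(r in `[c, d]) m.
  apply: etrans (esym (Rintegral_cst mu mcd m)); congr (_ * _).
    by rewrite -[LHS]/(fine (d - c)%:E) -mucd.
by apply: le_Rintegral => // r /=; rewrite in_itv/=; exact: fm.
Qed.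

(* Weyl sequence: plane waves e^{ikr}, k^2 = w - 1, cut off to [n, 3n]. *)
Lemma spectrum_above_threshold w : 1 < w -> spectrum (H1 U a) (w%:C)%C.
Proof.
move=> w1 [_ [C hC]].
have [kap kap0 hkap] := bump_half R.
have [B B0 hB] := bump_derive_bound.
pose k := Num.sqrt (w - 1).
have k0 : 0 <= k by exact: sqrtr_ge0.
have kk : k ^+ 2 = w - 1 by rewrite sqr_sqrtr// subr_ge0 ltW.
(* With this value 4 |C| e <= kap / 4, which defeats the inequality kap^2 n <= (4 |C| e)^2 n
   obtained at the end. *)
pose e := kap / (16 * (`|C| + 1)).
have C1 : 0 < `|C| + 1 by rewrite ltr_wpDl.
have e0 : 0 < e by rewrite divr_gt0// mulr_gt0.
have [M M0 hM] := potential1_nearoo profile e0.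
(* Beyond M the potential differs from 1 by at most e; the last summand makes the terms with
   derivatives of the cut-off, of order B / n, at most e in total. *)
pose n := M + 1 + B * (1 + 2 * k) / e.
have Bk : 0 <= B * (1 + 2 * k) by rewrite mulr_ge0// addr_ge0// mulr_ge0.
have q0 : 0 <= B * (1 + 2 * k) / e by rewrite divr_ge0// ltW.
have nM : M < n by rewrite /n -addrA ltrDl; apply: ltr_wpDr.
have n1 : 1 <= n by rewrite /n (addrC M) -addrA lerDl addr_ge0// ltW.
have n0 : 0 < n by exact: lt_le_trans n1.
have nn := lt0r_neq0 n0.
have nB : B * (1 + 2 * k) <= n * e.
  by rewrite -ler_pdivrMr// /n lerDr addr_ge0// ltW.
have sb := @smooth_bump R; have sb1 := smooth_derive sb; have sb2 := smooth_derive sb1.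
pose be (r : R) : R := bump (n^-1 * r + - 2).
pose be1 (r : R) : R := n^-1 * derive1 (@bump R) (n^-1 * r + - 2).
pose be2 (r : R) : R := n^-1 * (n^-1 * derive1 (derive1 (@bump R)) (n^-1 * r + - 2)).
have sh (f : R -> R) (r : R) : smooth f ->
    is_derive r 1 (fun r => f (n^-1 * r + - 2)) (n^-1 * derive1 f (n^-1 * r + - 2)).
  move=> sf; have h1 : is_derive r 1 (fun r => n^-1 * r + - 2) n^-1 by derive; ring.
  by apply: is_derive_val (is_derive_comp1 h1 (smooth_is_derive _ sf)) _; rewrite mulrC.
have dbe (r : R) : is_derive r 1 be (be1 r) by exact: sh.
have dbe1 (r : R) : is_derive r 1 be1 (be2 r).
  by have h := sh _ r sb1; rewrite /be1 /be2; derive; ring.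
have csh (f : R -> R) : smooth f -> continuous (fun r : R => f (n^-1 * r + - 2)).
  by move=> sf r; exact: is_derive_cont (sh f r sf).
have cbe : continuous be by exact: csh.
have cbe2 : continuous be2.
  by move=> r; apply: cvgM; [exact: cvg_cst|apply: cvgM; [exact: cvg_cst|exact: csh]].
have be_supp r : be r != 0 -> n <= r <= 3 * n.
  apply: contraNT; rewrite negb_and -!ltNge => hr; apply/eqP/bump_eq0.
  rewrite ler_normr; case/orP: hr => hr; apply/orP; [right|left].
    by have : n^-1 * r < 1 by [rewrite mulrC ltr_pdivrMr// mul1r]; lra.
  by have : 3 < n^-1 * r by [rewrite mulrC ltr_pdivlMr//]; lra.
have sbe : smooth be by exact: smooth_affine.
have be1_supp r : be1 r != 0 -> n <= r <= 3 * n.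
  have := derive1_support sbe be_supp (x := r); have [_ e1] := dbe r.
  by rewrite derive1E e1.
have sbe1 : smooth be1 by rewrite -(derive1_ext dbe); exact: smooth_derive.
have be2_supp r : be2 r != 0 -> n <= r <= 3 * n.
  have := derive1_support sbe1 be1_supp (x := r); have [_ e1] := dbe1 r.
  by rewrite derive1E e1.
have dco (r : R) : is_derive r 1 (fun r : R => cos (k * r)) (- k * sin (k * r)).
  have h1 : is_derive r 1 (fun r : R => k * r) k by derive; ring.
  by apply: is_derive_val (is_derive_comp1 h1 (is_derive_cos (k * r))) _; ring.
have dsi (r : R) : is_derive r 1 (fun r : R => sin (k * r)) (k * cos (k * r)).
  have h1 : is_derive r 1 (fun r : R => k * r) k by derive; ring.
  by apply: is_derive_val (is_derive_comp1 h1 (is_derive_sin (k * r))) _; ring.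
pose u (r : R) : R := be r * cos (k * r).
pose u1 (r : R) : R := be1 r * cos (k * r) - k * (be r * sin (k * r)).
pose u2 (r : R) : R := be2 r * cos (k * r) - 2 * k * (be1 r * sin (k * r)) - k ^+ 2 * u r.
pose v (r : R) : R := be r * sin (k * r).
pose v1 (r : R) : R := be1 r * sin (k * r) + k * (be r * cos (k * r)).
pose v2 (r : R) : R := be2 r * sin (k * r) + 2 * k * (be1 r * cos (k * r)) - k ^+ 2 * v r.
have du (r : R) : is_derive r 1 u (u1 r).
  by have h1 := dbe r; have h2 := dco r; rewrite /u /u1; derive; ring.
have du1 (r : R) : is_derive r 1 u1 (u2 r).
  have h1 := dbe r; have h2 := dco r; have h3 := dsi r; have h4 := dbe1 r.
  by rewrite /u1 /u2 /u; derive; ring.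
have dv (r : R) : is_derive r 1 v (v1 r).
  by have h1 := dbe r; have h2 := dsi r; rewrite /v /v1; derive; ring.
have dv1 (r : R) : is_derive r 1 v1 (v2 r).
  have h1 := dbe r; have h2 := dco r; have h3 := dsi r; have h4 := dbe1 r.
  by rewrite /v1 /v2 /v; derive; ring.
have cco : continuous (fun r : R => cos (k * r)) by move=> r; exact: is_derive_cont (dco r).
have csi : continuous (fun r : R => sin (k * r)) by move=> r; exact: is_derive_cont (dsi r).
have cbe1 : continuous be1 by move=> r; exact: is_derive_cont (dbe1 r).
have cu : continuous u by move=> r; exact: is_derive_cont (du r).
have cv : continuous v by move=> r; exact: is_derive_cont (dv r).
have cM (f g : R -> R) : continuous f -> continuous g -> continuous (fun r => f r * g r).
  by move=> cf cg r; apply: cvgM; [exact: cf|exact: cg].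
have cZ (x : R) (f : R -> R) : continuous f -> continuous (fun r => x * f r).
  by move=> cf r; apply: cvgM; [exact: cvg_cst|exact: cf].
have cu2 : continuous u2.
  move=> r; apply: cvgB; last exact: cZ cu r.
  by apply: cvgB; [exact: (cM _ _ cbe2 cco)|exact: (cZ _ _ (cM _ _ cbe1 csi))].
have cv2 : continuous v2.
  move=> r; apply: cvgB; last exact: cZ cv r.
  by apply: cvgD; [exact: (cM _ _ cbe2 csi)|exact: (cZ _ _ (cM _ _ cbe1 cco))].
have out r : ~~ (n <= r <= 3 * n) -> [/\ be r = 0, be1 r = 0 & be2 r = 0].
  move=> h; split; apply/eqP; apply: contraNT h; [exact: be_supp|exact: be1_supp|exact: be2_supp].
have supp (f : R -> R) : (forall r, be r = 0 -> be1 r = 0 -> be2 r = 0 -> f r = 0) ->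
    forall r, f r != 0 -> n <= r <= 3 * n.
  move=> hf r; apply: contraNT => /out[z0 z1 z2]; apply/eqP; exact: hf.
have Hu : schrodinger (@domain1 R) V u (fun r => V r * u r - u2 r).
  apply: (compact_support_domain1 n0 du du1 cu2); apply: supp => r z0 z1 z2.
    by rewrite /u z0 mul0r.
  by rewrite /u2 /u z0 z1 z2 !mul0r !mulr0 !subr0.
have Hv : schrodinger (@domain1 R) V v (fun r => V r * v r - v2 r).
  apply: (compact_support_domain1 n0 dv dv1 cv2); apply: supp => r z0 z1 z2.
    by rewrite /v z0 mul0r.
  by rewrite /v2 /v z0 z1 z2 !mul0r !mulr0 addr0 subr0.
pose f (r : R) : R[i] := (u r +i* v r)%C.
pose h (r : R) : R[i] := ((V r * u r - u2 r) +i* (V r * v r - v2 r))%C.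
have /(hC f h) : H1 U a f h by split.
rewrite /normL2.
(* Real and imaginary parts of (H1 - w) f: the plane wave cancels k^2 = w - 1, leaving V - 1 and the
   derivatives of the cut-off. *)
pose Eu r : R := (V r - 1) * u r - be2 r * cos (k * r) + 2 * k * (be1 r * sin (k * r)).
pose Ev r : R := (V r - 1) * v r - be2 r * sin (k * r) - 2 * k * (be1 r * cos (k * r)).
have -> : (fun r => complex.Re (f r) ^+ 2 + complex.Im (f r) ^+ 2) = (fun r => be r ^+ 2).
  apply/funext => r; rewrite /f /= /u /v !exprMn -mulrDr.
  by rewrite cos2Dsin2 mulr1.
have -> : (fun r => complex.Re (h r - (w%:C)%C * f r) ^+ 2 +
    complex.Im (h r - (w%:C)%C * f r) ^+ 2) = (fun r => Eu r ^+ 2 + Ev r ^+ 2).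
  apply/funext => r; rewrite /h /f /= /Eu /Ev /u2 /v2.
  rewrite kk; congr (_ ^+ 2 + _ ^+ 2); ring.
have mD : measurable (half_line : set (measurableTypeR R)) by exact: measurable_half_line.
have lower : kap ^+ 2 * n <= \int[mu]_(r in half_line) (be r ^+ 2).
  have -> : n = 5 / 2 * n - 3 / 2 * n by field.
  have L2be : L2_half be by apply: (@continuous_support_L2 _ n (3 * n)) => // r _; exact: cbe.
  have [_ ib] := (L2_halfP _).1 L2be.
  apply: Rintegral_ge_segment => //; try lra.
    by move=> r _; exact: sqr_ge0.
  move=> r /andP[r1 r2]; rewrite ler_pXn2r ?nnegrE ?bump_ge0 ?(ltW kap0)//.
  apply: hkap; rewrite ler_norml.
  have g1 : 3 / 2 <= n^-1 * r by rewrite (mulrC _ r) ler_pdivlMr.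
  have g2 : n^-1 * r <= 5 / 2 by rewrite (mulrC _ r) ler_pdivrMr.
  by move: g1 g2; lra.
have be01 r : 0 <= be r <= 1 by rewrite bump_ge0 bump_le1.
have invn : n^-1 <= 1 by rewrite invf_le1.
have in0 : 0 <= n^-1 by rewrite invr_ge0 ltW.
have b1B r : `|be1 r| <= n^-1 * B.
  by rewrite /be1 normrM (ger0_norm in0) ler_wpM2l//; case: (hB (n^-1 * r + - 2)).
have b2B r : `|be2 r| <= n^-1 * B.
  rewrite /be2 normrM (ger0_norm in0) ler_wpM2l// normrM (ger0_norm in0).
  have [_ h2] := hB (n^-1 * r + - 2).
  by apply: le_trans h2; rewrite ler_piMl.
have err r (x y : R) : n <= r -> `|x| <= 1 -> `|y| <= 1 ->
    `|(V r - 1) * (be r * x)| + `|be2 r * x| + `|2 * k * (be1 r * y)| <= 2 * e.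
  move=> nr x1 y1; have Mr : M < r by exact: lt_le_trans nr.
  have r0 : 0 < r by exact: lt_trans Mr.
  have Ve : `|V r - 1| <= e.
    by rewrite ger0_norm ?hM// subr_ge0 ltW// (potential1_gt1 profile).
  have /andP[bb0 bb1] := be01 r.
  have t1 : `|(V r - 1) * (be r * x)| <= e.
    have bx : `|be r * x| <= 1 by rewrite normrM mulr_ile1// ger0_norm.
    by rewrite normrM -[leRHS]mulr1 ler_pM.
  have t2 : `|be2 r * x| <= n^-1 * B by rewrite normrM -[leRHS]mulr1 ler_pM.
  have t3 : `|2 * k * (be1 r * y)| <= 2 * k * (n^-1 * B).
    have k2 : 0 <= 2 * k by rewrite mulr_ge0.
    by rewrite normrM (ger0_norm k2) ler_wpM2l// normrM -[leRHS]mulr1 ler_pM.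
  have t4 : n^-1 * B + 2 * k * (n^-1 * B) <= e.
    have -> : n^-1 * B + 2 * k * (n^-1 * B) = B * (1 + 2 * k) / n by ring.
    by rewrite ler_pdivrMr// (mulrC e).
  by move: t1 t2 t3 t4; lra.
have sq2 (z : R) : `|z| <= 2 * e -> z ^+ 2 <= 4 * e ^+ 2.
  move=> hz; have -> : 4 * e ^+ 2 = (2 * e) ^+ 2 by ring.
  by rewrite -(real_normK (num_real z)) ler_pXn2r// nnegrE mulr_ge0// ltW.
have upper : \int[mu]_(r in half_line) (Eu r ^+ 2 + Ev r ^+ 2) <= 8 * e ^+ 2 * (2 * n).
  have -> : 2 * n = 3 * n - n by ring.
  apply: Rintegral_le_segment => //; first by move: n0; lra.
  - have cV r : 0 < r -> {for r, continuous (fun r => V r - 1)}.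
      by move=> r0; apply: cvgB; [exact: (potential1_continuous profile)|exact: cvg_cst].
    move=> r r0; have cEu : {for r, continuous Eu}.
      apply: cvgD; last exact: (cZ _ _ (cM _ _ cbe1 csi)).
      by apply: cvgB; [apply: cvgM; [exact: cV|exact: cu]|exact: (cM _ _ cbe2 cco)].
    have cEv : {for r, continuous Ev}.
      apply: cvgB; last exact: (cZ _ _ (cM _ _ cbe1 cco)).
      by apply: cvgB; [apply: cvgM; [exact: cV|exact: cv]|exact: (cM _ _ cbe2 csi)].
    by apply: cvgD; rewrite expr2; apply: cvgM.
  - apply: supp => r z0 z1 z2; rewrite /Eu /Ev /u /v z0 z1 z2.
    by rewrite !mul0r !mulr0 !subr0 addr0 expr0n addr0.
  move=> r /andP[nr _].
  have co1 : `|cos (k * r)| <= 1 by rewrite ler_norml cos_geN1 cos_le1.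
  have si1 : `|sin (k * r)| <= 1 by rewrite ler_norml sin_geN1 sin_le1.
  have hEu : Eu r ^+ 2 <= 4 * e ^+ 2.
    apply: sq2; apply: le_trans (err r _ _ nr co1 si1).
    apply: le_trans (ler_normD _ _) _; rewrite lerD2r; exact: ler_normB.
  have hEv : Ev r ^+ 2 <= 4 * e ^+ 2.
    apply: sq2; apply: le_trans (err r _ _ nr si1 co1).
    apply: le_trans (ler_normB _ _) _; rewrite lerD2r; exact: ler_normB.
  by move: hEu hEv; lra.
set A := \int[mu]_(r in _) _ in lower *; set D := \int[mu]_(r in _) _ in upper *.
move=> AD.
have D0 : 0 <= D by apply: Rintegral_ge0 => r _; rewrite addr_ge0 ?sqr_ge0.
have A0 : 0 <= A by apply: Rintegral_ge0 => r _; exact: sqr_ge0.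
have A_le : A <= C ^+ 2 * D.
  have h1 : Num.sqrt A <= `|C| * Num.sqrt D.
    by apply: le_trans AD _; rewrite ler_wpM2r ?sqrtr_ge0// ler_norm.
  have -> : C ^+ 2 * D = (`|C| * Num.sqrt D) ^+ 2.
    by rewrite exprMn real_normK ?num_real// sqr_sqrtr.
  by rewrite -[leLHS](sqr_sqrtr A0) ler_pXn2r// nnegrE ?mulr_ge0 ?sqrtr_ge0.
have : kap ^+ 2 * n <= C ^+ 2 * (8 * e ^+ 2 * (2 * n)).
  by apply: le_trans lower (le_trans A_le _); rewrite ler_wpM2l ?sqr_ge0.
rewrite leNgt => /negP; apply.
have -> : C ^+ 2 * (8 * e ^+ 2 * (2 * n)) = (4 * (`|C| * e)) ^+ 2 * n.
  by rewrite -(real_normK (num_real C)); ring.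
rewrite ltr_pM2r// ltr_pXn2r// ?nnegrE ?mulr_ge0 ?(ltW kap0) ?(ltW e0)//.
have Ce : `|C| * e <= kap / 16.
  rewrite /e mulrA ler_pdivrMr ?mulr_gt0//.
  have -> : kap / 16 * (16 * (`|C| + 1)) = kap * `|C| + kap by field.
  by rewrite mulrC lerDl ltW.
by move: Ce kap0; lra.
Qed.

Lemma discrete_spectrum1 : discrete_spectrum (H1 U a) = set0.
Proof.
rewrite -subset0 => -[x y] [_ [e e0 iso] [f hf fn0] _].
have [x1|x1] := leP x 1; first exact: (fn0 (eigenfunction1_eq0 profile (or_introl x1) hf)).
have [y0|y0] := eqVneq y 0; last exact: (fn0 (eigenfunction1_eq0 profile (or_intror y0) hf)).
have w1 : 1 < x + e / 2 by rewrite (lt_le_trans x1)// lerDl divr_ge0// ltW.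
have := iso _ (spectrum_above_threshold w1); rewrite y0.
have -> : ((x + e / 2)%:C - (x +i* 0))%C = ((e / 2)%:C)%C :> R[i].
  by apply/eqP; rewrite eq_complex /= subrr eqxx andbT; apply/eqP; ring.
rewrite normc_def /= expr0n addr0 sqrtr_sqr ger0_norm ?divr_ge0 ?(ltW e0)//.
rewrite ltcR ltr_pdivrMr// ltr_pMr// ltr1n => /(_ isT) [/eqP].
by rewrite -subr_eq0 addrAC subrr add0r mulf_eq0 invr_eq0 (gt_eqF e0) pnatr_eq0.
Qed.

End Weyl.

Local Open Scope complex_scope.

Theorem proposition3p3 (R : realType) (U a : R -> R)
    (profile : vortex_profile U a) :
  (discrete_spectrum (H1 U a) = set0 /\ ~ threshold_resonance1 U a) /\
  ((exists! lam : R, 0 < lam < 1 /\ is_eigenvalue (H2 U) lam%:C) /\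
   ~ threshold_resonance2 U).
Proof.
split; split.
- exact: discrete_spectrum1 profile.
- exact: no_threshold_resonance1 profile.
- have [l [l01 hl]] := second_eigenvalue_exists profile.
  exists l; split => // m [m01 hm].
  exact: (second_eigenvalue_unique profile l01 m01 hl hm).
exact: no_threshold_resonance2 profile.
Qed.
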